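(* Let $\mathbb{T}=\mathbb{R}/\mathbb{Z}$, let $I=(r_-,r_+)$ with $-\infty\le r_-<r_+\le+\infty$, and let $f:\mathbb{T}\times I\to\mathbb{T}\times I$ be an analytic map with an $(a_*,b_* )$-analytic RIC $C$ of fixed points (that is, an $(a_*,b_* )$-analytic $(0,1)$-resonant RIC, as defined in the context), where either $C\subset\mathbb{T}\times I$, or $C=\mathbb{T}\times\{r_-\}$ for a finite $r_-$, or $C=\mathbb{T}\times\{r_+\}$ for a finite $r_+$. Let $(x,y)$ be the associated coordinates. Let $m\ge 2$ be an arbitrary integer (order) and let $\alpha\in(0,a_* )$. Then there exist constants $K>0$ and $b'_*\in(0,b_* )$ such that, if $b\in(0,b'_* )$, then there exists an analytic change of variables $(x,y)=\Phi(\xi,\eta)$ such that: (i) It is uniformly (with respect to $b$) close to the identity on $\mathbb{T}\times(-b,b)$. That is, $$x=\xi+\mathrm{O}(\eta),\qquad y=\eta+\mathrm{O}(\eta^2),\qquad \det[\mathrm{D}\Phi(\xi,\eta)]=1+\mathrm{O}(\eta),$$ for all $(\xi,\eta)\in\mathbb{T}\times(-b,b)$, where the $\mathrm{O}(\eta)$ and $\mathrm{O}(\eta^2)$ terms are uniform in $b$ (the implied constants do not depend on $b$); and (ii) The transformed map $(\xi,\eta)\mapsto(\xi_1,\eta_1)$ (that is, $\Phi^{-1}\circ f\circ\Phi$, with $f$ written in the coordinates $(x,y)$) is real analytic and has the intersection property on the cylinder $\mathbb{T}\times(-b,b)$. Besides, it has the form $$\xi_1=\xi+\eta+\eta^m g_1(\xi,\eta),\qquad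 \eta_1=\eta+\eta^{m+1}g_2(\xi,\eta),$$ where $|g_j(\xi,\eta)|\le K\mathrm{e}^{-2\pi\alpha/b}$ and $|\partial_i g_j(\xi,\eta)|\le K b^{-2}$ for all $(\xi,\eta)\in\mathbb{T}\times(-b,b)$ and $i,j\in\{1,2\}$.
   Context: A rotational invariant curve (RIC) of $f$ is a closed homotopically non trivial loop $C\subset\mathbb{T}\times I$ with $f(C)=C$; it is analytic when $C=\{(s,\gamma(s)):s\in\mathbb{T}\}$ for an analytic $\gamma:\mathbb{T}\to I$. It consists of fixed points (it is $(0,1)$-resonant) when a lift $F$ of $f$ to $\mathbb{R}\times I$ satisfies $F(s,r)=(s,r)$ on $C$. If $r_-$ is finite, $C_-=\mathbb{T}\times\{r_-\}$ is a $(0,1)$-resonant boundary when $f$ extends continuously to $\mathbb{T}\times[r_-,r_+)$ and the extended lift satisfies $F(s,r_-)=(s,r_-)$ for all $s$; similarly for $C_+=\mathbb{T}\times\{r_+\}$ when $r_+$ is finite. A continuous map defined on a cylinder $\mathbb{T}\times J$ ($J$ an open interval) has the intersection property on $\mathbb{T}\times J$ if the image of any closed homotopically non trivial loop of $\mathbb{T}\times J$ intersects the loop. $C$ is an $(a_*,b_* )$-analytic $(0,1)$-resonant RIC (with $a_*,b_*>0$) when $C$ is an analytic $(0,1)$-resonant RIC, or a $(0,1)$-resonant boundary, and there exist analytic coordinates $(x,y)$, $x\in\mathbb{T}$, in a neighbourhood of $C$, such that $C\equiv\{y=0\}$ and $f$ (analytically extended across $C$ when $C$ is a boundary), written in these coordinates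 as $(x_1,y_1)=f(x,y)$, satisfies: (1) it is real analytic on $\mathbb{T}\times(-b_*,b_* )$ and can be analytically extended to $D_{a_*,b_*}=\{(x,y)\in(\mathbb{C}/\mathbb{Z})\times\mathbb{C}:|\Im x|<a_*,\ |y|<b_*\}$; (2) it has the intersection property on $\mathbb{T}\times(-b_*,b_* )$; (3) it has the form $x_1=x+y+\mathrm{O}(y^2)$, $y_1=y+\mathrm{O}(y^3)$. $\partial_i$ denotes the derivative with respect to the $i$-th variable. *)

(* Defs.v *)
From Stdlib Require Import Reals ZArith.
From Coquelicot Require Import Coquelicot.
Open Scope R_scope.

(** With T = R/Z, points of T x R are pairs of reals up to [cyl_eq], its subsets are the
    [cyl_set]s, and a continuous map of (part of) the cylinder is given by one
    of its lifts, i.e. by a map of pairs compatible with [cyl_eq]; the other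
    lifts of the same map are [fun p => shift n (F p)] with [n : Z]. *)

Definition shift (n : Z) (p : R * R) : R * R := (fst p + IZR n, snd p).

Definition cyl_eq (p q : R * R) : Prop := exists n : Z, q = shift n p.

Definition cyl_set (U : R * R -> Prop) : Prop :=
  forall p q, cyl_eq p q -> U p -> U q.

Definition cyl_open (U : R * R -> Prop) : Prop := cyl_set U /\ open U.

Definition cyl_map (U W : R * R -> Prop) (F : R * R -> R * R) : Prop :=
  (forall p, U p -> W (F p)) /\
  (forall p q, U p -> U q -> cyl_eq p q -> cyl_eq (F p) (F q)).

Definition strip (J : R -> Prop) : R * R -> Prop := fun p => J (snd p).

Definition itv (lo hi : Rbar) : R -> Prop :=
  fun r => Rbar_lt lo r /\ Rbar_lt r hi.

Definition sym_itv (b : R) : R -> Prop := fun y => - b < y < b.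

Definition analytic1 (g : R -> R) : Prop :=
  forall s, exists (c : nat -> R) (rho : R), 0 < rho /\
    forall u, Rabs u < rho -> is_pseries c u (g (s + u)).

(* The Cauchy-type bound on the coefficients makes the double series absolutely
   convergent on the polydisc of radius [rho], so that summing it in the
   iterated way is immaterial.  [K] is the field of real or complex numbers,
   and [U] is meant to be open. *)
Definition analytic2 (K : AbsRing) (U : K * K -> Prop) (f : K * K -> K) : Prop :=
  forall p, U p ->
    exists (c : nat -> nat -> K) (rho M : R),
      0 < rho /\
      (forall j k, abs (c j k) * rho ^ (j + k) <= M) /\
      forall u v : K, abs u < rho -> abs v < rho ->
        exists S : nat -> K,
          (forall j,
             is_pseries (V := AbsRing_NormedModule K) (c j) v (S j)) /\
          is_pseries (V := AbsRing_NormedModule K) S u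
            (f (plus (fst p) u, plus (snd p) v)).

Definition analytic_map (U : R * R -> Prop) (F : R * R -> R * R) : Prop :=
  analytic2 R_AbsRing U (fun p => fst (F p)) /\
  analytic2 R_AbsRing U (fun p => snd (F p)).

Definition analytic_diffeo (U V : R * R -> Prop) (Phi Psi : R * R -> R * R) : Prop :=
  cyl_open U /\ cyl_open V /\
  cyl_map U V Phi /\ cyl_map V U Psi /\
  analytic_map U Phi /\ analytic_map V Psi /\
  (forall p, U p -> cyl_eq (Psi (Phi p)) p) /\
  (forall q, V q -> cyl_eq (Phi (Psi q)) q).

Definition partial1 (h : R * R -> R) (p : R * R) : R :=
  Derive (fun u => h (u, snd p)) (fst p).

Definition partial2 (h : R * R -> R) (p : R * R) : R :=
  Derive (fun v => h (fst p, v)) (snd p).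

Definition jacobian (F : R * R -> R * R) (p : R * R) : R :=
  partial1 (fun q => fst (F q)) p * partial2 (fun q => snd (F q)) p
  - partial2 (fun q => fst (F q)) p * partial1 (fun q => snd (F q)) p.

(* A closed loop of T x J is a continuous map T -> T x J, given by a lift
   R -> R x J. *)
Definition is_loop (J : R -> Prop) (c : R -> R * R) : Prop :=
  (forall t, continuous c t) /\
  (forall t, J (snd (c t))) /\
  (forall t, cyl_eq (c t) (c (t + 1))).

(* [H] is a lift of a homotopy [0,1] x T -> T x J. *)
Definition null_homotopic (J : R -> Prop) (c : R -> R * R) : Prop :=
  exists (H : R * R -> R * R) (p0 : R * R),
    continuous_on (fun q => 0 <= fst q <= 1) H /\
    (forall u t, 0 <= u <= 1 -> J (snd (H (u, t)))) /\
    (forall u t, 0 <= u <= 1 -> cyl_eq (H (u, t)) (H (u, t + 1))) /\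
    (forall t, H (0, t) = c t) /\
    (forall t, H (1, t) = p0).

Definition intersection_property (J : R -> Prop) (F : R * R -> R * R) : Prop :=
  forall c, is_loop J c -> ~ null_homotopic J c ->
    exists t t', cyl_eq (F (c t)) (c t').

Definition is_RIC (J : R -> Prop) (F : R * R -> R * R) (Gam : R * R -> Prop) : Prop :=
  (exists c, is_loop J c /\ ~ null_homotopic J c /\
     forall p, Gam p <-> exists t, cyl_eq (c t) p) /\
  (forall q, Gam q <-> exists p, Gam p /\ cyl_eq (F p) q).

Definition analytic_RIC (J : R -> Prop) (F : R * R -> R * R) (Gam : R * R -> Prop)
    : Prop :=
  is_RIC J F Gam /\
  exists gam : R -> R,
    analytic1 gam /\ (forall s, gam (s + 1) = gam s) /\ (forall s, J (gam s)) /\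
    (forall s r, Gam (s, r) <-> r = gam s).

(* Some lift of the map is the identity on [Gam]. *)
Definition resonant (F : R * R -> R * R) (Gam : R * R -> Prop) : Prop :=
  exists n : Z, forall p, Gam p -> shift n (F p) = p.

(* [Fc] is a lift of the continuous extension to T x (J u {r0}). *)
Definition resonant_boundary (J : R -> Prop) (F : R * R -> R * R) (r0 : R) : Prop :=
  exists (Fc : R * R -> R * R) (n : Z),
    continuous_on (fun p => J (snd p) \/ snd p = r0) Fc /\
    (forall p, J (snd p) -> Fc p = shift n (F p)) /\
    (forall s, Fc (s, r0) = (s, r0)).

(* Besides being an analytic resonant RIC or a resonant boundary, [Gam] comes
   with the map [E], on the open set [Dom], that is to be written in
   coordinates: the map itself when [Gam] lies inside the cylinder, and an
   analytic extension of it across [Gam] when [Gam] is a boundary. *)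
Definition resonant_curve (lo hi : Rbar) (F : R * R -> R * R)
    (Gam : R * R -> Prop) (Dom : R * R -> Prop) (E : R * R -> R * R) : Prop :=
  let J := itv lo hi in
  (forall p, J (snd p) -> E p = F p) /\
  ((analytic_RIC J F Gam /\ resonant F Gam /\
    (forall p, Dom p <-> J (snd p)))
   \/
   (exists r0 : R,
      (lo = Finite r0 \/ hi = Finite r0) /\
      (forall p, Gam p <-> snd p = r0) /\
      resonant_boundary J F r0 /\
      cyl_open Dom /\
      (forall p, J (snd p) \/ Gam p -> Dom p) /\
      cyl_map Dom (fun _ => True) E /\
      analytic_map Dom E)).

Definition complex_strip (a b : R) : C * C -> Prop :=
  fun p => Rabs (Im (fst p)) < a /\ Cmod (snd p) < b.

(* [H1], [H2] are the components of a lift of a map defined on a subset of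
   (C/Z) x C. *)
Definition extends_to_complex_strip (a b : R) (g : R * R -> R * R) : Prop :=
  exists H1 H2 : C * C -> C,
    analytic2 C_AbsRing (complex_strip a b) H1 /\
    analytic2 C_AbsRing (complex_strip a b) H2 /\
    (forall z w, complex_strip a b (z, w) ->
       (exists n : Z, H1 (Cplus z (RtoC 1), w) = Cplus (H1 (z, w)) (RtoC (IZR n))) /\
       H2 (Cplus z (RtoC 1), w) = H2 (z, w)) /\
    (forall x y, - b < y < b ->
       H1 (RtoC x, RtoC y) = RtoC (fst (g (x, y))) /\
       H2 (RtoC x, RtoC y) = RtoC (snd (g (x, y)))).

(* The coordinates are [(x, y) = kappa (s, r)], with inverse [psi]; they map the
   neighbourhood [U] of [Gam] onto [V], and [g] is [E] written in them. *)
Definition adapted_coordinates (a b : R) (Gam Dom : R * R -> Prop)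
    (E : R * R -> R * R) (U V : R * R -> Prop) (kappa psi g : R * R -> R * R) : Prop :=
  analytic_diffeo U V kappa psi /\
  (forall p, Gam p -> U p) /\
  (forall p, U p -> (Gam p <-> snd (kappa p) = 0)) /\
  (forall q, strip (sym_itv b) q ->
     V q /\ Dom (psi q) /\ U (E (psi q)) /\ cyl_eq (kappa (E (psi q))) (g q)) /\
  analytic_map (strip (sym_itv b)) g /\
  extends_to_complex_strip a b g /\
  intersection_property (sym_itv b) g /\
  (exists M delta : R, 0 < delta /\
     forall x y, Rabs y < delta ->
       Rabs (fst (g (x, y)) - (x + y)) <= M * Rabs y ^ 2 /\
       Rabs (snd (g (x, y)) - y) <= M * Rabs y ^ 3).

(* Main.v *)
(** Write the change of variables as [(x + y u, y + y^2 v)].  Conjugating the map to the twist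
    [(x + y, y)] leads to the homological equation [w(x + y, y) - w(x, y) = y f(x, y)], whose solution
    on the mode [k] involves the small divisor only through [y cot (pi k y)].  The power series of
    [1/x - cot x] at 0 has nonnegative coefficients and radius [pi], so for [|k b| <= r < 1] this factor
    is bounded independently of [b]: all modes below [N = r / b] can be solved.  Solving them
    repeatedly, each time gaining a factor 1/2 on a cylinder of width of order [b], leaves the modes
    above [N], which are exponentially small in [1 / b], and the mean, which the intersection property
    controls by the rest.  The powers of [y] come from first running the same scheme order by order.
    The functions are expanded in the atoms [amp cos (2 pi k x + phase) y^j]; that the given map
    has such an expansion is the Fourier inversion theorem, with the decay of the coefficients
    obtained by shifting the contour. *)

Require Import Defs.
From Stdlib Require Import Reals ZArith Lra Lia Psatz List Classical ClassicalEpsilon Cantor.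
From Coquelicot Require Import Coquelicot.
Open Scope R_scope.

(** * Absolutely convergent series *)

(** The conjugacy is kept in the form [F o Phi = Phi o twist + error], and the remainders [h1], [h2]
    of the given map are always composed with the whole change of variables, never with the error of
    an earlier step. Cauchy estimates therefore draw on the fixed gap between the domain of [h1],
    [h2] and the working cylinder. As the solution on the low modes loses no width either, any
    number of steps can be taken on one and the same cylinder, and [Phi] is inverted only once, at
    the end. The factor 1/2 per step is a power of [y], hence of [b], against a constant. The two
    means behave differently. The mean of the first component is absorbed by [v], because the twist
    turns a change of [y] into a shift of [x]. The mean of the second is outside the range of the
    homological operator and stays in the error. The rate comes from the cut-off: in a strip of
    width [a] the modes above [r / b] are of size [exp (- 2 pi a r / b)] on the real circle. Since
    [a] can be taken close to the given width and [r] close to 1, every smaller [alpha] is reached;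
    the strict inequalities also pay for layers of height proportional to [b], on which derivatives
    and inverses are estimated. *)

Fixpoint psum (a : nat -> R) (n : nat) : R :=
  match n with O => 0 | S n => psum a n + a n end.

Lemma psum_sum_n (a : nat -> R) n : psum a (S n) = sum_n a n.
Proof.
  induction n as [|n IH].
  - rewrite sum_O. simpl. ring.
  - rewrite sum_Sn, <- IH. reflexivity.
Qed.

Lemma is_series_psum (a : nat -> R) (l : R) :
  is_series a l <-> is_lim_seq (psum a) l.
Proof.
  split; intros H.
  - apply is_lim_seq_incr_1. apply is_lim_seq_ext with (sum_n a); [|exact H].
    intros n. symmetry. apply psum_sum_n.
  - apply is_lim_seq_incr_1 in H. apply (is_lim_seq_ext _ (sum_n a)) in H; [exact H|].
    intros n. apply psum_sum_n.
Qed.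

Lemma psum_ext a b n : (forall i, (i < n)%nat -> a i = b i) -> psum a n = psum b n.
Proof.
  intros H. induction n as [|n IH]; simpl; [reflexivity|].
  rewrite IH, H; auto.
Qed.

Lemma psum_le a b n : (forall i, (i < n)%nat -> a i <= b i) -> psum a n <= psum b n.
Proof.
  intros H. induction n as [|n IH]; simpl; [lra|].
  apply Rplus_le_compat; auto.
Qed.

Lemma psum_nonneg a n : (forall i, 0 <= a i) -> 0 <= psum a n.
Proof.
  intros H. induction n as [|n IH]; simpl; [lra|]. specialize (H n). lra.
Qed.

Lemma psum_le_mono a n m : (forall i, 0 <= a i) -> (n <= m)%nat -> psum a n <= psum a m.
Proof.
  intros H. induction 1 as [|m Hm IH]; simpl; [lra|]. specialize (H m). lra.
Qed.

Lemma psum_scal c a n : psum (fun i => c * a i) n = c * psum a n.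
Proof. induction n as [|n IH]; simpl; [ring|]. rewrite IH. ring. Qed.

Lemma psum_plus a b n : psum (fun i => a i + b i) n = psum a n + psum b n.
Proof. induction n as [|n IH]; simpl; [ring|]. rewrite IH. ring. Qed.

Lemma psum_zero n : psum (fun _ => 0) n = 0.
Proof. induction n as [|n IH]; simpl; [ring|]. rewrite IH. ring. Qed.

Lemma psum_Rabs a n : Rabs (psum a n) <= psum (fun i => Rabs (a i)) n.
Proof.
  induction n as [|n IH]; simpl; [rewrite Rabs_R0; lra|].
  eapply Rle_trans; [apply Rabs_triang|]. lra.
Qed.

(** Absolute convergence and a bound for the sum in one condition that mentions no limit, so that it
    passes through algebraic manipulations of finite sums. *)
Definition bsum (a : nat -> R) (M : R) : Prop :=
  forall n, psum (fun i => Rabs (a i)) n <= M.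

Lemma bsum_nonneg a M : bsum a M -> 0 <= M.
Proof. intros H. exact (H 0%nat). Qed.

Lemma bsum_term a M n : bsum a M -> Rabs (a n) <= M.
Proof.
  intros H. specialize (H (S n)). simpl in H.
  assert (0 <= psum (fun i => Rabs (a i)) n) by (apply psum_nonneg; intros; apply Rabs_pos).
  lra.
Qed.

Lemma bsum_le a b M N :
  (forall n, Rabs (a n) <= Rabs (b n)) -> M <= N -> bsum b M -> bsum a N.
Proof.
  intros H HM Hb n. eapply Rle_trans; [|apply HM]. eapply Rle_trans; [|apply (Hb n)].
  apply psum_le. auto.
Qed.

Lemma bsum_le_pos a b M N :
  (forall n, Rabs (a n) <= b n) -> M <= N -> (forall n, psum b n <= M) -> bsum a N.
Proof.
  intros H HM Hb n. eapply Rle_trans; [|apply HM]. eapply Rle_trans; [|apply (Hb n)].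
  apply psum_le. auto.
Qed.

Lemma bsum_scal c a M : bsum a M -> bsum (fun n => c * a n) (Rabs c * M).
Proof.
  intros H n.
  rewrite (psum_ext _ (fun i => Rabs c * Rabs (a i))) by (intros; apply Rabs_mult).
  rewrite psum_scal. apply Rmult_le_compat_l; [apply Rabs_pos|apply H].
Qed.

Lemma bsum_ex_Rabs a M : bsum a M -> ex_series (fun n => Rabs (a n)).
Proof.
  intros H.
  destruct (ex_finite_lim_seq_incr (psum (fun i => Rabs (a i))) M) as [l Hl].
  - intros n. simpl. pose proof (Rabs_pos (a n)). lra.
  - exact H.
  - exists l. apply is_series_psum. exact Hl.
Qed.

Lemma bsum_ex a M : bsum a M -> ex_series a.
Proof. intros H. apply ex_series_Rabs. eapply bsum_ex_Rabs; eauto. Qed.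

Lemma bsum_is_series a M : bsum a M -> is_series a (Series a).
Proof. intros H. apply Series_correct. eapply bsum_ex; eauto. Qed.

Lemma is_series_Rabs_le a M l : is_series a l -> bsum a M -> Rabs l <= M.
Proof.
  intros Hl H. apply is_series_psum in Hl. apply is_lim_seq_abs in Hl.
  refine (is_lim_seq_le _ _ _ _ _ Hl (is_lim_seq_const M)).
  intros n. eapply Rle_trans; [apply psum_Rabs|apply H].
Qed.

Lemma is_series_psum_le a l n : (forall i, 0 <= a i) -> is_series a l -> psum a n <= l.
Proof.
  intros Hp Hl. apply is_series_psum in Hl.
  apply (is_lim_seq_incr_compare (psum a) l Hl). intros k. simpl. specialize (Hp k). lra.
Qed.

Lemma is_series_unique_R a (l l' : R) : is_series a l -> is_series a l' -> l = l'.
Proof. intros H H'. apply is_series_unique in H. apply is_series_unique in H'. congruence. Qed.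

Lemma is_series_finite (a : nat -> R) n :
  (forall i, (n <= i)%nat -> a i = 0) -> is_series a (psum a n).
Proof.
  intros H. apply is_series_psum.
  apply is_lim_seq_ext_loc with (fun _ => psum a n); [|apply is_lim_seq_const].
  exists n. intros m Hm. induction Hm as [|m Hm IH]; [reflexivity|].
  simpl. rewrite <- IH, H by exact Hm. ring.
Qed.

Lemma is_series_finite_eq (a : nat -> R) n l :
  (forall i, (n <= i)%nat -> a i = 0) -> psum a n = l -> is_series a l.
Proof. intros H <-. apply is_series_finite, H. Qed.

Lemma psum_finite_le a n m : (forall i, (n <= i)%nat -> a i = 0) -> (forall i, 0 <= a i) ->
  psum a m <= psum a n.
Proof.
  intros H Hp. apply is_series_psum_le; [exact Hp|]. apply is_series_finite. exact H.
Qed.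

Lemma psum_exp x n : 0 <= x -> psum (fun n => x ^ n / INR (fact n)) n <= exp x.
Proof.
  intros Hx. apply is_series_psum_le.
  - intros i. apply Rmult_le_pos; [apply pow_le; lra|].
    left. apply Rinv_0_lt_compat, INR_fact_lt_0.
  - pose proof (is_exp_Reals x) as H. unfold is_pseries in H.
    revert H. apply is_series_ext. intros k. rewrite pow_n_pow. reflexivity.
Qed.

(** * Rearrangement of double series *)

Section ListSums.
Context {T : Type}.

Fixpoint lsum (f : T -> R) (l : list T) : R :=
  match l with nil => 0 | x :: l => f x + lsum f l end.

Lemma lsum_app f l l' : lsum f (l ++ l') = lsum f l + lsum f l'.
Proof. induction l as [|x l IH]; simpl; [ring|]. rewrite IH. ring. Qed.

Lemma lsum_nonneg f l : (forall x, 0 <= f x) -> 0 <= lsum f l.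
Proof. intros H. induction l as [|x l IH]; simpl; [lra|]. specialize (H x). lra. Qed.

(** Rearrangements of nonnegative sums reduce to this: finite partial sums along two enumerations
    are compared by inclusion of their lists of indices. *)
Lemma lsum_incl f l l' :
  (forall x, 0 <= f x) -> NoDup l -> incl l l' -> lsum f l <= lsum f l'.
Proof.
  intros Hf Hnd. revert l'. induction Hnd as [|x l Hx Hnd IH]; intros l' Hincl; simpl.
  - apply lsum_nonneg, Hf.
  - destruct (in_split x l') as [l1 [l2 ->]]; [apply Hincl; left; reflexivity|].
    rewrite lsum_app. simpl.
    assert (lsum f l <= lsum f (l1 ++ l2)).
    { apply IH. intros y Hy. specialize (Hincl y (or_intror Hy)).
      apply in_app_iff in Hincl. apply in_app_iff.
      destruct Hincl as [H|[H|H]]; auto. subst y. contradiction. }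
    rewrite lsum_app in H. lra.
Qed.

End ListSums.

Lemma lsum_map {T U} (g : T -> U) (f : U -> R) l :
  lsum f (map g l) = lsum (fun x => f (g x)) l.
Proof. induction l as [|x l IH]; simpl; [reflexivity|]. rewrite IH. reflexivity. Qed.

Lemma psum_lsum a n : psum a n = lsum a (seq 0 n).
Proof.
  induction n as [|n IH]; [reflexivity|].
  rewrite seq_S, lsum_app, <- IH. simpl. ring.
Qed.

Lemma psum_box (f : nat * nat -> R) n m :
  psum (fun i => psum (fun j => f (i, j)) m) n = lsum f (list_prod (seq 0 n) (seq 0 m)).
Proof.
  induction n as [|n IH]; [reflexivity|].
  rewrite seq_S.
  assert (E : forall l l' : list nat, list_prod (l ++ l') (seq 0 m)
             = list_prod l (seq 0 m) ++ list_prod l' (seq 0 m)).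
  { intros l l'. induction l as [|x l IHl]; simpl; [reflexivity|].
    rewrite IHl, app_assoc. reflexivity. }
  rewrite E, lsum_app, <- IH. simpl. rewrite app_nil_r, lsum_map, (psum_lsum _ m). ring.
Qed.

Definition dbsum (a : nat -> nat -> R) (M : R) : Prop :=
  forall n m, psum (fun i => psum (fun j => Rabs (a i j)) m) n <= M.

Lemma NoDup_list_prod (l l' : list nat) : NoDup l -> NoDup l' -> NoDup (list_prod l l').
Proof.
  intros H H'. induction H as [|x l Hx H IH]; simpl; [constructor|].
  apply NoDup_app; [|exact IH|].
  - apply NoDup_map_NoDup_ForallPairs; [|exact H']. intros y z _ _ E. congruence.
  - intros [p q] Hin Hin'. apply in_map_iff in Hin. destruct Hin as [y [E _]].
    apply in_prod_iff in Hin'. injection E as -> ->. tauto.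
Qed.

Section Bijection.
Variables (e : nat -> nat * nat) (e' : nat * nat -> nat).
Hypotheses (He : forall n, e' (e n) = n) (He' : forall p, e (e' p) = p).

(** Finitely many enumerated pairs fit in a square. Together with [box_le_enum] this makes partial
    sums along the enumeration and over boxes cofinal. *)
Lemma enum_le_box n :
  exists N, forall f : nat * nat -> R, (forall p, 0 <= f p) ->
    psum (fun k => f (e k)) n <= psum (fun i => psum (fun j => f (i, j)) N) N.
Proof.
  assert (HN : exists N, forall k, (k < n)%nat -> (fst (e k) < N /\ snd (e k) < N)%nat).
  { clear. induction n as [|n [N HN]]; [exists 0%nat; lia|].
    exists (S (Nat.max N (Nat.max (fst (e n)) (snd (e n))))). intros k Hk.
    destruct (Nat.eq_dec k n) as [->|Hne]; [lia|].
    specialize (HN k ltac:(lia)). lia. }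
  destruct HN as [N HN]. exists N. intros f Hf.
  rewrite (psum_box f N N), psum_lsum, <- (lsum_map e f).
  apply lsum_incl; [exact Hf| |].
  - apply NoDup_map_NoDup_ForallPairs; [|apply seq_NoDup].
    intros x y _ _ Hxy. rewrite <- (He x), <- (He y), Hxy. reflexivity.
  - intros [i j] Hin. apply in_map_iff in Hin. destruct Hin as [k [Hk Hin]].
    apply in_seq in Hin. specialize (HN k ltac:(lia)). rewrite Hk in HN. simpl in HN.
    apply in_prod; apply in_seq; lia.
Qed.

Lemma box_le_enum n m :
  exists N, forall f : nat * nat -> R, (forall p, 0 <= f p) ->
    psum (fun i => psum (fun j => f (i, j)) m) n <= psum (fun k => f (e k)) N.
Proof.
  set (l := list_prod (seq 0 n) (seq 0 m)).
  assert (HN : exists N, forall p, In p l -> (e' p < N)%nat).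
  { clearbody l. induction l as [|p l [N HN]]; [exists 0%nat; simpl; tauto|].
    exists (S (Nat.max N (e' p))). intros q [<-|Hq]; [lia|]. specialize (HN q Hq). lia. }
  destruct HN as [N HN]. exists N. intros f Hf.
  rewrite (psum_box f n m), psum_lsum, <- (lsum_map e f).
  apply lsum_incl; [exact Hf| |].
  - apply NoDup_list_prod; apply seq_NoDup.
  - intros p Hp. apply in_map_iff. exists (e' p). split; [apply He'|].
    apply in_seq. specialize (HN p Hp). lia.
Qed.

(** Tonelli: the sum along the enumeration and the iterated sum are both the supremum of the sums
    over boxes. *)
Lemma dsum_pos (f : nat * nat -> R) M :
  (forall p, 0 <= f p) ->
  (forall n m, psum (fun i => psum (fun j => f (i, j)) m) n <= M) ->
  exists s, is_series (fun n => f (e n)) s /\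
    (forall i, ex_series (fun j => f (i, j))) /\
    is_series (fun i => Series (fun j => f (i, j))) s /\ s <= M.
Proof.
  intros Hf HM.
  assert (Hrow : forall i, bsum (fun j => f (i, j)) M).
  { intros i m. eapply Rle_trans; [|apply (HM (S i) m)]. simpl.
    rewrite (psum_ext (fun i0 => Rabs (f (i, i0))) (fun j => f (i, j)))
      by (intros; apply Rabs_pos_eq, Hf).
    assert (0 <= psum (fun i0 => psum (fun j => f (i0, j)) m) i)
      by (apply psum_nonneg; intros; apply psum_nonneg; intros; apply Hf).
    lra. }
  assert (Hs : forall i, is_series (fun j => f (i, j)) (Series (fun j => f (i, j))))
    by (intros i; eapply bsum_is_series; eauto).
  set (r := fun i => Series (fun j => f (i, j))) in *.
  assert (Hr0 : forall i, 0 <= r i).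
  { intros i. apply (is_series_psum_le _ _ 0 (fun j => Hf (i, j)) (Hs i)). }
  assert (Hlim : forall n, is_lim_seq (fun m => psum (fun i => psum (fun j => f (i, j)) m) n)
                             (psum r n)).
  { induction n as [|n IH]; simpl; [apply is_lim_seq_const|].
    apply (is_lim_seq_plus' _ _ _ _ IH). apply is_series_psum, Hs. }
  assert (Hr : bsum r M).
  { intros n. rewrite (psum_ext _ r) by (intros; apply Rabs_pos_eq, Hr0).
    apply (is_lim_seq_le _ _ (psum r n) M (fun m => HM n m) (Hlim n)).
    apply is_lim_seq_const. }
  assert (He1 : bsum (fun n => f (e n)) M).
  { intros n. rewrite (psum_ext _ (fun n => f (e n))) by (intros; apply Rabs_pos_eq, Hf).
    destruct (enum_le_box n) as [N HN]. eapply Rle_trans; [apply HN, Hf|apply HM]. }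
  pose proof (bsum_is_series _ _ He1) as Hse.
  pose proof (bsum_is_series _ _ Hr) as Hsr.
  assert (E : Series (fun n => f (e n)) = Series r).
  { apply Rle_antisym.
    - pose proof (proj1 (is_series_psum _ _) Hse) as Hl.
      apply (is_lim_seq_le _ _ (Series (fun n => f (e n))) (Series r)) with (2 := Hl)
        (3 := is_lim_seq_const _).
      intros n. destruct (enum_le_box n) as [N HN].
      eapply Rle_trans; [apply HN, Hf|].
      eapply Rle_trans; [|apply (is_series_psum_le r _ N Hr0 Hsr)].
      apply psum_le. intros i _. apply is_series_psum_le; [intros; apply Hf|apply Hs].
    - pose proof (proj1 (is_series_psum _ _) Hsr) as Hl.
      apply (is_lim_seq_le _ _ (Series r) (Series (fun n => f (e n)))) with (2 := Hl)
        (3 := is_lim_seq_const _).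
      intros n.
      apply (is_lim_seq_le _ _ (psum r n) (Series (fun n => f (e n)))) with (2 := Hlim n)
        (3 := is_lim_seq_const _).
      intros m. destruct (box_le_enum n m) as [N HN].
      eapply Rle_trans; [apply HN, Hf|].
      apply is_series_psum_le; [intros; apply Hf|exact Hse]. }
  exists (Series r). repeat split.
  - rewrite <- E. exact Hse.
  - intros i. eexists; apply Hs.
  - exact Hsr.
  - eapply Rle_trans; [apply Rle_abs|]. eapply is_series_Rabs_le; eauto.
Qed.

Lemma dsum_gen (f : nat * nat -> R) M :
  (forall n m, psum (fun i => psum (fun j => Rabs (f (i, j))) m) n <= M) ->
  exists s, is_series (fun n => f (e n)) s /\
    (forall i, ex_series (fun j => f (i, j))) /\
    is_series (fun i => Series (fun j => f (i, j))) s /\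
    bsum (fun n => f (e n)) M.
Proof.
  intros HM.
  (* For [q = 1] and [q = -1] these are the positive and negative parts of [f]; both are bounded by
     its absolute value. *)
  pose (g := fun (q : R) p => (Rabs (f p) + q * f p) / 2).
  assert (Hg0 : forall q p, q = 1 \/ q = -1 -> 0 <= g q p <= Rabs (f p)).
  { intros q p Hq. unfold g. pose proof (Rabs_pos (f p)).
    assert (Rabs (q * f p) <= Rabs (f p)).
    { rewrite Rabs_mult. destruct Hq as [->| ->].
      - rewrite Rabs_R1; lra.
      - replace (-1) with (- (1)) by ring. rewrite Rabs_Ropp, Rabs_R1. lra. }
    destruct (Rabs_le_between (q * f p) (Rabs (f p))) as [HH _]. specialize (HH H0). lra. }
  assert (D : forall q, q = 1 \/ q = -1 -> exists s, is_series (fun n => g q (e n)) s /\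
    (forall i, ex_series (fun j => g q (i, j))) /\
    is_series (fun i => Series (fun j => g q (i, j))) s /\ s <= M).
  { intros q Hq. apply dsum_pos; [intros p; apply Hg0, Hq|].
    intros n m. eapply Rle_trans; [|apply (HM n m)].
    apply psum_le; intros i _. apply psum_le; intros j _. apply Hg0, Hq. }
  destruct (D 1 (or_introl eq_refl)) as [s1 [A1 [B1 [C1 _]]]].
  destruct (D (-1) (or_intror eq_refl)) as [s2 [A2 [B2 [C2 _]]]].
  assert (Ef : forall p, g 1 p - g (-1) p = f p) by (intros p; unfold g; field).
  exists (minus s1 s2). repeat split.
  - pose proof (is_series_minus _ _ _ _ A1 A2) as H. revert H. apply is_series_ext.
    intros n. apply Ef.
  - intros i. pose proof (ex_series_minus _ _ (B1 i) (B2 i)) as H. revert H.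
    apply ex_series_ext. intros n. apply Ef.
  - pose proof (is_series_minus _ _ _ _ C1 C2) as H. revert H. apply is_series_ext.
    intros i.
    change (Series (fun j => g 1 (i, j)) - Series (fun j => g (-1) (i, j))
      = Series (fun j => f (i, j))).
    rewrite <- Series_minus; [|apply B1|apply B2]. apply Series_ext. intros j. apply Ef.
  - intros n. destruct (enum_le_box n) as [N HN].
    eapply Rle_trans; [apply (HN (fun p => Rabs (f p)))|apply HM].
    intros; apply Rabs_pos.
Qed.

End Bijection.

Lemma dsum (a : nat -> nat -> R) M : dbsum a M ->
  exists s, is_series (fun n => a (fst (of_nat n)) (snd (of_nat n))) s /\
    (forall i, ex_series (a i)) /\
    is_series (fun i => Series (a i)) s /\
    bsum (fun n => a (fst (of_nat n)) (snd (of_nat n))) M.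
Proof.
  intros H.
  destruct (dsum_gen of_nat to_nat cancel_to_of cancel_of_to
              (fun p => a (fst p) (snd p)) M H) as [s Hs].
  exists s. exact Hs.
Qed.

(** The transposed array is enumerated by the transposed pairing. Both iterated sums then equal the
    sum of literally the same sequence of terms. *)
Lemma dsum_swap (a : nat -> nat -> R) M : dbsum a M ->
  exists s, is_series (fun i => Series (a i)) s /\
    is_series (fun j => Series (fun i => a i j)) s /\
    (forall i, ex_series (a i)) /\ (forall j, ex_series (fun i => a i j)).
Proof.
  intros H.
  destruct (dsum a M H) as [s [A [B [C _]]]].
  destruct (dsum_gen (fun n => (snd (of_nat n), fst (of_nat n)))
              (fun p => to_nat (snd p, fst p))) with (f := fun p => a (snd p) (fst p)) (M := M)
    as [s' [A' [B' [C' _]]]].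
  - intros n. cbn [fst snd]. rewrite <- surjective_pairing. apply cancel_to_of.
  - intros [p q]. cbn [fst snd]. rewrite cancel_of_to. reflexivity.
  - intros n m. simpl. eapply Rle_trans; [|apply (H m n)].
    clear. induction n as [|n IH]; simpl.
    + right. rewrite psum_zero. reflexivity.
    + rewrite psum_plus. lra.
  - simpl in *. assert (s' = s) by exact (is_series_unique_R _ _ _ A' A). subst s'.
    exists s. auto.
Qed.

Lemma dbsum_rows (a : nat -> nat -> R) (r : nat -> R) M :
  (forall i, bsum (a i) (r i)) -> (forall n, psum r n <= M) -> dbsum a M.
Proof.
  intros H HM n m. eapply Rle_trans; [|apply (HM n)]. apply psum_le. intros i _. apply H.
Qed.

(* Equations produced by Coquelicot live in carriers of structures, where [ring] does not see [R]. *)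
Ltac eqR := match goal with |- ?l = ?r => change (@eq R l r) end.

Lemma fun_choice {A B : Type} (Q : A -> B -> Prop) :
  (forall x, exists y, Q x y) -> exists f, forall x, Q x (f x).
Proof.
  intros H. exists (fun x => proj1_sig (constructive_indefinite_description _ (H x))).
  intros x. apply (proj2_sig (constructive_indefinite_description _ (H x))).
Qed.

Lemma is_series_cmult (c : R) a l : is_series a l -> is_series (fun n => c * a n) (c * l).
Proof. exact (is_series_scal_l c a l). Qed.

(** * Weighted trigonometric sums *)

(** The phase covers sines and cosines by one shape, which derivatives and Taylor expansions
    preserve because they only shift it by quarter turns. *)
Record atom := Atom { amp : R; mode : Z; phase : R; deg : nat }.

Definition ev (t : atom) (x y : R) : R :=
  amp t * (cos (2 * PI * IZR (mode t) * x + phase t) * y ^ deg t).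

Definition wt (a b : R) (t : atom) : R :=
  Rabs (amp t) * (exp (2 * PI * a * Rabs (IZR (mode t))) * b ^ deg t).

(* [Wm P a b M f]: on [|y| <= b], [f] is a sum of atoms with modes in [P] whose weights add up to
   at most [M].  The weight of an atom bounds its extension to [|Im x| <= a], [|y| <= b]; this
   makes [W] a Banach algebra of functions analytic on that domain, handled without complex
   variables. *)
Definition Wm (P : Z -> Prop) (a b M : R) (f : R -> R -> R) : Prop :=
  (0 <= a /\ 0 <= b) /\
  exists t : nat -> atom,
    (forall n, amp (t n) = 0 \/ P (mode (t n))) /\
    (forall n, psum (fun i => wt a b (t i)) n <= M) /\
    (forall x y, Rabs y <= b -> is_series (fun n => ev (t n) x y) (f x y)).

Notation W := (Wm (fun _ => True)).

Lemma exp_ge_1 x : 0 <= x -> 1 <= exp x.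
Proof. intros H. pose proof (exp_ineq1_le x). lra. Qed.

Lemma exp_le x y : x <= y -> exp x <= exp y.
Proof. intros [H| ->]; [left; apply exp_increasing; exact H|right; reflexivity]. Qed.

Lemma PI_ge_3 : 3 <= PI.
Proof. pose proof PI2_3_2. unfold PI2 in *. lra. Qed.

Lemma wt_nonneg a b t : 0 <= b -> 0 <= wt a b t.
Proof.
  intros Hb. unfold wt. apply Rmult_le_pos; [apply Rabs_pos|].
  apply Rmult_le_pos; [left; apply exp_pos|apply pow_le; exact Hb].
Qed.

Lemma wt_mono a a' b b' t : a' <= a -> 0 <= b' <= b -> wt a' b' t <= wt a b t.
Proof.
  intros Ha Hb. unfold wt. apply Rmult_le_compat_l; [apply Rabs_pos|].
  apply Rmult_le_compat; [left; apply exp_pos|apply pow_le; lra| |apply pow_incr; lra].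
  apply exp_le. apply Rmult_le_compat_r; [apply Rabs_pos|]. pose proof PI_ge_3. nra.
Qed.

Lemma Rabs_cos_le x : Rabs (cos x) <= 1.
Proof. apply Rabs_le. pose proof (COS_bound x). lra. Qed.

Lemma ev_le_wt a b t x y : 0 <= a -> Rabs y <= b -> Rabs (ev t x y) <= wt a b t.
Proof.
  intros Ha Hy. unfold ev, wt. rewrite !Rabs_mult, <- RPow_abs.
  apply Rmult_le_compat_l; [apply Rabs_pos|].
  apply Rmult_le_compat; [apply Rabs_pos|apply pow_le, Rabs_pos| |].
  - eapply Rle_trans; [apply Rabs_cos_le|]. apply exp_ge_1.
    pose proof PI_ge_3. pose proof (Rabs_pos (IZR (mode t))).
    apply Rmult_le_pos; [nra|lra].
  - apply pow_incr. split; [apply Rabs_pos|exact Hy].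
Qed.

Section WAlgebra.
Variables (P : Z -> Prop).
Implicit Types (a b M : R) (f g : R -> R -> R).

Lemma W_pos a b M f : Wm P a b M f -> 0 <= a /\ 0 <= b.
Proof. intros [H _]; exact H. Qed.

Lemma W_M_pos a b M f : Wm P a b M f -> 0 <= M.
Proof. intros [_ [t [_ [H _]]]]. exact (H 0%nat). Qed.

Lemma W_ext a b M f g :
  (forall x y, Rabs y <= b -> f x y = g x y) -> Wm P a b M f -> Wm P a b M g.
Proof.
  intros E [H0 [t [H1 [H2 H3]]]]. split; [exact H0|]. exists t. repeat split; auto.
  intros x y Hy. rewrite <- E; auto.
Qed.

Lemma W_mono a b M f a' b' M' :
  0 <= a' <= a -> 0 <= b' <= b -> M <= M' -> Wm P a b M f -> Wm P a' b' M' f.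
Proof.
  intros Ha Hb HM [H0 [t [H1 [H2 H3]]]]. split; [lra|]. exists t. repeat split; auto.
  - intros n. eapply Rle_trans; [|apply HM]. eapply Rle_trans; [|apply (H2 n)].
    apply psum_le. intros i _. apply wt_mono; lra.
  - intros x y Hy. apply H3. lra.
Qed.

Lemma W_le a b M M' f : M <= M' -> Wm P a b M f -> Wm P a b M' f.
Proof. intros H HW. pose proof (W_pos _ _ _ _ HW). apply (W_mono a b M f); auto; lra. Qed.

Lemma W_bound a b M f x y : Wm P a b M f -> Rabs y <= b -> Rabs (f x y) <= M.
Proof.
  intros [H0 [t [H1 [H2 H3]]]] Hy. eapply is_series_Rabs_le; [apply H3, Hy|].
  apply (bsum_le_pos _ (fun i => wt a b (t i)) M); [|lra|exact H2].
  intros n. apply ev_le_wt; [lra|exact Hy].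
Qed.

Lemma W_period a b M f x y n : Wm P a b M f -> Rabs y <= b -> f (x + IZR n) y = f x y.
Proof.
  intros [H0 [t [H1 [H2 H3]]]] Hy.
  eapply is_series_unique_R; [apply H3, Hy|].
  generalize (H3 x y Hy). apply is_series_ext. intros i. unfold ev. do 2 f_equal.
  assert (H : forall k : Z, forall z, cos (z + 2 * PI * IZR k) = cos z).
  { assert (Hn : forall k : nat, forall z, cos (z + 2 * PI * INR k) = cos z).
    { intros k z. rewrite <- (cos_period z k). f_equal. ring. }
    intros k z. destruct (Z_le_gt_dec 0 k) as [Hk|Hk].
    - rewrite <- (Hn (Z.to_nat k) z), INR_IZR_INZ, Z2Nat.id by exact Hk. reflexivity.
    - rewrite <- (Hn (Z.to_nat (- k)) (z + 2 * PI * IZR k)), INR_IZR_INZ, Z2Nat.id by lia.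
      f_equal. rewrite opp_IZR. ring. }
  rewrite <- (H (mode (t i) * n)%Z). f_equal. rewrite mult_IZR. ring.
Qed.

(** Completeness of the algebra: the atoms of all the [fn] are listed as one family by the pairing
    function. Sums, products, compositions and limits below all rest on it. *)
Lemma W_series a b M (Mn : nat -> R) (fn : nat -> R -> R -> R) f :
  (forall n, Wm P a b (Mn n) (fn n)) -> (forall n, psum Mn n <= M) ->
  (forall x y, Rabs y <= b -> is_series (fun n => fn n x y) (f x y)) ->
  Wm P a b M f.
Proof.
  intros HW HM Hf.
  pose proof (W_pos _ _ _ _ (HW 0%nat)) as H0. split; [exact H0|].
  destruct (fun_choice (fun n (t : nat -> atom) =>
    (forall i, amp (t i) = 0 \/ P (mode (t i))) /\
    (forall i, psum (fun i => wt a b (t i)) i <= Mn n) /\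
    (forall x y, Rabs y <= b -> is_series (fun i => ev (t i) x y) (fn n x y)))) as [t Ht].
  { intros n. apply (HW n). }
  exists (fun k => t (fst (of_nat k)) (snd (of_nat k))). repeat split.
  - intros n. apply (Ht (fst (of_nat n))).
  - intros n. destruct (dsum (fun i j => wt a b (t i j)) M) as [s [_ [_ [_ H]]]].
    { apply (dbsum_rows _ Mn); [|exact HM]. intros i m.
      rewrite (psum_ext _ (fun j => wt a b (t i j))); [apply (Ht i)|].
      intros; apply Rabs_pos_eq, wt_nonneg; lra. }
    specialize (H n).
    rewrite (psum_ext _ (fun k => wt a b (t (fst (of_nat k)) (snd (of_nat k))))) in H; [exact H|].
    intros; apply Rabs_pos_eq, wt_nonneg; lra.
  - intros x y Hy. destruct (dsum (fun i j => ev (t i j) x y) M) as [s [A [_ [C _]]]].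
    { apply (dbsum_rows _ Mn); [|exact HM]. intros i.
      apply (bsum_le_pos _ (fun j => wt a b (t i j)) (Mn i)); [|lra|apply (Ht i)].
      intros j. apply ev_le_wt; [lra|exact Hy]. }
    replace (f x y) with s; [exact A|].
    apply (is_series_unique_R _ _ _ C). generalize (Hf x y Hy). apply is_series_ext.
    intros n. symmetry. apply is_series_unique. apply (Ht n). exact Hy.
Qed.

Lemma W_zero a b : 0 <= a -> 0 <= b -> Wm P a b 0 (fun _ _ => 0).
Proof.
  intros Ha Hb. split; [lra|]. exists (fun _ => Atom 0 0 0 0). repeat split.
  - intros; left; reflexivity.
  - intros n. rewrite (psum_ext _ (fun _ => 0)); [rewrite psum_zero; lra|].
    intros; unfold wt; simpl. rewrite Rabs_R0. ring.
  - intros x y _. apply (is_series_finite (fun _ => ev (Atom 0 0 0 0) x y) 0).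
    intros; unfold ev; simpl; ring.
Qed.

Lemma W_atom a b t : 0 <= a -> 0 <= b -> (amp t = 0 \/ P (mode t)) ->
  Wm P a b (wt a b t) (ev t).
Proof.
  intros Ha Hb Hp. split; [lra|].
  exists (fun n => match n with O => t | _ => Atom 0 0 0 0 end). repeat split.
  - intros [|n]; [exact Hp|left; reflexivity].
  - intros n. eapply Rle_trans; [apply (psum_finite_le _ 1)|].
    + intros [|i] Hi; [lia|]. unfold wt; simpl. rewrite Rabs_R0. ring.
    + intros i. apply wt_nonneg, Hb.
    + simpl. lra.
  - intros x y _. replace (ev t x y) with (psum (fun n => ev (match n with O => t | _ => Atom 0 0 0 0 end) x y) 1).
    + apply is_series_finite. intros [|i] Hi; [lia|]. unfold ev; simpl; ring.
    + simpl. ring.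
Qed.

Lemma W_plus a b M N f g :
  Wm P a b M f -> Wm P a b N g -> Wm P a b (M + N) (fun x y => f x y + g x y).
Proof.
  intros Hf Hg. pose proof (W_pos _ _ _ _ Hf). pose proof (W_M_pos _ _ _ _ Hf).
  pose proof (W_M_pos _ _ _ _ Hg).
  apply (W_series a b _ (fun n => match n with O => M | 1%nat => N | _ => 0 end)
    (fun n => match n with O => f | 1%nat => g | _ => fun _ _ => 0 end)).
  - intros [|[|n]]; auto. apply W_zero; lra.
  - intros n. eapply Rle_trans; [apply (psum_finite_le _ 2)|simpl; lra].
    + intros [|[|i]] Hi; try lia. reflexivity.
    + intros [|[|i]]; lra.
  - intros x y _. replace (f x y + g x y) with (psum (fun n => (match n with O => f | 1%nat => g | _ => fun _ _ => 0 end) x y) 2).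
    + apply is_series_finite. intros [|[|i]] Hi; try lia. reflexivity.
    + simpl. ring.
Qed.

Lemma W_lin a b M f c : Wm P a b M f -> Wm P a b (Rabs c * M) (fun x y => c * f x y).
Proof.
  intros [H0 [t [H1 [H2 H3]]]]. split; [exact H0|].
  exists (fun n => Atom (c * amp (t n)) (mode (t n)) (phase (t n)) (deg (t n))). repeat split.
  - intros n. destruct (H1 n) as [E|HP]; [left; simpl; rewrite E; ring|right; exact HP].
  - intros n. rewrite (psum_ext _ (fun i => Rabs c * wt a b (t i))).
    + rewrite psum_scal. apply Rmult_le_compat_l; [apply Rabs_pos|apply H2].
    + intros i _. unfold wt; simpl. rewrite Rabs_mult. ring.
  - intros x y Hy. generalize (is_series_cmult c _ _ (H3 x y Hy)). apply is_series_ext.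
    intros n. unfold ev; simpl. ring.
Qed.

Lemma W_opp a b M f : Wm P a b M f -> Wm P a b M (fun x y => - f x y).
Proof.
  intros H. apply (W_lin _ _ _ _ (-1)) in H. replace (Rabs (-1) * M) with M in H.
  - revert H. apply W_ext. intros; ring.
  - replace (-1) with (- (1)) by ring. rewrite Rabs_Ropp, Rabs_R1. ring.
Qed.

Lemma W_minus a b M N f g :
  Wm P a b M f -> Wm P a b N g -> Wm P a b (M + N) (fun x y => f x y - g x y).
Proof. intros Hf Hg. apply W_plus; [exact Hf|]. apply W_opp, Hg. Qed.

(** An operator that multiplies the weight of each atom by at most [c] extends to the whole space
    with norm at most [c]. The last hypothesis identifies the image with a given [g], with the
    convergence of the sum supplied. *)
Lemma W_atomwise (Q : Z -> Prop) a b a' b' c M f (T : atom -> R -> R -> R) g :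
  Wm Q a b M f -> 0 <= a' -> 0 <= b' -> 0 <= c ->
  (forall t, amp t = 0 \/ Q (mode t) -> Wm P a' b' (c * wt a b t) (T t)) ->
  (forall t : nat -> atom, (forall x y, Rabs y <= b -> is_series (fun n => ev (t n) x y) (f x y)) ->
     (forall n, amp (t n) = 0 \/ Q (mode (t n))) ->
     (forall x y, Rabs y <= b' -> ex_series (fun n => T (t n) x y)) ->
     forall x y, Rabs y <= b' -> is_series (fun n => T (t n) x y) (g x y)) ->
  Wm P a' b' (c * M) g.
Proof.
  intros [H0 [t [H1 [H2 H3]]]] Ha' Hb' Hc HT Hg.
  assert (Hs : forall n, psum (fun n => c * wt a b (t n)) n <= c * M)
    by (intros n; rewrite psum_scal; apply Rmult_le_compat_l; auto).
  apply (W_series a' b' _ (fun n => c * wt a b (t n)) (fun n => T (t n))); auto.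
  apply Hg; auto. intros x y Hy.
  apply (bsum_ex _ (c * M)). apply (bsum_le_pos _ (fun n => c * wt a b (t n)) (c * M)); auto.
  - intros n. apply (W_bound a' b' _ (T (t n))); auto.
  - lra.
Qed.

End WAlgebra.

Lemma W_weaken (P Q : Z -> Prop) a b M f :
  (forall k, P k -> Q k) -> Wm P a b M f -> Wm Q a b M f.
Proof.
  intros HPQ [H0 [t [H1 H2]]]. split; [exact H0|]. exists t. split; [|exact H2].
  intros n. destruct (H1 n); auto.
Qed.

Lemma W_True P a b M f : Wm P a b M f -> W a b M f.
Proof. apply W_weaken. auto. Qed.

(** The atoms themselves are distributed according to their mode, the missing ones being replaced by
    a zero atom. Hence the projections have norm at most 1 and no uniqueness of the expansion
    enters. *)
Lemma W_split_in (P0 P : Z -> Prop) a b M f : Wm P0 a b M f ->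
  exists f1 f2, Wm (fun k => P k /\ P0 k) a b M f1 /\ Wm (fun k => ~ P k /\ P0 k) a b M f2 /\
    forall x y, Rabs y <= b -> f x y = f1 x y + f2 x y.
Proof.
  intros [H0 [t [H1 [H2 H3]]]].
  assert (D : forall Q : Z -> Prop, exists t', (forall n, amp (t' n) = 0 \/ (Q (mode (t' n)) /\ P0 (mode (t' n)))) /\
    (forall n, (Q (mode (t n)) /\ t' n = t n) \/ (~ Q (mode (t n)) /\ t' n = Atom 0 0 0 0))).
  { intros Q. exists (fun n => if excluded_middle_informative (Q (mode (t n))) then t n else Atom 0 0 0 0).
    split; intros n; destruct excluded_middle_informative; simpl; auto.
    destruct (H1 n); auto. }
  assert (E : forall Q : Z -> Prop, exists t' g, Wm (fun k => Q k /\ P0 k) a b M g /\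
    (forall n, (Q (mode (t n)) /\ t' n = t n) \/ (~ Q (mode (t n)) /\ t' n = Atom 0 0 0 0)) /\
    (forall x y, Rabs y <= b -> is_series (fun n => ev (t' n) x y) (g x y))).
  { intros Q. destruct (D Q) as [t' [D1 D2]].
    assert (Hw : forall n, wt a b (t' n) <= wt a b (t n)).
    { intros n. destruct (D2 n) as [[_ ->]|[_ ->]]; [lra|].
      unfold wt at 1; simpl. rewrite Rabs_R0, Rmult_0_l. apply wt_nonneg; lra. }
    assert (Hs : forall x y, Rabs y <= b ->
       is_series (fun n => ev (t' n) x y) (Series (fun n => ev (t' n) x y))).
    { intros x y Hy. apply (bsum_is_series _ M).
      apply (bsum_le_pos _ (fun n => wt a b (t n)) M); [|lra|exact H2].
      intros n. eapply Rle_trans; [apply (ev_le_wt a b); lra|apply Hw]. }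
    exists t', (fun x y => Series (fun n => ev (t' n) x y)). repeat split; auto; try lra.
    exists t'. repeat split; auto. intros n. eapply Rle_trans; [|apply (H2 n)].
    apply psum_le; auto. }
  destruct (E P) as [t1 [f1 [A1 [B1 C1]]]].
  destruct (E (fun k => ~ P k)) as [t2 [f2 [A2 [B2 C2]]]].
  exists f1, f2. repeat split; [apply A1|apply A1|apply A1|apply A2|apply A2|apply A2|].
  intros x y Hy. apply (is_series_unique_R _ _ _ (H3 x y Hy)).
  generalize (is_series_plus _ _ _ _ (C1 x y Hy) (C2 x y Hy)). apply is_series_ext.
  intros n. assert (Z : ev (Atom 0 0 0 0) x y = 0) by (unfold ev; simpl; ring).
  change (ev (t1 n) x y + ev (t2 n) x y = ev (t n) x y).
  destruct (B1 n) as [[Q1 ->]|[Q1 ->]]; destruct (B2 n) as [[Q2 ->]|[Q2 ->]];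
    try contradiction; rewrite ?Z; ring.
Qed.

Lemma W_split (P : Z -> Prop) a b M f : W a b M f ->
  exists f1 f2, Wm P a b M f1 /\ Wm (fun k => ~ P k) a b M f2 /\
    forall x y, Rabs y <= b -> f x y = f1 x y + f2 x y.
Proof.
  intros H. destruct (W_split_in _ P _ _ _ _ H) as [f1 [f2 [A [B E]]]].
  exists f1, f2. split; [|split; [|exact E]].
  - revert A. apply W_weaken. tauto.
  - revert B. apply W_weaken. tauto.
Qed.

Lemma W_const a b c : 0 <= a -> 0 <= b -> W a b (Rabs c) (fun _ _ => c).
Proof.
  intros Ha Hb. pose proof (W_atom (fun _ => True) a b (Atom c 0 0 0) Ha Hb (or_intror I)) as H.
  apply (W_le _ _ _ _ (Rabs c)) in H.
  - revert H. apply W_ext. intros x y _. unfold ev; simpl.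
    replace (2 * PI * 0 * x + 0) with 0 by ring. rewrite cos_0. ring.
  - unfold wt; simpl. rewrite Rabs_R0, !Rmult_0_r, exp_0. lra.
Qed.

Lemma W_y a b : 0 <= a -> 0 <= b -> W a b b (fun _ y => y).
Proof.
  intros Ha Hb. pose proof (W_atom (fun _ => True) a b (Atom 1 0 0 1) Ha Hb (or_intror I)) as H.
  apply (W_le _ _ _ _ b) in H.
  - revert H. apply W_ext. intros x y _. unfold ev; simpl.
    replace (2 * PI * 0 * x + 0) with 0 by ring. rewrite cos_0. ring.
  - unfold wt; simpl. rewrite Rabs_R0, !Rmult_0_r, exp_0, Rabs_R1. lra.
Qed.

(** The product formula for cosines gives two atoms with half the product of the amplitudes. Since
    [|k1 + k2|] and [|k1 - k2|] are at most [|k1| + |k2|], the weight is submultiplicative with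
    constant 1. *)
Lemma W_atom_mult a b t s : 0 <= a -> 0 <= b ->
  W a b (wt a b t * wt a b s) (fun x y => ev t x y * ev s x y).
Proof.
  intros Ha Hb. destruct t as [l1 k1 p1 d1], s as [l2 k2 p2 d2].
  set (t1 := Atom (l1 * l2 / 2) (k1 + k2) (p1 + p2) (d1 + d2)).
  set (t2 := Atom (l1 * l2 / 2) (k1 - k2) (p1 - p2) (d1 + d2)).
  assert (Hw : forall k, Rabs (IZR k) <= Rabs (IZR k1) + Rabs (IZR k2) ->
    forall p, wt a b (Atom (l1 * l2 / 2) k p (d1 + d2))
      <= wt a b (Atom l1 k1 p1 d1) * wt a b (Atom l2 k2 p2 d2) / 2).
  { intros k Hk p. unfold wt; simpl. rewrite pow_add. unfold Rdiv. rewrite !Rabs_mult.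
    rewrite (Rabs_pos_eq (/ 2)) by lra.
    assert (He : exp (2 * PI * a * Rabs (IZR k))
      <= exp (2 * PI * a * Rabs (IZR k1)) * exp (2 * PI * a * Rabs (IZR k2))).
    { rewrite <- exp_plus. apply exp_le. rewrite <- Rmult_plus_distr_l.
      apply Rmult_le_compat_l; [|exact Hk]. pose proof PI_ge_3. nra. }
    assert (0 <= Rabs l1 * Rabs l2 * (b ^ d1 * b ^ d2)).
    { apply Rmult_le_pos; apply Rmult_le_pos; try apply Rabs_pos; apply pow_le; exact Hb. }
    nra. }
  eapply W_ext; [|eapply W_le; [|apply (W_plus _ a b _ _ _ _
    (W_atom _ a b t1 Ha Hb (or_intror I)) (W_atom _ a b t2 Ha Hb (or_intror I)))]].
  - intros x y _. unfold ev; simpl. rewrite plus_IZR, minus_IZR, pow_add.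
    replace (2 * PI * (IZR k1 + IZR k2) * x + (p1 + p2))
      with ((2 * PI * IZR k1 * x + p1) + (2 * PI * IZR k2 * x + p2)) by ring.
    replace (2 * PI * (IZR k1 - IZR k2) * x + (p1 - p2))
      with ((2 * PI * IZR k1 * x + p1) - (2 * PI * IZR k2 * x + p2)) by ring.
    rewrite cos_plus, cos_minus. field.
  - assert (A1 := Hw (k1 + k2)%Z ltac:(rewrite plus_IZR; apply Rabs_triang) (p1 + p2)).
    assert (A2 := Hw (k1 - k2)%Z ltac:(rewrite minus_IZR; unfold Rminus;
      eapply Rle_trans; [apply Rabs_triang|rewrite Rabs_Ropp; lra]) (p1 - p2)).
    unfold t1, t2. lra.
Qed.

Lemma W_mult a b M N f g :
  W a b M f -> W a b N g -> W a b (M * N) (fun x y => f x y * g x y).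
Proof.
  intros Hf Hg. pose proof (W_pos _ _ _ _ _ Hf) as [Ha Hb].
  pose proof (W_M_pos _ _ _ _ _ Hf). pose proof (W_M_pos _ _ _ _ _ Hg).
  rewrite Rmult_comm.
  apply (W_atomwise _ (fun _ => True) a b a b N M f (fun t x y => ev t x y * g x y)); auto.
  - intros t _. rewrite Rmult_comm.
    apply (W_atomwise _ (fun _ => True) a b a b (wt a b t) N g (fun s x y => ev t x y * ev s x y)); auto.
    + apply wt_nonneg, Hb.
    + intros s _. apply W_atom_mult; auto.
    + intros s Hs _ _ x y Hy. apply is_series_cmult, Hs, Hy.
  - intros t Ht _ _ x y Hy. replace (f x y * g x y) with (g x y * f x y) by ring.
    generalize (is_series_cmult (g x y) _ _ (Ht x y Hy)). apply is_series_ext. intros n; apply Rmult_comm.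
Qed.

Lemma W_pow a b M f n : W a b M f -> W a b (M ^ n) (fun x y => f x y ^ n).
Proof.
  intros H. pose proof (W_pos _ _ _ _ _ H). induction n as [|n IH]; simpl.
  - pose proof (W_const a b 1 ltac:(lra) ltac:(lra)) as H1. rewrite Rabs_R1 in H1. exact H1.
  - apply W_mult; auto.
Qed.

Lemma W_psum a b (M : nat -> R) (f : nat -> R -> R -> R) n : 0 <= a -> 0 <= b ->
  (forall i, (i < n)%nat -> W a b (M i) (f i)) ->
  W a b (psum M n) (fun x y => psum (fun i => f i x y) n).
Proof.
  intros Ha Hb H. induction n as [|n IH]; simpl.
  - apply W_zero; auto.
  - apply W_plus; auto.
Qed.

(** * Taylor series of the cosine and composition *)

Lemma cos_nPI A n : cos (A + INR n * PI) = (-1) ^ n * cos A.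
Proof.
  induction n as [|n IH].
  - simpl. rewrite Rmult_0_l, Rplus_0_r. ring.
  - rewrite S_INR. replace (A + (INR n + 1) * PI) with (A + INR n * PI + PI) by ring.
    rewrite neg_cos, IH. simpl. ring.
Qed.

Lemma is_series_cos z : is_series (fun n => cos_n n * (z ^ 2) ^ n) (cos z).
Proof.
  apply is_series_Reals. unfold cos. destruct (exist_cos (Rsqr z)) as [l Hl].
  unfold cos_in in Hl. replace (z ^ 2) with (Rsqr z) by (unfold Rsqr; ring). exact Hl.
Qed.

Lemma is_series_sinc z : exists l, is_series (fun n => sin_n n * (z ^ 2) ^ n) l /\ sin z = z * l.
Proof.
  unfold sin. destruct (exist_sin (Rsqr z)) as [l Hl]. exists l. split; [|reflexivity].
  apply is_series_Reals. unfold sin_in in Hl.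
  replace (z ^ 2) with (Rsqr z) by (unfold Rsqr; ring). exact Hl.
Qed.

Lemma is_pseries_R (a : nat -> R) (x l : R) :
  is_pseries a x l <-> is_series (fun n => x ^ n * a n) l.
Proof.
  unfold is_pseries. split; apply is_series_ext; intros n; rewrite <- (pow_n_pow x n); reflexivity.
Qed.

(** The n-th derivative of the cosine is a shift by n quarter turns. The even and odd terms are
    [cos A cos z] and [- sin A sin z]. *)
Lemma cos_taylor A z :
  is_series (fun n => z ^ n / INR (fact n) * cos (A + INR n * (PI / 2))) (cos (A + z)).
Proof.
  destruct (is_series_sinc z) as [l [Hl Hs]].
  assert (H : is_pseries (fun n => / INR (fact n) * cos (A + INR n * (PI / 2))) z
    (cos A * cos z + z * (- sin A * l))).
  { apply is_pseries_odd_even.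
    - apply is_pseries_R. generalize (is_series_cmult (cos A) _ _ (is_series_cos z)). apply is_series_ext.
      intros n.
      change (cos A * (cos_n n * (z ^ 2) ^ n) =
        (z ^ 2) ^ n * (/ INR (fact (2 * n)) * cos (A + INR (2 * n) * (PI / 2)))).
      replace (A + INR (2 * n) * (PI / 2)) with (A + INR n * PI)
        by (rewrite mult_INR; simpl; field).
      rewrite cos_nPI. unfold cos_n. field. apply INR_fact_neq_0.
    - apply is_pseries_R. generalize (is_series_cmult (- sin A) _ _ Hl). apply is_series_ext.
      intros n.
      change (- sin A * (sin_n n * (z ^ 2) ^ n) =
        (z ^ 2) ^ n * (/ INR (fact (2 * n + 1)) * cos (A + INR (2 * n + 1) * (PI / 2)))).
      replace (A + INR (2 * n + 1) * (PI / 2)) with (PI / 2 + A + INR n * PI)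
        by (rewrite plus_INR, mult_INR; simpl; field).
      rewrite cos_nPI, cos_plus, cos_PI2, sin_PI2. unfold sin_n. field. apply INR_fact_neq_0. }
  rewrite cos_plus, Hs. replace (cos A * cos z - sin A * (z * l))
    with (cos A * cos z + z * (- sin A * l)) by ring.
  apply is_pseries_R in H. revert H. apply is_series_ext. intros n.
  change (z ^ n * (/ INR (fact n) * cos (A + INR n * (PI / 2)))
    = z ^ n / INR (fact n) * cos (A + INR n * (PI / 2))). unfold Rdiv. ring.
Qed.

(** The difference quotient as a power series in [z], so that it keeps a meaning, namely the
    derivative, where [z] vanishes. *)
Lemma cos_taylor_diff A z : exists l,
  is_series (fun n => z ^ n / INR (fact (S n)) * cos (A + INR (S n) * (PI / 2))) l /\
  cos (A + z) - cos A = z * l /\ (z = 0 -> l = cos (A + PI / 2)).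
Proof.
  pose proof (cos_taylor A z) as H.
  assert (Hex : exists l, is_series (fun n => z ^ n / INR (fact (S n)) * cos (A + INR (S n) * (PI / 2))) l).
  { eexists. apply (bsum_is_series _ (exp (Rabs z))).
    apply (bsum_le_pos _ (fun n => Rabs z ^ n / INR (fact n)) (exp (Rabs z))); [|lra|].
    - intros n. unfold Rdiv. rewrite !Rabs_mult, <- RPow_abs.
      assert (0 < / INR (fact (S n)) <= / INR (fact n)).
      { pose proof (INR_fact_lt_0 n). split; [apply Rinv_0_lt_compat, INR_fact_lt_0|].
        apply Rinv_le_contravar; [exact H0|]. apply le_INR, fact_le. lia. }
      rewrite (Rabs_pos_eq (/ _)) by lra.
      pose proof (Rabs_cos_le (A + INR (S n) * (PI / 2))) as Hc.
      pose proof (Rabs_pos (cos (A + INR (S n) * (PI / 2)))).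
      assert (0 <= Rabs z ^ n) by (apply pow_le, Rabs_pos).
      assert (0 <= Rabs z ^ n * / INR (fact (S n))) by (apply Rmult_le_pos; lra).
      assert (Rabs z ^ n * / INR (fact (S n)) <= Rabs z ^ n * / INR (fact n))
        by (apply Rmult_le_compat_l; lra). nra.
    - intros n. apply psum_exp, Rabs_pos. }
  destruct Hex as [l Hl]. exists l. split; [exact Hl|]. pose proof Hl as Hl0.
  apply (is_series_cmult z) in Hl.
  assert (H' : is_series (fun n => z ^ n / INR (fact n) * cos (A + INR n * (PI / 2))) (z * l + cos A)).
  { apply is_series_decr_1.
    match goal with |- is_series _ ?v => replace v with (z * l) end.
    - revert Hl. apply is_series_ext. intros n.
      change (z * (z ^ n / INR (fact (S n)) * cos (A + INR (S n) * (PI / 2))) =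
        z * z ^ n / INR (fact (S n)) * cos (A + INR (S n) * (PI / 2))). unfold Rdiv. ring.
    - change (z * l = z * l + cos A - z ^ 0 / INR (fact 0) * cos (A + INR 0 * (PI / 2))).
      simpl. replace (A + 0 * (PI / 2)) with A by ring. field. }
  rewrite (is_series_unique_R _ _ _ H H'). split; [ring|].
  intros ->. apply (is_series_unique_R _ _ _ Hl0).
  apply (is_series_finite_eq _ 1).
  - intros [|i] Hi; [lia|]. simpl. unfold Rdiv. ring.
  - simpl. replace (A + 1 * (PI / 2)) with (A + PI / 2) by ring. field.
Qed.

(** A bound of [cos (2 pi k x + th)] on [|Im x| <= a]: the weight of a mode without amplitude and
    power of [y]. *)
Definition carrier_norm (a : R) (k : Z) : R := exp (2 * PI * a * Rabs (IZR k)).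

Lemma W_cos_shift a b M k th z : W a b M z ->
  W a b (carrier_norm a k * exp M) (fun x y => cos (2 * PI * IZR k * x + th + z x y)).
Proof.
  intros Hz. pose proof (W_pos _ _ _ _ _ Hz) as [Ha Hb]. pose proof (W_M_pos _ _ _ _ _ Hz).
  apply (W_series _ a b _ (fun n => carrier_norm a k * (M ^ n / INR (fact n)))
    (fun n x y => z x y ^ n / INR (fact n) * cos (2 * PI * IZR k * x + th + INR n * (PI / 2)))).
  - intros n. pose proof (INR_fact_lt_0 n).
    pose proof (W_pow _ _ _ _ n Hz) as Hp.
    pose proof (W_atom (fun _ => True) a b (Atom (/ INR (fact n)) k (th + INR n * (PI / 2)) 0)
      Ha Hb (or_intror I)) as Ht.
    pose proof (W_mult _ _ _ _ _ _ Hp Ht) as Hpt.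
    apply (W_le _ _ _ _ (carrier_norm a k * (M ^ n / INR (fact n)))) in Hpt.
    + revert Hpt. apply W_ext. intros x y _. unfold ev; simpl.
      rewrite <- Rplus_assoc. field. lra.
    + unfold wt, carrier_norm; simpl. rewrite (Rabs_pos_eq (/ INR (fact n))).
      * right. field. lra.
      * left. apply Rinv_0_lt_compat; lra.
  - intros n. rewrite psum_scal. apply Rmult_le_compat_l; [left; apply exp_pos|].
    apply psum_exp; lra.
  - intros x y _. apply cos_taylor.
Qed.

(** The quotient of the difference by [z] stays in the algebra even though [z] may vanish. Its value
    at the zeros of [z] is what fixes the leading term in [homological_jet]. *)
Lemma W_cos_diff a b M N k th z0 z : W a b N z0 -> W a b M z ->
  exists f, W a b (carrier_norm a k * exp (N + M)) f /\
    forall x y, Rabs y <= b ->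
      cos (2 * PI * IZR k * x + th + z0 x y + z x y) - cos (2 * PI * IZR k * x + th + z0 x y)
      = z x y * f x y /\
      (z x y = 0 -> f x y = cos (2 * PI * IZR k * x + th + z0 x y + PI / 2)).
Proof.
  intros Hz0 Hz. pose proof (W_pos _ _ _ _ _ Hz) as [Ha Hb].
  pose proof (W_M_pos _ _ _ _ _ Hz). pose proof (W_M_pos _ _ _ _ _ Hz0).
  destruct (fun_choice (fun p l =>
    is_series (fun n => z (fst p) (snd p) ^ n / INR (fact (S n)) *
      cos (2 * PI * IZR k * fst p + th + z0 (fst p) (snd p) + INR (S n) * (PI / 2))) l /\
    cos (2 * PI * IZR k * fst p + th + z0 (fst p) (snd p) + z (fst p) (snd p)) -
      cos (2 * PI * IZR k * fst p + th + z0 (fst p) (snd p)) = z (fst p) (snd p) * l /\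
    (z (fst p) (snd p) = 0 ->
      l = cos (2 * PI * IZR k * fst p + th + z0 (fst p) (snd p) + PI / 2))))
    as [f Hf].
  { intros [x y]. apply cos_taylor_diff. }
  exists (fun x y => f (x, y)). split; [|intros x y _; apply (Hf (x, y))].
  apply (W_series _ a b _ (fun n => carrier_norm a k * exp N * (M ^ n / INR (fact n)))
    (fun n x y => z x y ^ n / INR (fact (S n)) *
      cos (2 * PI * IZR k * x + th + z0 x y + INR (S n) * (PI / 2)))).
  - intros n. pose proof (INR_fact_lt_0 n). pose proof (INR_fact_lt_0 (S n)).
    pose proof (W_pow _ _ _ _ n Hz) as Hp.
    pose proof (W_cos_shift a b N k (th + INR (S n) * (PI / 2)) z0 Hz0) as Hc.
    pose proof (W_mult _ _ _ _ _ _ Hp Hc) as Hpc.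
    apply (W_lin _ _ _ _ _ (/ INR (fact (S n)))) in Hpc.
    apply (W_le _ _ _ _ (carrier_norm a k * exp N * (M ^ n / INR (fact n)))) in Hpc.
    + revert Hpc. apply W_ext. intros x y _.
      replace (2 * PI * IZR k * x + (th + INR (S n) * (PI / 2)) + z0 x y)
        with (2 * PI * IZR k * x + th + z0 x y + INR (S n) * (PI / 2)) by ring.
      unfold Rdiv. ring.
    + rewrite (Rabs_pos_eq (/ INR (fact (S n)))) by (left; apply Rinv_0_lt_compat; lra).
      assert (/ INR (fact (S n)) <= / INR (fact n)).
      { apply Rinv_le_contravar; [lra|]. apply le_INR, fact_le. lia. }
      assert (0 <= M ^ n * (carrier_norm a k * exp N)).
      { apply Rmult_le_pos; [apply pow_le; lra|].
        apply Rmult_le_pos; left; apply exp_pos. }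
      unfold Rdiv. nra.
  - intros n. rewrite psum_scal, exp_plus, <- Rmult_assoc. apply Rmult_le_compat_l.
    + apply Rmult_le_pos; left; apply exp_pos.
    + apply psum_exp; lra.
  - intros x y _. apply (Hf (x, y)).
Qed.

Lemma carrier_norm_exp a k c : carrier_norm a k * exp (2 * PI * Rabs (IZR k) * c) = carrier_norm (a + c) k.
Proof. unfold carrier_norm. rewrite <- exp_plus. f_equal. ring. Qed.

Lemma carrier_norm_pos a k : 0 < carrier_norm a k.
Proof. apply exp_pos. Qed.

Lemma carrier_norm_mono a a' k : a <= a' -> carrier_norm a k <= carrier_norm a' k.
Proof.
  intros H. apply exp_le. apply Rmult_le_compat_r; [apply Rabs_pos|].
  pose proof PI_ge_3. nra.
Qed.

Lemma W_yshift a b N V : W a b N V -> W a b (b + N) (fun x y => y + V x y).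
Proof. intros H. pose proof (W_pos _ _ _ _ _ H). apply W_plus; [apply W_y; lra|exact H]. Qed.

(** On an atom of mode [k] the argument of the cosine moves by [2 pi k U], of norm at most
    [2 pi |k| mu]. The factor [exp] of this norm is exactly the growth of [carrier_norm] from width
    [a] to [a + mu], so composition costs width but no constant. *)
Lemma W_comp a b a' b' M h mu nu U V :
  W a' b' M h -> W a b mu U -> W a b nu V -> a + mu <= a' -> b + nu <= b' ->
  W a b M (fun x y => h (x + U x y) (y + V x y)).
Proof.
  intros Hh HU HV Hmu Hnu. pose proof (W_pos _ _ _ _ _ HU) as [Ha Hb].
  pose proof (W_M_pos _ _ _ _ _ HU) as Hmu0. pose proof (W_M_pos _ _ _ _ _ HV) as Hnu0.
  pose proof (W_yshift _ _ _ _ HV) as HY.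
  rewrite <- (Rmult_1_l M).
  apply (W_atomwise _ (fun _ => True) a' b' a b 1 M h
    (fun t x y => ev t (x + U x y) (y + V x y))); auto; try lra.
  - intros t _.
    pose proof (W_cos_shift a b _ (mode t) (phase t) _
      (W_lin _ _ _ _ _ (2 * PI * IZR (mode t)) HU)) as Hc.
    pose proof (W_mult _ _ _ _ _ _ Hc (W_pow _ _ _ _ (deg t) HY)) as Hm.
    apply (W_lin _ _ _ _ _ (amp t)) in Hm.
    eapply W_le; [|eapply W_ext; [|exact Hm]].
    + unfold wt. rewrite Rmult_1_l. apply Rmult_le_compat_l; [apply Rabs_pos|].
      apply Rmult_le_compat.
      * apply Rmult_le_pos; left; [apply carrier_norm_pos|apply exp_pos].
      * apply pow_le; lra.
      * rewrite !Rabs_mult, (Rabs_pos_eq 2), (Rabs_pos_eq PI) by (pose proof PI_ge_3; lra).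
        rewrite carrier_norm_exp. apply carrier_norm_mono. exact Hmu.
      * apply pow_incr; lra.
    + intros x y _. unfold ev. do 3 f_equal. ring.
  - intros t Ht _ _ x y Hy. apply Ht.
    eapply Rle_trans; [apply (W_bound _ a b (b + nu) _ x y HY Hy)|lra].
Qed.

Lemma pow_diff u d j :
  (u + d) ^ j - u ^ j = d * psum (fun i => (u + d) ^ i * u ^ (j - 1 - i)) j.
Proof.
  assert (H : forall u v j, u ^ j - v ^ j = (u - v) * psum (fun i => u ^ i * v ^ (j - 1 - i)) j).
  { clear. intros u v j. induction j as [|j IH]; [simpl; ring|].
    cbn [psum].
    rewrite (psum_ext _ (fun i => v * (u ^ i * v ^ (j - 1 - i)))).
    - rewrite psum_scal. replace (S j - 1 - j)%nat with 0%nat by lia. simpl.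
      transitivity (u * u ^ j - v * u ^ j + v * (u ^ j - v ^ j)); [ring|]. rewrite IH. ring.
    - intros i Hi. replace (S j - 1 - i)%nat with (S (j - 1 - i)) by lia. simpl. ring. }
  rewrite H. f_equal. ring.
Qed.

(** The sum is [j s^(j-1)]: this is the Cauchy estimate for the derivative of [y^j] with margin
    [t]. *)
Lemma pow_tangent_le s t j : 0 <= s -> 0 <= t ->
  t * psum (fun i => s ^ i * s ^ (j - 1 - i)) j <= (s + t) ^ j.
Proof.
  intros Hs Ht. assert (E : psum (fun i => s ^ i * s ^ (j - 1 - i)) j
     <= psum (fun i => (s + t) ^ i * s ^ (j - 1 - i)) j).
  { apply psum_le. intros i _. apply Rmult_le_compat_r; [apply pow_le, Hs|].
    apply pow_incr; lra. }
  pose proof (pow_diff s t j). pose proof (pow_le s j Hs). nra.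
Qed.

(** Mean value theorem with Cauchy estimates. [A] collects the difference quotients in [x], taken at
    the new second argument, and [B] those in [y], taken at the old first argument; the margins [sg]
    and [ta] pay for the two derivatives. *)
Lemma W_diff a b a' b' M h mu nu mu' nu' sg ta U V d1 d2 :
  W a' b' M h -> W a b mu U -> W a b nu V -> W a b mu' d1 -> W a b nu' d2 ->
  0 < sg -> 0 < ta -> a + mu + mu' + sg <= a' -> b + nu + nu' + ta <= b' ->
  exists A B, W a b (M / sg) A /\ W a b (M / ta) B /\
    forall x y, Rabs y <= b ->
      h (x + U x y + d1 x y) (y + V x y + d2 x y) - h (x + U x y) (y + V x y)
      = A x y * d1 x y + B x y * d2 x y.
Proof.
  intros Hh HU HV Hd1 Hd2 Hsg Hta H1 H2.
  pose proof (W_pos _ _ _ _ _ HU) as [Ha Hb]. pose proof PI_ge_3 as HPI.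
  pose proof (W_M_pos _ _ _ _ _ HU). pose proof (W_M_pos _ _ _ _ _ HV).
  pose proof (W_M_pos _ _ _ _ _ Hd1). pose proof (W_M_pos _ _ _ _ _ Hd2).
  pose proof (W_yshift _ _ _ _ HV) as HY.
  pose proof (W_plus _ _ _ _ _ _ _ HY Hd2) as HY1.
  set (Y := fun x y => y + V x y) in *.
  set (Y1 := fun x y => y + V x y + d2 x y) in *.
  assert (HA : forall t, exists f, W a b (/ sg * wt a' b' t) f /\
    forall x y, Rabs y <= b ->
      amp t * ((cos (2 * PI * IZR (mode t) * (x + U x y + d1 x y) + phase t)
       - cos (2 * PI * IZR (mode t) * (x + U x y) + phase t)) * Y1 x y ^ deg t) = f x y * d1 x y).
  { intros t. set (k := mode t).
    destruct (W_cos_diff a b _ _ k (phase t) _ _ (W_lin _ _ _ _ _ (2 * PI * IZR k) HU)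
      (W_lin _ _ _ _ _ (2 * PI * IZR k) Hd1)) as [f [Hf Ef]].
    rewrite !Rabs_mult, (Rabs_pos_eq 2), (Rabs_pos_eq PI) in Hf by lra.
    rewrite <- Rmult_plus_distr_l, carrier_norm_exp in Hf.
    pose proof (W_mult _ _ _ _ _ _ Hf (W_pow _ _ _ _ (deg t) HY1)) as Hm.
    apply (W_lin _ _ _ _ _ (amp t * (2 * PI * IZR k))) in Hm.
    exists (fun x y => amp t * (2 * PI * IZR k) * (f x y * Y1 x y ^ deg t)). split.
    - revert Hm. apply W_le. rewrite !Rabs_mult, (Rabs_pos_eq 2), (Rabs_pos_eq PI) by lra.
      unfold wt. rewrite <- Rmult_assoc, (Rmult_comm (/ sg)), !Rmult_assoc.
      apply Rmult_le_compat_l; [apply Rabs_pos|].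
      set (q := 2 * PI * Rabs (IZR k)).
      assert (0 <= q) by (unfold q; pose proof (Rabs_pos (IZR k)); nra).
      (* The derivative in [x] brings out [q = 2 pi |k|], and [q <= exp (q sg) / sg] trades it for
         the margin. *)
      assert (Hq : q * carrier_norm (a + (mu + mu')) k <= / sg * carrier_norm a' k).
      { apply Rle_trans with (/ sg * carrier_norm (a + (mu + mu') + sg) k).
        - rewrite <- (carrier_norm_exp _ k sg). fold q.
          pose proof (exp_ineq1_le (q * sg)). pose proof (carrier_norm_pos (a + (mu + mu')) k).
          replace q with (/ sg * (q * sg)) at 1 by (field; lra).
          rewrite Rmult_assoc. apply Rmult_le_compat_l; [left; apply Rinv_0_lt_compat; lra|]. nra.
        - apply Rmult_le_compat_l; [left; apply Rinv_0_lt_compat; lra|].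
          apply carrier_norm_mono. lra. }
      apply Rle_trans with ((q * carrier_norm (a + (mu + mu')) k) * (b + nu + nu') ^ deg t);
        [unfold q; right; ring|].
      apply Rle_trans with ((/ sg * carrier_norm a' k) * b' ^ deg t).
      + apply Rmult_le_compat; auto.
        * apply Rmult_le_pos; [lra|left; apply carrier_norm_pos].
        * apply pow_le; lra.
        * apply pow_incr; lra.
      + unfold carrier_norm, k. rewrite !Rmult_assoc. right. ring.
    - intros x y Hy. specialize (Ef x y Hy).
      replace (2 * PI * IZR k * (x + U x y + d1 x y) + phase t) with
        (2 * PI * IZR k * x + phase t + 2 * PI * IZR k * U x y + 2 * PI * IZR k * d1 x y) by ring.
      replace (2 * PI * IZR k * (x + U x y) + phase t) with
        (2 * PI * IZR k * x + phase t + 2 * PI * IZR k * U x y) by ring.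
      rewrite (proj1 Ef). ring. }
  assert (HB : forall t, exists f, W a b (/ ta * wt a' b' t) f /\
    forall x y, Rabs y <= b ->
      amp t * (cos (2 * PI * IZR (mode t) * (x + U x y) + phase t)
       * (Y1 x y ^ deg t - Y x y ^ deg t)) = f x y * d2 x y).
  { intros t. set (k := mode t). set (j := deg t).
    pose proof (W_cos_shift a b _ k (phase t) _ (W_lin _ _ _ _ _ (2 * PI * IZR k) HU)) as Hc.
    rewrite !Rabs_mult, (Rabs_pos_eq 2), (Rabs_pos_eq PI), carrier_norm_exp in Hc by lra.
    set (s := b + nu + nu').
    assert (Hs : W a b (psum (fun i => s ^ i * s ^ (j - 1 - i)) j)
      (fun x y => psum (fun i => Y1 x y ^ i * Y x y ^ (j - 1 - i)) j)).
    { apply W_psum; auto. intros i _. apply W_mult; [apply W_pow; exact HY1|].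
      eapply W_le; [|apply W_pow; exact HY]. apply pow_incr. unfold s; lra. }
    pose proof (W_lin _ _ _ _ _ (amp t) (W_mult _ _ _ _ _ _ Hc Hs)) as Hm.
    eexists. split; [eapply W_le; [|exact Hm]|].
    - unfold wt.
      apply Rle_trans with (Rabs (amp t) *
        (/ ta * (exp (2 * PI * a' * Rabs (IZR (mode t))) * b' ^ deg t))); [|right; ring].
      apply Rmult_le_compat_l; [apply Rabs_pos|].
      set (q := psum _ j).
      assert (0 <= q).
      { apply psum_nonneg. intros i. apply Rmult_le_pos; apply pow_le; unfold s; lra. }
      assert (Hq : ta * q <= b' ^ j).
      { eapply Rle_trans; [apply pow_tangent_le; unfold s; lra|].
        apply pow_incr; unfold s; lra. }
      assert (q <= / ta * b' ^ j).
      { replace q with (/ ta * (ta * q)) by (field; lra).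
        apply Rmult_le_compat_l; [left; apply Rinv_0_lt_compat; lra|exact Hq]. }
      assert (carrier_norm (a + mu) k <= carrier_norm a' k) by (apply carrier_norm_mono; lra).
      pose proof (carrier_norm_pos (a + mu) k).
      apply Rle_trans with (carrier_norm a' k * (/ ta * b' ^ j)).
      + apply Rmult_le_compat; lra.
      + unfold carrier_norm, k, j. right. ring.
    - intros x y _. unfold Y1 at 1.
      change (y + V x y + d2 x y) with (Y x y + d2 x y) at 1.
      rewrite pow_diff. change (Y x y + d2 x y) with (Y1 x y).
      replace (2 * PI * IZR k * (x + U x y) + phase t) with
        (2 * PI * IZR k * x + phase t + 2 * PI * IZR k * U x y) by ring. simpl. ring. }
  apply fun_choice in HA. destruct HA as [fA HA].
  apply fun_choice in HB. destruct HB as [fB HB].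
  destruct Hh as [Hp [t [Ht1 [Ht2 Ht3]]]].
  assert (Hw : forall c, 0 < c -> forall n, psum (fun i => / c * wt a' b' (t i)) n <= M / c).
  { intros c Hc n. rewrite psum_scal. unfold Rdiv. rewrite Rmult_comm.
    apply Rmult_le_compat_r; [left; apply Rinv_0_lt_compat; lra|apply Ht2]. }
  assert (Hex : forall c F, 0 < c -> (forall t, W a b (/ c * wt a' b' t) (F t)) ->
    exists G, W a b (M / c) G /\
      forall x y, Rabs y <= b -> is_series (fun n => F (t n) x y) (G x y)).
  { intros c F Hc HF.
    assert (Hs : forall x y, Rabs y <= b ->
      is_series (fun n => F (t n) x y) (Series (fun n => F (t n) x y))).
    { intros x y Hy. apply (bsum_is_series _ (M / c)).
      apply (bsum_le_pos _ (fun n => / c * wt a' b' (t n)) (M / c)); [|lra|auto].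
      intros n. apply (W_bound _ _ _ _ _ x y (HF (t n)) Hy). }
    exists (fun x y => Series (fun n => F (t n) x y)). split; [|exact Hs].
    apply (W_series _ a b _ (fun n => / c * wt a' b' (t n)) (fun n => F (t n))); auto. }
  destruct (Hex sg fA Hsg) as [A [WA SA]]; [intros; apply HA|].
  destruct (Hex ta fB Hta) as [B [WB SB]]; [intros; apply HB|].
  exists A, B. repeat split; auto; try lra; try apply WA; try apply WB.
  intros x y Hy.
  assert (Hy0 : Rabs (y + V x y) <= b')
    by (eapply Rle_trans; [apply (W_bound _ a b _ _ x y HY Hy)|lra]).
  assert (Hy1 : Rabs (y + V x y + d2 x y) <= b')
    by (eapply Rle_trans; [apply (W_bound _ a b _ _ x y HY1 Hy)|lra]).
  pose proof (is_series_minus _ _ _ _ (Ht3 (x + U x y + d1 x y) _ Hy1) (Ht3 (x + U x y) _ Hy0)) as L.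
  pose proof (is_series_plus _ _ _ _ (is_series_cmult (d1 x y) _ _ (SA x y Hy))
    (is_series_cmult (d2 x y) _ _ (SB x y Hy))) as Rr.
  apply (is_series_unique_R _ _ _ L).
  replace (A x y * d1 x y + B x y * d2 x y) with (plus (d1 x y * A x y) (d2 x y * B x y))
    by (unfold plus; simpl; ring).
  revert Rr. apply is_series_ext. intros n.
  change (d1 x y * fA (t n) x y + d2 x y * fB (t n) x y =
    ev (t n) (x + U x y + d1 x y) (y + V x y + d2 x y) - ev (t n) (x + U x y) (y + V x y)).
  rewrite (Rmult_comm (d1 x y)), (Rmult_comm (d2 x y)).
  rewrite <- (proj2 (HA (t n)) x y Hy), <- (proj2 (HB (t n)) x y Hy).
  unfold ev, Y1, Y. ring.
Qed.

(** Narrowing the strip from [a] to [a'] divides the weight of mode [k] by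
    [exp (2 pi (a - a') |k|)]. This is the only source of the exponentially small factor. *)
Lemma W_high N a a' b M f : 0 <= a' <= a ->
  Wm (fun k => N <= Rabs (IZR k)) a b M f ->
  W a' b (exp (- (2 * PI * (a - a') * N)) * M) f.
Proof.
  intros Ha Hf. pose proof (W_pos _ _ _ _ _ Hf) as [_ Hb].
  apply (W_atomwise _ (fun k => N <= Rabs (IZR k)) a b a' b _ M f ev); auto; try lra.
  - left; apply exp_pos.
  - intros t Ht. eapply W_le; [|apply W_atom; auto; lra].
    unfold wt. destruct Ht as [Ht|Ht].
    + rewrite Ht, Rabs_R0. right. ring.
    + apply Rle_trans with (Rabs (amp t) *
        ((exp (- (2 * PI * (a - a') * N)) * exp (2 * PI * a * Rabs (IZR (mode t)))) * b ^ deg t));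
        [|right; ring].
      apply Rmult_le_compat_l; [apply Rabs_pos|].
      apply Rmult_le_compat_r; [apply pow_le, Hb|].
      rewrite <- exp_plus. apply exp_le. pose proof PI_ge_3.
      assert (0 <= 2 * PI * (a - a') * (Rabs (IZR (mode t)) - N)); [|lra].
      apply Rmult_le_pos; [|lra]. nra.
Qed.

Lemma W_mean a b M f x x' y : Wm (fun k => k = 0%Z) a b M f -> Rabs y <= b -> f x y = f x' y.
Proof.
  intros [H0 [t [H1 [H2 H3]]]] Hy.
  eapply is_series_unique_R; [apply H3, Hy|].
  generalize (H3 x' y Hy). apply is_series_ext. intros n. unfold ev.
  eqR. destruct (H1 n) as [->| ->]; [ring|]. do 3 f_equal. ring.
Qed.

(** Atoms of degree 0 carry the value at [y = 0], which [0 ^ 0 = 1] selects in [T0]. The others lose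
    one degree, and their weight is divided by [b]. *)
Lemma W_div P a b M f : 0 < b -> Wm P a b M f ->
  exists f0 f1, Wm P a b M f0 /\ Wm P a b (M / b) f1 /\
    (forall x y, f0 x y = f x 0) /\
    forall x y, Rabs y <= b -> f x y = f x 0 + y * f1 x y.
Proof.
  intros Hb [H0 [t [H1 [H2 H3]]]].
  set (T0 := fun t => Atom (amp t * 0 ^ deg t) (mode t) (phase t) 0).
  set (T1 := fun t => match deg t with O => Atom 0 (mode t) (phase t) 0
     | S j => Atom (amp t) (mode t) (phase t) j end).
  assert (W0 : forall t, wt a b (T0 t) <= wt a b t).
  { intros s. unfold wt, T0; simpl. destruct (deg s); simpl.
    - rewrite Rmult_1_r. lra.
    - rewrite Rmult_0_l, Rmult_0_r, Rabs_R0, Rmult_0_l. apply Rmult_le_pos; [apply Rabs_pos|].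
      apply Rmult_le_pos; [left; apply exp_pos|]. apply Rmult_le_pos; [lra|apply pow_le; lra]. }
  assert (W1 : forall t, wt a b (T1 t) <= / b * wt a b t).
  { intros s. unfold wt, T1; simpl. destruct (deg s); simpl.
    - rewrite Rabs_R0, Rmult_0_l. pose proof (Rinv_0_lt_compat b Hb).
      apply Rmult_le_pos; [lra|]. apply Rmult_le_pos; [apply Rabs_pos|].
      apply Rmult_le_pos; [left; apply exp_pos|lra].
    - right. field. lra. }
  assert (S1 : forall n, psum (fun i => wt a b (T1 (t i))) n <= M / b).
  { intros n. apply Rle_trans with (/ b * M); [|right; unfold Rdiv; ring].
    eapply Rle_trans; [apply psum_le; intros i _; apply W1|].
    rewrite psum_scal. apply Rmult_le_compat_l; [left; apply Rinv_0_lt_compat, Hb|apply H2]. }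
  assert (E1 : forall x y, Rabs y <= b -> is_series (fun n => ev (T1 (t n)) x y)
    (Series (fun n => ev (T1 (t n)) x y))).
  { intros x y Hy. apply (bsum_is_series _ (M / b)).
    apply (bsum_le_pos _ (fun n => wt a b (T1 (t n))) (M / b)); [|lra|exact S1].
    intros n. apply ev_le_wt; [lra|exact Hy]. }
  assert (E0 : forall x y, is_series (fun n => ev (T0 (t n)) x y) (f x 0)).
  { intros x y. assert (H : Rabs 0 <= b) by (rewrite Rabs_R0; lra).
    generalize (H3 x 0 H). apply is_series_ext. intros n. unfold ev, T0; simpl. ring. }
  exists (fun x _ => f x 0), (fun x y => Series (fun n => ev (T1 (t n)) x y)).
  repeat split; try lra.
  - exists (fun n => T0 (t n)). repeat split; auto.
    + intros n. destruct (H1 n) as [E|HP]; [left; unfold T0; simpl; rewrite E; ring|right; exact HP].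
    + intros n. eapply Rle_trans; [|apply (H2 n)]. apply psum_le. auto.
  - exists (fun n => T1 (t n)). repeat split; auto.
    intros n. unfold T1. destruct (deg (t n)); simpl; [left; reflexivity|apply H1].
  - intros x y Hy. apply (is_series_unique_R _ _ _ (H3 x y Hy)).
    generalize (is_series_plus _ _ _ _ (E0 x y) (is_series_cmult y _ _ (E1 x y Hy))).
    apply is_series_ext. intros n.
    change (ev (T0 (t n)) x y + y * ev (T1 (t n)) x y = ev (t n) x y).
    unfold ev, T0, T1. simpl. destruct (deg (t n)); simpl; ring.
Qed.

Lemma W_lip a b M f sg ta x y s t :
  W a b M f -> 0 < sg -> 0 < ta -> Rabs s + sg <= a -> Rabs y + Rabs t + ta <= b ->
  Rabs (f (x + s) (y + t) - f x y) <= M / sg * Rabs s + M / ta * Rabs t.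
Proof.
  intros Hf Hs Ht H1 H2.
  pose proof (Rabs_pos y). pose proof (Rabs_pos s). pose proof (Rabs_pos t).
  (* [W_diff] on the degenerate cylinder of width 0 and height [|y|], with constant increments, is a
     pointwise estimate. *)
  destruct (W_diff 0 (Rabs y) a b M f 0 0 (Rabs s) (Rabs t) sg ta (fun _ _ => 0) (fun _ _ => 0)
    (fun _ _ => s) (fun _ _ => t)) as [A [B [HA [HB E]]]]; auto; try lra;
    try (apply W_zero; lra); try (apply W_const; lra).
  specialize (E x y (Rle_refl _)). rewrite !Rplus_0_r in E. rewrite E.
  eapply Rle_trans; [apply Rabs_triang|]. rewrite !Rabs_mult.
  apply Rplus_le_compat; (apply Rmult_le_compat_r; [apply Rabs_pos|]).
  - apply (W_bound _ _ _ _ _ x y HA). lra.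
  - apply (W_bound _ _ _ _ _ x y HB). lra.
Qed.

(** * Taylor expansions and partial derivatives *)

Definition expansion (f : R * R -> R) (p : R * R) (c : nat -> nat -> R) (rho M : R) : Prop :=
  (forall j k, Rabs (c j k) * rho ^ (j + k) <= M) /\
  forall u v, Rabs u < rho -> Rabs v < rho ->
    exists S : nat -> R, (forall j, is_series (fun k => c j k * v ^ k) (S j)) /\
      is_series (fun j => S j * u ^ j) (f (fst p + u, snd p + v)).

Lemma is_pseries_R_r (a : nat -> R) (x l : R) :
  is_pseries a x l <-> is_series (fun n => a n * x ^ n) l.
Proof.
  rewrite is_pseries_R. split; apply is_series_ext; intros n; apply Rmult_comm.
Qed.

Lemma expansion_analytic2 (U : R * R -> Prop) f :
  (forall p, U p -> exists c rho M, 0 < rho /\ expansion f p c rho M) ->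
  analytic2 R_AbsRing U f.
Proof.
  intros H p Hp. destruct (H p Hp) as [c [rho [M [H1 [H2 H3]]]]].
  exists c, rho, M. split; [exact H1|]. split; [exact H2|].
  intros u v Hu Hv. destruct (H3 u v Hu Hv) as [S [HS1 HS2]].
  exists S. split.
  - intros j. apply (is_pseries_R_r (c j) v (S j)). apply HS1.
  - apply (is_pseries_R_r S u). exact HS2.
Qed.

Lemma binom_expand y0 j : exists be : nat -> R,
  (forall v, is_series (fun l => be l * v ^ l) ((y0 + v) ^ j)) /\
  (forall r, 0 <= r -> bsum (fun l => be l * r ^ l) ((Rabs y0 + r) ^ j)).
Proof.
  exists (fun l => if le_dec l j then Binomial.C j l * y0 ^ (j - l) else 0).
  assert (E : forall z v, psum (fun l => (if le_dec l j then Binomial.C j l * z ^ (j - l) else 0) * v ^ l) (S j)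
     = (z + v) ^ j).
  { intros z v. rewrite (Rplus_comm z v), binomial. rewrite psum_sum_n, sum_n_Reals.
    apply sum_eq. intros i Hi. destruct (le_dec i j); [ring|lia]. }
  assert (F : forall z v i, (S j <= i)%nat ->
    (if le_dec i j then Binomial.C j i * z ^ (j - i) else 0) * v ^ i = 0).
  { intros z v i Hi. destruct (le_dec i j); [lia|ring]. }
  split.
  - intros v. rewrite <- E. apply is_series_finite. apply F.
  - intros r Hr n. rewrite <- E.
    rewrite (psum_ext _ (fun l => (if le_dec l j then Binomial.C j l * Rabs y0 ^ (j - l) else 0) * r ^ l)).
    + apply psum_finite_le; [apply F|]. intros i. apply Rmult_le_pos; [|apply pow_le, Hr].
      destruct (le_dec i j); [|lra]. apply Rmult_le_pos; [|apply pow_le, Rabs_pos].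
      unfold Binomial.C. apply Rmult_le_pos; [apply pos_INR|]. left. apply Rinv_0_lt_compat.
      apply Rmult_lt_0_compat; apply INR_fact_lt_0.
    + intros l _. rewrite Rabs_mult, <- (RPow_abs r), (Rabs_pos_eq r Hr). f_equal.
      destruct (le_dec l j); [|apply Rabs_R0]. rewrite Rabs_mult, <- RPow_abs. f_equal.
      apply Rabs_pos_eq. unfold Binomial.C. apply Rmult_le_pos; [apply pos_INR|]. left.
      apply Rinv_0_lt_compat. apply Rmult_lt_0_compat; apply INR_fact_lt_0.
Qed.

Lemma cos_expand k th x0 : exists al : nat -> R,
  (forall u, is_series (fun i => al i * u ^ i) (cos (2 * PI * IZR k * (x0 + u) + th))) /\
  (forall r, 0 <= r -> bsum (fun i => al i * r ^ i) (carrier_norm r k)).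
Proof.
  set (q := 2 * PI * IZR k).
  exists (fun i => q ^ i / INR (fact i) * cos (q * x0 + th + INR i * (PI / 2))). split.
  - intros u. replace (q * (x0 + u) + th) with (q * x0 + th + q * u) by ring.
    generalize (cos_taylor (q * x0 + th) (q * u)). apply is_series_ext. intros n.
    rewrite Rpow_mult_distr. unfold Rdiv. simpl. ring.
  - intros r Hr.
    assert (Hq : 0 <= Rabs q * r) by (apply Rmult_le_pos; [apply Rabs_pos|exact Hr]).
    apply (bsum_le_pos _ (fun n => (Rabs q * r) ^ n / INR (fact n)) (exp (Rabs q * r))).
    + intros n. unfold Rdiv. rewrite !Rabs_mult, <- !RPow_abs, (Rabs_pos_eq r Hr).
      rewrite Rpow_mult_distr. pose proof (INR_fact_lt_0 n).
      assert (Hi : 0 < / INR (fact n)) by (apply Rinv_0_lt_compat; lra).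
      rewrite (Rabs_pos_eq (/ _)) by lra.
      pose proof (Rabs_cos_le (q * x0 + th + INR n * (PI / 2))) as Hc.
      pose proof (Rabs_pos (cos (q * x0 + th + INR n * (PI / 2)))).
      assert (0 <= Rabs q ^ n * r ^ n * / INR (fact n)).
      { apply Rmult_le_pos; [apply Rmult_le_pos; apply pow_le; [apply Rabs_pos|exact Hr]|lra]. }
      nra.
    + right. unfold carrier_norm, q. rewrite !Rabs_mult, (Rabs_pos_eq 2), (Rabs_pos_eq PI)
        by (pose proof PI_ge_3; lra). f_equal. ring.
    + intros n. apply psum_exp, Hq.
Qed.

(** Each atom is a product of a power series in [u] and a polynomial in [v] whose majorants at
    radius [rho] are at most its weight. The sum over atoms is exchanged first with the sum over
    powers of [v], then with that over powers of [u]. *)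
Lemma W_expansion a b M f x0 y0 rho :
  W a b M f -> 0 < rho <= a -> Rabs y0 + rho <= b ->
  exists c, expansion (fun p => f (fst p) (snd p)) (x0, y0) c rho M.
Proof.
  intros Hf Hr Hy. pose proof (W_M_pos _ _ _ _ _ Hf) as HM.
  destruct Hf as [H0 [t [_ [H2 H3]]]].
  destruct (fun_choice _ (fun n => binom_expand y0 (deg (t n)))) as [be Hbe].
  destruct (fun_choice _ (fun n => cos_expand (mode (t n)) (phase (t n)) x0)) as [al Hal].
  set (lm := fun n => amp (t n)).
  set (Y := fun n => (Rabs y0 + rho) ^ deg (t n)).
  set (X := fun n => carrier_norm rho (mode (t n))).
  assert (HY0 : forall n, 0 <= Y n) by (intros; apply pow_le; pose proof (Rabs_pos y0); lra).
  assert (HX0 : forall n, 0 < X n) by (intros; apply carrier_norm_pos).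
  assert (Hwt : forall n, Rabs (lm n) * (X n * Y n) <= wt a b (t n)).
  { intros n. unfold wt. apply Rmult_le_compat_l; [apply Rabs_pos|].
    apply Rmult_le_compat; auto; [left; auto| |].
    - apply carrier_norm_mono; lra.
    - apply pow_incr. pose proof (Rabs_pos y0). lra. }
  assert (Hsum : forall n, psum (fun n => Rabs (lm n) * (X n * Y n)) n <= M).
  { intros n. eapply Rle_trans; [|apply (H2 n)]. apply psum_le; auto. }
  assert (Hali : forall n i, Rabs (al n i) * rho ^ i <= X n).
  { intros n i. pose proof (bsum_term _ _ i (proj2 (Hal n) rho ltac:(lra))) as H.
    cbv beta in H. rewrite Rabs_mult, <- RPow_abs, (Rabs_pos_eq rho) in H by lra. exact H. }
  assert (Hbel : forall n l, Rabs (be n l) * rho ^ l <= Y n).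
  { intros n l. pose proof (bsum_term _ _ l (proj2 (Hbe n) rho ltac:(lra))) as H.
    cbv beta in H. rewrite Rabs_mult, <- RPow_abs, (Rabs_pos_eq rho) in H by lra. exact H. }
  assert (Hpow : forall i, 0 < rho ^ i) by (intros; apply pow_lt; lra).
  set (T := fun i l n => lm n * (al n i * be n l)).
  assert (HT : forall i l, bsum (fun n => rho ^ (i + l) * T i l n) M).
  { intros i l. apply (bsum_le_pos _ (fun n => Rabs (lm n) * (X n * Y n)) M); [|lra|exact Hsum].
    intros n. unfold T. rewrite !Rabs_mult, (Rabs_pos_eq (rho ^ (i + l))) by (left; auto).
    rewrite pow_add.
    apply Rle_trans with (Rabs (lm n) * ((Rabs (al n i) * rho ^ i) * (Rabs (be n l) * rho ^ l)));
      [right; ring|].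
    apply Rmult_le_compat_l; [apply Rabs_pos|].
    apply Rmult_le_compat; auto; apply Rmult_le_pos; try apply Rabs_pos; left; auto. }
  assert (HTs : forall i l, is_series (T i l) (Series (T i l))).
  { intros i l. apply (bsum_is_series _ (/ rho ^ (i + l) * M)).
    pose proof (bsum_scal (/ rho ^ (i + l)) _ _ (HT i l)) as H.
    rewrite Rabs_pos_eq in H by (left; apply Rinv_0_lt_compat; auto).
    revert H. apply bsum_le; [|lra]. intros n. right. f_equal. field.
    apply Rgt_not_eq. apply Hpow. }
  exists (fun i l => Series (T i l)). split.
  - intros i l.
    pose proof (is_series_Rabs_le _ _ _ (is_series_cmult (rho ^ (i + l)) _ _ (HTs i l)) (HT i l)) as H.
    rewrite Rabs_mult, (Rabs_pos_eq (rho ^ (i + l))) in H by (left; auto). lra.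
  - intros u v Hu Hv. simpl.
    set (B := fun n => (y0 + v) ^ deg (t n)).
    assert (Hrv : forall n, bsum (fun l => be n l * v ^ l) (Y n)).
    { intros n. generalize (proj2 (Hbe n) rho ltac:(lra)). apply bsum_le; [|right; reflexivity].
      intros l. rewrite !Rabs_mult, <- !RPow_abs. apply Rmult_le_compat_l; [apply Rabs_pos|].
      apply pow_incr. rewrite (Rabs_pos_eq rho) by lra. split; [apply Rabs_pos|lra]. }
    assert (Hru : forall n, bsum (fun i => al n i * u ^ i) (X n)).
    { intros n. generalize (proj2 (Hal n) rho ltac:(lra)). apply bsum_le; [|right; reflexivity].
      intros l. rewrite !Rabs_mult, <- !RPow_abs. apply Rmult_le_compat_l; [apply Rabs_pos|].
      apply pow_incr. rewrite (Rabs_pos_eq rho) by lra. split; [apply Rabs_pos|lra]. }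
    assert (HB : forall n, Rabs (B n) <= Y n).
    { intros n. unfold B, Y. rewrite <- RPow_abs. apply pow_incr. split; [apply Rabs_pos|].
      eapply Rle_trans; [apply Rabs_triang|lra]. }
    assert (D1 : forall i, exists s, is_series (fun n => lm n * al n i * B n) s /\
      is_series (fun l => Series (T i l) * v ^ l) s).
    { intros i.
      destruct (dsum_swap (fun n l => lm n * al n i * (be n l * v ^ l)) (/ rho ^ i * M))
        as [s [A1 [A2 _]]].
      { apply (dbsum_rows _ (fun n => / rho ^ i * (Rabs (lm n) * (X n * Y n)))).
        - intros n. generalize (bsum_scal (lm n * al n i) _ _ (Hrv n)). apply bsum_le.
          + intros l. right. reflexivity.
          + rewrite Rabs_mult.
            apply Rle_trans with (/ rho ^ i * (Rabs (lm n) * ((Rabs (al n i) * rho ^ i) * Y n))).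
            * right. field. apply Rgt_not_eq, Hpow.
            * apply Rmult_le_compat_l; [left; apply Rinv_0_lt_compat; auto|].
              apply Rmult_le_compat_l; [apply Rabs_pos|]. apply Rmult_le_compat_r; auto.
        - intros n. rewrite psum_scal. apply Rmult_le_compat_l; auto.
          left; apply Rinv_0_lt_compat; auto. }
      exists s. split.
      - revert A1. apply is_series_ext. intros n. rewrite Series_scal_l. f_equal.
        apply is_series_unique. apply Hbe.
      - revert A2. apply is_series_ext. intros l.
        rewrite <- Series_scal_r. apply Series_ext. intros n. unfold T. ring. }
    apply fun_choice in D1. destruct D1 as [S HS].
    exists S. split; [intros j; apply HS|].
    destruct (dsum_swap (fun n i => lm n * B n * (al n i * u ^ i)) M) as [s [A1 [A2 _]]].
    { apply (dbsum_rows _ (fun n => Rabs (lm n) * (X n * Y n))); [|exact Hsum].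
      intros n. generalize (bsum_scal (lm n * B n) _ _ (Hru n)). apply bsum_le.
      - intros l. right. reflexivity.
      - rewrite Rabs_mult, Rmult_assoc. apply Rmult_le_compat_l; [apply Rabs_pos|].
        rewrite Rmult_comm. apply Rmult_le_compat_l; [left; auto|auto]. }
    replace (f (x0 + u) (y0 + v)) with s.
    + revert A2. apply is_series_ext. intros i. rewrite <- (is_series_unique _ _ (proj1 (HS i))).
      rewrite <- Series_scal_r. apply Series_ext. intros n. ring.
    + apply (is_series_unique_R _ _ _ A1).
      assert (Hyv : Rabs (y0 + v) <= b) by (eapply Rle_trans; [apply Rabs_triang|lra]).
      generalize (H3 (x0 + u) (y0 + v) Hyv). apply is_series_ext. intros n.
      rewrite Series_scal_l. rewrite (is_series_unique _ _ (proj1 (Hal n) u)).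
      eqR. unfold ev, lm, B. ring.
Qed.

Lemma bounded_CV_radius (a : nat -> R) rho M : 0 < rho ->
  (forall n, Rabs (a n) * rho ^ n <= M) -> Rbar_lt 0 (CV_radius a).
Proof.
  intros Hr Ha. assert (H : CV_disk a (rho / 2)).
  { apply (ex_series_le (K := R_AbsRing) (V := R_CompleteNormedModule) _ (fun n => M * (1 / 2) ^ n)).
    - intros n. change (Rabs (Rabs (a n * (rho / 2) ^ n)) <= M * (1 / 2) ^ n).
      rewrite Rabs_Rabsolu, Rabs_mult, <- RPow_abs, (Rabs_pos_eq (rho / 2)) by lra.
      replace (rho / 2) with (rho * (1 / 2)) by field. rewrite Rpow_mult_distr, <- Rmult_assoc.
      apply Rmult_le_compat_r; [apply pow_le; lra|apply Ha].
    - destruct (ex_series_geom (1 / 2)) as [l Hl]; [rewrite Rabs_pos_eq; lra|].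
      exists (M * l). apply is_series_cmult, Hl. }
  unfold CV_radius. destruct (Lub_Rbar_correct (CV_disk a)) as [HL _].
  apply Rbar_lt_le_trans with (rho / 2); [simpl; lra|]. apply HL, H.
Qed.

Lemma is_derive_power_series (h : R -> R) x0 (a : nat -> R) rho M : 0 < rho ->
  (forall n, Rabs (a n) * rho ^ n <= M) ->
  (forall u, Rabs u < rho -> is_series (fun n => a n * u ^ n) (h (x0 + u))) ->
  is_derive h x0 (a 1%nat).
Proof.
  intros Hr Ha Hs.
  pose proof (is_derive_PSeries a 0) as D. rewrite Rabs_R0 in D.
  specialize (D (bounded_CV_radius a rho M Hr Ha)).
  rewrite PSeries_0 in D. unfold PS_derive in D. rewrite Rmult_1_l in D.
  apply (is_derive_ext_loc (fun x => PSeries a (x - x0))).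
  - assert (E0 : forall x, x = x0 + (x - x0)) by (intros; ring).
    exists (mkposreal rho Hr). intros x Hx.
    change (Rabs (x - x0) < rho) in Hx.
    specialize (Hs (x - x0) Hx). replace (x0 + (x - x0)) with x in Hs by exact (E0 x).
    unfold PSeries. apply is_series_unique. exact Hs.
  - replace (a 1%nat) with (1 * a 1%nat) by ring.
    apply (is_derive_comp (PSeries a) (fun x => x - x0)).
    + replace (x0 - x0) with 0 by ring. exact D.
    + auto_derive; auto.
Qed.

Lemma expansion_partials f p c rho M : 0 < rho -> expansion f p c rho M ->
  is_derive (fun u => f (u, snd p)) (fst p) (c 1%nat 0%nat) /\
  is_derive (fun v => f (fst p, v)) (snd p) (c 0%nat 1%nat).
Proof.
  intros Hr [H1 H2]. assert (R00 : Rabs 0 < rho) by (rewrite Rabs_R0; lra).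
  assert (Z : forall (a : nat -> R) l, is_series (fun n => a n * 0 ^ n) l -> l = a 0%nat).
  { intros a l H. apply (is_series_unique_R _ _ _ H).
    replace (a 0%nat) with (psum (fun n => a n * 0 ^ n) 1) by (simpl; ring).
    apply is_series_finite. intros [|i] Hi; [lia|simpl; ring]. }
  split.
  - apply (is_derive_power_series _ _ (fun j => c j 0%nat) rho M Hr).
    + intros n. specialize (H1 n 0%nat). rewrite Nat.add_0_r in H1. exact H1.
    + intros u Hu. destruct (H2 u 0 Hu R00) as [S [S1 S2]]. rewrite Rplus_0_r in S2.
      revert S2. apply is_series_ext. intros n. rewrite (Z _ _ (S1 n)). reflexivity.
  - apply (is_derive_power_series _ _ (fun j => c 0%nat j) rho M Hr).
    + intros n. apply (H1 0%nat n).
    + intros v Hv. destruct (H2 0 v R00 Hv) as [S [S1 S2]]. rewrite Rplus_0_r in S2.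
      pose proof (S1 0%nat) as S10. rewrite <- (Z _ _ S2) in S10. exact S10.
Qed.

Lemma W_partials a b M f x y rho : W a b M f -> 0 < rho <= a -> Rabs y + rho <= b ->
  exists d1 d2, is_derive (fun u => f u y) x d1 /\ is_derive (fun v => f x v) y d2 /\
    Rabs d1 <= M / rho /\ Rabs d2 <= M / rho.
Proof.
  intros Hf Hr Hy. destruct (W_expansion a b M f x y rho Hf Hr Hy) as [c Hc].
  destruct (expansion_partials _ _ _ _ _ (proj1 Hr) Hc) as [D1 D2].
  exists (c 1%nat 0%nat), (c 0%nat 1%nat). split; [exact D1|]. split; [exact D2|]. split.
  - apply Rmult_le_reg_r with rho; [lra|]. pose proof (proj1 Hc 1%nat 0%nat) as H.
    simpl in H. unfold Rdiv. rewrite Rmult_assoc, Rinv_l by lra. lra.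
  - apply Rmult_le_reg_r with rho; [lra|]. pose proof (proj1 Hc 0%nat 1%nat) as H.
    simpl in H. unfold Rdiv. rewrite Rmult_assoc, Rinv_l by lra. lra.
Qed.

Lemma W_analytic2 a b b' M f : W a b M f -> 0 < a -> b' <= b ->
  analytic2 R_AbsRing (strip (sym_itv b')) (fun p => f (fst p) (snd p)).
Proof.
  intros Hf Ha Hb. apply expansion_analytic2. intros [x0 y0] Hp.
  unfold strip, sym_itv in Hp. simpl in Hp.
  assert (Rabs y0 < b') by (apply Rabs_def1; lra).
  set (rho := Rmin a (b - Rabs y0)).
  assert (0 < rho) by (apply Rmin_pos; lra).
  pose proof (Rmin_l a (b - Rabs y0)). pose proof (Rmin_r a (b - Rabs y0)). fold rho in H1, H2.
  destruct (W_expansion a b M f x0 y0 rho Hf) as [c Hc]; try lra.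
  exists c, rho, M. auto.
Qed.

Lemma W_analytic2_fst a b b' M f : W a b M f -> 0 < a -> b' <= b ->
  analytic2 R_AbsRing (strip (sym_itv b')) (fun p => fst p + f (fst p) (snd p)).
Proof.
  intros Hf Ha Hb. apply expansion_analytic2. intros [x0 y0] Hp.
  unfold strip, sym_itv in Hp. simpl in Hp.
  assert (Rabs y0 < b') by (apply Rabs_def1; lra).
  set (rho := Rmin a (b - Rabs y0)).
  assert (Hr : 0 < rho) by (apply Rmin_pos; lra).
  pose proof (Rmin_l a (b - Rabs y0)). pose proof (Rmin_r a (b - Rabs y0)). fold rho in H0, H1.
  destruct (W_expansion a b M f x0 y0 rho Hf) as [c [Hc1 Hc2]]; try lra.
  (* The identity in [x] is not periodic, hence not a sum of atoms: its two Taylor coefficients are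
     added by hand. *)
  pose (e := fun j k => match j, k with O, O => x0 | 1%nat, O => 1 | _, _ => 0 end).
  assert (HM : 0 <= M) by (eapply W_M_pos; eauto).
  exists (fun j k => c j k + e j k), rho, (M + (Rabs x0 + rho)). split; [exact Hr|]. split.
  - intros j k. specialize (Hc1 j k).
    assert (Rabs (e j k) * rho ^ (j + k) <= Rabs x0 + rho).
    { pose proof (Rabs_pos x0).
      destruct j as [|[|j]]; destruct k as [|k]; simpl; rewrite ?Rabs_R0, ?Rabs_R1; lra. }
    pose proof (Rabs_triang (c j k) (e j k)). assert (0 < rho ^ (j + k)) by (apply pow_lt, Hr).
    nra.
  - intros u v Hu Hv. destruct (Hc2 u v Hu Hv) as [S [S1 S2]].
    pose (e' := fun j => match j with O => x0 | 1%nat => 1 | _ => 0 end).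
    exists (fun j => S j + e' j). split.
    + intros j. assert (He : is_series (fun k => e j k * v ^ k) (e' j)).
      { replace (e' j) with (psum (fun k => e j k * v ^ k) 1).
        - apply is_series_finite. intros [|i] Hi; [lia|].
          destruct j as [|[|j]]; simpl; ring.
        - destruct j as [|[|j]]; simpl; ring. }
      generalize (is_series_plus _ _ _ _ (S1 j) He). apply is_series_ext.
      intros n. change (c j n * v ^ n + e j n * v ^ n = (c j n + e j n) * v ^ n). ring.
    + assert (He : is_series (fun j => e' j * u ^ j) (x0 + u)).
      { replace (x0 + u) with (psum (fun j => e' j * u ^ j) 2) by (simpl; ring).
        apply is_series_finite. intros [|[|i]] Hi; try lia. simpl. ring. }
      simpl in *. generalize (is_series_plus _ _ _ _ He S2). apply is_series_ext.
      intros n. change (e' n * u ^ n + S n * u ^ n = (S n + e' n) * u ^ n). ring.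
Qed.

(** * The homological equation *)

Lemma derive_nonneg_le (f f' : R -> R) a b : a <= b ->
  (forall x, a <= x <= b -> is_derive f x (f' x)) ->
  (forall x, a <= x <= b -> 0 <= f' x) -> f a <= f b.
Proof.
  intros Hab Hd Hp. destruct (MVT_gen f a b f') as [c [Hc E]].
  - intros x Hx. apply Hd. rewrite Rmin_left, Rmax_right in Hx; lra.
  - intros x Hx. rewrite Rmin_left, Rmax_right in Hx by lra.
    apply continuity_pt_filterlim. apply (ex_derive_continuous f x). eexists; apply Hd; lra.
  - rewrite Rmin_left, Rmax_right in Hc by lra. specialize (Hp c Hc). nra.
Qed.

(** * The power series of the cotangent *)

Lemma psum_conv a b N :
  psum (fun m => psum (fun i => a i * b (m - i)%nat) (S m)) N = psum (fun i => a i * psum b (N - i)) N.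
Proof.
  set (c := fun m => psum (fun i => a i * b (m - i)%nat) (S m)).
  induction N as [|N IH]; [reflexivity|].
  cbn [psum]. rewrite IH. replace (S N - N)%nat with 1%nat by lia.
  rewrite (psum_ext (fun i => a i * psum b (S N - i)) (fun i => a i * psum b (N - i) + a i * b (N - i)%nat)).
  - rewrite psum_plus. unfold c. cbn [psum]. rewrite Nat.sub_diag. ring.
  - intros i Hi. replace (S N - i)%nat with (S (N - i)) by lia. simpl. ring.
Qed.

(* The Taylor coefficients of [1/x - cot x], which solves [x u' + 2 u = x (1 + u^2)]. *)
Fixpoint cot_coef_upto (n : nat) : nat -> R :=
  match n with
  | O => fun _ => 0
  | S n => fun k => if Nat.eq_dec k n
      then ((if Nat.eq_dec n 1 then 1 else 0)
        + psum (fun i => cot_coef_upto n i * cot_coef_upto n (n - 1 - i)%nat) n) / (INR n + 2)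
      else cot_coef_upto n k
  end.

Definition cot_coef (n : nat) : R := cot_coef_upto (S n) n.

Lemma cot_coef_upto_eq n k : (k < n)%nat -> cot_coef_upto n k = cot_coef k.
Proof.
  induction n as [|n IH]; intros Hk; [lia|].
  destruct (Nat.eq_dec k n) as [->|Hne]; [reflexivity|].
  rewrite <- IH by lia. simpl. destruct (Nat.eq_dec k n); [contradiction|reflexivity].
Qed.

Lemma cot_coef_eq n : (INR n + 2) * cot_coef n =
  (if Nat.eq_dec n 1 then 1 else 0) + psum (fun i => cot_coef i * cot_coef (n - 1 - i)) n.
Proof.
  unfold cot_coef at 1. cbn [cot_coef_upto]. destruct (Nat.eq_dec n n) as [_|]; [|contradiction].
  rewrite (psum_ext (fun i => cot_coef_upto n i * _) (fun i => cot_coef i * cot_coef (n - 1 - i))).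
  - field. pose proof (pos_INR n). lra.
  - intros i Hi. rewrite !cot_coef_upto_eq by lia. reflexivity.
Qed.

Lemma cot_coef_nonneg n : 0 <= cot_coef n.
Proof.
  assert (H : forall n k, (k < n)%nat -> 0 <= cot_coef k).
  { clear. induction n as [|n IH]; intros k Hk; [lia|].
    pose proof (cot_coef_eq k) as E. pose proof (pos_INR k).
    assert (0 <= psum (fun i => cot_coef i * cot_coef (k - 1 - i)) k).
    { rewrite (psum_ext _ (fun i => if lt_dec i k then cot_coef i * cot_coef (k - 1 - i) else 0)).
      - apply psum_nonneg. intros i. destruct (lt_dec i k); [|lra].
        apply Rmult_le_pos; apply IH; lia.
      - intros i Hi. destruct (lt_dec i k); [reflexivity|lia]. }
    assert (0 <= (INR k + 2) * cot_coef k) by (rewrite E; destruct (Nat.eq_dec k 1); lra).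
    nra. }
  apply (H (S n)). lia.
Qed.

Definition cot_psum (N : nat) (x : R) : R := psum (fun n => cot_coef n * x ^ n) N.

Lemma is_derive_x2_cot_psum N x :
  is_derive (fun x => x ^ 2 * cot_psum N x) x
    (psum (fun n => (INR n + 2) * cot_coef n * x ^ S n) N).
Proof.
  unfold cot_psum. induction N as [|N IH]; simpl psum.
  - apply (is_derive_ext (fun _ => 0)); [intros; eqR; ring|]. exact (is_derive_const (K := R_AbsRing) (V := R_NormedModule) 0 x).
  - apply (is_derive_ext (fun x => x ^ 2 * psum (fun n => cot_coef n * x ^ n) N
      + x ^ 2 * (cot_coef N * x ^ N))); [intros; eqR; simpl; ring|].
    assert (D : is_derive (fun x => x ^ 2 * (cot_coef N * x ^ N)) x ((INR N + 2) * cot_coef N * x ^ S N)).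
    { apply (is_derive_ext (fun x => cot_coef N * x ^ S (S N))); [intros; eqR; simpl; ring|].
      auto_derive; [auto|]. change (match N with O => 1 | S _ => INR N + 1 end) with (INR (S N)). rewrite S_INR. simpl. ring. }
    exact (is_derive_plus _ _ _ _ _ IH D).
Qed.

(** Comparison for the differential equation, by induction on the truncation. With [u = 1/x - cot x]
    one has [(x^2 u)' = x^2 (1 + u^2)]. For the next truncation the derivative of [x^2 S] is at most
    [x^2 (1 + S_N^2)], since all coefficients are nonnegative and the square contains every product
    used by the recursion. So [D], the difference of the two, is nondecreasing, and it tends to 0 at
    0. *)
Lemma cot_psum_le N x : 0 < x < PI -> cot_psum N x <= / x - cos x / sin x.
Proof.
  revert x. induction N as [|N IH]; intros x Hx.
  - unfold cot_psum; simpl.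
    assert (Hs : 0 < sin x) by (apply sin_gt_0; lra).
    assert (x * cos x <= sin x).
    { pose proof (derive_nonneg_le (fun t => sin t - t * cos t) (fun t => t * sin t) 0 x) as D.
      cbv beta in D. rewrite sin_0 in D.
      assert (0 - 0 * cos 0 <= sin x - x * cos x); [apply D|]; try lra.
      - intros t _. auto_derive; auto. ring.
      - intros t Ht. apply Rmult_le_pos; [lra|]. apply sin_ge_0; lra. }
    replace (/ x - cos x / sin x) with ((sin x - x * cos x) / (x * sin x)) by (field; lra).
    apply Rmult_le_pos; [lra|]. left. apply Rinv_0_lt_compat. apply Rmult_lt_0_compat; lra.
  - pose (D := fun t => t - t ^ 2 * (cos t / sin t) - t ^ 2 * cot_psum (S N) t).
    assert (HD : forall e, 0 < e <= x -> D e <= D x).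
    { intros e He.
      apply (derive_nonneg_le D (fun t =>
        (1 - (2 * t * (cos t / sin t) + t ^ 2 * (- 1 - (cos t / sin t) ^ 2)))
         - psum (fun n => (INR n + 2) * cot_coef n * t ^ S n) (S N))); [lra| |].
      - intros t Ht. assert (Hs : 0 < sin t) by (apply sin_gt_0; lra).
        apply (is_derive_minus (fun t => t - t ^ 2 * (cos t / sin t))
          (fun t => t ^ 2 * cot_psum (S N) t)); [|apply is_derive_x2_cot_psum].
        auto_derive; [lra|]. field. lra.
      - intros t Ht. assert (Hs : 0 < sin t) by (apply sin_gt_0; lra).
        specialize (IH t ltac:(lra)). set (c := cos t / sin t) in *.
        assert (B : psum (fun n => (INR n + 2) * cot_coef n * t ^ S n) (S N)
          <= t ^ 2 * (1 + cot_psum N t ^ 2)).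
        { rewrite (psum_ext _ (fun n => (if Nat.eq_dec n 1 then t ^ 2 else 0) +
             t ^ S n * psum (fun i => cot_coef i * cot_coef (n - 1 - i)) n)).
          2: { intros n _. rewrite cot_coef_eq. destruct (Nat.eq_dec n 1) as [->|]; simpl; ring. }
          rewrite psum_plus.
          assert (psum (fun n => if Nat.eq_dec n 1 then t ^ 2 else 0) (S N) <= t ^ 2).
          { eapply Rle_trans; [apply (psum_finite_le _ 2)|].
            - intros [|[|i]] Hi; try lia. reflexivity.
            - intros i. destruct (Nat.eq_dec i 1); [apply pow2_ge_0|lra].
            - simpl. lra. }
          assert (psum (fun n => t ^ S n * psum (fun i => cot_coef i * cot_coef (n - 1 - i)) n) (S N)
             <= t ^ 2 * cot_psum N t ^ 2); [|lra].
          assert (E : psum (fun n => t ^ S n * psum (fun i => cot_coef i * cot_coef (n - 1 - i)) n) (S N)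
            = t ^ 2 * psum (fun m => psum (fun i => (cot_coef i * t ^ i) *
                 (cot_coef (m - i) * t ^ (m - i))) (S m)) N).
          { clear. induction N as [|N IH].
            - simpl. ring.
            - cbn [psum] in IH |- *. rewrite IH.
              rewrite (Rmult_plus_distr_l (t ^ 2)). f_equal.
              change (t ^ S (S N) * psum (fun i => cot_coef i * cot_coef (S N - 1 - i)) (S N) =
                t ^ 2 * psum (fun i => cot_coef i * t ^ i * (cot_coef (N - i) * t ^ (N - i))) (S N)).
              rewrite <- !psum_scal. apply psum_ext. intros i Hi.
              replace (S N - 1 - i)%nat with (N - i)%nat by lia.
              replace (S (S N)) with (2 + (i + (N - i)))%nat by lia. rewrite !pow_add. ring. }
          rewrite E. apply Rmult_le_compat_l; [apply pow2_ge_0|].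
          rewrite (psum_conv (fun i => cot_coef i * t ^ i) (fun i => cot_coef i * t ^ i) N). unfold cot_psum. simpl. rewrite Rmult_1_r.
          rewrite <- psum_scal.
          assert (Hp : forall i, 0 <= cot_coef i * t ^ i)
            by (intros i; apply Rmult_le_pos; [apply cot_coef_nonneg|apply pow_le; lra]).
          apply psum_le. intros i Hi. rewrite Rmult_comm. apply Rmult_le_compat_r; [apply Hp|].
          apply psum_le_mono; [exact Hp|lia]. }
        assert (0 <= cot_psum N t).
        { apply psum_nonneg. intros i. apply Rmult_le_pos; [apply cot_coef_nonneg|apply pow_le; lra]. }
        assert (cot_psum N t ^ 2 <= (/ t - c) ^ 2) by (apply pow_incr; lra).
        assert (t ^ 2 * (1 + cot_psum N t ^ 2) <= t ^ 2 * (1 + (/ t - c) ^ 2)).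
        { apply Rmult_le_compat_l; [apply pow2_ge_0|lra]. }
        replace (t ^ 2 * (1 + (/ t - c) ^ 2)) with (t ^ 2 + 1 - 2 * t * c + t ^ 2 * c ^ 2) in H1
          by (field; lra). lra. }
    assert (HS : forall e, 0 < e <= 1 -> cot_psum (S N) e <= cot_psum (S N) 1).
    { intros e He. apply psum_le. intros i _. apply Rmult_le_compat_l; [apply cot_coef_nonneg|].
      apply pow_incr. lra. }
    assert (Hpos : 0 <= D x).
    { apply Rnot_lt_le. intros Hneg.
      set (K := cot_psum (S N) 1) in *.
      assert (HK : 0 <= K).
      { apply psum_nonneg. intros i. apply Rmult_le_pos; [apply cot_coef_nonneg|apply pow_le; lra]. }
      (* In place of a limit at 0: if [D x < 0], this [e] satisfies [D e >= - e K > D x], against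
         monotonicity. *)
      set (e := Rmin (Rmin x 1) (- D x / (2 * (K + 1)))).
      assert (0 < - D x / (2 * (K + 1))).
      { apply Rmult_lt_0_compat; [lra|]. apply Rinv_0_lt_compat. lra. }
      assert (He : 0 < e) by (repeat apply Rmin_pos; lra).
      assert (He1 : e <= Rmin x 1) by apply Rmin_l.
      assert (He2 : e <= - D x / (2 * (K + 1))) by apply Rmin_r.
      pose proof (Rmin_l x 1). pose proof (Rmin_r x 1).
      specialize (HD e ltac:(lra)). specialize (HS e ltac:(lra)).
      assert (Hs : 0 < sin e) by (apply sin_gt_0; lra).
      assert (0 - 0 * cos 0 <= sin e - e * cos e).
      { pose proof (derive_nonneg_le (fun t => sin t - t * cos t) (fun t => t * sin t) 0 e) as Q.
        cbv beta in Q. rewrite sin_0 in Q. apply Q; try lra.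
        - intros t _. auto_derive; auto. ring.
        - intros t Ht. apply Rmult_le_pos; [lra|]. apply sin_ge_0; lra. }
      assert (e * (cos e / sin e) <= 1).
      { apply Rmult_le_reg_r with (sin e); [exact Hs|].
        replace (e * (cos e / sin e) * sin e) with (e * cos e) by (field; lra). lra. }
      assert (- (e * K) <= D e).
      { unfold D. replace (e - e ^ 2 * (cos e / sin e) - e ^ 2 * cot_psum (S N) e)
          with (e * (1 - e * (cos e / sin e)) - e * (e * cot_psum (S N) e)) by ring.
        assert (e * cot_psum (S N) e <= K).
        { apply Rle_trans with (1 * K); [|lra].
          assert (0 <= cot_psum (S N) e).
          { apply psum_nonneg. intros i. apply Rmult_le_pos; [apply cot_coef_nonneg|apply pow_le; lra]. }
          apply Rmult_le_compat; lra. }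
        nra. }
      assert (e * (2 * (K + 1)) <= - D x).
      { apply Rmult_le_reg_r with (/ (2 * (K + 1))); [apply Rinv_0_lt_compat; lra|].
        rewrite Rmult_assoc, Rinv_r by lra. unfold Rdiv in He2. lra. }
      nra. }
    unfold D in Hpos. assert (0 < x ^ 2) by (apply pow_lt; lra).
    apply Rmult_le_reg_l with (x ^ 2); [assumption|].
    replace (x ^ 2 * (/ x - cos x / sin x)) with (x - x ^ 2 * (cos x / sin x)) by (field;
      split; [apply Rgt_not_eq, sin_gt_0; lra|lra]).
    lra.
Qed.

Lemma cot_coef_bsum r : 0 < r < 1 -> exists M, bsum (fun n => cot_coef n * (PI * r) ^ n) M.
Proof.
  intros Hr. pose proof PI_ge_3.
  exists (/ (PI * r) - cos (PI * r) / sin (PI * r)).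
  assert (Hpr : 0 < PI * r < PI) by (split; nra).
  intros n. rewrite (psum_ext _ (fun n => cot_coef n * (PI * r) ^ n)).
  - apply cot_psum_le. exact Hpr.
  - intros i _. apply Rabs_pos_eq. apply Rmult_le_pos; [apply cot_coef_nonneg|apply pow_le; lra].
Qed.

Lemma cot_radius x : Rabs x < PI -> Rbar_lt (Rabs x) (CV_radius cot_coef).
Proof.
  intros Hx. pose proof PI_ge_3. pose proof (Rabs_pos x).
  set (r := (Rabs x / PI + 1) / 2).
  assert (Hq : 0 <= Rabs x / PI < 1).
  { split; [apply Rmult_le_pos; [lra|left; apply Rinv_0_lt_compat; lra]|].
    apply Rmult_lt_reg_r with PI; [lra|]. unfold Rdiv. rewrite Rmult_assoc, Rinv_l; lra. }
  assert (Hr : 0 < r < 1) by (unfold r; lra).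
  destruct (cot_coef_bsum r Hr) as [M HM].
  unfold CV_radius. destruct (Lub_Rbar_correct (CV_disk cot_coef)) as [HL _].
  apply Rbar_lt_le_trans with (PI * r).
  - simpl. apply Rlt_le_trans with (PI * (Rabs x / PI) + (PI * r - PI * (Rabs x / PI))); [|lra].
    replace (PI * (Rabs x / PI)) with (Rabs x) by (field; lra).
    assert (PI * (Rabs x / PI) < PI * r) by (apply Rmult_lt_compat_l; unfold r; lra).
    replace (PI * (Rabs x / PI)) with (Rabs x) in H1 by (field; lra). lra.
  - apply HL. unfold CV_disk. apply (bsum_ex_Rabs _ M HM).
Qed.

Lemma cot_ode x : Rabs x < PI ->
  x * PSeries (PS_derive cot_coef) x + 2 * PSeries cot_coef x
  = x * (1 + PSeries cot_coef x ^ 2).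
Proof.
  intros Hx. pose proof (cot_radius x Hx) as HR.
  pose proof (PSeries_correct _ _ (CV_radius_inside _ _ HR)) as H0.
  assert (HR' : Rbar_lt (Rabs x) (CV_radius (PS_derive cot_coef)))
    by (rewrite CV_radius_derive; exact HR).
  pose proof (PSeries_correct _ _ (CV_radius_inside _ _ HR')) as H1.
  pose proof (is_pseries_mult _ _ _ _ _ H0 H0 HR HR) as H2.
  apply is_pseries_incr_1 in H1. apply is_pseries_R in H1.
  pose proof (proj1 (is_pseries_R _ _ _) H0) as H0'.
  pose proof (is_series_plus _ _ _ _ H1 (is_series_cmult 2 _ _ H0')) as L.
  assert (Hone : is_pseries (fun n => match n with O => 1 | _ => 0 end) x 1).
  { apply is_pseries_R. apply (is_series_finite_eq _ 1); [|simpl; ring].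
    intros [|i] Hi; [lia|ring]. }
  pose proof (is_pseries_plus _ _ _ _ _ Hone H2) as Rr.
  apply is_pseries_incr_1 in Rr. apply is_pseries_R in Rr.
  change (is_series (fun n => x ^ n * PS_incr_1 (PS_plus (fun n => match n with O => 1 | _ => 0 end)
    (PS_mult cot_coef cot_coef)) n) (x * (1 + PSeries cot_coef x * PSeries cot_coef x))) in Rr.
  change (is_series (fun n => x ^ n * PS_incr_1 (PS_derive cot_coef) n + 2 * (x ^ n * cot_coef n))
    (x * PSeries (PS_derive cot_coef) x + 2 * PSeries cot_coef x)) in L.
  replace (PSeries cot_coef x ^ 2) with (PSeries cot_coef x * PSeries cot_coef x) by ring.
  apply (is_series_unique_R _ _ _ L). revert Rr. apply is_series_ext.
  intros n. eqR. pose proof (cot_coef_eq n) as E.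
  destruct n as [|n].
  - simpl in E. simpl. unfold zero; simpl. nra.
  - change (PS_incr_1 (PS_derive cot_coef) (S n)) with (INR (S n) * cot_coef (S n)).
    change (PS_incr_1 (PS_plus (fun n => match n with O => 1 | _ => 0 end)
       (PS_mult cot_coef cot_coef)) (S n)) with
      (match n with O => 1 | _ => 0 end + sum_f_R0 (fun k => cot_coef k * cot_coef (n - k)) n).
    replace (x ^ S n * (INR (S n) * cot_coef (S n)) + 2 * (x ^ S n * cot_coef (S n)))
      with (x ^ S n * ((INR (S n) + 2) * cot_coef (S n))) by ring.
    rewrite E, <- sum_n_Reals, <- psum_sum_n. f_equal. f_equal.
    + destruct n as [|n]; [reflexivity|]. destruct (Nat.eq_dec (S (S n)) 1); [lia|reflexivity].
    + apply psum_ext. intros i Hi. replace (S n - 1 - i)%nat with (n - i)%nat by lia. reflexivity.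
Qed.

(** Gronwall: [F^2 exp (- 2 K t)] does not increase to the right of 0, and [F^2 exp (2 K t)] does
    not decrease on the left. *)
Lemma linear_ode_zero (F s : R -> R) (B K x : R) :
  (forall t, Rabs t <= B -> is_derive F t (s t * F t)) ->
  (forall t, Rabs t <= B -> Rabs (s t) <= K) -> F 0 = 0 -> Rabs x <= B -> F x = 0.
Proof.
  intros HF Hs HF0 Hx.
  assert (Z : F x ^ 2 <= 0).
  { destruct (Rle_dec 0 x) as [Hx0|Hx0].
    - assert (HD : - (F 0 ^ 2 * exp (- (2 * K * 0))) <= - (F x ^ 2 * exp (- (2 * K * x)))).
      { apply (derive_nonneg_le (fun t => - (F t ^ 2 * exp (- (2 * K * t))))
          (fun t => 2 * (K - s t) * F t ^ 2 * exp (- (2 * K * t)))); [lra| |].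
        - intros t Ht. assert (Ht' : Rabs t <= B) by (rewrite Rabs_pos_eq in *; lra).
          pose proof (HF t Ht') as D.
          auto_derive; [eexists; exact D|].
          rewrite (is_derive_unique _ _ _ D : Derive (fun x => F x) t = _). ring.
        - intros t Ht. assert (Ht' : Rabs t <= B) by (rewrite Rabs_pos_eq in *; lra).
          pose proof (Rle_abs (s t)). specialize (Hs t Ht').
          apply Rmult_le_pos; [apply Rmult_le_pos; [lra|apply pow2_ge_0]|left; apply exp_pos]. }
      rewrite HF0 in HD. pose proof (exp_pos (- (2 * K * x))). pose proof (pow2_ge_0 (F x)). nra.
    - assert (HD : F x ^ 2 * exp (2 * K * x) <= F 0 ^ 2 * exp (2 * K * 0)).
      { apply (derive_nonneg_le (fun t => F t ^ 2 * exp (2 * K * t))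
          (fun t => 2 * (K + s t) * F t ^ 2 * exp (2 * K * t))); [lra| |].
        - intros t Ht. assert (Ht' : Rabs t <= B) by (rewrite Rabs_left1 in *; lra).
          pose proof (HF t Ht') as D.
          auto_derive; [eexists; exact D|].
          rewrite (is_derive_unique _ _ _ D : Derive (fun x => F x) t = _). ring.
        - intros t Ht. assert (Ht' : Rabs t <= B) by (rewrite Rabs_left1 in *; lra).
          pose proof (Rle_abs (- s t)). rewrite Rabs_Ropp in H. specialize (Hs t Ht').
          apply Rmult_le_pos; [apply Rmult_le_pos; [lra|apply pow2_ge_0]|left; apply exp_pos]. }
      rewrite HF0 in HD. pose proof (exp_pos (2 * K * x)). pose proof (pow2_ge_0 (F x)). nra. }
  pose proof (pow2_ge_0 (F x)). nra.
Qed.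

(** The defect [F] of the identity satisfies [F' = s F] and [F 0 = 0], because the series solves the
    same Riccati equation as [1/x - cot x]. Multiplied by [x sin x], the identity makes sense at 0
    as well. *)
Lemma cot_identity x : Rabs x < PI ->
  (1 - x * PSeries cot_coef x) * sin x = x * cos x.
Proof.
  intros Hx. set (s := PSeries cot_coef).
  set (F := fun t => t * s t * sin t + t * cos t - sin t).
  assert (HF : forall t, Rabs t < PI -> is_derive F t (s t * F t)).
  { intros t Ht. pose proof (is_derive_PSeries _ _ (cot_radius t Ht)) as D.
    fold s in D. pose proof (cot_ode t Ht) as E. fold s in E.
    set (s' := PSeries (PS_derive cot_coef) t) in *.
    unfold F.
    assert (D' : is_derive (fun t => t * s t * sin t + t * cos t - sin t) t
      ((s t + t * s') * sin t + t * s t * cos t + (cos t - t * sin t) - cos t)).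
    { auto_derive; [repeat split; exists s'; exact D|].
      rewrite (is_derive_unique _ _ _ D : Derive (fun x => s x) t = s'). ring. }
    replace (s t * (t * s t * sin t + t * cos t - sin t)) with
      ((s t + t * s') * sin t + t * s t * cos t + (cos t - t * sin t) - cos t); [exact D'|].
    replace (t * s') with (t * (1 + s t ^ 2) - 2 * s t) by lra. ring. }
  set (r := (Rabs x / PI + 1) / 2). pose proof PI_ge_3. pose proof (Rabs_pos x).
  assert (Hq : 0 <= Rabs x / PI < 1).
  { split; [apply Rmult_le_pos; [lra|left; apply Rinv_0_lt_compat; lra]|].
    apply Rmult_lt_reg_r with PI; [lra|]. unfold Rdiv. rewrite Rmult_assoc, Rinv_l; lra. }
  assert (Hr : 0 < r < 1) by (unfold r; lra).
  assert (Hxr : Rabs x <= PI * r).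
  { replace (Rabs x) with (PI * (Rabs x / PI)) by (field; lra).
    apply Rmult_le_compat_l; unfold r; lra. }
  assert (Hprl : PI * r < PI) by nra.
  destruct (cot_coef_bsum r Hr) as [K HK].
  assert (Hs : forall t, Rabs t <= PI * r -> Rabs (s t) <= K).
  { intros t Ht. apply (is_series_Rabs_le (fun n => t ^ n * cot_coef n)).
    - apply is_pseries_R. apply PSeries_correct. apply CV_radius_inside. apply cot_radius. lra.
    - revert HK. apply bsum_le; [|lra]. intros n. rewrite !Rabs_mult, <- !RPow_abs, Rmult_comm.
      apply Rmult_le_compat_l; [apply Rabs_pos|]. apply pow_incr.
      rewrite (Rabs_pos_eq (PI * r)) by nra. split; [apply Rabs_pos|exact Ht]. }
  assert (HF0 : F 0 = 0) by (unfold F; rewrite sin_0; ring).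
  pose proof (linear_ode_zero F s (PI * r) K x (fun t Ht => HF t ltac:(lra)) Hs HF0 Hxr) as Z.
  unfold F in Z. lra.
Qed.

(* The factor [c] is [(pi k)^-1 X cot X] with [X = pi k y]. *)
Lemma W_cot r : 0 < r < 1 -> exists K, 0 <= K /\ forall k a b, k <> 0%Z -> 0 <= a -> 0 <= b ->
  Rabs (IZR k) * b <= r ->
  exists c : R -> R, W a b K (fun _ y => c y) /\
    forall y, Rabs y <= b -> c y * sin (PI * IZR k * y) = y * cos (PI * IZR k * y).
Proof.
  intros Hr. destruct (cot_coef_bsum r Hr) as [M HM]. pose proof PI_ge_3.
  assert (HM0 : 0 <= M) by (eapply bsum_nonneg; eauto).
  exists (1 + r * M). split; [nra|].
  intros k a b Hk Ha Hb Hkb.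
  assert (Hk1 : 1 <= Rabs (IZR k)) by (rewrite <- abs_IZR; apply IZR_le; lia).
  assert (Hk0 : IZR k <> 0) by (apply not_0_IZR; exact Hk).
  assert (Hin : forall y, Rabs y <= b -> Rabs (PI * IZR k * y) <= PI * r).
  { intros y Hy. rewrite !Rabs_mult, (Rabs_pos_eq PI), Rmult_assoc by lra.
    apply Rmult_le_compat_l; [lra|]. eapply Rle_trans; [|exact Hkb].
    apply Rmult_le_compat_l; lra. }
  set (s := PSeries cot_coef).
  exists (fun y => / (PI * IZR k) + - (y * s (PI * IZR k * y))). split.
  - assert (Hs : W a b M (fun _ y => s (PI * IZR k * y))).
    { apply (W_series _ a b _ (fun n => Rabs (cot_coef n * (PI * r) ^ n))
        (fun n _ y => cot_coef n * (PI * IZR k * y) ^ n)); [|exact HM|].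
      - intros n. pose proof (W_lin _ _ _ _ _ (PI * IZR k) (W_y a b Ha Hb)) as H1.
        pose proof (W_lin _ _ _ _ _ (cot_coef n) (W_pow _ _ _ _ n H1)) as H2.
        revert H2. apply W_le. rewrite !Rabs_mult, <- RPow_abs.
        apply Rmult_le_compat_l; [apply Rabs_pos|]. apply pow_incr.
        rewrite (Rabs_pos_eq PI), (Rabs_pos_eq (PI * r)) by nra. split; [|nra].
        apply Rmult_le_pos; [apply Rmult_le_pos; [lra|apply Rabs_pos]|lra].
      - intros x y Hy. pose proof (cot_radius (PI * IZR k * y)) as HR.
        specialize (Hin y Hy). specialize (HR ltac:(nra)).
        apply (is_pseries_R_r cot_coef (PI * IZR k * y)). apply PSeries_correct. apply CV_radius_inside, HR. }
    eapply W_le; [|apply (W_plus _ a b _ _ _ _ (W_const a b (/ (PI * IZR k)) Ha Hb)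
      (W_opp _ _ _ _ _ (W_mult _ _ _ _ _ _ (W_y a b Ha Hb) Hs)))].
    assert (Rabs (/ (PI * IZR k)) <= 1).
    { rewrite Rabs_inv, Rabs_mult, (Rabs_pos_eq PI) by lra.
      rewrite <- Rinv_1. apply Rinv_le_contravar; nra. }
    assert (b <= r) by nra.
    nra.
  - intros y Hy. specialize (Hin y Hy).
    pose proof (cot_identity (PI * IZR k * y) ltac:(nra)) as E. fold s in E.
    set (X := PI * IZR k * y) in *.
    replace y with (X / (PI * IZR k)) by (unfold X; field; lra).
    replace (/ (PI * IZR k) + - (X / (PI * IZR k) * s X)) with
      ((1 - X * s X) / (PI * IZR k)) by (field; lra).
    replace ((1 - X * s X) / (PI * IZR k) * sin X) with ((1 - X * s X) * sin X / (PI * IZR k))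
      by (field; lra).
    rewrite E. field. lra.
Qed.

(** The family of atoms is fixed before the operators, so that several operators can be applied to
    the same family: [homological_jet] builds [w] and [g] from one expansion of [f]. *)
Lemma W_extend (Q : Z -> Prop) a b M f :
  Wm Q a b M f ->
  exists t, (forall n, amp (t n) = 0 \/ Q (mode (t n))) /\
    (forall x y, Rabs y <= b -> is_series (fun n => ev (t n) x y) (f x y)) /\
    forall P a' b' c (T : atom -> R -> R -> R), 0 <= c -> 0 <= a' -> 0 <= b' ->
      (forall t, amp t = 0 \/ Q (mode t) -> Wm P a' b' (c * wt a b t) (T t)) ->
      exists g, Wm P a' b' (c * M) g /\
        forall x y, Rabs y <= b' -> is_series (fun n => T (t n) x y) (g x y).
Proof.
  intros [H0 [t [H1 [H2 H3]]]]. exists t. split; [exact H1|]. split; [exact H3|].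
  intros P a' b' c T Hc Ha' Hb' HT.
  assert (Hs : forall n, psum (fun n => c * wt a b (t n)) n <= c * M)
    by (intros n; rewrite psum_scal; apply Rmult_le_compat_l; auto).
  assert (Hg : forall x y, Rabs y <= b' ->
    is_series (fun n => T (t n) x y) (Series (fun n => T (t n) x y))).
  { intros x y Hy. apply (bsum_is_series _ (c * M)).
    apply (bsum_le_pos _ (fun n => c * wt a b (t n)) (c * M)); [|lra|exact Hs].
    intros n. apply (W_bound P a' b' _ (T (t n))); auto. }
  exists (fun x y => Series (fun n => T (t n) x y)). split; [|exact Hg].
  apply (W_series P a' b' _ (fun n => c * wt a b (t n)) (fun n => T (t n))); auto.
Qed.

Lemma sin_as_cos x : sin x = cos (x + - (PI / 2)).
Proof. rewrite cos_plus, cos_neg, sin_neg, cos_PI2, sin_PI2. ring. Qed.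

Lemma W_atom_cos a b l k th j : 0 <= a -> 0 <= b ->
  W a b (Rabs l * (carrier_norm a k * b ^ j)) (fun x y => l * (cos (2 * PI * IZR k * x + th) * y ^ j)).
Proof. intros Ha Hb. apply (W_atom (fun _ => True) a b (Atom l k th j) Ha Hb). right; exact I. Qed.

(* On a single mode, [w = (sin A . y cot(pi k y) - y cos A) / 2] with [A = 2 pi k x + theta]. *)
Lemma homological_low r : 0 < r < 1 -> exists K, 0 <= K /\ forall a b N M f,
  0 <= b <= 1 -> N * b <= r ->
  Wm (fun k => k <> 0%Z /\ Rabs (IZR k) <= N) a b M f ->
  exists w, W a b (K * M) w /\
    forall x y, Rabs y <= b -> w (x + y) y - w x y = y * f x y.
Proof.
  intros Hr. destruct (W_cot r Hr) as [K [HK Hcot]].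
  exists (/ 2 * (K + 1)). split; [lra|]. intros a b N M f Hb HN Hf.
  pose proof (W_pos _ _ _ _ _ Hf) as [Ha _].
  set (Q := fun k => k <> 0%Z /\ Rabs (IZR k) <= N) in *.
  (* A solution is chosen for every atom, including those that the hypothesis excludes, which
     receive a dummy. Atoms of amplitude 0 may carry any mode and are treated apart. *)
  assert (HT : forall t, exists w, amp t = 0 \/ Q (mode t) ->
    W a b (/ 2 * (K + 1) * wt a b t) w /\
    forall x y, Rabs y <= b -> w (x + y) y - w x y = y * ev t x y).
  { intros [l k th j]. destruct (Req_dec l 0) as [->|Hl].
    { exists (fun _ _ => 0). intros _. split.
      - eapply W_le; [|apply W_zero; lra]. unfold wt; simpl. rewrite Rabs_R0. lra.
      - intros x y _. unfold ev; simpl. ring. }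
    destruct (classic (Q k)) as [HQ|HQ].
    2: { exists (fun _ _ => 0). intros [H|H]; [contradiction|contradiction]. }
    destruct (Hcot k a b) as [c [Wc Ec]]; [apply HQ|exact Ha|lra| |].
    { eapply Rle_trans; [|exact HN]. apply Rmult_le_compat_r; [lra|apply HQ]. }
    pose proof (W_mult _ _ _ _ _ _ (W_atom_cos a b l k (th + - (PI / 2)) j Ha ltac:(lra)) Wc) as H1.
    pose proof (W_mult _ _ _ _ _ _ (W_y a b Ha ltac:(lra)) (W_atom_cos a b l k th j Ha ltac:(lra))) as H2.
    exists (fun x y => / 2 * (l * (cos (2 * PI * IZR k * x + (th + - (PI / 2))) * y ^ j) * c y
       - y * (l * (cos (2 * PI * IZR k * x + th) * y ^ j)))). intros _. split.
    - pose proof (W_lin _ _ _ _ _ (/ 2) (W_minus _ _ _ _ _ _ _ H1 H2)) as H3.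
      revert H3. apply W_le. rewrite Rabs_pos_eq by lra.
      unfold wt; cbn [amp mode deg]. fold (carrier_norm a k).
      assert (0 <= Rabs l * (carrier_norm a k * b ^ j)).
      { apply Rmult_le_pos; [apply Rabs_pos|]. apply Rmult_le_pos; [left; apply carrier_norm_pos|].
        apply pow_le; lra. }
      nra.
    - intros x y Hy. unfold ev; cbn [amp mode deg phase]. specialize (Ec y Hy).
      set (B := PI * IZR k * y) in *. set (A := 2 * PI * IZR k * x + th).
      replace (2 * PI * IZR k * (x + y) + (th + - (PI / 2))) with ((A + 2 * B) + - (PI / 2))
        by (unfold A, B; ring).
      replace (2 * PI * IZR k * x + (th + - (PI / 2))) with (A + - (PI / 2)) by (unfold A; ring).
      replace (2 * PI * IZR k * (x + y) + th) with (A + 2 * B) by (unfold A, B; ring).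
      rewrite <- !sin_as_cos.
      assert (E1 : sin (A + 2 * B) - sin A = 2 * cos (A + B) * sin B).
      { replace (A + 2 * B) with ((A + B) + B) by ring.
        replace (sin A) with (sin ((A + B) - B)) by (f_equal; ring).
        rewrite sin_plus, sin_minus. ring. }
      assert (E2 : cos (A + 2 * B) - cos A = - (2 * sin (A + B) * sin B)).
      { replace (A + 2 * B) with ((A + B) + B) by ring.
        replace (cos A) with (cos ((A + B) - B)) by (f_equal; ring).
        rewrite cos_plus, cos_minus. ring. }
      assert (E3 : cos A = cos (A + B) * cos B + sin (A + B) * sin B).
      { rewrite <- cos_minus. f_equal. ring. }
      transitivity (/ 2 * l * y ^ j * (c y * (sin (A + 2 * B) - sin A) - y * (cos (A + 2 * B) - cos A)));
        [ring|].
      rewrite E1, E2.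
      replace (c y * (2 * cos (A + B) * sin B)) with (2 * cos (A + B) * (c y * sin B)) by ring.
      rewrite Ec, E3. field. }
  apply fun_choice in HT. destruct HT as [T HT].
  destruct (W_extend Q a b M f Hf) as [t [A1 [A2 HE]]].
  destruct (HE (fun _ => True) a b (/ 2 * (K + 1)) T) as [w [A3 A4]]; try lra.
  { intros s Hs. apply (HT s Hs). }
  exists w. split; [exact A3|]. intros x y Hy.
  pose proof (is_series_minus _ _ _ _ (A4 (x + y) y Hy) (A4 x y Hy)) as L.
  apply (is_series_unique_R _ _ _ L).
  generalize (is_series_cmult y _ _ (A2 x y Hy)). apply is_series_ext.
  intros n. symmetry. apply (HT (t n) (A1 n)). exact Hy.
Qed.

(** Without a cut-off the small divisors are avoided by solving only at [y = 0]: [w] is the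
    primitive of [f] in [x], mode by mode, and [y g] is its exact increment. The increment by [y]
    costs [b] in width; the factor [1 / (2 pi k)] of the primitive is at most 1. *)
Lemma homological_jet a a' b M f : 0 <= a' -> 0 < b -> a' + b <= a ->
  Wm (fun k => k <> 0%Z) a b M f ->
  exists w g, W a' b M w /\ W a' b M g /\ (forall x, g x 0 = f x 0) /\
    forall x y, Rabs y <= b -> w (x + y) y - w x y = y * g x y.
Proof.
  intros Ha' Hb Hab Hf. set (Q := fun k : Z => k <> 0%Z) in *. pose proof PI_ge_3 as HPI.
  assert (HT : forall t, exists wg : (R -> R -> R) * (R -> R -> R), amp t = 0 \/ Q (mode t) ->
    W a' b (1 * wt a b t) (fst wg) /\ W a' b (1 * wt a b t) (snd wg) /\
    (forall x, snd wg x 0 = ev t x 0) /\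
    forall x y, Rabs y <= b -> fst wg (x + y) y - fst wg x y = y * snd wg x y).
  { intros [l k th j]. destruct (Req_dec l 0) as [->|Hl].
    { exists ((fun _ _ => 0), (fun _ _ => 0)). intros _. cbn [fst snd].
      assert (W a' b (1 * wt a b (Atom 0 k th j)) (fun _ _ => 0)).
      { eapply W_le; [|apply W_zero; lra]. unfold wt; simpl. rewrite Rabs_R0. lra. }
      repeat split; try apply H; try (intros; unfold ev; simpl; ring). }
    destruct (classic (Q k)) as [HQ|HQ].
    2: { exists ((fun _ _ => 0), (fun _ _ => 0)). intros [H|H]; contradiction. }
    assert (Hk1 : 1 <= Rabs (IZR k)) by (unfold Q in HQ; rewrite <- abs_IZR; apply IZR_le; lia).
    assert (Hk0 : IZR k <> 0) by (apply not_0_IZR; exact HQ).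
    set (q := 2 * PI * IZR k).
    assert (Hq0 : q <> 0) by (unfold q; apply Rmult_integral_contrapositive; lra).
    assert (Hq1 : 1 <= Rabs q).
    { unfold q. rewrite !Rabs_mult, (Rabs_pos_eq 2), (Rabs_pos_eq PI) by lra. nra. }
    assert (Hqi : Rabs (/ q) <= 1).
    { rewrite Rabs_inv. rewrite <- Rinv_1. apply Rinv_le_contravar; lra. }
    destruct (W_cos_diff a' b _ _ k (th + - (PI / 2)) _ _ (W_zero (fun _ => True) a' b Ha' ltac:(lra))
      (W_lin _ _ _ _ _ q (W_y a' b Ha' ltac:(lra)))) as [f0 [Wf Ef]].
    rewrite Rplus_0_l in Wf.
    replace (Rabs q * b) with (2 * PI * Rabs (IZR k) * b) in Wf
      by (unfold q; rewrite !Rabs_mult, (Rabs_pos_eq 2), (Rabs_pos_eq PI) by lra; ring).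
    rewrite carrier_norm_exp in Wf.
    assert (HC : carrier_norm a' k <= carrier_norm a k) by (apply carrier_norm_mono; lra).
    assert (HC' : carrier_norm (a' + b) k <= carrier_norm a k) by (apply carrier_norm_mono; lra).
    assert (Hbj : 0 <= b ^ j) by (apply pow_le; lra).
    assert (Hl0 : 0 <= Rabs l) by apply Rabs_pos.
    exists (fun x y => l * (/ q) * (cos (q * x + (th + - (PI / 2))) * y ^ j),
            fun x y => l * (f0 x y * y ^ j)). intros _. cbn [fst snd].
    split; [|split; [|split]].
    - apply (W_le _ _ _ (Rabs (l * / q) * (carrier_norm a' k * b ^ j))); [|apply W_atom_cos; lra].
      unfold wt; cbn [amp mode deg]. fold (carrier_norm a k). rewrite Rabs_mult.
      pose proof (carrier_norm_pos a' k). pose proof (Rabs_pos (/ q)).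
      rewrite Rmult_1_l, Rmult_assoc. apply Rmult_le_compat_l; [exact Hl0|].
      rewrite <- (Rmult_1_l (carrier_norm a k * b ^ j)).
      apply Rmult_le_compat; [lra|apply Rmult_le_pos; lra|exact Hqi|].
      apply Rmult_le_compat_r; lra.
    - apply (W_le _ _ _ (Rabs l * (carrier_norm (a' + b) k * b ^ j))).
      + unfold wt; cbn [amp mode deg]. fold (carrier_norm a k). rewrite Rmult_1_l.
        apply Rmult_le_compat_l; [exact Hl0|]. apply Rmult_le_compat_r; lra.
      + apply W_lin. apply W_mult; [exact Wf|]. apply W_pow, W_y; lra.
    - intros x. unfold ev; cbn [amp mode deg phase].
      rewrite (proj2 (Ef x 0 ltac:(rewrite Rabs_R0; lra))) by ring.
      do 3 f_equal. ring.
    - intros x y Hy. destruct (Ef x y Hy) as [E _]. fold q in E.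
      replace (q * (x + y) + (th + - (PI / 2))) with (q * x + (th + - (PI / 2)) + 0 + q * y) by ring.
      replace (l * / q * (cos (q * x + (th + - (PI / 2)) + 0 + q * y) * y ^ j) -
        l * / q * (cos (q * x + (th + - (PI / 2))) * y ^ j)) with
        (l * / q * y ^ j * (cos (q * x + (th + - (PI / 2)) + 0 + q * y) -
          cos (q * x + (th + - (PI / 2)) + 0))) by (rewrite Rplus_0_r; ring).
      rewrite E. field. exact Hq0. }
  apply fun_choice in HT. destruct HT as [T HT].
  destruct (W_extend Q a b M f Hf) as [t [A1 [A2 HE]]].
  destruct (HE (fun _ => True) a' b 1 (fun t => fst (T t))) as [w [W1 S1]]; try lra.
  { intros s Hs. apply (HT s Hs). }
  destruct (HE (fun _ => True) a' b 1 (fun t => snd (T t))) as [g [W2 S2]]; try lra.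
  { intros s Hs. apply (HT s Hs). }
  rewrite Rmult_1_l in W1, W2.
  assert (H0 : Rabs 0 <= b) by (rewrite Rabs_R0; lra).
  exists w, g. split; [exact W1|]. split; [exact W2|]. split.
  - intros x. apply (is_series_unique_R _ _ _ (S2 x 0 H0)).
    generalize (A2 x 0 H0). apply is_series_ext. intros n. symmetry. apply (HT (t n) (A1 n)).
  - intros x y Hy.
    pose proof (is_series_minus _ _ _ _ (S1 (x + y) y Hy) (S1 x y Hy)) as L.
    apply (is_series_unique_R _ _ _ L).
    generalize (is_series_cmult y _ _ (S2 x y Hy)). apply is_series_ext.
    intros n. symmetry. apply (HT (t n) (A1 n)). exact Hy.
Qed.

Lemma W_ypow a b M f n : 0 <= b <= 1 -> W a b M f -> W a b M (fun x y => y ^ n * f x y).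
Proof.
  intros Hb Hf. pose proof (W_pos _ _ _ _ _ Hf). pose proof (W_M_pos _ _ _ _ _ Hf).
  eapply W_le; [|apply (W_mult _ _ _ _ _ _ (W_pow _ _ _ _ n (W_y a b ltac:(lra) ltac:(lra))) Hf)].
  assert (b ^ n <= 1) by (rewrite <- (pow1 n); apply pow_incr; lra).
  assert (0 <= b ^ n) by (apply pow_le; lra). nra.
Qed.

Lemma W_ypow_S a b M f n : 0 <= b <= 1 -> W a b M f -> W a b (b * M) (fun x y => y ^ S n * f x y).
Proof.
  intros Hb Hf. pose proof (W_pos _ _ _ _ _ Hf).
  eapply W_ext; [|apply (W_mult _ _ _ _ _ _ (W_y a b ltac:(lra) ltac:(lra)) (W_ypow _ _ _ _ n Hb Hf))].
  intros x y _. simpl. ring.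
Qed.

Lemma psum_const c n : psum (fun _ => c) n = INR n * c.
Proof. induction n as [|n IH]; simpl psum; [simpl; ring|]. rewrite IH, S_INR. ring. Qed.

(* Both powers and differences of [Y = y (1 + y v)] are divided by the power of [y] they contain. *)
Lemma diff_pow s p a b a' b' M h u v w1 w2 C D sg ta :
  (1 <= p)%nat -> W a' b' M h -> W a b C u -> W a b C v -> W a b D w1 -> W a b D w2 ->
  0 <= b <= 1 -> 0 < sg -> 0 < ta -> b * (C + D) <= 1 ->
  a + b * (C + D) + sg <= a' -> b + b * (b * (C + D)) + ta <= b' ->
  let K := 3 ^ s * M * (/ sg + b * / ta + INR s) in
  exists A B, W a b K A /\ W a b K B /\ forall x y, Rabs y <= b ->
    (1 + y * v x y + y ^ p * w2 x y) ^ s *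
      h (x + y * u x y + y ^ p * w1 x y) (y + y ^ 2 * v x y + y ^ S p * w2 x y)
    - (1 + y * v x y) ^ s * h (x + y * u x y) (y + y ^ 2 * v x y)
    = y ^ p * (A x y * w1 x y + B x y * w2 x y).
Proof.
  intros Hp Hh Hu Hv H1 H2 Hb Hsg Hta Hs1 Hs2 Hs3 K.
  destruct p as [|p]; [lia|]. clear Hp.
  pose proof (W_pos _ _ _ _ _ Hu) as [Ha _]. pose proof (W_M_pos _ _ _ _ _ Hu) as HC.
  pose proof (W_M_pos _ _ _ _ _ H1) as HD. pose proof (W_M_pos _ _ _ _ _ Hh) as HM.
  assert (HbC : 0 <= b * C) by (apply Rmult_le_pos; lra).
  assert (HbD : 0 <= b * D) by (apply Rmult_le_pos; lra).
  rewrite !Rmult_plus_distr_l in Hs1, Hs2, Hs3.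
  assert (HbbC : 0 <= b * (b * C)) by (apply Rmult_le_pos; lra).
  assert (HbbD : 0 <= b * (b * D)) by (apply Rmult_le_pos; lra).
  pose proof (W_ypow_S a b C u 0 Hb Hu) as HU.
  pose proof (W_ypow_S a b C v 0 Hb Hv) as Hv1.
  assert (HV : W a b (b * (b * C)) (fun x y => y ^ 2 * v x y)).
  { eapply W_ext; [|apply (W_mult _ _ _ _ _ _ (W_y a b Ha ltac:(lra)) Hv1)].
    intros x y _. cbv beta. ring. }
  pose proof (W_ypow_S a b D w1 p Hb H1) as Hd1.
  pose proof (W_ypow_S a b D w2 p Hb H2) as Hd2.
  assert (Hd2' : W a b (b * (b * D)) (fun x y => y ^ S (S p) * w2 x y)).
  { eapply W_ext; [|apply (W_mult _ _ _ _ _ _ (W_y a b Ha ltac:(lra)) Hd2)].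
    intros x y _. simpl. ring. }
  destruct (W_diff a b a' b' M h _ _ _ _ sg ta _ _ _ _ Hh HU HV Hd1 Hd2')
    as [A [B [HA [HB E]]]]; try lra.
  pose proof (W_comp a b a' b' M h _ _ _ _ Hh HU HV ltac:(lra) ltac:(lra)) as Hcomp.
  assert (Hc : W a b 3 (fun x y => 1 + y * v x y)).
  { pose proof (W_const a b 1 Ha ltac:(lra)) as O. rewrite Rabs_R1 in O.
    pose proof (W_plus _ _ _ _ _ _ _ O Hv1) as Q. apply (W_le _ _ _ _ 3) in Q; [|lra].
    revert Q. apply W_ext. intros x y _. ring. }
  assert (Hc1 : W a b 3 (fun x y => 1 + y * v x y + y ^ S p * w2 x y)).
  { pose proof (W_const a b 1 Ha ltac:(lra)) as O. rewrite Rabs_R1 in O.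
    pose proof (W_plus _ _ _ _ _ _ _ (W_plus _ _ _ _ _ _ _ O Hv1) Hd2) as Q.
    apply (W_le _ _ _ _ 3) in Q; [|lra].
    revert Q. apply W_ext. intros x y _. ring. }
  set (c := fun x y => 1 + y * v x y) in *.
  set (c1 := fun x y => 1 + y * v x y + y ^ S p * w2 x y) in *.
  pose proof (W_pow _ _ _ _ s Hc1) as Hcs.
  assert (H3 : 0 < 3 ^ s) by (apply pow_lt; lra).
  assert (Hisg : 0 < / sg) by (apply Rinv_0_lt_compat; lra).
  assert (Hita : 0 < / ta) by (apply Rinv_0_lt_compat; lra).
  assert (HsN : 0 <= INR s) by apply pos_INR.
  assert (Hbta : 0 <= b * / ta) by (apply Rmult_le_pos; lra).
  assert (HA' : W a b K (fun x y => c1 x y ^ s * A x y)).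
  { eapply W_le; [|apply (W_mult _ _ _ _ _ _ Hcs HA)]. unfold K, Rdiv.
    rewrite <- Rmult_assoc. apply Rmult_le_compat_l; [nra|lra]. }
  assert (HT : W a b (INR s * 3 ^ s) (fun x y => psum (fun i => c1 x y ^ i * c x y ^ (s - 1 - i)) s)).
  { rewrite <- psum_const. apply W_psum; [lra|lra|]. intros i Hi.
    eapply W_le; [|apply (W_mult _ _ _ _ _ _ (W_pow _ _ _ _ i Hc1) (W_pow _ _ _ _ (s - 1 - i) Hc))].
    rewrite <- pow_add. apply Rle_pow; [lra|lia]. }
  assert (HB' : W a b K (fun x y => y * (c1 x y ^ s * B x y)
     + psum (fun i => c1 x y ^ i * c x y ^ (s - 1 - i)) s * h (x + y * u x y) (y + y ^ 2 * v x y))).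
  { assert (Hcomp' : W a b M (fun x y => h (x + y * u x y) (y + y ^ 2 * v x y))).
    { revert Hcomp. apply W_ext. intros x y _. rewrite pow_1. reflexivity. }
    eapply W_le; [|apply (W_plus _ _ _ _ _ _ _
      (W_mult _ _ _ _ _ _ (W_y a b Ha ltac:(lra)) (W_mult _ _ _ _ _ _ Hcs HB))
      (W_mult _ _ _ _ _ _ HT Hcomp'))].
    unfold K, Rdiv.
    assert (0 <= 3 ^ s * (M * / sg)) by (apply Rmult_le_pos; [lra|apply Rmult_le_pos; lra]).
    lra. }
  eexists. eexists. split; [exact HA'|]. split; [exact HB'|].
  intros x y Hy. specialize (E x y Hy). rewrite pow_1 in E.
  set (h1 := h (x + y * u x y + y ^ S p * w1 x y) (y + y ^ 2 * v x y + y ^ S (S p) * w2 x y)) in *.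
  set (h0 := h (x + y * u x y) (y + y ^ 2 * v x y)) in *.
  fold (c1 x y). fold (c x y).
  assert (E2 : c1 x y ^ s - c x y ^ s =
    y ^ S p * w2 x y * psum (fun i => c1 x y ^ i * c x y ^ (s - 1 - i)) s).
  { unfold c1. fold (c x y). apply pow_diff. }
  transitivity (c1 x y ^ s * (h1 - h0) + (c1 x y ^ s - c x y ^ s) * h0); [ring|].
  rewrite E, E2. fold h0. simpl pow. ring.
Qed.

(** * Normal forms *)

Section Map.
Variables (a0 b0 M0 : R) (h1 h2 : R -> R -> R).
Hypotheses (Hh1 : W a0 b0 M0 h1) (Hh2 : W a0 b0 M0 h2).
Hypotheses (Ha0 : 0 < a0) (Hb0 : 0 < b0).

Definition F1 (x y : R) : R := x + y + y ^ 2 * h1 x y.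
Definition F2 (x y : R) : R := y + y ^ 3 * h2 x y.

(* [(x + y u, y + y^2 v)] conjugates the map to the twist [(x + y, y)] up to the error [E]. *)
Definition conj1 (u v E : R -> R -> R) (x y : R) : Prop :=
  F1 (x + y * u x y) (y + y ^ 2 * v x y) = x + y + y * u (x + y) y + E x y.
Definition conj2 (u v E : R -> R -> R) (x y : R) : Prop :=
  F2 (x + y * u x y) (y + y ^ 2 * v x y) = y + y ^ 2 * v (x + y) y + E x y.

(** The constant of [diff_pow] for [s <= 3] with the margins [(a0 - a) / 2] and [b0 / 2]. Here
    [54 = 2 * 3 ^ 3], the 2 counting the terms in [w1] and [w2]. *)
Definition update_const (a : R) : R := 54 * M0 * (2 / (a0 - a) + 2 / b0 + 3).

(** With [C] bounding [u] and [v], these inequalities keep the changed point in the domain of [h1],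
    [h2], leaving half of the gap for Cauchy estimates. *)
Definition update_small (a b C : R) : Prop :=
  0 <= b <= 1 /\ b * C <= 1 /\ b * C <= (a0 - a) / 2 /\ b + b * C <= b0 / 2.

Lemma M0_pos : 0 <= M0.
Proof. exact (W_M_pos _ _ _ _ _ Hh1). Qed.

Lemma update_const_pos a : a < a0 -> 0 <= update_const a.
Proof.
  intros Ha. unfold update_const. pose proof M0_pos.
  assert (0 < 2 / (a0 - a)) by (apply Rdiv_lt_0_compat; lra).
  assert (0 < 2 / b0) by (apply Rdiv_lt_0_compat; lra).
  apply Rmult_le_pos; lra.
Qed.

Lemma update_small_mono a b C b' C' : update_small a b C -> 0 <= b' <= b -> 0 <= C' <= C ->
  update_small a b' C'.
Proof.
  unfold update_small. intros [H1 [H2 [H3 H4]]] Hb HC.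
  assert (b' * C' <= b * C) by (apply Rmult_le_compat; lra). lra.
Qed.

Lemma update_term s a b C D h u v w1 w2 p : (1 <= p)%nat -> (2 <= s <= 3)%nat -> a < a0 ->
  W a0 b0 M0 h -> W a b C u -> W a b C v -> W a b D w1 -> W a b D w2 -> update_small a b (C + D) ->
  exists g, W a b (update_const a * D) g /\ forall x y, Rabs y <= b ->
    (y + y ^ 2 * v x y + y ^ S p * w2 x y) ^ s *
      h (x + y * u x y + y ^ p * w1 x y) (y + y ^ 2 * v x y + y ^ S p * w2 x y)
    - (y + y ^ 2 * v x y) ^ s * h (x + y * u x y) (y + y ^ 2 * v x y)
    = y ^ (s + p) * g x y.
Proof.
  intros Hp Hs Ha Hh Hu Hv H1 H2 [HS1 [HS2 [HS3 HS4]]].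
  destruct (diff_pow s p a b a0 b0 M0 h u v w1 w2 C D ((a0 - a) / 2) (b0 / 2))
    as [A [B [HA [HB E]]]]; auto; try lra.
  { pose proof (W_M_pos _ _ _ _ _ H1). pose proof (W_M_pos _ _ _ _ _ Hu).
    assert (0 <= b * (C + D)) by (apply Rmult_le_pos; lra).
    assert (b * (b * (C + D)) <= 1 * (b * (C + D))) by (apply Rmult_le_compat_r; lra). lra. }
  pose proof M0_pos as HM. pose proof (W_M_pos _ _ _ _ _ H1).
  exists (fun x y => A x y * w1 x y + B x y * w2 x y). split.
  - eapply W_le; [|apply (W_plus _ _ _ _ _ _ _ (W_mult _ _ _ _ _ _ HA H1) (W_mult _ _ _ _ _ _ HB H2))].
    rewrite <- Rmult_plus_distr_r. apply Rmult_le_compat_r; [exact H|].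
    unfold update_const.
    replace (/ ((a0 - a) / 2)) with (2 / (a0 - a)) by (field; lra).
    replace (/ (b0 / 2)) with (2 / b0) by (field; lra).
    assert (0 < 2 / (a0 - a)) by (apply Rdiv_lt_0_compat; lra).
    assert (0 < 2 / b0) by (apply Rdiv_lt_0_compat; lra).
    assert (INR s <= 3) by (replace 3 with (INR 3) by (simpl; ring); apply le_INR; lia).
    assert (3 ^ s <= 27) by (replace 27 with (3 ^ 3) by ring; apply Rle_pow; [lra|lia]).
    assert (0 < 3 ^ s) by (apply pow_lt; lra). pose proof (pos_INR s).
    assert (3 ^ s * M0 <= 27 * M0) by (apply Rmult_le_compat_r; lra).
    assert (0 <= 3 ^ s * M0) by (apply Rmult_le_pos; lra).
    assert (b * (2 / b0) <= 1 * (2 / b0)) by (apply Rmult_le_compat_r; lra).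
    assert (0 <= b * (2 / b0)) by (apply Rmult_le_pos; lra).
    assert (3 ^ s * M0 * (2 / (a0 - a) + b * (2 / b0) + INR s) <= 27 * M0 * (2 / (a0 - a) + 2 / b0 + 3))
      by (apply Rmult_le_compat; lra).
    lra.
  - intros x y Hy. specialize (E x y Hy). rewrite pow_add, Rmult_assoc, <- E.
    replace (y + y ^ 2 * v x y + y ^ S p * w2 x y) with (y * (1 + y * v x y + y ^ p * w2 x y))
      at 1 by (simpl; ring).
    replace (y + y ^ 2 * v x y) with (y * (1 + y * v x y)) at 2 by ring.
    rewrite !Rpow_mult_distr. ring.
Qed.

(** The corrections enter the errors through their increment along the twist. The term [y^(p+2) w2]
    in the first component is the twist itself: a change of the height moves [x]. The terms [s1],
    [s2] come from evaluating [h1], [h2] at a displaced point and carry one more power of [y] than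
    the terms to be solved for. *)
Lemma update a b C D u v w1 w2 E1 E2 p : a < a0 ->
  W a b C u -> W a b C v -> W a b D w1 -> W a b D w2 -> update_small a b (C + D) ->
  (forall x y, Rabs y <= b -> conj1 u v E1 x y) ->
  (forall x y, Rabs y <= b -> conj2 u v E2 x y) ->
  let u' := fun x y => u x y + y ^ p * w1 x y in
  let v' := fun x y => v x y + y ^ p * w2 x y in
  W a b (C + D) u' /\ W a b (C + D) v' /\
  exists s1 s2, W a b (update_const a * D) s1 /\ W a b (update_const a * D) s2 /\
    forall x y, Rabs y <= b ->
      conj1 u' v' (fun x y => E1 x y + y ^ S p * (w1 x y - w1 (x + y) y)
         + y ^ S (S p) * (w2 x y + y * s1 x y)) x y /\
      conj2 u' v' (fun x y => E2 x y + y ^ S (S p) * (w2 x y - w2 (x + y) y)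
         + y ^ S (S (S (S p))) * s2 x y) x y.
Proof.
  intros Ha Hu Hv H1 H2 HS HE1 HE2 u' v'.
  assert (Hb : 0 <= b <= 1) by apply HS.
  split; [apply W_plus; [exact Hu|apply W_ypow; auto]|].
  split; [apply W_plus; [exact Hv|apply W_ypow; auto]|].
  destruct (update_term 2 a b C D h1 u v w1 w2 (S p)) as [s1 [Hs1 Q1]]; auto; try lia.
  destruct (update_term 3 a b C D h2 u v w1 w2 (S p)) as [s2 [Hs2 Q2]]; auto; try lia.
  exists s1, s2. split; [exact Hs1|]. split; [exact Hs2|].
  intros x y Hy. specialize (HE1 x y Hy). specialize (HE2 x y Hy).
  specialize (Q1 x y Hy). specialize (Q2 x y Hy).
  unfold conj1, conj2, F1, F2, u', v' in *.
  replace (x + y * (u x y + y ^ p * w1 x y)) with (x + y * u x y + y ^ S p * w1 x y) by (simpl; ring).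
  replace (y + y ^ 2 * (v x y + y ^ p * w2 x y)) with (y + y ^ 2 * v x y + y ^ S (S p) * w2 x y)
    by (simpl; ring).
  set (X1 := x + y * u x y + y ^ S p * w1 x y) in *.
  set (Y1 := y + y ^ 2 * v x y + y ^ S (S p) * w2 x y) in *.
  set (X := x + y * u x y) in *. set (Y := y + y ^ 2 * v x y) in *.
  split.
  - apply Rplus_eq_reg_r with (- (Y ^ 2 * h1 X Y)).
    replace (X1 + Y1 + Y1 ^ 2 * h1 X1 Y1 + - (Y ^ 2 * h1 X Y)) with (X1 + Y1 + y ^ (2 + S p) * s1 x y)
      by (rewrite <- Q1; ring).
    replace (Y ^ 2 * h1 X Y) with (x + y + y * u (x + y) y + E1 x y - X - Y) by lra.
    unfold X1, Y1. simpl. ring.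
  - apply Rplus_eq_reg_r with (- (Y ^ 3 * h2 X Y)).
    replace (Y1 + Y1 ^ 3 * h2 X1 Y1 + - (Y ^ 3 * h2 X Y)) with (Y1 + y ^ (3 + S p) * s2 x y)
      by (rewrite <- Q2; ring).
    replace (Y ^ 3 * h2 X Y) with (y + y ^ 2 * v (x + y) y + E2 x y - Y) by lra.
    unfold Y1. simpl. ring.
Qed.

(* The intersection property, for the loops [t |-> (t + c1 t, c2 t)] of degree one. *)
Definition meets (bs : R) : Prop := forall c1 c2 : R -> R,
  (forall t, continuous c1 t) -> (forall t, continuous c2 t) ->
  (forall t, c1 (t + 1) = c1 t) -> (forall t, c2 (t + 1) = c2 t) ->
  (forall t, Rabs (c2 t) < bs) ->
  exists t t', F1 (t + c1 t) (c2 t) = t' + c1 t' /\ F2 (t + c1 t) (c2 t) = c2 t'.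

(** A shift in [x] alone leaves the margin in [y] arbitrary in [W_lip], and shifts longer than
    [a / 2] are covered by the supremum. The constant therefore depends neither on the shift nor on
    the distance of [y] to the boundary. *)
Lemma W_lip_x a b M f x x' y : W a b M f -> 0 < a -> Rabs y < b ->
  Rabs (f x' y - f x y) <= 4 * M / a * Rabs (x' - x).
Proof.
  intros Hf Ha Hy. pose proof (W_M_pos _ _ _ _ _ Hf) as HM.
  assert (Hia : 0 < / a) by (apply Rinv_0_lt_compat; lra).
  destruct (Rle_dec (Rabs (x' - x)) (a / 2)) as [Hs|Hs].
  - pose proof (W_lip a b M f (a / 2) (b - Rabs y) x y (x' - x) 0 Hf) as H.
    rewrite Rabs_R0, Rmult_0_r, !Rplus_0_r in H.
    replace (x + (x' - x)) with x' in H by ring.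
    specialize (H ltac:(lra) ltac:(lra) ltac:(lra) ltac:(lra)).
    eapply Rle_trans; [exact H|]. apply Rmult_le_compat_r; [apply Rabs_pos|].
    unfold Rdiv. rewrite Rinv_mult, Rinv_inv. nra.
  - pose proof (W_bound _ _ _ _ _ x y Hf ltac:(lra)). pose proof (W_bound _ _ _ _ _ x' y Hf ltac:(lra)).
    assert (Rabs (f x' y - f x y) <= 2 * M).
    { eapply Rle_trans; [apply Rabs_triang|]. rewrite Rabs_Ropp. lra. }
    eapply Rle_trans; [exact H1|].
    apply Rle_trans with (4 * M / a * (a / 2)); [right; field; lra|].
    apply Rmult_le_compat_l; [unfold Rdiv; apply Rmult_le_pos; lra|lra].
Qed.

Lemma W_continuous_x a b M f y t : W a b M f -> 0 < a -> Rabs y < b -> continuous (fun x => f x y) t.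
Proof.
  intros Hf Ha Hy. destruct (W_partials a b M f t y (Rmin a (b - Rabs y)) Hf) as [d [_ [D _]]].
  - split; [apply Rmin_pos; lra|apply Rmin_l].
  - pose proof (Rmin_r a (b - Rabs y)). lra.
  - apply (ex_derive_continuous (fun x => f x y)). eexists; exact D.
Qed.

(* The image of the loop [(t + y u, y + y^2 v)] meets the loop, which fixes the size of [D]. *)
Lemma mean_drift_bound bs a b C u v E1 E2 D e1 e2 y :
  meets bs -> 0 < a -> W a b C u -> W a b C v -> Rabs y < b -> Rabs y + Rabs y ^ 2 * C < bs ->
  Rabs y * (4 * C / a) <= 1 / 2 ->
  (forall x, conj1 u v E1 x y) -> (forall x, conj2 u v (fun x y => E2 x y + D) x y) ->
  (forall x, Rabs (E1 x y) <= e1) -> (forall x, Rabs (E2 x y) <= e2) ->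
  Rabs D <= e2 + Rabs y ^ 2 * (8 * C / a) * e1.
Proof.
  intros Hm Ha Hu Hv Hy Hbs Hsm H1 H2 He1 He2.
  pose proof (Rabs_pos y) as Hy0. pose proof (W_M_pos _ _ _ _ _ Hu) as HC.
  destruct (Hm (fun t => y * u t y) (fun t => y + y ^ 2 * v t y)) as [t [t' [A1 A2]]].
  - intros t. apply (continuous_mult (fun _ => y)); [apply continuous_const|].
    eapply W_continuous_x; eauto.
  - intros t. apply (continuous_plus (fun _ => y) (fun t => y ^ 2 * v t y)); [apply continuous_const|].
    apply (continuous_mult (fun _ => y ^ 2)); [apply continuous_const|].
    eapply W_continuous_x; eauto.
  - intros t. rewrite (W_period _ _ _ _ _ t y 1 Hu ltac:(lra)). reflexivity.
  - intros t. rewrite (W_period _ _ _ _ _ t y 1 Hv ltac:(lra)). reflexivity.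
  - intros t. eapply Rle_lt_trans; [apply Rabs_triang|]. rewrite Rabs_mult, <- RPow_abs.
    pose proof (W_bound _ _ _ _ _ t y Hv ltac:(lra)).
    assert (Rabs y ^ 2 * Rabs (v t y) <= Rabs y ^ 2 * C); [|lra].
    apply Rmult_le_compat_l; [apply pow2_ge_0|exact H].
  - rewrite (H1 t) in A1. rewrite (H2 t) in A2.
    specialize (He1 t). specialize (He2 t).
    pose proof (W_lip_x _ _ _ _ t' (t + y) y Hu Ha Hy) as L1.
    pose proof (W_lip_x _ _ _ _ (t + y) t' y Hv Ha Hy) as L2.
    set (d := t + y - t') in *.
    assert (Hd : Rabs d <= 2 * e1).
    { assert (Ed : d = - (y * (u (t + y) y - u t' y)) + - E1 t y) by (unfold d; lra).
      assert (Rabs (y * (u (t + y) y - u t' y)) <= 1 / 2 * Rabs d).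
      { rewrite Rabs_mult. eapply Rle_trans; [apply Rmult_le_compat_l; [lra|exact L1]|].
        rewrite <- Rmult_assoc. apply Rmult_le_compat_r; [apply Rabs_pos|exact Hsm]. }
      assert (Rabs d <= Rabs (y * (u (t + y) y - u t' y)) + Rabs (E1 t y)).
      { rewrite Ed at 1. eapply Rle_trans; [apply Rabs_triang|]. rewrite !Rabs_Ropp. lra. }
      lra. }
    assert (ED : D = y ^ 2 * (v t' y - v (t + y) y) + - E2 t y) by lra.
    rewrite ED. eapply Rle_trans; [apply Rabs_triang|]. rewrite Rabs_Ropp, Rabs_mult, <- RPow_abs.
    replace (Rabs (t' - (t + y))) with (Rabs d) in L2 by (unfold d; rewrite Rabs_minus_sym; f_equal; ring).
    assert (Rabs y ^ 2 * Rabs (v t' y - v (t + y) y) <= Rabs y ^ 2 * (8 * C / a) * e1); [|lra].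
    rewrite Rmult_assoc. apply Rmult_le_compat_l; [apply pow2_ge_0|].
    eapply Rle_trans; [exact L2|].
    assert (0 <= 4 * C / a) by (apply Rmult_le_pos; [lra|left; apply Rinv_0_lt_compat; lra]).
    assert (4 * C / a * Rabs d <= 4 * C / a * (2 * e1)) by (apply Rmult_le_compat_l; lra).
    unfold Rdiv in *. lra.
Qed.

Definition conj_to_order (p : nat) (a b C : R) (u v r1 r2 : R -> R -> R) : Prop :=
  W a b C u /\ W a b C v /\ W a b C r1 /\ W a b C r2 /\
  forall x y, Rabs y <= b ->
    conj1 u v (fun x y => y ^ S p * r1 x y) x y /\
    conj2 u v (fun x y => y ^ S (S p) * r2 x y) x y.

Lemma update_small_ex a C : a < a0 -> 0 <= C -> exists b, 0 < b <= 1 /\ update_small a b C.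
Proof.
  intros Ha HC. set (d := Rmin (Rmin 1 ((a0 - a) / 2)) (b0 / 2)).
  assert (Hd : 0 < d) by (repeat apply Rmin_pos; lra).
  assert (H1 : d <= 1) by (eapply Rle_trans; [apply Rmin_l|apply Rmin_l]).
  assert (H2 : d <= (a0 - a) / 2) by (eapply Rle_trans; [apply Rmin_l|apply Rmin_r]).
  assert (H3 : d <= b0 / 2) by apply Rmin_r.
  assert (Hb : 0 < d / (1 + C)) by (apply Rdiv_lt_0_compat; lra).
  assert (Hb' : d / (1 + C) + d / (1 + C) * C = d) by (field; lra).
  exists (d / (1 + C)). assert (0 <= d / (1 + C) * C) by (apply Rmult_le_pos; lra).
  unfold update_small. repeat split; lra.
Qed.

Lemma small_bound_zero m K e : 0 < e -> (forall y, 0 < y < e -> Rabs m <= K * y) -> m = 0.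
Proof.
  intros He H. destruct (Req_dec m 0) as [|Hm]; [assumption|exfalso].
  assert (0 < Rabs m) by (apply Rabs_pos_lt, Hm).
  pose proof (Rabs_pos K). pose proof (Rle_abs K).
  set (y := Rmin (e / 2) (Rabs m / (2 * (Rabs K + 1)))).
  assert (Hq : 0 < Rabs m / (2 * (Rabs K + 1))) by (apply Rdiv_lt_0_compat; lra).
  assert (Hy : 0 < y) by (apply Rmin_pos; lra).
  pose proof (Rmin_l (e / 2) (Rabs m / (2 * (Rabs K + 1)))).
  pose proof (Rmin_r (e / 2) (Rabs m / (2 * (Rabs K + 1)))). fold y in H3, H4.
  specialize (H y ltac:(lra)).
  assert (y * (2 * (Rabs K + 1)) <= Rabs m).
  { apply Rle_trans with (Rabs m / (2 * (Rabs K + 1)) * (2 * (Rabs K + 1))).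
    - apply Rmult_le_compat_r; lra.
    - right. field. lra. }
  nra.
Qed.

(** After division by [y^(p+2)], [mean_drift_bound] says that [|m|] is at most [(C + K C) y] for all
    small positive [y]; the number [e] collects the conditions under which it applies. *)
Lemma mean_drift_zero bs a b C p u v r1 r2 m : meets bs -> 0 < bs -> 0 < a -> 0 < b <= 1 ->
  W a b C u -> W a b C v -> W a b C r1 -> W a b C r2 ->
  (forall x y, Rabs y <= b -> conj1 u v (fun x y => y ^ S (S p) * r1 x y) x y) ->
  (forall x y, Rabs y <= b ->
    conj2 u v (fun x y => y ^ S (S (S p)) * r2 x y + y ^ S (S p) * m) x y) ->
  m = 0.
Proof.
  intros Hm Hbs Ha Hb Hu Hv H1 H2 Q1 Q2.
  pose proof (W_M_pos _ _ _ _ _ Hu) as HC.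
  set (K := 8 * C / a).
  assert (HK : 0 <= K) by (apply Rmult_le_pos; [lra|left; apply Rinv_0_lt_compat; lra]).
  set (e := Rmin b (Rmin (bs / (1 + C)) (/ (1 + K)))).
  assert (Hq : 0 < bs / (1 + C)) by (apply Rdiv_lt_0_compat; lra).
  assert (Hq' : 0 < / (1 + K)) by (apply Rinv_0_lt_compat; lra).
  apply (small_bound_zero m (C + K * C) e); [repeat apply Rmin_pos; lra|].
  intros y Hy.
  assert (E1 : e <= b) by apply Rmin_l.
  assert (E2 : e <= bs / (1 + C)) by (eapply Rle_trans; [apply Rmin_r|apply Rmin_l]).
  assert (E3 : e <= / (1 + K)) by (eapply Rle_trans; [apply Rmin_r|apply Rmin_r]).
  assert (Ay : Rabs y = y) by (apply Rabs_pos_eq; lra).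
  assert (Hyb : Rabs y <= b) by lra.
  assert (Hp : forall n, 0 < y ^ n) by (intros; apply pow_lt; lra).
  pose proof (mean_drift_bound bs a b C u v (fun x y => y ^ S (S p) * r1 x y)
    (fun x y => y ^ S (S (S p)) * r2 x y) (y ^ S (S p) * m)
    (y ^ S (S p) * C) (y ^ S (S (S p)) * C) y Hm Ha Hu Hv) as D.
  assert (HD : Rabs (y ^ S (S p) * m) <= y ^ S (S (S p)) * C + Rabs y ^ 2 * (8 * C / a) * (y ^ S (S p) * C)).
  { apply D.
    - lra.
    - rewrite Ay. apply Rlt_le_trans with (e * (1 + C)).
      + assert (y ^ 2 <= y * 1) by nra.
        assert (y ^ 2 * C <= y * 1 * C) by (apply Rmult_le_compat_r; lra). nra.
      + apply Rle_trans with (bs / (1 + C) * (1 + C)); [apply Rmult_le_compat_r; lra|right; field; lra].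
    - rewrite Ay. replace (4 * C / a) with (K / 2) by (unfold K; field; lra).
      assert (y * (1 + K) <= 1).
      { apply Rle_trans with (/ (1 + K) * (1 + K)); [apply Rmult_le_compat_r; lra|right; field; lra]. }
      nra.
    - intros x. apply Q1, Hyb.
    - intros x. apply Q2, Hyb.
    - intros x. rewrite Rabs_mult, (Rabs_pos_eq (y ^ _)) by (left; apply Hp).
      cbv beta. apply Rmult_le_compat_l; [left; apply Hp|apply (W_bound _ _ _ _ _ x y H1 Hyb)].
    - intros x. rewrite Rabs_mult, (Rabs_pos_eq (y ^ _)) by (left; apply Hp).
      cbv beta. apply Rmult_le_compat_l; [left; apply Hp|apply (W_bound _ _ _ _ _ x y H2 Hyb)]. }
  rewrite Rabs_mult, (Rabs_pos_eq (y ^ _)) in HD by (left; apply Hp).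
  rewrite Ay in HD. fold K in HD.
  apply Rmult_le_reg_l with (y ^ S (S p)); [apply Hp|].
  eapply Rle_trans; [exact HD|].
  replace (y ^ S (S (S p)) * C + y ^ 2 * K * (y ^ S (S p) * C)) with
    (y ^ S (S p) * (y * C + y * y * (K * C))) by (simpl; ring).
  apply Rmult_le_compat_l; [left; apply Hp|].
  assert (0 <= K * C) by (apply Rmult_le_pos; lra).
  assert (y * y <= y * 1) by (apply Rmult_le_compat_l; lra). nra.
Qed.

(** Each step gains one power of [y]. The second component is solved before the first, because its
    solution [w2] enters the first through the twist. Both are solved to leading order at [y = 0],
    so that what remains is divisible by [y], except for the constant [m], which must vanish by the
    intersection property. *)
Lemma formal_normal_form bs : meets bs -> 0 < bs -> forall q a, 0 < a < a0 ->
  exists b C u v r1 r2, 0 < b <= 1 /\ conj_to_order (S q) a b C u v r1 r2.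
Proof.
  intros Hm Hbs. induction q as [|q IH]; intros a Ha.
  - exists (Rmin b0 1), M0, (fun _ _ => 0), (fun _ _ => 0), h1, h2.
    pose proof (Rmin_l b0 1). pose proof (Rmin_r b0 1).
    assert (0 < Rmin b0 1) by (apply Rmin_pos; lra). pose proof M0_pos.
    split; [lra|]. unfold conj_to_order.
    assert (Z : W a (Rmin b0 1) M0 (fun _ _ => 0)) by (apply (W_le _ _ _ 0); [lra|apply W_zero; lra]).
    split; [exact Z|]. split; [exact Z|].
    split; [apply (W_mono _ a0 b0 M0); auto; lra|].
    split; [apply (W_mono _ a0 b0 M0); auto; lra|].
    intros x y _. unfold conj1, conj2, F1, F2. rewrite !Rmult_0_r, !Rplus_0_r. split; ring.
  (* The induction hypothesis is taken at the midpoint, and the width gained is cut in three: the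
     two homological equations use one third each. *)
  - set (a1 := (a + a0) / 2). set (sg := (a1 - a) / 3).
    assert (Hsg : 0 < sg) by (unfold sg, a1; lra).
    destruct (IH a1) as [b1 [C [u [v [r1 [r2 [Hb1 [Hu [Hv [Hr1 [Hr2 HE]]]]]]]]]]]; [unfold a1; lra|].
    set (b2 := Rmin b1 sg).
    assert (Hb2 : 0 < b2) by (apply Rmin_pos; lra).
    pose proof (Rmin_l b1 sg) as Hb21. pose proof (Rmin_r b1 sg) as Hb22. fold b2 in Hb21, Hb22.
    assert (Ha1 : a + 3 * sg = a1) by (unfold sg; field).
    assert (Hlow : forall f, W a1 b1 C f -> W a1 b2 C f)
      by (intros f; apply W_mono; lra).
    apply Hlow in Hu, Hv, Hr1, Hr2.
    destruct (W_split (fun k => k = 0%Z) _ _ _ _ Hr2) as [r2m [r2h [W2m [W2h S2]]]].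
    destruct (homological_jet a1 (a + 2 * sg) b2 C r2h) as [w2 [g2 [Ww2 [Wg2 [Z2 G2]]]]]; try lra.
    { exact W2h. }
    assert (Hr1' : W (a + 2 * sg) b2 (C + C) (fun x y => r1 x y + w2 x y)).
    { apply W_plus; [revert Hr1; apply W_mono; lra|exact Ww2]. }
    destruct (W_split (fun k => k = 0%Z) _ _ _ _ Hr1') as [r1m [r1h [W1m [W1h S1]]]].
    destruct (homological_jet (a + 2 * sg) (a + sg) b2 (C + C) r1h) as [w1 [g1 [Ww1 [Wg1 [Z1 G1]]]]]; try lra.
    { exact W1h. }
    (* Subtracting [r1m] from [v] cancels the mean of the first component through the twist. Being
       independent of [x], it has no increment along the twist and leaves the second equation
       unchanged. *)
    set (dv := fun x y => w2 x y - r1m x y).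
    assert (HC : 0 <= C) by (eapply W_M_pos; eauto).
    assert (Hdn : forall P M f, Wm P (a + sg) b2 M f -> W a b2 M f)
      by (intros P M f Hf; apply W_True in Hf; revert Hf; apply W_mono; lra).
    assert (Hdn2 : forall P M f, Wm P (a + 2 * sg) b2 M f -> W a b2 M f)
      by (intros P M f Hf; apply W_True in Hf; revert Hf; apply W_mono; lra).
    assert (Hdn1 : forall P M f, Wm P a1 b2 M f -> W a b2 M f)
      by (intros P M f Hf; apply W_True in Hf; revert Hf; apply W_mono; lra).
    assert (Wdv : W a b2 (C + (C + C)) dv) by (apply W_minus; [apply (Hdn2 _ _ _ Ww2)|apply (Hdn2 _ _ _ W1m)]).
    apply Hdn1 in Hu, Hv. apply Hdn in Ww1, Wg1.
    (* the remainders left by the jet equation vanish at y = 0 *)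
    destruct (W_div _ a b2 _ (fun x y => r1h x y - g1 x y) Hb2
      (W_minus _ _ _ _ _ _ _ (Hdn2 _ _ _ W1h) Wg1)) as [_ [q1 [_ [Wq1 [_ Eq1]]]]].
    destruct (W_div _ a b2 _ (fun x y => r2h x y - g2 x y) Hb2
      (W_minus _ _ _ _ _ _ _ (Hdn1 _ _ _ W2h) (Hdn2 _ _ _ Wg2))) as [_ [q2 [_ [Wq2 [_ Eq2]]]]].
    destruct (W_div _ a b2 _ r2m Hb2 (Hdn1 _ _ _ W2m)) as [_ [q3 [_ [Wq3 [_ Eq3]]]]].
    set (D := C + (C + C)).
    destruct (update_small_ex a (C + D)) as [b3 [Hb3 HS3]]; [lra|unfold D; lra|].
    set (b := Rmin b2 b3).
    assert (Hb : 0 < b) by (apply Rmin_pos; lra).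
    pose proof (Rmin_l b2 b3) as Hbb2. pose proof (Rmin_r b2 b3) as Hbb3. fold b in Hbb2, Hbb3.
    assert (Hr : forall M f, W a b2 M f -> W a b M f) by (intros M f; apply W_mono; lra).
    assert (HS : update_small a b (C + D)).
    { apply (update_small_mono _ b3 (C + D)); [exact HS3|lra|unfold D; lra]. }
    destruct (update a b C D u v w1 dv (fun x y => y ^ S (S q) * r1 x y)
      (fun x y => y ^ S (S (S q)) * r2 x y) q) as [Wu' [Wv' [s1 [s2 [Ws1 [Ws2 HE']]]]]]; auto; try lra.
    { apply Hr, (W_le _ _ _ _ D) in Ww1; [exact Ww1|unfold D; lra]. }
    { intros x y Hy. apply HE. lra. }
    { intros x y Hy. apply HE. lra. }
    set (u' := fun x y => u x y + y ^ q * w1 x y) in *.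
    set (v' := fun x y => v x y + y ^ q * dv x y) in *.
    set (n1 := fun x y => q1 x y + s1 x y). set (n2 := fun x y => q2 x y + s2 x y + q3 x y).
    (* The mean of the second component at [y = 0], the one obstruction left at this order. *)
    set (m := r2m 0 0).
    assert (Wn1 := W_plus _ _ _ _ _ _ _ (Hr _ _ Wq1) Ws1).
    assert (Wn2 := W_plus _ _ _ _ _ _ _ (W_plus _ _ _ _ _ _ _ (Hr _ _ Wq2) Ws2) (Hr _ _ Wq3)).
    fold n1 in Wn1.
    assert (K1 : forall x y, Rabs y <= b -> conj1 u' v' (fun x y => y ^ S (S (S q)) * n1 x y) x y).
    { intros x y Hy. destruct (HE' x y Hy) as [E _]. unfold conj1 in *. rewrite E.
      specialize (G1 x y ltac:(lra)). specialize (S1 x y ltac:(lra)). specialize (Eq1 x y ltac:(lra)).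
      rewrite (Z1 x) in Eq1. unfold n1, dv.
      assert (EE : y ^ S (S q) * r1 x y + (y ^ S q * (w1 x y - w1 (x + y) y)
        + y ^ S (S q) * (w2 x y - r1m x y + y * s1 x y)) = y ^ S (S (S q)) * (q1 x y + s1 x y)); [|lra].
      replace (w1 x y - w1 (x + y) y) with (- (y * g1 x y)) by lra.
      transitivity (y ^ S (S q) * ((r1 x y + w2 x y - r1m x y) - g1 x y + y * s1 x y)); [simpl; ring|].
      replace (r1 x y + w2 x y - r1m x y) with (r1h x y) by lra.
      rewrite Eq1. simpl. ring. }
    assert (K2 : forall x y, Rabs y <= b -> conj2 u' v'
      (fun x y => y ^ S (S (S (S q))) * n2 x y + y ^ S (S (S q)) * m) x y).
    { intros x y Hy. destruct (HE' x y Hy) as [_ E]. unfold conj2 in *. rewrite E.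
      specialize (G2 x y ltac:(lra)). specialize (S2 x y ltac:(lra)). specialize (Eq2 x y ltac:(lra)).
      specialize (Eq3 x y ltac:(lra)). rewrite (Z2 x) in Eq2. unfold n2, dv.
      assert (H0 : Rabs 0 <= b2) by (rewrite Rabs_R0; lra).
      rewrite (W_mean _ _ _ _ x 0 0 W2m H0) in Eq3. fold m in Eq3.
      rewrite (W_mean _ _ _ _ (x + y) x y W1m ltac:(lra)).
      assert (EE : y ^ S (S (S q)) * r2 x y + y ^ S (S q) * (w2 x y - r1m x y - (w2 (x + y) y - r1m x y))
         + y ^ S (S (S (S q))) * s2 x y =
        y ^ S (S (S (S q))) * (q2 x y + s2 x y + q3 x y) + y ^ S (S (S q)) * m); [|lra].
      replace (w2 x y - r1m x y - (w2 (x + y) y - r1m x y)) with (- (y * g2 x y)) by lra.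
      transitivity (y ^ S (S (S q)) * (r2m x y + (r2h x y - g2 x y) + y * s2 x y)); [rewrite S2; simpl; ring|].
      rewrite Eq2, Eq3. simpl. ring. }
    match type of Wn1 with W _ _ ?M _ => set (N1 := M) in * end.
    match type of Wn2 with W _ _ ?M _ => set (N2 := M) in * end.
    set (CC := Rmax (C + D) (Rmax N1 N2)).
    assert (L1 : C + D <= CC) by apply Rmax_l.
    assert (L2 : N1 <= CC) by (eapply Rle_trans; [apply Rmax_l|apply Rmax_r]).
    assert (L3 : N2 <= CC) by (eapply Rle_trans; [apply Rmax_r|apply Rmax_r]).
    apply (W_le _ _ _ _ CC) in Wu'; [|exact L1]. apply (W_le _ _ _ _ CC) in Wv'; [|exact L1].
    apply (W_le _ _ _ _ CC) in Wn1; [|exact L2]. apply (W_le _ _ _ _ CC) in Wn2; [|exact L3].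
    assert (m = 0) as Hm0.
    { apply (mean_drift_zero bs a b CC (S q) u' v' n1 n2 m); auto; lra. }
    exists b, CC, u', v', n1, n2. split; [lra|]. repeat (split; [assumption|]).
    intros x y Hy. split; [apply K1, Hy|].
    generalize (K2 x y Hy). unfold conj2. rewrite Hm0. intros ->. ring.
Qed.

Lemma W_decompose N a b M f : W a b M f -> exists fm fl fh,
  Wm (fun k => k = 0%Z) a b M fm /\ Wm (fun k => k <> 0%Z /\ Rabs (IZR k) <= N) a b M fl /\
  Wm (fun k => N <= Rabs (IZR k)) a b M fh /\
  forall x y, Rabs y <= b -> f x y = fm x y + fl x y + fh x y.
Proof.
  intros H. destruct (W_split (fun k => k = 0%Z) _ _ _ _ H) as [fm [fr [A [B E1]]]].
  destruct (W_split_in _ (fun k => Rabs (IZR k) <= N) _ _ _ _ B) as [fl [fh [A2 [B2 E2]]]].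
  exists fm, fl, fh. split; [exact A|]. split; [|split].
  - revert A2. apply W_weaken. tauto.
  - revert B2. apply W_weaken. intros k [H1 _]. lra.
  - intros x y Hy. rewrite E1, E2 by exact Hy. ring.
Qed.

(** At each step the low modes of [e1], [e2] are solved; the high modes are moved to [H1], [H2] and
    the mean of the second component to [d], which later steps only add to. The new errors are the
    [y s] of [update], half as large. The constants depend on neither [b] nor [n], and the cylinder
    never shrinks during the iteration. *)
Lemma iterated_normal_form r q a b1 C u0 v0 r1 r2 : 0 < r < 1 -> 0 < a < a0 -> 0 < b1 <= 1 ->
  conj_to_order (S q) a b1 C u0 v0 r1 r2 ->
  exists b2 C2, 0 < b2 <= b1 /\ 0 <= C2 /\ forall b N n, 0 < b <= b2 -> N * b <= r ->
    exists u v H1 H2 d e1 e2, W a b C2 u /\ W a b C2 v /\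
      Wm (fun k => N <= Rabs (IZR k)) a b C2 H1 /\ Wm (fun k => N <= Rabs (IZR k)) a b C2 H2 /\
      Wm (fun k => k = 0%Z) a b C2 d /\
      W a b (C2 * (1 / 2) ^ n) e1 /\ W a b (C2 * (1 / 2) ^ n) e2 /\
      forall x y, Rabs y <= b ->
        conj1 u v (fun x y => y ^ S (S q) * (H1 x y + e1 x y)) x y /\
        conj2 u v (fun x y => y ^ S (S (S q)) * (H2 x y + e2 x y + d x y)) x y.
Proof.
  intros Hr Ha Hb1 [Hu0 [Hv0 [Hr1 [Hr2 HE]]]].
  destruct (homological_low r Hr) as [K [HK Hsolve]].
  assert (HC : 0 <= C) by (eapply W_M_pos; eauto).
  (* [Q] dominates both corrections relative to the current error: [K + (1 + K)] for [dv], and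
     [K (1 + K)] for [w1], which is solved from [e1 + w2]. *)
  set (Q := (1 + K) ^ 2). assert (HQ : 1 <= Q) by (unfold Q; nra).
  assert (HQC : 0 <= Q * C) by (apply Rmult_le_pos; lra).
  destruct (update_small_ex a (C + 2 * (Q * C))) as [b3 [Hb3 HS3]]; [lra|lra|].
  pose proof (update_const_pos a ltac:(lra)) as Hsc.
  set (sQ := update_const a * Q).
  assert (HsQ : 0 <= sQ) by (apply Rmult_le_pos; lra).
  (* Below this height [b * update_const a * Q <= 1 / 2], which is the halving of the error. *)
  set (b4 := / (2 * (1 + sQ))). assert (Hb4 : 0 < b4) by (apply Rinv_0_lt_compat; lra).
  set (b2 := Rmin b1 (Rmin b3 b4)).
  assert (L1 : b2 <= b1) by apply Rmin_l.
  assert (L3 : b2 <= b3) by (eapply Rle_trans; [apply Rmin_r|apply Rmin_l]).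
  assert (L4 : b2 <= b4) by (eapply Rle_trans; [apply Rmin_r|apply Rmin_r]).
  assert (Hb2 : 0 < b2) by (repeat apply Rmin_pos; lra).
  exists b2, (3 * (Q * C)). split; [lra|]. split; [lra|].
  intros b N n Hb HN.
  assert (Hbs : b * (sQ) <= 1 / 2).
  { apply Rle_trans with (b4 * sQ); [apply Rmult_le_compat_r; lra|].
    assert (b4 * (2 * (1 + sQ)) = 1) by (unfold b4; field; lra). nra. }
  (* [2 - 2 h] is the sum of the first [n] powers of 1/2: the total of the corrections made so far,
     in units of [Q C]. *)
  assert (I : forall n, exists u v H1 H2 d e1 e2, let h := (1 / 2) ^ n in
      W a b (C + Q * C * (2 - 2 * h)) u /\ W a b (C + Q * C * (2 - 2 * h)) v /\
      Wm (fun k => N <= Rabs (IZR k)) a b (Q * C * (2 - 2 * h)) H1 /\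
      Wm (fun k => N <= Rabs (IZR k)) a b (Q * C * (2 - 2 * h)) H2 /\
      Wm (fun k => k = 0%Z) a b (Q * C * (2 - 2 * h)) d /\
      W a b (C * h) e1 /\ W a b (C * h) e2 /\
      forall x y, Rabs y <= b ->
        conj1 u v (fun x y => y ^ S (S q) * (H1 x y + e1 x y)) x y /\
        conj2 u v (fun x y => y ^ S (S (S q)) * (H2 x y + e2 x y + d x y)) x y).
  { clear n. assert (Hdn : forall f, W a b1 C f -> W a b C f) by (intros f; apply W_mono; lra).
    induction n as [|n [u [v [H1 [H2 [d [e1 [e2 [Hu [Hv [HH1 [HH2 [Hd [He1 [He2 HE']]]]]]]]]]]]]]].
    - exists u0, v0, (fun _ _ => 0), (fun _ _ => 0), (fun _ _ => 0), r1, r2. cbv zeta.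
      simpl pow. replace (2 - 2 * 1) with 0 by ring. rewrite Rmult_0_r, Rplus_0_r, Rmult_1_r.
      do 7 (split; [auto; try (apply W_zero; lra)|]).
      intros x y Hy. destruct (HE x y ltac:(lra)) as [E1 E2]. unfold conj1, conj2 in *.
      rewrite E1, E2. split; simpl; ring.
    - cbv zeta in *. set (h := (1 / 2) ^ n) in *.
      assert (Hh : 0 < h <= 1).
      { split; [apply pow_lt; lra|]. unfold h. apply Rle_trans with (1 ^ n); [apply pow_incr; lra|rewrite pow1; lra]. }
      assert (HCh : 0 <= C * h) by (apply Rmult_le_pos; lra).
      destruct (W_decompose N _ _ _ _ He2) as [m2 [l2 [g2 [Wm2 [Wl2 [Wg2 S2]]]]]].
      destruct (Hsolve a b N _ l2 ltac:(lra) HN Wl2) as [w2 [Ww2 G2]].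
      assert (Wr : W a b (C * h + K * (C * h)) (fun x y => e1 x y + w2 x y))
        by (apply W_plus; [exact He1|exact Ww2]).
      destruct (W_decompose N _ _ _ _ Wr) as [m1 [l1 [g1 [Wm1 [Wl1 [Wg1 S1]]]]]].
      destruct (Hsolve a b N _ l1 ltac:(lra) HN Wl1) as [w1 [Ww1 G1]].
      set (dv := fun x y => w2 x y - m1 x y).
      assert (Wdv : W a b (Q * (C * h)) dv).
      { eapply W_le; [|apply W_minus; [exact Ww2|apply (W_True _ _ _ _ _ Wm1)]].
        unfold Q. nra. }
      assert (Ww1' : W a b (Q * (C * h)) w1).
      { eapply W_le; [|exact Ww1]. unfold Q. nra. }
      assert (Eh : C + Q * C * (2 - 2 * h) + Q * (C * h) = C + Q * C * (2 - h)) by ring.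
      assert (HQCh : 0 <= Q * C * h <= Q * C) by (split; [apply Rmult_le_pos|]; nra).
      destruct (update a b (C + Q * C * (2 - 2 * h)) (Q * (C * h)) u v w1 dv
        (fun x y => y ^ S (S q) * (H1 x y + e1 x y))
        (fun x y => y ^ S (S (S q)) * (H2 x y + e2 x y + d x y)) q)
        as [Wu' [Wv' [s1 [s2 [Ws1 [Ws2 HE'']]]]]]; auto; try lra.
      { apply (update_small_mono _ b3 (C + 2 * (Q * C))); [exact HS3|lra|nra]. }
      { intros x y Hy. apply HE', Hy. }
      { intros x y Hy. apply HE', Hy. }
      replace (2 - 2 * (1 / 2) ^ S n) with (2 - h) by (simpl; fold h; field).
      rewrite Eh in Wu', Wv'.
      assert (EH : Q * C * (2 - 2 * h) + Q * C * h = Q * C * (2 - h)) by ring.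
      assert (Hys : forall s, W a b (update_const a * (Q * (C * h))) s ->
        W a b (C * (1 / 2) ^ S n) (fun x y => y * s x y)).
      { intros s Hs. eapply W_le; [|apply (W_mult _ _ _ _ _ _ (W_y a b ltac:(lra) ltac:(lra)) Hs)].
        replace (b * (update_const a * (Q * (C * h)))) with (b * sQ * (C * h)) by (unfold sQ; ring).
        replace (C * (1 / 2) ^ S n) with (1 / 2 * (C * h)) by (simpl; fold h; ring).
        apply Rmult_le_compat_r; lra. }
      exists (fun x y => u x y + y ^ q * w1 x y), (fun x y => v x y + y ^ q * dv x y),
        (fun x y => H1 x y + g1 x y), (fun x y => H2 x y + g2 x y), (fun x y => d x y + m2 x y),
        (fun x y => y * s1 x y), (fun x y => y * s2 x y).
      split; [exact Wu'|]. split; [exact Wv'|].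
      split. { rewrite <- EH. apply W_plus; [exact HH1|]. eapply W_le; [|exact Wg1]. unfold Q. nra. }
      split. { rewrite <- EH. apply W_plus; [exact HH2|]. eapply W_le; [|exact Wg2]. nra. }
      split. { rewrite <- EH. apply W_plus; [exact Hd|]. eapply W_le; [|exact Wm2]. nra. }
      split; [apply Hys, Ws1|]. split; [apply Hys, Ws2|].
      intros x y Hy. destruct (HE'' x y Hy) as [E1 E2].
      specialize (G1 x y Hy). specialize (G2 x y Hy). specialize (S1 x y Hy). specialize (S2 x y Hy).
      unfold conj1, conj2 in *. rewrite E1, E2. unfold dv.
      rewrite (W_mean _ _ _ _ (x + y) x y Wm1 Hy).
      replace (w1 x y - w1 (x + y) y) with (- (y * l1 x y)) by lra.
      replace (w2 x y - m1 x y - (w2 (x + y) y - m1 x y)) with (- (y * l2 x y)) by lra.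
      split; apply f_equal.
      + replace (w2 x y) with (m1 x y + l1 x y + g1 x y - e1 x y) by lra. simpl. ring.
      + rewrite S2. simpl. ring. }
  destruct (I n) as [u [v [H1 [H2 [d [e1 [e2 [Hu [Hv [HH1 [HH2 [Hd [He1 [He2 HE']]]]]]]]]]]]]].
  set (h := (1 / 2) ^ n) in *.
  assert (Hh : 0 < h <= 1).
  { split; [apply pow_lt; lra|]. unfold h. apply Rle_trans with (1 ^ n); [apply pow_incr; lra|rewrite pow1; lra]. }
  assert (C <= Q * C) by nra. assert (0 <= Q * C * h) by (apply Rmult_le_pos; lra).
  assert (C * h <= 3 * (Q * C) * h) by (apply Rmult_le_compat_r; lra).
  exists u, v, H1, H2, d, e1, e2.
  split; [revert Hu; apply W_le; nra|]. split; [revert Hv; apply W_le; nra|].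
  split; [revert HH1; apply W_le; nra|]. split; [revert HH2; apply W_le; nra|].
  split; [revert Hd; apply W_le; nra|]. split; [revert He1; apply W_le; auto|].
  split; [revert He2; apply W_le; auto|]. exact HE'.
Qed.

End Map.

(** * Inversion of the change of variables *)

Lemma psum_half C n : psum (fun n => C * (1 / 2) ^ n) n = 2 * C - 2 * C * (1 / 2) ^ n.
Proof. induction n as [|n IH]; simpl; [ring|]. rewrite IH. field. Qed.

Lemma half_pow_bounds n : 0 < (1 / 2) ^ n <= 1.
Proof.
  split; [apply pow_lt; lra|]. apply Rle_trans with (1 ^ n); [apply pow_incr; lra|rewrite pow1; lra].
Qed.

(** With [X = x + y p] and [Y = y (1 + y q)], the equations [X + Y u(X, Y) = x] and
    [Y + Y^2 v(X, Y) = y] become, after division by [y] and [y^2], the fixed point equations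
    iterated here. *)
Fixpoint inverse_iter (u v : R -> R -> R) (n : nat) : (R -> R -> R) * (R -> R -> R) :=
  match n with
  | O => (fun _ _ => 0, fun _ _ => 0)
  | S n => let (p, q) := inverse_iter u v n in
    (fun x y => - ((1 + y * q x y) * u (x + y * p x y) (y + y ^ 2 * q x y)),
     fun x y => - ((1 + y * q x y) ^ 2 * v (x + y * p x y) (y + y ^ 2 * q x y)))
  end.

(** Differences of the iterated expressions carry a factor [y], so the iteration contracts on low
    cylinders. The condition [b' <= ka * (b - b')] keeps the gap between the heights proportional to
    the height: the Cauchy factor [b' / (b - b')] stays bounded, and the threshold on [b'] is
    independent of [b]. *)
Lemma inverse a a' C ka : 0 <= a' < a -> 0 <= C -> 0 <= ka ->
  exists b2, 0 < b2 <= 1 /\ forall b b' u v, 0 < b' < b -> b' <= b2 -> b' <= ka * (b - b') ->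
    W a b C u -> W a b C v ->
    exists p q, W a' b' (2 * C) p /\ W a' b' (2 * C) q /\ forall x y, Rabs y <= b' ->
      let X := x + y * p x y in let Y := y + y ^ 2 * q x y in
      X + Y * u X Y = x /\ Y + Y ^ 2 * v X Y = y.
Proof.
  intros Ha HC Hka.
  set (K := 9 * C * (2 / (a - a') + 2 * ka + 2)).
  assert (Hia : 0 < / (a - a')) by (apply Rinv_0_lt_compat; lra).
  assert (HK : 0 <= K) by (unfold K, Rdiv; apply Rmult_le_pos; lra).
  (* One summand for each smallness condition [S1] to [S4], so that [b' <= / T] gives them together;
     [4 K] is the one for the contraction by 1/2. *)
  set (T := 1 + 6 * C + 12 * C / (a - a') + 12 * C * ka + 4 * K).
  assert (HCa : 0 <= 12 * C / (a - a')) by (unfold Rdiv; apply Rmult_le_pos; lra).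
  assert (HCk : 0 <= 12 * C * ka) by (apply Rmult_le_pos; lra).
  assert (HT : 1 <= T) by (unfold T; lra).
  assert (Hb2 : 0 < / T) by (apply Rinv_0_lt_compat; lra).
  exists (/ T). split; [split; [lra|rewrite <- Rinv_1; apply Rinv_le_contravar; lra]|].
  intros b b' u v Hb Hb'2 Hgap Hu Hv.
  assert (HbT : b' * T <= 1).
  { apply Rle_trans with (/ T * T); [apply Rmult_le_compat_r; lra|right; field; lra]. }
  assert (Hb0 : 0 <= b' <= 1) by nra.
  assert (S1 : b' * (6 * C) <= 1) by (unfold T in HbT; nra).
  assert (S2 : b' * (6 * C) <= (a - a') / 2).
  { assert (b' * (12 * C / (a - a')) <= 1) by (unfold T in HbT; nra).
    apply (Rmult_le_compat_r ((a - a') / 2)) in H; [|lra].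
    replace (b' * (12 * C / (a - a')) * ((a - a') / 2)) with (b' * (6 * C)) in H by (field; lra). lra. }
  assert (S3 : b' * (b' * (6 * C)) <= (b - b') / 2).
  { assert (b' * (12 * C * ka) <= 1) by (unfold T in HbT; nra).
    assert (b' * (6 * C) * b' <= b' * (6 * C) * (ka * (b - b'))).
    { apply Rmult_le_compat_l; [apply Rmult_le_pos; lra|exact Hgap]. }
    nra. }
  assert (S4 : b' * (4 * K) <= 1) by (unfold T in HbT; nra).
  assert (HD : forall s h p q w1 w2 D, (s <= 2)%nat -> W a b C h -> 0 <= D <= 4 * C ->
    W a' b' (2 * C) p -> W a' b' (2 * C) q -> W a' b' D w1 -> W a' b' D w2 ->
    exists A B, W a' b' K A /\ W a' b' K B /\ forall x y, Rabs y <= b' ->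
      (1 + y * (q x y + w2 x y)) ^ s *
        h (x + y * (p x y + w1 x y)) (y + y ^ 2 * (q x y + w2 x y))
      - (1 + y * q x y) ^ s * h (x + y * p x y) (y + y ^ 2 * q x y)
      = y * (A x y * w1 x y + B x y * w2 x y)).
  { intros s h p q w1 w2 D Hs Hh HD Hp Hq Hw1 Hw2.
    assert (HbD : b' * (2 * C + D) <= b' * (6 * C)) by (apply Rmult_le_compat_l; lra).
    assert (HbD' : b' * (b' * (2 * C + D)) <= b' * (b' * (6 * C))) by (apply Rmult_le_compat_l; lra).
    destruct (diff_pow s 1 a' b' a b C h p q w1 w2 (2 * C) D ((a - a') / 2) ((b - b') / 2))
      as [A [B [HA [HB E]]]]; auto; try lra; try lia.
    assert (Kle : 3 ^ s * C * (/ ((a - a') / 2) + b' * / ((b - b') / 2) + INR s) <= K).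
    { unfold K. replace (/ ((a - a') / 2)) with (2 / (a - a')) by (field; lra).
      assert (b' * / ((b - b') / 2) <= 2 * ka).
      { apply Rmult_le_reg_r with ((b - b') / 2); [lra|].
        rewrite Rmult_assoc, Rinv_l by lra. lra. }
      assert (0 <= b' * / ((b - b') / 2)).
      { apply Rmult_le_pos; [lra|left; apply Rinv_0_lt_compat; lra]. }
      assert (INR s <= 2) by (replace 2 with (INR 2) by (simpl; ring); apply le_INR; lia).
      pose proof (pos_INR s).
      assert (0 <= 2 / (a - a')) by (unfold Rdiv; lra).
      assert (3 ^ s <= 9) by (replace 9 with (3 ^ 2) by ring; apply Rle_pow; [lra|lia]).
      assert (0 < 3 ^ s) by (apply pow_lt; lra).
      apply Rmult_le_compat; [apply Rmult_le_pos; lra|lra|apply Rmult_le_compat_r; lra|lra]. }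
    exists A, B. split; [revert HA; apply W_le, Kle|]. split; [revert HB; apply W_le, Kle|].
    intros x y Hy. specialize (E x y Hy). rewrite pow_1 in E. rewrite <- E.
    f_equal. f_equal; [f_equal; ring|f_equal; simpl; ring]. }
  set (P := fun n => fst (inverse_iter u v n)). set (Q := fun n => snd (inverse_iter u v n)).
  assert (PS : forall n x y, P (S n) x y = - ((1 + y * Q n x y) * u (x + y * P n x y) (y + y ^ 2 * Q n x y))).
  { intros n x y. unfold P, Q. simpl. destruct (inverse_iter u v n). reflexivity. }
  assert (QS : forall n x y, Q (S n) x y = - ((1 + y * Q n x y) ^ 2 * v (x + y * P n x y) (y + y ^ 2 * Q n x y))).
  { intros n x y. unfold P, Q. simpl. destruct (inverse_iter u v n). reflexivity. }
  assert (P0 : forall x y, P 0%nat x y = 0) by reflexivity.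
  assert (Q0 : forall x y, Q 0%nat x y = 0) by reflexivity.
  clearbody P Q.
  assert (I : forall n, W a' b' (2 * C - 2 * C * (1 / 2) ^ n) (P n) /\
    W a' b' (2 * C - 2 * C * (1 / 2) ^ n) (Q n) /\
    W a' b' (C * (1 / 2) ^ n) (fun x y => P (S n) x y - P n x y) /\
    W a' b' (C * (1 / 2) ^ n) (fun x y => Q (S n) x y - Q n x y)).
  { induction n as [|n [IP [IQ [JP JQ]]]].
    - replace (2 * C - 2 * C * (1 / 2) ^ 0) with 0 by (simpl; ring).
      replace (C * (1 / 2) ^ 0) with C by (simpl; ring).
      assert (Z : W a' b' 0 (fun _ _ => 0)) by (apply W_zero; lra).
      split; [revert Z; apply W_ext; intros; rewrite P0; reflexivity|].
      split; [revert Z; apply W_ext; intros; rewrite Q0; reflexivity|]. split.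
      + apply W_opp in Hu. apply (W_mono _ _ _ _ _ a' b' C) in Hu; try lra.
        revert Hu. apply W_ext. intros x y _. rewrite PS, P0, Q0, !Rmult_0_r, !Rplus_0_r. ring.
      + apply W_opp in Hv. apply (W_mono _ _ _ _ _ a' b' C) in Hv; try lra.
        revert Hv. apply W_ext. intros x y _. rewrite QS, P0, Q0, !Rmult_0_r, !Rplus_0_r. ring.
    - set (h := (1 / 2) ^ n) in *. pose proof (half_pow_bounds n) as Hh. fold h in Hh.
      replace ((1 / 2) ^ S n) with (h / 2) by (unfold h; simpl; field).
      assert (HCh : 0 <= C * h <= C) by nra.
      split. { pose proof (W_plus _ _ _ _ _ _ _ IP JP) as G. apply (W_le _ _ _ _ (2 * C - 2 * C * (h / 2))) in G; [|lra].
        revert G. apply W_ext. intros; ring. }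
      split. { pose proof (W_plus _ _ _ _ _ _ _ IQ JQ) as G. apply (W_le _ _ _ _ (2 * C - 2 * C * (h / 2))) in G; [|lra].
        revert G. apply W_ext. intros; ring. }
      apply (W_le _ _ _ _ (2 * C)) in IP; [|lra]. apply (W_le _ _ _ _ (2 * C)) in IQ; [|lra].
      assert (Hfin : forall A B, W a' b' K A -> W a' b' K B -> W a' b' (C * (h / 2))
        (fun x y => - (y * (A x y * (P (S n) x y - P n x y) + B x y * (Q (S n) x y - Q n x y))))).
      { intros A B HA HB. apply W_opp.
        eapply W_le; [|apply (W_mult _ _ _ _ _ _ (W_y a' b' ltac:(lra) ltac:(lra))
          (W_plus _ _ _ _ _ _ _ (W_mult _ _ _ _ _ _ HA JP) (W_mult _ _ _ _ _ _ HB JQ)))].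
        replace (b' * (K * (C * h) + K * (C * h))) with (b' * (4 * K) * (C * h / 2)) by field. nra. }
      split.
      + destruct (HD 1%nat u _ _ _ _ _ ltac:(lia) Hu ltac:(split; [apply HCh|lra]) IP IQ JP JQ) as [A [B [HA [HB E]]]].
        eapply W_ext; [|apply (Hfin A B HA HB)]. intros x y Hy. cbv beta. rewrite <- (E x y Hy).
        rewrite (PS (S n)).
        replace (P n x y + (P (S n) x y - P n x y)) with (P (S n) x y) by ring.
        replace (Q n x y + (Q (S n) x y - Q n x y)) with (Q (S n) x y) by ring. rewrite (PS n). ring.
      + destruct (HD 2%nat v _ _ _ _ _ ltac:(lia) Hv ltac:(split; [apply HCh|lra]) IP IQ JP JQ) as [A [B [HA [HB E]]]].
        eapply W_ext; [|apply (Hfin A B HA HB)]. intros x y Hy. cbv beta. rewrite <- (E x y Hy).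
        rewrite (QS (S n)).
        replace (P n x y + (P (S n) x y - P n x y)) with (P (S n) x y) by ring.
        replace (Q n x y + (Q (S n) x y - Q n x y)) with (Q (S n) x y) by ring. rewrite (QS n). ring. }
  assert (HL : forall F : nat -> R -> R -> R, (forall x y, F 0%nat x y = 0) ->
    (forall n, W a' b' (C * (1 / 2) ^ n) (fun x y => F (S n) x y - F n x y)) ->
    exists f, W a' b' (2 * C) f /\ forall x y, Rabs y <= b' -> is_lim_seq (fun n => F n x y) (f x y)).
  { intros F F0 HF.
    assert (Hps : forall x y n, psum (fun n => F (S n) x y - F n x y) n = F n x y).
    { intros x y. induction n as [|n IH]; simpl; [symmetry; apply F0|]. rewrite IH. ring. }
    assert (Hsum : forall n, psum (fun n => C * (1 / 2) ^ n) n <= 2 * C).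
    { intros n. rewrite psum_half. pose proof (half_pow_bounds n).
      assert (0 <= 2 * C * (1 / 2) ^ n) by (apply Rmult_le_pos; lra). lra. }
    assert (Hs : forall x y, Rabs y <= b' -> is_series (fun n => F (S n) x y - F n x y)
      (Series (fun n => F (S n) x y - F n x y))).
    { intros x y Hy. apply (bsum_is_series _ (2 * C)).
      apply (bsum_le_pos _ (fun n => C * (1 / 2) ^ n) (2 * C)); [|lra|exact Hsum].
      intros n. apply (W_bound _ _ _ _ _ x y (HF n) Hy). }
    exists (fun x y => Series (fun n => F (S n) x y - F n x y)). split.
    - apply (W_series _ a' b' _ (fun n => C * (1 / 2) ^ n) (fun n x y => F (S n) x y - F n x y)); auto.
    - intros x y Hy. apply (is_lim_seq_ext (psum (fun n => F (S n) x y - F n x y))); [apply Hps|].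
      apply is_series_psum, Hs, Hy. }
  destruct (HL P P0 (fun n => proj1 (proj2 (proj2 (I n))))) as [p [Wp Lp]].
  destruct (HL Q Q0 (fun n => proj2 (proj2 (proj2 (I n))))) as [q [Wq Lq]].
  exists p, q. split; [exact Wp|]. split; [exact Wq|].
  assert (WPn : forall n, W a' b' (2 * C) (P n) /\ W a' b' (2 * C) (Q n)).
  { intros n. destruct (I n) as [IP [IQ _]]. pose proof (half_pow_bounds n).
    assert (0 <= 2 * C * (1 / 2) ^ n) by (apply Rmult_le_pos; lra).
    split; [revert IP|revert IQ]; apply W_le; lra. }
  assert (Wd : forall F f, W a' b' (2 * C) F -> W a' b' (2 * C) f -> W a' b' (4 * C) (fun x y => f x y - F x y)).
  { intros F f HF Hf. replace (4 * C) with (2 * C + 2 * C) by ring. apply W_minus; auto. }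
  (* The residual of the limit is at most [K] times its distance to the iterates, which tends to
     0. *)
  assert (Hlim : forall s h (F : nat -> R -> R -> R) (f : R -> R -> R), (s <= 2)%nat -> W a b C h ->
    (forall x y, Rabs y <= b' -> is_lim_seq (fun n => F n x y) (f x y)) ->
    (forall n x y, F (S n) x y = - ((1 + y * Q n x y) ^ s * h (x + y * P n x y) (y + y ^ 2 * Q n x y))) ->
    forall x y, Rabs y <= b' -> (1 + y * q x y) ^ s * h (x + y * p x y) (y + y ^ 2 * q x y) + f x y = 0).
  { intros s h F f Hs Hh HF HFS x y Hy.
    set (L := (1 + y * q x y) ^ s * h (x + y * p x y) (y + y ^ 2 * q x y)).
    assert (B : forall n, Rabs (L + F (S n) x y) <= K * (Rabs (p x y - P n x y) + Rabs (q x y - Q n x y))).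
    { intros n. destruct (WPn n) as [WP WQ].
      destruct (HD s h _ _ _ _ _ Hs Hh ltac:(split; [|apply Rle_refl]; lra) WP WQ (Wd _ _ WP Wp) (Wd _ _ WQ Wq))
        as [A [B [HA [HB E]]]].
      specialize (E x y Hy). cbv beta in E.
      replace (P n x y + (p x y - P n x y)) with (p x y) in E by ring.
      replace (Q n x y + (q x y - Q n x y)) with (q x y) in E by ring.
      rewrite HFS. fold L in E. unfold Rminus in E at 1. rewrite E, Rabs_mult.
      assert (B1 : Rabs (A x y) <= K) by (apply (W_bound _ _ _ _ _ x y HA Hy)).
      assert (B2 : Rabs (B x y) <= K) by (apply (W_bound _ _ _ _ _ x y HB Hy)).
      pose proof (Rabs_triang (A x y * (p x y - P n x y)) (B x y * (q x y - Q n x y))) as Tr.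
      rewrite !Rabs_mult in Tr.
      pose proof (Rabs_pos (p x y - P n x y)). pose proof (Rabs_pos (q x y - Q n x y)).
      assert (Rabs (A x y) * Rabs (p x y - P n x y) <= K * Rabs (p x y - P n x y)) by (apply Rmult_le_compat_r; lra).
      assert (Rabs (B x y) * Rabs (q x y - Q n x y) <= K * Rabs (q x y - Q n x y)) by (apply Rmult_le_compat_r; lra).
      pose proof (Rabs_pos y).
      pose proof (Rabs_pos (A x y * (p x y + - P n x y) + B x y * (q x y + - Q n x y))).
      unfold Rminus in *. nra. }
    assert (L1 : is_lim_seq (fun n => Rabs (L + F (S n) x y)) (Rabs (L + f x y))).
    { apply (is_lim_seq_abs _ (L + f x y)). apply is_lim_seq_plus'; [apply is_lim_seq_const|].
      apply (proj1 (is_lim_seq_incr_1 (fun n => F n x y) (f x y))). exact (HF x y Hy). }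
    assert (L2 : is_lim_seq (fun n => K * (Rabs (p x y - P n x y) + Rabs (q x y - Q n x y))) 0).
    { replace 0 with (K * (Rabs (p x y - p x y) + Rabs (q x y - q x y)))
        by (unfold Rminus; rewrite !Rplus_opp_r, Rabs_R0; ring).
      apply (is_lim_seq_scal_l _ K (Rabs (p x y - p x y) + Rabs (q x y - q x y))).
      apply is_lim_seq_plus'.
      - apply (is_lim_seq_abs _ (p x y - p x y)). apply is_lim_seq_minus'; [apply is_lim_seq_const|apply Lp, Hy].
      - apply (is_lim_seq_abs _ (q x y - q x y)). apply is_lim_seq_minus'; [apply is_lim_seq_const|apply Lq, Hy]. }
    pose proof (is_lim_seq_le _ _ _ _ B L1 L2) as Hle. simpl in Hle.
    pose proof (Rabs_pos (L + f x y)).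
    destruct (Req_dec (L + f x y) 0) as [|Hn]; [assumption|].
    apply Rabs_pos_lt in Hn. lra. }
  intros x y Hy. cbv zeta.
  pose proof (Hlim 1%nat u P p ltac:(lia) Hu Lp) as H1. pose proof (Hlim 2%nat v Q q ltac:(lia) Hv Lq) as H2.
  specialize (H1 ltac:(intros; rewrite PS, pow_1; reflexivity) x y Hy).
  specialize (H2 ltac:(intros; rewrite QS; reflexivity) x y Hy).
  rewrite pow_1 in H1. split.
  - replace (x + y * p x y + (y + y ^ 2 * q x y) * u (x + y * p x y) (y + y ^ 2 * q x y))
      with (x + y * ((1 + y * q x y) * u (x + y * p x y) (y + y ^ 2 * q x y) + p x y)) by ring.
    rewrite H1. ring.
  - replace (y + y ^ 2 * q x y + (y + y ^ 2 * q x y) ^ 2 * v (x + y * p x y) (y + y ^ 2 * q x y))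
      with (y + y ^ 2 * ((1 + y * q x y) ^ 2 * v (x + y * p x y) (y + y ^ 2 * q x y) + q x y)) by ring.
    rewrite H2. ring.
Qed.

(** The map [(x + y u, y + y^2 v)] applied after [(x + y p, y + y^2 q)] fixes the point. *)
Definition inverse_at (u v p q : R -> R -> R) (x y : R) : Prop :=
  x + y * p x y + (y + y ^ 2 * q x y) * u (x + y * p x y) (y + y ^ 2 * q x y) = x /\
  y + y ^ 2 * q x y + (y + y ^ 2 * q x y) ^ 2 * v (x + y * p x y) (y + y ^ 2 * q x y) = y.

Lemma shear_bound a b C v x y : W a b C v -> Rabs y <= b -> Rabs (y + y ^ 2 * v x y) <= b + b * (b * C).
Proof.
  intros Hv Hy. eapply Rle_trans; [apply Rabs_triang|]. rewrite Rabs_mult, <- RPow_abs.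
  pose proof (W_bound _ _ _ _ _ x y Hv Hy). pose proof (Rabs_pos y). pose proof (Rabs_pos (v x y)).
  assert (Rabs y ^ 2 * Rabs (v x y) <= b * (b * C)); [|lra].
  simpl. rewrite Rmult_1_r, Rmult_assoc. apply Rmult_le_compat; try lra.
  - apply Rmult_le_pos; lra.
  - apply Rmult_le_compat; lra.
Qed.

(* A right inverse of a right inverse of a map is the map itself, so right inverses suffice. *)
Lemma two_sided_inverse a C ka : 0 < a -> 0 <= C -> 0 <= ka ->
  exists b2, 0 < b2 <= 1 /\ forall b b' b'' u v, 0 < b'' < b' -> b' < b -> b' <= b2 ->
    b' <= ka * (b - b') -> b'' <= ka * (b' - b'') -> W a b C u -> W a b C v ->
    exists p q, W (a / 2) b' (2 * C) p /\ W (a / 2) b' (2 * C) q /\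
      (forall x y, Rabs y <= b' -> inverse_at u v p q x y) /\
      (forall x y, Rabs y <= b'' -> inverse_at p q u v x y).
Proof.
  intros Ha HC Hka.
  destruct (inverse a (a / 2) C ka) as [c1 [Hc1 I1]]; try lra.
  destruct (inverse (a / 2) (a / 4) (2 * C) ka) as [c2 [Hc2 I2]]; try lra.
  assert (HCk : 0 <= 4 * C * ka) by (apply Rmult_le_pos; lra).
  assert (Hi : 0 < / (1 + 4 * C * ka)) by (apply Rinv_0_lt_compat; lra).
  set (b2 := Rmin (Rmin c1 c2) (/ (1 + 4 * C * ka))).
  assert (Hb2 : 0 < b2) by (repeat apply Rmin_pos; lra).
  assert (L1 : b2 <= c1) by (eapply Rle_trans; [apply Rmin_l|apply Rmin_l]).
  assert (L2 : b2 <= c2) by (eapply Rle_trans; [apply Rmin_l|apply Rmin_r]).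
  assert (L3 : b2 <= / (1 + 4 * C * ka)) by apply Rmin_r.
  exists b2. split; [lra|].
  intros b b' b'' u v Hb'' Hb' Hbb2 G1 G2 Hu Hv.
  destruct (I1 b b' u v) as [p [q [Wp [Wq E1]]]]; auto; try lra.
  destruct (I2 b' b'' p q) as [u' [v' [Wu' [Wv' E2]]]]; auto; try lra.
  exists p, q. split; [exact Wp|]. split; [exact Wq|].
  assert (D1 : forall x y, Rabs y <= b' -> inverse_at u v p q x y).
  { intros x y Hy. apply (E1 x y Hy). }
  split; [exact D1|]. intros x y Hy. destruct (E2 x y Hy) as [F1 F2].
  set (X := x + y * u' x y) in *. set (Y := y + y ^ 2 * v' x y) in *.
  assert (HY : Rabs Y <= b').
  { eapply Rle_trans; [apply (shear_bound _ _ _ _ x y Wv' Hy)|].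
    assert (b'' * (1 + 4 * C * ka) <= 1).
    { apply Rle_trans with (/ (1 + 4 * C * ka) * (1 + 4 * C * ka)).
      - apply Rmult_le_compat_r; lra.
      - right; field; lra. }
    assert (b'' * (4 * C * ka) <= 1) by lra.
    assert (b'' * (b'' * (2 * (2 * C))) <= b' - b''); [|lra].
    apply Rle_trans with (ka * (b' - b'') * (b'' * (2 * (2 * C)))).
    - apply Rmult_le_compat_r; [apply Rmult_le_pos; lra|exact G2].
    - replace (ka * (b' - b'') * (b'' * (2 * (2 * C)))) with (b'' * (4 * C * ka) * (b' - b'')) by ring.
      rewrite <- (Rmult_1_l (b' - b'')) at 2. apply Rmult_le_compat_r; lra. }
  destruct (D1 X Y HY) as [G3 G4]. rewrite F1, F2 in G3, G4.
  unfold inverse_at. rewrite G3, G4. split; assumption.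
Qed.

Lemma limit_bound (f : R -> R) k : continuous f 0 ->
  (exists e, 0 < e /\ forall y, 0 < y < e -> Rabs (f y) <= k) -> Rabs (f 0) <= k.
Proof.
  intros Hf [e [He H]]. apply Rnot_lt_le. intros Hlt.
  assert (Hc : continuous (fun y => Rabs (f y)) 0) by (apply (continuous_comp f Rabs); [exact Hf|apply continuous_Rabs]).
  assert (Hd : 0 < Rabs (f 0) - k) by lra.
  destruct (Hc (fun z => k < z)) as [d Hd'].
  { exists (mkposreal _ Hd). intros z Hz. change (Rabs (z - Rabs (f 0)) < Rabs (f 0) - k) in Hz.
    apply Rabs_def2 in Hz. lra. }
  set (y := Rmin (d / 2) (e / 2)). pose proof (cond_pos d).
  assert (0 < y) by (apply Rmin_pos; lra).
  assert (y <= d / 2) by apply Rmin_l. assert (y <= e / 2) by apply Rmin_r.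
  assert (Hb : k < Rabs (f y)).
  { apply Hd'. change (Rabs (y - 0) < d). rewrite Rminus_0_r, Rabs_pos_eq; lra. }
  specialize (H y ltac:(lra)). lra.
Qed.

(** * Normal form with exponentially small remainder *)

Section Model.
Variables (a0 b0 M0 bs : R) (h1 h2 : R -> R -> R).
Hypotheses (Hh1 : W a0 b0 M0 h1) (Hh2 : W a0 b0 M0 h2).
Hypotheses (Ha0 : 0 < a0) (Hb0 : 0 < b0) (Hbs : 0 < bs).
Hypothesis Hmeets : meets h1 h2 bs.

(** The functions live on cylinders of decreasing heights, from [(1 + 5 e) b] for the change of
    variables to [(1 + e) b] for the remainder. Since the layers between them are proportional to
    [b], the Cauchy factors, ratios of heights to gaps, are bounded in terms of [e] alone, and [C]
    is uniform in [b]. *)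
Theorem model_normal_form q al : 0 < al < a0 ->
  exists ah C e bst, 0 < ah /\ 0 < C /\ 0 < e <= 1 /\ 0 < bst /\ forall b, 0 < b < bst ->
    b * (144 * (C + M0 + 1)) <= e /\ 12 * b <= Rmin bs 1 /\ 6 * b + 6 * b * (6 * b * C) <= b0 /\
    exists u v p p' g1 g2,
      W ah ((1 + 5 * e) * b) C u /\ W ah ((1 + 5 * e) * b) C v /\
      W ah ((1 + 4 * e) * b) C p /\ W ah ((1 + 4 * e) * b) C p' /\
      W ah ((1 + e) * b) C g1 /\ W ah ((1 + e) * b) C g2 /\
      (forall x y, Rabs y <= (1 + 4 * e) * b -> inverse_at u v p p' x y) /\
      (forall x y, Rabs y <= (1 + 3 * e) * b -> inverse_at p p' u v x y) /\
      forall x y, Rabs y <= (1 + e) * b ->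
        let X := F1 h1 (x + y * u x y) (y + y ^ 2 * v x y) in
        let Y := F2 h2 (x + y * u x y) (y + y ^ 2 * v x y) in
        X + Y * p X Y = x + y + y ^ S (S q) * g1 x y /\
        Y + Y ^ 2 * p' X Y = y + y ^ S (S (S q)) * g2 x y /\
        Rabs (g1 x y) <= C * exp (- (2 * PI * al / b)) /\
        Rabs (g2 x y) <= C * exp (- (2 * PI * al / b)).
Proof.
  intros Hal. pose proof PI_ge_3 as HPI.
  assert (HM0 : 0 <= M0) by (eapply W_M_pos; eauto).
  set (a := (al + a0) / 2). assert (Ha : al < a < a0) by (unfold a; lra).
  (* This is the [e] with [a (1 - e) = al (1 + 5 e)]. With the cut-off
     [N = (1 - e) / ((1 + 5 e) b)], the largest that [r = 1 - e] admits, the exponent [2 pi a N] is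
     exactly [2 pi al / b]. *)
  set (e := (a - al) / (a + 5 * al)).
  assert (He : 0 < e < 1).
  { split; [apply Rdiv_lt_0_compat; lra|]. apply Rmult_lt_reg_r with (a + 5 * al); [lra|].
    unfold e, Rdiv. rewrite Rmult_assoc, Rinv_l; lra. }
  assert (Hea : a * (1 - e) = al * (1 + 5 * e)) by (unfold e; field; lra).
  clearbody e.
  destruct (formal_normal_form a0 b0 M0 h1 h2 Hh1 Hh2 Ha0 Hb0 bs Hmeets Hbs q a) as [b1 [C1 [u0 [v0 [r1 [r2 [Hb1 Hnf]]]]]]]; [lra|].
  destruct (iterated_normal_form a0 b0 M0 h1 h2 Hh1 Hh2 Hb0 (1 - e) q a b1 C1 u0 v0 r1 r2)
    as [b2 [C2 [Hb2 [HC2 Hph]]]]; auto; try lra.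
  set (ka := 6 / e).
  assert (Hka : 0 < ka) by (apply Rdiv_lt_0_compat; lra).
  destruct (two_sided_inverse a C2 ka) as [b3 [Hb3 Hinv]]; try lra.
  set (K3 := 18 * C2 * (8 / a + 2 / e + 2)).
  assert (Hia : 0 < 8 / a) by (apply Rdiv_lt_0_compat; lra).
  assert (Hie : 0 < 2 / e) by (apply Rdiv_lt_0_compat; lra).
  assert (HK3 : 0 <= K3) by (unfold K3; apply Rmult_le_pos; lra).
  set (E0 := 4 * C2 * (1 + 8 * C2 / a)).
  assert (HCa : 0 <= 8 * C2 / a) by (apply Rmult_le_pos; [lra|left; apply Rinv_0_lt_compat; lra]).
  assert (HE0 : 4 * C2 <= E0) by (unfold E0; assert (0 <= C2 * (8 * C2 / a)) by (apply Rmult_le_pos; lra); lra).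
  set (C := 1 + 2 * C2 + (3 * C2 + E0) * (1 + 2 * K3)).
  assert (HC : 1 + 5 * C2 + E0 <= C) by (unfold C; assert (0 <= (3 * C2 + E0) * K3) by (apply Rmult_le_pos; lra); lra).
  (* Each summand yields one of the conditions [Q1] to [Q6] on [b < / T]. *)
  set (T := 144 * (C + M0 + 1) / e + 12 / bs + 12 + 6 / b2 + 6 / b3 + 36 * (1 + 4 * C) / a + 6 * (1 + 6 * C) / b0).
  assert (Hpos : forall x y, 0 <= x -> 0 < y -> 0 <= x / y).
  { intros x y Hx Hy. apply Rmult_le_pos; [lra|left; apply Rinv_0_lt_compat; lra]. }
  pose proof (Hpos (144 * (C + M0 + 1)) e ltac:(lra) ltac:(lra)) as T1.
  pose proof (Hpos 12 bs ltac:(lra) ltac:(lra)) as T2.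
  pose proof (Hpos 6 b2 ltac:(lra) ltac:(lra)) as T3.
  pose proof (Hpos 6 b3 ltac:(lra) ltac:(lra)) as T4.
  pose proof (Hpos (36 * (1 + 4 * C)) a ltac:(lra) ltac:(lra)) as T5.
  pose proof (Hpos (6 * (1 + 6 * C)) b0 ltac:(lra) ltac:(lra)) as T6.
  assert (HT : 12 <= T) by (unfold T; lra).
  exists (a / 4), C, e, (/ T). split; [lra|]. split; [lra|]. split; [lra|].
  split; [apply Rinv_0_lt_compat; lra|]. intros b Hb.
  assert (HbT : b * T <= 1).
  { apply Rle_trans with (/ T * T); [apply Rmult_le_compat_r; lra|right; field; lra]. }
  assert (Hget : forall x y, 0 < y -> 0 <= x / y -> x / y <= T -> b * x <= y).
  { intros x y Hy H0 H. replace (b * x) with (b * (x / y) * y) by (field; lra).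
    apply Rle_trans with (1 * y); [|lra]. apply Rmult_le_compat_r; [lra|].
    apply Rle_trans with (b * T); [apply Rmult_le_compat_l; lra|exact HbT]. }
  assert (Q1 : b * (144 * (C + M0 + 1)) <= e) by (apply Hget; unfold T; lra).
  assert (Q2 : b * 12 <= bs) by (apply Hget; unfold T; lra).
  assert (Q2' : b * 12 <= 1).
  { assert (0 <= b * C) by (apply Rmult_le_pos; lra). assert (0 <= b * M0) by (apply Rmult_le_pos; lra). lra. }
  assert (Q3 : b * 6 <= b2) by (apply Hget; unfold T; lra).
  assert (Q4 : b * 6 <= b3) by (apply Hget; unfold T; lra).
  assert (Q5 : b * (36 * (1 + 4 * C)) <= a) by (apply Hget; unfold T; lra).
  assert (Q6 : b * (6 * (1 + 6 * C)) <= b0) by (apply Hget; unfold T; lra).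
  clearbody T. clear T1 T2 T3 T4 T5 T6 HT HbT Hget Hpos.
  assert (HbC : 0 <= b * C) by (apply Rmult_le_pos; lra).
  split; [exact Q1|]. split; [apply Rmin_glb; lra|].
  split. { assert (6 * b * (6 * b * C) <= 1 * (6 * b * C)) by (apply Rmult_le_compat_r; lra). lra. }
  set (bP := (1 + 5 * e) * b). assert (HbP : b < bP <= 6 * b) by (unfold bP; clear -He Hb; nra).
  set (X := exp (- (2 * PI * al / b))).
  assert (HX : 0 < X) by apply exp_pos.
  (* Finitely many iterations, their number depending on [b], bring the solvable part of the error
     below the exponential. The constant [C2] does not depend on that number. *)
  destruct (pow_lt_1_zero (1 / 2) ltac:(rewrite Rabs_pos_eq; lra) X HX) as [n Hn].
  specialize (Hn n (le_n n)). pose proof (half_pow_bounds n) as Hhalf.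
  rewrite Rabs_pos_eq in Hn by lra.
  set (N := (1 - e) / bP).
  assert (HNb : N * bP = 1 - e) by (unfold N; field; lra).
  destruct (Hph bP N n) as [u [v [H1 [H2 [d [e1 [e2 [Hu [Hv [HH1 [HH2 [Hd [He1 [He2 HE]]]]]]]]]]]]]]; try lra.
  assert (Hexp : exp (- (2 * PI * (a - 0) * N)) = X).
  { unfold X. f_equal. f_equal. rewrite Rminus_0_r.
    replace (2 * PI * a * N) with (2 * PI * (a * (1 - e)) / bP) by (unfold N; field; lra).
    rewrite Hea. unfold bP. field. split; lra. }
  (* Only real points are estimated, so the whole width [a] is spent on the exponent. *)
  assert (Hhigh : forall f, Wm (fun k => N <= Rabs (IZR k)) a bP C2 f ->
    forall x y, Rabs y <= bP -> Rabs (f x y) <= C2 * X).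
  { intros f Hf x y Hy. apply (W_high N a 0) in Hf; [|lra]. rewrite Hexp in Hf.
    pose proof (W_bound _ _ _ _ _ x y Hf Hy). lra. }
  assert (Hsmall : forall f, W a bP (C2 * (1 / 2) ^ n) f ->
    forall x y, Rabs y <= bP -> Rabs (f x y) <= C2 * X).
  { intros f Hf x y Hy. pose proof (W_bound _ _ _ _ _ x y Hf Hy).
    assert (C2 * (1 / 2) ^ n <= C2 * X) by (apply Rmult_le_compat_l; lra). lra. }
  set (w1 := fun x y => H1 x y + e1 x y).
  set (w2 := fun x y => H2 x y + e2 x y).
  assert (Bw1 : forall x y, Rabs y <= bP -> Rabs (w1 x y) <= 2 * C2 * X).
  { intros x y Hy. eapply Rle_trans; [apply Rabs_triang|].
    pose proof (Hhigh _ HH1 x y Hy). pose proof (Hsmall _ He1 x y Hy). lra. }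
  assert (Bw2 : forall x y, Rabs y <= bP -> Rabs (w2 x y) <= 2 * C2 * X).
  { intros x y Hy. eapply Rle_trans; [apply Rabs_triang|].
    pose proof (Hhigh _ HH2 x y Hy). pose proof (Hsmall _ He2 x y Hy). lra. }
  assert (HC2X : 0 <= C2 * X) by (apply Rmult_le_pos; lra).
  (* At a fixed height [d] is a constant and plays the part of the drift in [mean_drift_bound]; a
     power of [y] is divided out afterwards. *)
  assert (Bd : forall x y, Rabs y <= (1 + e) * b -> Rabs (d x y) <= 2 * C2 * X * (1 + 8 * C2 / a)).
  { assert (Bd1 : forall x y, y <> 0 -> Rabs y <= (1 + e) * b -> Rabs (d x y) <= 2 * C2 * X * (1 + 8 * C2 / a)).
    { intros x y Hy0 Hy. assert (HyP : Rabs y < bP) by (unfold bP; clear -He Hb Hy; nra).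
      pose proof (Rabs_pos_lt y Hy0) as Hy1.
      assert (Hyb : Rabs y <= 2 * b) by (clear -He Hb Hy; nra).
      assert (Hpw : forall k, 0 < Rabs y ^ k) by (intros; apply pow_lt; lra).
      assert (D : Rabs (y ^ S (S (S q)) * d x y) <= Rabs y ^ S (S (S q)) * (2 * C2 * X) +
        Rabs y ^ 2 * (8 * C2 / a) * (Rabs y ^ S (S q) * (2 * C2 * X))).
      { apply (mean_drift_bound h1 h2 bs a bP C2 u v (fun x y => y ^ S (S q) * w1 x y)
          (fun x y => y ^ S (S (S q)) * w2 x y)); auto; try lra.
        - assert (Rabs y ^ 2 * C2 <= 2 * b * (2 * b) * C).
          { apply Rmult_le_compat; [apply pow_le; lra|lra| |lra]. simpl. rewrite Rmult_1_r.
            apply Rmult_le_compat; lra. }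
          assert (b * (b * C) <= b * 1) by (apply Rmult_le_compat_l; [lra|]; assert (0 <= b * M0) by (apply Rmult_le_pos; lra); lra). lra.
        - assert (Rabs y * (4 * C2 / a) <= 2 * b * (4 * C / a)).
          { apply Rmult_le_compat; try lra.
            apply Rmult_le_compat_r; [left; apply Rinv_0_lt_compat; lra|lra]. }
          assert (2 * b * (4 * C / a) <= 1 / 2); [|lra].
          replace (2 * b * (4 * C / a)) with (b * (8 * C) / a) by (field; lra).
          apply Rmult_le_reg_r with a; [lra|]. unfold Rdiv. rewrite Rmult_assoc, Rinv_l by lra. lra.
        - intros x'. destruct (HE x' y ltac:(lra)) as [E _]. exact E.
        - intros x'. destruct (HE x' y ltac:(lra)) as [_ E]. unfold conj2 in *. rewrite E. unfold w2.
          rewrite (W_mean _ _ _ _ x' x y Hd ltac:(lra)). ring.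
        - intros x'. rewrite Rabs_mult, <- RPow_abs. apply Rmult_le_compat_l; [left; apply Hpw|apply Bw1; lra].
        - intros x'. rewrite Rabs_mult, <- RPow_abs. apply Rmult_le_compat_l; [left; apply Hpw|apply Bw2; lra]. }
      rewrite Rabs_mult, <- RPow_abs in D.
      apply Rmult_le_reg_l with (Rabs y ^ S (S (S q))); [apply Hpw|].
      eapply Rle_trans; [exact D|].
      replace (Rabs y ^ 2 * (8 * C2 / a) * (Rabs y ^ S (S q) * (2 * C2 * X))) with
        (Rabs y ^ S (S (S q)) * (Rabs y * (8 * C2 / a * (2 * C2 * X)))) by (simpl; ring).
      rewrite <- Rmult_plus_distr_l. apply Rmult_le_compat_l; [left; apply Hpw|].
      assert (0 <= 8 * C2 / a * (2 * C2 * X)) by (apply Rmult_le_pos; lra).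
      assert (Rabs y * (8 * C2 / a * (2 * C2 * X)) <= 1 * (8 * C2 / a * (2 * C2 * X))) by (apply Rmult_le_compat_r; lra). lra. }
    (* At [y = 0] the drift equation is void, and the bound is obtained as a limit. *)
    intros x y Hy. destruct (Req_dec y 0) as [->|Hy0]; [|apply Bd1; auto].
    apply (limit_bound (fun y => d x y)).
    - apply W_True in Hd.
      destruct (W_partials a bP C2 d x 0 (Rmin a bP) Hd) as [_ [d2 [_ [D _]]]].
      + split; [apply Rmin_pos; lra|apply Rmin_l].
      + rewrite Rabs_R0, Rplus_0_l. apply Rmin_r.
      + apply (ex_derive_continuous (fun y => d x y)). eexists; exact D.
    - exists ((1 + e) * b). split; [apply Rmult_lt_0_compat; lra|]. intros y Hy'. apply Bd1; [lra|].
      rewrite Rabs_pos_eq; lra. }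
  set (w3 := fun x y => w2 x y + d x y).
  set (bG := (1 + e) * b). assert (HbG : b < bG <= 2 * b) by (unfold bG; clear -He Hb; nra).
  assert (HG4 : bG <= bP) by (unfold bG, bP; clear -He Hb; nra).
  assert (Bw3 : forall x y, Rabs y <= bG -> Rabs (w3 x y) <= E0 * X).
  { intros x y Hy. eapply Rle_trans; [apply Rabs_triang|].
    pose proof (Bw2 x y ltac:(lra)). pose proof (Bd x y Hy).
    replace (E0 * X) with (2 * (2 * C2 * X * (1 + 8 * C2 / a))) by (unfold E0; ring).
    assert (0 <= 2 * C2 * X * (8 * C2 / a)) by (apply Rmult_le_pos; lra). lra. }
  assert (HNle : C2 * (1 / 2) ^ n <= C2 * 1) by (apply Rmult_le_compat_l; lra).
  assert (Ww1 : W a bP (3 * C2) w1).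
  { eapply W_le; [|apply W_plus; [apply (W_True _ _ _ _ _ HH1)|exact He1]]. lra. }
  assert (Ww3 : W a bP (3 * C2) w3).
  { eapply W_le; [|apply W_plus; [apply W_plus; [apply (W_True _ _ _ _ _ HH2)|exact He2]|apply (W_True _ _ _ _ _ Hd)]]. lra. }
  destruct (Hinv bP ((1 + 4 * e) * b) ((1 + 3 * e) * b) u v) as [p [p' [Wp [Wp' [I1 I2]]]]]; auto.
  { clear -He Hb. nra. } { unfold bP; clear -He Hb; nra. } { clear -He Hb Q4. nra. }
  { unfold ka, bP. replace (6 / e * ((1 + 5 * e) * b - (1 + 4 * e) * b)) with (6 * b) by (field; lra). clear -He Hb; nra. }
  { unfold ka. replace (6 / e * ((1 + 4 * e) * b - (1 + 3 * e) * b)) with (6 * b) by (field; lra). clear -He Hb; nra. }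
  set (aG := a / 4).
  assert (Hsh : forall f, W a bP C2 f -> W aG bG C2 (fun x y => f (x + y) y)).
  { intros f Hf. assert (W aG bG C2 (fun x y => f (x + y) (y + 0))).
    { apply (W_comp aG bG a bP C2 f bG 0 (fun _ y => y) (fun _ _ => 0) Hf).
      - apply W_y; unfold aG; lra.
      - apply W_zero; unfold aG; lra.
      - unfold aG. assert (0 <= b * (36 * 4 * C)) by lra. lra.
      - lra. }
    revert H. apply W_ext. intros x y _. rewrite Rplus_0_r. reflexivity. }
  assert (Wu1 : W aG bG (1 + C2) (fun x y => 1 + u (x + y) y)).
  { apply W_plus; [|apply (Hsh u Hu)]. pose proof (W_const aG bG 1 ltac:(unfold aG; lra) ltac:(lra)) as O.
    rewrite Rabs_R1 in O. exact O. }
  assert (Wv1 : W aG bG (1 + C2) (fun x y => v (x + y) y)).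
  { eapply W_le; [|apply (Hsh v Hv)]. lra. }
  assert (Hdn : forall f, W a bP (3 * C2) f -> W aG bG (3 * C2) f)
    by (intros f; apply W_mono; unfold aG; lra).
  (* The image of [(x, y)] under the map after [Phi] differs from [Phi (x + y, y)] by terms of order
     [y^(q+2)]. At the latter point the inverse returns [(x + y, y)] exactly, so only the difference
     of the two values of the inverse has to be estimated. Writing [x + y] as a correction [y * 1]
     lets [diff_pow] apply, with [1 + u(x + y, y)] in the place of [u]. *)
  assert (Hdiff : forall s h, (1 <= s <= 2)%nat -> W (a / 2) ((1 + 4 * e) * b) (2 * C2) h ->
    exists A B, W aG bG K3 A /\ W aG bG K3 B /\ forall x y, Rabs y <= bG ->
      (1 + y * v (x + y) y + y ^ S (S q) * w3 x y) ^ s *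
        h (x + y * (1 + u (x + y) y) + y ^ S (S q) * w1 x y) (y + y ^ 2 * v (x + y) y + y ^ S (S (S q)) * w3 x y)
      - (1 + y * v (x + y) y) ^ s * h (x + y * (1 + u (x + y) y)) (y + y ^ 2 * v (x + y) y)
      = y ^ S (S q) * (A x y * w1 x y + B x y * w3 x y)).
  { intros s h Hs Hh.
    assert (Z0 : bG * (1 + C2 + 3 * C2) <= 2 * b * (1 + 4 * C)) by (apply Rmult_le_compat; lra).
    assert (Z1 : bG * (1 + C2 + 3 * C2) <= a / 18) by lra.
    assert (Z2 : bG * (1 + C2 + 3 * C2) <= e).
    { assert (0 <= b * M0) by (apply Rmult_le_pos; lra). lra. }
    assert (Z3 : bG * (bG * (1 + C2 + 3 * C2)) <= 2 * b * e).
    { apply Rmult_le_compat; try lra. apply Rmult_le_pos; lra. }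
    destruct (diff_pow s (S (S q)) aG bG (a / 2) ((1 + 4 * e) * b) (2 * C2) h _ _ w1 w3 (1 + C2) (3 * C2)
      (a / 8) (e * b) ltac:(lia) Hh Wu1 Wv1 (Hdn _ Ww1) (Hdn _ Ww3)) as [A [B [HA [HB E]]]]; try lra.
    { apply Rmult_lt_0_compat; lra. } { unfold aG. lra. } { unfold bG in *. lra. }
    assert (Kle : 3 ^ s * (2 * C2) * (/ (a / 8) + bG * / (e * b) + INR s) <= K3).
    { unfold K3. replace (/ (a / 8)) with (8 / a) by (field; lra).
      assert (bG * / (e * b) <= 2 / e).
      { unfold bG. replace ((1 + e) * b * / (e * b)) with ((1 + e) / e) by (field; lra).
        apply Rmult_le_compat_r; [left; apply Rinv_0_lt_compat; lra|lra]. }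
      assert (0 <= bG * / (e * b)).
      { apply Rmult_le_pos; [lra|left; apply Rinv_0_lt_compat; apply Rmult_lt_0_compat; lra]. }
      assert (INR s <= 2) by (replace 2 with (INR 2) by (simpl; ring); apply le_INR; lia).
      pose proof (pos_INR s).
      assert (3 ^ s <= 9) by (replace 9 with (3 ^ 2) by ring; apply Rle_pow; [lra|lia]).
      assert (0 < 3 ^ s) by (apply pow_lt; lra).
      apply Rmult_le_compat; [apply Rmult_le_pos; lra|lra| |lra].
      apply Rle_trans with (9 * (2 * C2)); [apply Rmult_le_compat_r; lra|lra]. }
    exists A, B. split; [revert HA; apply W_le, Kle|]. split; [revert HB; apply W_le, Kle|].
    exact E. }
  destruct (Hdiff 1%nat p ltac:(lia) Wp) as [A1 [B1 [WA1 [WB1 D1]]]].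
  destruct (Hdiff 2%nat p' ltac:(lia) Wp') as [A2 [B2 [WA2 [WB2 D2]]]].
  assert (Hg : forall w A B, W aG bG (3 * C2) w -> W aG bG K3 A -> W aG bG K3 B ->
    W aG bG C (fun x y => w x y + y * (A x y * w1 x y + B x y * w3 x y))).
  { intros w A B Hw HA HB.
    eapply W_le; [|apply (W_plus _ _ _ _ _ _ _ Hw (W_mult _ _ _ _ _ _ (W_y aG bG ltac:(unfold aG; lra) ltac:(lra))
      (W_plus _ _ _ _ _ _ _ (W_mult _ _ _ _ _ _ HA (Hdn _ Ww1)) (W_mult _ _ _ _ _ _ HB (Hdn _ Ww3)))))].
    assert (0 <= K3 * (3 * C2)) by (apply Rmult_le_pos; lra).
    assert (bG * (K3 * (3 * C2) + K3 * (3 * C2)) <= 1 * (K3 * (3 * C2) + K3 * (3 * C2)))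
      by (apply Rmult_le_compat_r; lra).
    unfold C. assert (0 <= E0 * (1 + 2 * K3)) by (apply Rmult_le_pos; lra). lra. }
  assert (Hgb : forall w A B x y, Rabs y <= bG -> Rabs (w x y) <= E0 * X -> W aG bG K3 A -> W aG bG K3 B ->
    Rabs (w x y + y * (A x y * w1 x y + B x y * w3 x y)) <= C * X).
  { intros w A B x y Hy Hw HA HB.
    pose proof (W_bound _ _ _ _ _ x y HA Hy) as BA. pose proof (W_bound _ _ _ _ _ x y HB Hy) as BB.
    pose proof (Bw1 x y ltac:(lra)) as b1'. pose proof (Bw3 x y Hy) as b3'.
    assert (HE0X : 0 <= E0 * X) by (apply Rmult_le_pos; lra).
    assert (b1'' : Rabs (w1 x y) <= E0 * X).
    { assert (4 * C2 * X <= E0 * X) by (apply Rmult_le_compat_r; lra). lra. }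
    assert (P1 : Rabs (A x y * w1 x y) <= K3 * (E0 * X)).
    { rewrite Rabs_mult. apply Rmult_le_compat; auto; apply Rabs_pos. }
    assert (P2 : Rabs (B x y * w3 x y) <= K3 * (E0 * X)).
    { rewrite Rabs_mult. apply Rmult_le_compat; auto; apply Rabs_pos. }
    assert (P3 : Rabs (y * (A x y * w1 x y + B x y * w3 x y)) <= 1 * (2 * (K3 * (E0 * X)))).
    { rewrite Rabs_mult. apply Rmult_le_compat; try apply Rabs_pos; [lra|].
      eapply Rle_trans; [apply Rabs_triang|lra]. }
    eapply Rle_trans; [apply Rabs_triang|].
    apply Rle_trans with ((E0 * (1 + 2 * K3)) * X); [lra|].
    apply Rmult_le_compat_r; [lra|]. unfold C.
    assert (0 <= C2 * (1 + 2 * K3)) by (apply Rmult_le_pos; lra). lra. }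
  exists u, v, p, p', (fun x y => w1 x y + y * (A1 x y * w1 x y + B1 x y * w3 x y)),
    (fun x y => w3 x y + y * (A2 x y * w1 x y + B2 x y * w3 x y)).
  fold bP bG.
  split; [apply (W_mono _ a bP C2); [unfold aG; lra|lra|lra|exact Hu]|].
  split; [apply (W_mono _ a bP C2); [unfold aG; lra|lra|lra|exact Hv]|].
  assert (HW4 : forall f, W (a / 2) ((1 + 4 * e) * b) (2 * C2) f -> W (a / 4) ((1 + 4 * e) * b) C f).
  { intros f Hf. pose proof (W_pos _ _ _ _ _ Hf). revert Hf. apply W_mono; lra. }
  split; [apply HW4, Wp|]. split; [apply HW4, Wp'|].
  split; [apply Hg; auto|]. split; [apply Hg; auto|].
  split; [exact I1|]. split; [exact I2|].
  intros x y Hy. cbv zeta.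
  destruct (HE x y ltac:(lra)) as [E1 E2]. unfold conj1, conj2 in E1, E2.
  specialize (D1 x y Hy). specialize (D2 x y Hy).
  destruct (I2 (x + y) y) as [J1 J2]; [unfold bG in Hy; clear -Hy He Hb; nra|].
  set (XX := F1 h1 (x + y * u x y) (y + y ^ 2 * v x y)) in *.
  set (YY := F2 h2 (x + y * u x y) (y + y ^ 2 * v x y)) in *.
  assert (EX : x + y * (1 + u (x + y) y) + y ^ S (S q) * w1 x y = XX) by (rewrite E1; unfold w1; ring).
  assert (EY : y + y ^ 2 * v (x + y) y + y ^ S (S (S q)) * w3 x y = YY) by (rewrite E2; unfold w3, w2; ring).
  assert (EX0 : x + y * (1 + u (x + y) y) = x + y + y * u (x + y) y) by ring.
  rewrite EX, EY, EX0 in D1, D2. rewrite pow_1 in D1.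
  set (X0 := x + y + y * u (x + y) y) in *. set (Y0 := y + y ^ 2 * v (x + y) y) in *.
  assert (EYc : YY = y * (1 + y * v (x + y) y + y ^ S (S q) * w3 x y)) by (rewrite <- EY; unfold Y0; simpl; ring).
  assert (EY0 : Y0 = y * (1 + y * v (x + y) y)) by (unfold Y0; ring).
  set (c1 := 1 + y * v (x + y) y + y ^ S (S q) * w3 x y) in *.
  set (c0 := 1 + y * v (x + y) y) in *.
  rewrite pow_1 in D1.
  split; [|split; [|split]].
  - transitivity (XX - X0 + y * (c1 * p XX YY - c0 * p X0 Y0) + (X0 + Y0 * p X0 Y0)).
    + generalize (p XX YY) (p X0 Y0). intros z1 z0. rewrite EYc, EY0. ring.
    + rewrite J1, D1. rewrite <- EX, EX0. fold X0. simpl. ring.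
  - transitivity (YY - Y0 + y ^ 2 * (c1 ^ 2 * p' XX YY - c0 ^ 2 * p' X0 Y0) + (Y0 + Y0 ^ 2 * p' X0 Y0)).
    + generalize (p' XX YY) (p' X0 Y0). intros z1 z0. rewrite EYc, EY0. ring.
    + rewrite J2, D2. rewrite <- EY. simpl. ring.
  - apply Hgb; auto. pose proof (Bw1 x y ltac:(lra)).
    assert (4 * C2 * X <= E0 * X) by (apply Rmult_le_compat_r; lra). lra.
  - apply Hgb; auto.
Qed.

End Model.

(** * Complex power series and Fourier coefficients *)

(** Convergence of real and imaginary parts, so that the lemmas on real series apply to each. The
    price is a factor 2 in [csum_bound]. *)
Definition csum (a : nat -> C) (l : C) : Prop :=
  is_series (fun n => Re (a n)) (Re l) /\ is_series (fun n => Im (a n)) (Im l).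

Lemma Rabs_Re_le z : Rabs (Re z) <= Cmod z.
Proof. apply re_le_Cmod. Qed.

Lemma Rabs_Im_le z : Rabs (Im z) <= Cmod z.
Proof. destruct z as [x y]. eapply Rle_trans; [apply Rmax_r|apply Rmax_Cmod]. Qed.

Lemma Cmod_le_Re_Im z : Cmod z <= Rabs (Re z) + Rabs (Im z).
Proof.
  pose proof (Rabs_pos (Re z)). pose proof (Rabs_pos (Im z)).
  apply Rsqr_incr_0_var; [|lra]. unfold Rsqr.
  replace (Cmod z * Cmod z) with (Cmod z ^ 2) by ring. rewrite Cmod2_alt.
  rewrite <- (pow2_abs (Re z)), <- (pow2_abs (Im z)). nra.
Qed.

Lemma csum_bound a l b M : csum a l -> (forall n, Cmod (a n) <= b n) -> (forall n, psum b n <= M) ->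
  Cmod l <= 2 * M.
Proof.
  intros [H1 H2] Hb HM. eapply Rle_trans; [apply Cmod_le_Re_Im|].
  assert (Rabs (Re l) <= M).
  { apply (is_series_Rabs_le _ _ _ H1). apply (bsum_le_pos _ b M); [|lra|exact HM].
    intros n. eapply Rle_trans; [apply Rabs_Re_le|apply Hb]. }
  assert (Rabs (Im l) <= M).
  { apply (is_series_Rabs_le _ _ _ H2). apply (bsum_le_pos _ b M); [|lra|exact HM].
    intros n. eapply Rle_trans; [apply Rabs_Im_le|apply Hb]. }
  lra.
Qed.

Lemma csum_ex a b M : (forall n, Cmod (a n) <= b n) -> (forall n, psum b n <= M) -> exists l, csum a l.
Proof.
  intros Hb HM. exists (Series (fun n => Re (a n)), Series (fun n => Im (a n))). split; simpl.
  - apply (bsum_is_series _ M). apply (bsum_le_pos _ b M); [|lra|exact HM].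
    intros n. eapply Rle_trans; [apply Rabs_Re_le|apply Hb].
  - apply (bsum_is_series _ M). apply (bsum_le_pos _ b M); [|lra|exact HM].
    intros n. eapply Rle_trans; [apply Rabs_Im_le|apply Hb].
Qed.

Lemma csum_unique a l l' : csum a l -> csum a l' -> l = l'.
Proof.
  intros [H1 H2] [H3 H4]. destruct l as [x y], l' as [x' y']. simpl in *.
  f_equal; eapply is_series_unique_R; eauto.
Qed.

Lemma csum_ext a b l : (forall n, a n = b n) -> csum a l -> csum b l.
Proof. intros E [H1 H2]. split; [revert H1|revert H2]; apply is_series_ext; intros n; rewrite E; reflexivity. Qed.

Lemma csum_minus a b l l' : csum a l -> csum b l' -> csum (fun n => Cminus (a n) (b n)) (Cminus l l').
Proof.
  intros [H1 H2] [H3 H4]. split.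
  - exact (is_series_minus _ _ _ _ H1 H3).
  - exact (is_series_minus _ _ _ _ H2 H4).
Qed.

Lemma csum_scal z a l : csum a l -> csum (fun n => Cmult z (a n)) (Cmult z l).
Proof.
  intros [H1 H2]. split.
  - generalize (is_series_minus _ _ _ _ (is_series_cmult (Re z) _ _ H1) (is_series_cmult (Im z) _ _ H2)).
    apply is_series_ext. reflexivity.
  - generalize (is_series_plus _ _ _ _ (is_series_cmult (Re z) _ _ H2) (is_series_cmult (Im z) _ _ H1)).
    apply is_series_ext. reflexivity.
Qed.

Lemma pow_n_Cpow (z : C) n : pow_n (K := C_AbsRing) z n = Cpow z n.
Proof.
  induction n as [|n IH]; [reflexivity|].
  change (Cmult z (pow_n (K := C_AbsRing) z n) = Cmult z (Cpow z n)). rewrite IH. reflexivity.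
Qed.

Lemma sum_n_Re (a : nat -> C) n : Re (sum_n (G := C_AbsRing) a n) = sum_n (fun k => Re (a k)) n /\
  Im (sum_n (G := C_AbsRing) a n) = sum_n (fun k => Im (a k)) n.
Proof.
  induction n as [|n [IH1 IH2]].
  - rewrite !sum_O. auto.
  - rewrite !sum_Sn, <- IH1, <- IH2. split; reflexivity.
Qed.

Lemma is_pseries_csum (a : nat -> C) (z l : C) :
  is_pseries (K := C_AbsRing) (V := AbsRing_NormedModule C_AbsRing) a z l ->
  csum (fun k => Cmult (a k) (Cpow z k)) l.
Proof.
  intros H. unfold is_pseries, is_series in H.
  assert (HH : forall eps : posreal, exists N, forall n, (N <= n)%nat ->
    Cmod (Cminus (sum_n (G := C_AbsRing) (fun k => Cmult (Cpow z k) (a k)) n) l) < eps).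
  { intros eps. destruct (H (fun w => Cmod (Cminus w l) < eps)) as [N HN].
    - exists eps. intros y Hy. exact Hy.
    - exists N. intros n Hn. specialize (HN n Hn).
      rewrite (sum_n_ext _ (fun k => scal (pow_n (K := C_AbsRing) z k) (a k))); [exact HN|].
      intros k. rewrite <- pow_n_Cpow. reflexivity. }
  split.
  - intros Q [eps HQ]. destruct (HH eps) as [N HN]. exists N. intros n Hn. apply HQ.
    change (Rabs (sum_n (fun k => Re (Cmult (a k) (Cpow z k))) n - Re l) < eps).
    specialize (HN n Hn). eapply Rle_lt_trans; [|exact HN].
    eapply Rle_trans; [|apply Rabs_Re_le]. right. f_equal.
    rewrite (sum_n_ext (fun k => Re (Cmult (a k) (Cpow z k))) (fun k => Re (Cmult (Cpow z k) (a k))))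
      by (intros k; rewrite Cmult_comm; reflexivity).
    rewrite <- (proj1 (sum_n_Re (fun k => Cmult (Cpow z k) (a k)) n)). reflexivity.
  - intros Q [eps HQ]. destruct (HH eps) as [N HN]. exists N. intros n Hn. apply HQ.
    change (Rabs (sum_n (fun k => Im (Cmult (a k) (Cpow z k))) n - Im l) < eps).
    specialize (HN n Hn). eapply Rle_lt_trans; [|exact HN].
    eapply Rle_trans; [|apply Rabs_Im_le]. right. f_equal.
    rewrite (sum_n_ext (fun k => Im (Cmult (a k) (Cpow z k))) (fun k => Im (Cmult (Cpow z k) (a k))))
      by (intros k; rewrite Cmult_comm; reflexivity).
    rewrite <- (proj2 (sum_n_Re (fun k => Cmult (Cpow z k) (a k)) n)). reflexivity.
Qed.

(** * Holomorphy and the Cauchy-Riemann equations *)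

Definition analytic_at (c : C -> C) (z0 : C) (rho B : R) : Prop :=
  exists ga : nat -> C, (forall j, Cmod (ga j) * rho ^ j <= B) /\
    forall u, Cmod u < rho -> csum (fun j => Cmult (ga j) (Cpow u j)) (c (Cplus z0 u)).

Lemma psum_geom M q n : 0 <= M -> 0 <= q < 1 -> psum (fun n => M * q ^ n) n <= M / (1 - q).
Proof.
  intros HM Hq. rewrite psum_scal. unfold Rdiv. apply Rmult_le_compat_l; [exact HM|].
  assert (E : psum (pow q) n = (1 - q ^ n) / (1 - q)).
  { induction n as [|n IH]; simpl; [field; lra|]. rewrite IH. field. lra. }
  rewrite E. unfold Rdiv. rewrite <- (Rmult_1_l (/ (1 - q))) at 2.
  apply Rmult_le_compat_r; [left; apply Rinv_0_lt_compat; lra|].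
  pose proof (pow_le q n (proj1 Hq)). lra.
Qed.

Lemma analytic_at_bound c z0 rho B u : 0 < rho -> analytic_at c z0 rho B -> Cmod u <= rho / 2 ->
  Cmod (c (Cplus z0 u)) <= 4 * B.
Proof.
  intros Hr [ga [H1 H2]] Hu.
  assert (HB : 0 <= B).
  { specialize (H1 0%nat). simpl in H1. pose proof (Cmod_ge_0 (ga 0%nat)). lra. }
  replace (4 * B) with (2 * (B / (1 - 1 / 2))) by field.
  apply (csum_bound _ _ (fun j => B * (1 / 2) ^ j) _ (H2 u ltac:(lra))).
  - intros j. rewrite Cmod_mult, Cmod_pow.
    apply Rle_trans with (Cmod (ga j) * (rho * (1 / 2)) ^ j).
    + apply Rmult_le_compat_l; [apply Cmod_ge_0|]. apply pow_incr. split; [apply Cmod_ge_0|lra].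
    + rewrite Rpow_mult_distr, <- Rmult_assoc. apply Rmult_le_compat_r; [apply pow_le; lra|apply H1].
  - intros n. apply psum_geom; lra.
Qed.

Lemma INR_pow_pred_le s t j : 0 <= s -> 0 < t -> INR j * s ^ (j - 1) <= (s + t) ^ j / t.
Proof.
  intros Hs Ht. pose proof (pow_tangent_le s t j Hs (Rlt_le _ _ Ht)) as H.
  rewrite (psum_ext _ (fun _ => s ^ (j - 1))) in H.
  - rewrite psum_const in H. apply Rmult_le_reg_r with t; [exact Ht|].
    replace ((s + t) ^ j / t * t) with ((s + t) ^ j) by (field; lra). lra.
  - intros i Hi. rewrite <- pow_add. f_equal. lia.
Qed.

(** The Taylor remainder of order two of the power [u^j]; its recursion in [j] bounds it by [|h|^2]
    times a geometric term, so that it can be summed against the coefficients. *)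
Definition Cpow_rem (u h : C) (j : nat) : C :=
  Cminus (Cminus (Cpow (Cplus u h) j) (Cpow u j)) (Cmult h (Cmult (RtoC (INR j)) (Cpow u (j - 1)))).

Lemma Cpow_rem_S u h j : Cpow_rem u h (S j) =
  Cplus (Cmult (Cplus u h) (Cpow_rem u h j)) (Cmult (Cmult h h) (Cmult (RtoC (INR j)) (Cpow u (j - 1)))).
Proof.
  unfold Cpow_rem. rewrite S_INR, RtoC_plus. replace (S j - 1)%nat with j by lia.
  destruct j as [|j].
  - simpl. ring.
  - replace (S j - 1)%nat with j by lia. rewrite !Cpow_S. ring.
Qed.

Lemma Cpow_rem_bound rho u h j : 0 < rho -> Cmod u <= rho / 4 -> Cmod h <= rho / 4 ->
  Cmod (Cpow_rem u h j) <= Cmod h ^ 2 * (16 / rho ^ 2 * (3 * rho / 4) ^ j).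
Proof.
  intros Hr Hu Hh. induction j as [|j IH].
  - assert (E : Cpow_rem u h 0 = RtoC 0) by (unfold Cpow_rem; simpl; ring).
    rewrite E, Cmod_0. apply Rmult_le_pos; [apply pow2_ge_0|]. simpl. rewrite Rmult_1_r.
    apply Rmult_le_pos; [lra|]. left. apply Rinv_0_lt_compat. nra.
  - rewrite Cpow_rem_S. eapply Rle_trans; [apply Cmod_triangle|].
    rewrite !Cmod_mult, Cmod_pow, Cmod_R, (Rabs_pos_eq (INR j)) by apply pos_INR.
    assert (Huh : Cmod (Cplus u h) <= rho / 2) by (eapply Rle_trans; [apply Cmod_triangle|lra]).
    pose proof (Cmod_ge_0 h). pose proof (Cmod_ge_0 u).
    set (A := 16 / rho ^ 2 * (3 * rho / 4) ^ j) in *.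
    assert (HA : 0 <= A).
    { unfold A. apply Rmult_le_pos; [|apply pow_le; lra].
      apply Rmult_le_pos; [lra|]. left. apply Rinv_0_lt_compat, pow_lt, Hr. }
    assert (Hd : INR j * Cmod u ^ (j - 1) <= rho / 4 * A).
    { apply Rle_trans with (INR j * (rho / 2) ^ (j - 1)).
      - apply Rmult_le_compat_l; [apply pos_INR|]. apply pow_incr. lra.
      - eapply Rle_trans; [apply (INR_pow_pred_le (rho / 2) (rho / 4)); lra|].
        replace (rho / 2 + rho / 4) with (3 * rho / 4) by field.
        unfold A. right. field. lra. }
    assert (H1 : Cmod (Cplus u h) * Cmod (Cpow_rem u h j) <= rho / 2 * (Cmod h ^ 2 * A)).
    { apply Rmult_le_compat; auto; apply Cmod_ge_0. }
    assert (H2 : Cmod h * Cmod h * (INR j * Cmod u ^ (j - 1)) <= Cmod h ^ 2 * (rho / 4 * A)).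
    { simpl. rewrite Rmult_1_r. apply Rmult_le_compat_l; [nra|exact Hd]. }
    replace (Cmod h ^ 2 * (16 / rho ^ 2 * (3 * rho / 4) ^ S j)) with
      (rho / 2 * (Cmod h ^ 2 * A) + Cmod h ^ 2 * (rho / 4 * A)); [lra|].
    unfold A. simpl. field. lra.
Qed.

(** Termwise differentiation with a quadratic remainder. The estimate is uniform over base points
    [u] near the centre, and from this the continuity of the derivative follows as well. *)
Lemma analytic_at_deriv c z0 rho B : 0 < rho -> analytic_at c z0 rho B ->
  exists D K, 0 <= K /\ forall u h, Cmod u <= rho / 4 -> Cmod h <= rho / 4 ->
    Cmod (Cminus (Cminus (c (Cplus z0 (Cplus u h))) (c (Cplus z0 u))) (Cmult h (D u))) <= K * Cmod h ^ 2.
Proof.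
  intros Hr [ga [H1 H2]].
  assert (HB : 0 <= B).
  { specialize (H1 0%nat). simpl in H1. pose proof (Cmod_ge_0 (ga 0%nat)). lra. }
  assert (Hga : forall j, Cmod (ga j) <= B / rho ^ j).
  { intros j. pose proof (pow_lt rho j Hr). apply Rmult_le_reg_r with (rho ^ j); [exact H|].
    unfold Rdiv. rewrite Rmult_assoc, Rinv_l by lra. rewrite Rmult_1_r. apply H1. }
  assert (HD : forall u, exists l, Cmod u <= rho / 4 ->
    csum (fun j => Cmult (ga j) (Cmult (RtoC (INR j)) (Cpow u (j - 1)))) l).
  { intros u. destruct (Rle_dec (Cmod u) (rho / 4)) as [Hu|Hu]; [|exists (RtoC 0); intros; lra].
    destruct (csum_ex (fun j => Cmult (ga j) (Cmult (RtoC (INR j)) (Cpow u (j - 1))))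
      (fun j => B * 4 / rho * (3 / 4) ^ j) (B * 4 / rho / (1 - 3 / 4))) as [l Hl].
    - intros j. rewrite !Cmod_mult, Cmod_pow, Cmod_R, (Rabs_pos_eq (INR j)) by apply pos_INR.
      pose proof (pow_lt rho j Hr).
      apply Rle_trans with (B / rho ^ j * ((3 * rho / 4) ^ j / (rho / 4))).
      + apply Rmult_le_compat; auto; [apply Cmod_ge_0|apply Rmult_le_pos; [apply pos_INR|apply pow_le, Cmod_ge_0]|].
        apply Rle_trans with (INR j * (rho / 2) ^ (j - 1)).
        * apply Rmult_le_compat_l; [apply pos_INR|]. apply pow_incr. pose proof (Cmod_ge_0 u). lra.
        * eapply Rle_trans; [apply (INR_pow_pred_le (rho / 2) (rho / 4)); lra|].
          replace (rho / 2 + rho / 4) with (3 * rho / 4) by field. lra.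
      + replace (3 * rho / 4) with (3 / 4 * rho) by field. rewrite Rpow_mult_distr. right. field. lra.
    - intros n. apply psum_geom; [|lra]. apply Rmult_le_pos; [lra|left; apply Rinv_0_lt_compat, Hr].
    - exists l. intros _. exact Hl. }
  apply fun_choice in HD. destruct HD as [D HD].
  set (K := 2 * (B * (16 / rho ^ 2) / (1 - 3 / 4))).
  assert (Hr2 : 0 < 16 / rho ^ 2) by (apply Rdiv_lt_0_compat; [lra|apply pow_lt, Hr]).
  exists D, K. split.
  { unfold K. apply Rmult_le_pos; [lra|]. apply Rmult_le_pos; [apply Rmult_le_pos; lra|lra]. }
  intros u h Hu Hh.
  assert (Huh : Cmod (Cplus u h) <= rho / 2) by (eapply Rle_trans; [apply Cmod_triangle|lra]).
  pose proof (csum_minus _ _ _ _ (csum_minus _ _ _ _ (H2 (Cplus u h) ltac:(lra)) (H2 u ltac:(lra)))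
    (csum_scal h _ _ (HD u Hu))) as L.
  replace (K * Cmod h ^ 2) with (2 * (Cmod h ^ 2 * (B * (16 / rho ^ 2)) / (1 - 3 / 4)))
    by (unfold K; field; lra).
  apply (csum_bound _ _ (fun j => Cmod h ^ 2 * (B * (16 / rho ^ 2)) * (3 / 4) ^ j) _ L).
  - intros j.
    replace (Cminus _ _) with (Cmult (ga j) (Cpow_rem u h j)) by (unfold Cpow_rem; ring).
    rewrite Cmod_mult. pose proof (pow_lt rho j Hr).
    apply Rle_trans with (B / rho ^ j * (Cmod h ^ 2 * (16 / rho ^ 2 * (3 * rho / 4) ^ j))).
    + apply Rmult_le_compat; auto; try apply Cmod_ge_0. apply Cpow_rem_bound; auto.
    + replace (3 * rho / 4) with (3 / 4 * rho) by field. rewrite Rpow_mult_distr. right. field. lra.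
  - intros n. apply psum_geom; [|lra]. apply Rmult_le_pos; [apply pow2_ge_0|apply Rmult_le_pos; lra].
Qed.

(* The Cauchy-Riemann equations for [P + i Q] in the variable [x + i t]. *)
Definition CR_at (P Q : R -> R -> R) (x0 t0 : R) : Prop :=
  continuity_2d_pt P x0 t0 /\ continuity_2d_pt Q x0 t0 /\
  exists p q : R -> R -> R, continuity_2d_pt p x0 t0 /\ continuity_2d_pt q x0 t0 /\
    locally_2d (fun x t => is_derive (fun x => P x t) x (p x t) /\ is_derive (fun t => P x t) t (- q x t) /\
      is_derive (fun x => Q x t) x (q x t) /\ is_derive (fun t => Q x t) t (p x t)) x0 t0.

Lemma is_derive_quadratic f x l K d : 0 < d ->
  (forall s, Rabs s <= d -> Rabs (f (x + s) - f x - s * l) <= K * s ^ 2) -> is_derive f x l.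
Proof.
  intros Hd H. apply is_derive_Reals. intros eps Heps.
  pose proof (Rabs_pos K) as HK0.
  assert (Hd' : 0 < Rmin d (eps / (Rabs K + 1))).
  { apply Rmin_pos; [exact Hd|]. apply Rdiv_lt_0_compat; lra. }
  exists (mkposreal _ Hd'). intros s Hs Hsd. simpl in Hsd.
  pose proof (Rmin_l d (eps / (Rabs K + 1))). pose proof (Rmin_r d (eps / (Rabs K + 1))).
  specialize (H s ltac:(lra)).
  replace ((f (x + s) - f x) / s - l) with ((f (x + s) - f x - s * l) / s) by (field; exact Hs).
  unfold Rdiv. rewrite Rabs_mult, Rabs_inv. apply Rabs_pos_lt in Hs.
  apply Rle_lt_trans with (Rabs K * Rabs s).
  - apply Rmult_le_reg_r with (Rabs s); [exact Hs|].
    rewrite Rmult_assoc, Rinv_l by lra. rewrite Rmult_1_r, Rmult_assoc.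
    eapply Rle_trans; [exact H|]. rewrite <- (pow2_abs s).
    replace (Rabs s ^ 2) with (Rabs s * Rabs s) by ring.
    apply Rmult_le_compat_r; [nra|apply Rle_abs].
  - apply Rle_lt_trans with (Rabs K * (eps / (Rabs K + 1))).
    + apply Rmult_le_compat_l; lra.
    + apply Rmult_lt_reg_r with (Rabs K + 1); [lra|]. unfold Rdiv.
      replace (Rabs K * (eps * / (Rabs K + 1)) * (Rabs K + 1)) with (Rabs K * eps) by (field; lra). nra.
Qed.

Lemma lipschitz_continuity_2d (f : R -> R -> R) x0 t0 K d : 0 < d ->
  (forall x t, Rabs (x - x0) <= d -> Rabs (t - t0) <= d ->
    Rabs (f x t - f x0 t0) <= K * (Rabs (x - x0) + Rabs (t - t0))) -> continuity_2d_pt f x0 t0.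
Proof.
  intros Hd H eps. pose proof (cond_pos eps). pose proof (Rabs_pos K).
  set (r := Rmin d (eps / (2 * (Rabs K + 1)))).
  assert (Hq : 0 < eps / (2 * (Rabs K + 1))) by (apply Rdiv_lt_0_compat; lra).
  assert (Hr : 0 < r) by (apply Rmin_pos; assumption).
  assert (r <= d) by apply Rmin_l. assert (r <= eps / (2 * (Rabs K + 1))) by apply Rmin_r.
  exists (mkposreal r Hr). simpl. intros x t Hx Ht.
  specialize (H x t ltac:(lra) ltac:(lra)).
  pose proof (Rabs_pos (x - x0)). pose proof (Rabs_pos (t - t0)).
  assert (K * (Rabs (x - x0) + Rabs (t - t0)) <= Rabs K * (Rabs (x - x0) + Rabs (t - t0)))
    by (apply Rmult_le_compat_r; [lra|apply Rle_abs]).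
  assert (r * (2 * (Rabs K + 1)) <= eps).
  { apply Rle_trans with (eps / (2 * (Rabs K + 1)) * (2 * (Rabs K + 1))).
    - apply Rmult_le_compat_r; lra.
    - right. field. lra. }
  assert (Rabs K * (Rabs (x - x0) + Rabs (t - t0)) <= Rabs K * (2 * r)) by (apply Rmult_le_compat_l; lra).
  nra.
Qed.

Lemma analytic_at_CR c x0 t0 rho B : 0 < rho -> analytic_at c (x0, t0) rho B ->
  CR_at (fun x t => Re (c (x, t))) (fun x t => Im (c (x, t))) x0 t0.
Proof.
  intros Hr Hc. destruct (analytic_at_deriv _ _ _ _ Hr Hc) as [D [K [HK HD]]].
  set (d := rho / 8).
  assert (Hmod : forall x t, Rabs (x - x0) <= d -> Rabs (t - t0) <= d -> Cmod (x - x0, t - t0) <= rho / 4).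
  { intros x t Hx Ht. eapply Rle_trans; [apply Cmod_le_Re_Im|]. simpl. unfold d in *. lra. }
  assert (E : forall x t, c (Cplus (x0, t0) (x - x0, t - t0)) = c (x, t)).
  { intros x t. f_equal. unfold Cplus; simpl. f_equal; ring. }
  assert (Hstep : forall x t h, Rabs (x - x0) <= d -> Rabs (t - t0) <= d -> Cmod h <= rho / 4 ->
    Cmod (Cminus (Cminus (c (x + Re h, t + Im h)) (c (x, t))) (Cmult h (D (x - x0, t - t0)))) <= K * Cmod h ^ 2).
  { intros x t h Hx Ht Hh. specialize (HD _ h (Hmod x t Hx Ht) Hh).
    rewrite E in HD. replace (c (x + Re h, t + Im h)) with (c (Cplus (x0, t0) (Cplus (x - x0, t - t0) h))); [exact HD|].
    f_equal. destruct h as [h1 h2]. unfold Cplus; simpl. f_equal; ring. }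
  (* Adding the estimates for the step from 0 to [u] and for the step back leaves [u (D u - D 0)],
     bounded by [2 K |u|^2]. *)
  assert (HDlip : forall u, Cmod u <= rho / 4 -> Cmod (Cminus (D u) (D (RtoC 0))) <= 2 * K * Cmod u).
  { intros u Hu. destruct (Ceq_dec u 0) as [->|Hu0].
    - replace (Cminus (D 0) (D 0)) with (RtoC 0) by ring. rewrite Cmod_0. lra.
    - pose proof (HD (RtoC 0) u ltac:(rewrite Cmod_0; lra) Hu) as A1.
      pose proof (HD u (Copp u) Hu ltac:(rewrite Cmod_opp; exact Hu)) as A2.
      rewrite Cmod_opp in A2.
      replace (Cplus u (Copp u)) with (RtoC 0) in A2 by ring. rewrite Cplus_0_l in A1.
      set (c0 := c (Cplus (x0, t0) (RtoC 0))) in *. set (c1 := c (Cplus (x0, t0) u)) in *.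
      assert (A3 : Cmod (Cmult u (Cminus (D u) (D (RtoC 0)))) <= 2 * K * Cmod u ^ 2).
      { replace (Cmult u (Cminus (D u) (D (RtoC 0)))) with
          (Cplus (Cminus (Cminus c1 c0) (Cmult u (D (RtoC 0)))) (Cminus (Cminus c0 c1) (Cmult (Copp u) (D u)))) by ring.
        eapply Rle_trans; [apply Cmod_triangle|]. lra. }
      rewrite Cmod_mult in A3. apply Cmod_gt_0 in Hu0.
      apply Rmult_le_reg_l with (Cmod u); [exact Hu0|]. simpl in A3. lra. }
  set (p := fun x t => Re (D (x - x0, t - t0))). set (q := fun x t => Im (D (x - x0, t - t0))).
  assert (Hd : 0 < d) by (unfold d; lra).
  assert (Hp : continuity_2d_pt p x0 t0 /\ continuity_2d_pt q x0 t0).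
  { assert (HH : forall x t, Rabs (x - x0) <= d -> Rabs (t - t0) <= d ->
      Cmod (Cminus (D (x - x0, t - t0)) (D (x0 - x0, t0 - t0))) <= 2 * K * (Rabs (x - x0) + Rabs (t - t0))).
    { intros x t Hx Ht. replace (x0 - x0, t0 - t0) with (RtoC 0)
        by (unfold RtoC; f_equal; ring).
      eapply Rle_trans; [apply HDlip, Hmod; auto|]. apply Rmult_le_compat_l; [lra|].
      apply (Cmod_le_Re_Im (x - x0, t - t0)). }
    split; apply (lipschitz_continuity_2d _ x0 t0 (2 * K) d Hd); intros x t Hx Ht;
      (eapply Rle_trans; [|apply (HH x t Hx Ht)]).
    - apply (Rabs_Re_le (Cminus (D (x - x0, t - t0)) (D (x0 - x0, t0 - t0)))).
    - apply (Rabs_Im_le (Cminus (D (x - x0, t - t0)) (D (x0 - x0, t0 - t0)))). }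
  assert (Hloc : forall x t, Rabs (x - x0) <= d -> Rabs (t - t0) <= d ->
    is_derive (fun x => Re (c (x, t))) x (p x t) /\ is_derive (fun t => Re (c (x, t))) t (- q x t) /\
    is_derive (fun x => Im (c (x, t))) x (q x t) /\ is_derive (fun t => Im (c (x, t))) t (p x t)).
  { intros x t Hx Ht.
    assert (S1 : forall s, Rabs s <= d ->
      Cmod (Cminus (Cminus (c (x + s, t)) (c (x, t))) (Cmult (s, 0) (D (x - x0, t - t0)))) <= K * s ^ 2).
    { intros s Hs. assert (Hm : Cmod (s, 0) = Rabs s) by (apply (Cmod_R s)).
      pose proof (Hstep x t (s, 0) Hx Ht ltac:(rewrite Hm; unfold d in *; lra)) as Q.
      rewrite Hm, pow2_abs in Q. simpl in Q. rewrite Rplus_0_r in Q. simpl. exact Q. }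
    assert (S2 : forall s, Rabs s <= d ->
      Cmod (Cminus (Cminus (c (x, t + s)) (c (x, t))) (Cmult (0, s) (D (x - x0, t - t0)))) <= K * s ^ 2).
    { intros s Hs. assert (Hm : Cmod (0, s) = Rabs s).
      { unfold Cmod. simpl. replace (0 * (0 * 1) + s * (s * 1)) with (Rsqr s) by (unfold Rsqr; ring).
        apply sqrt_Rsqr_abs. }
      pose proof (Hstep x t (0, s) Hx Ht ltac:(rewrite Hm; unfold d in *; lra)) as Q.
      rewrite Hm, pow2_abs in Q. simpl in Q. rewrite Rplus_0_r in Q. simpl. exact Q. }
    repeat match goal with |- _ /\ _ => split end; apply (is_derive_quadratic _ _ _ K d Hd); intros s Hs.
    - eapply Rle_trans; [|apply (S1 s Hs)]. eapply Rle_trans; [|apply Rabs_Re_le].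
      right. f_equal. unfold p, Re, Im. simpl. ring.
    - eapply Rle_trans; [|apply (S2 s Hs)]. eapply Rle_trans; [|apply Rabs_Re_le].
      right. f_equal. unfold q, Re, Im. simpl. ring.
    - eapply Rle_trans; [|apply (S1 s Hs)]. eapply Rle_trans; [|apply Rabs_Im_le].
      right. f_equal. unfold q, Re, Im. simpl. ring.
    - eapply Rle_trans; [|apply (S2 s Hs)]. eapply Rle_trans; [|apply Rabs_Im_le].
      right. f_equal. unfold p, Re, Im. simpl. ring. }
  assert (Hloc2 : locally_2d (fun x t => is_derive (fun x => Re (c (x, t))) x (p x t) /\
    is_derive (fun t => Re (c (x, t))) t (- q x t) /\
    is_derive (fun x => Im (c (x, t))) x (q x t) /\ is_derive (fun t => Im (c (x, t))) t (p x t)) x0 t0).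
  { exists (mkposreal d Hd). simpl. intros x t Hx Ht. apply Hloc; lra. }
  assert (Hc0 : forall x t, Rabs (x - x0) <= d -> Rabs (t - t0) <= d ->
    Cmod (Cminus (c (x, t)) (c (x0, t0))) <= (K * (2 * d) + Cmod (D (RtoC 0))) * (Rabs (x - x0) + Rabs (t - t0))).
  { intros x t Hx Ht. pose proof (Hmod x t Hx Ht) as Hm.
    pose proof (HD (RtoC 0) (x - x0, t - t0) ltac:(rewrite Cmod_0; lra) Hm) as Q.
    rewrite Cplus_0_l, E in Q. replace (Cplus (x0, t0) (RtoC 0)) with (x0, t0) in Q
      by (unfold Cplus; simpl; f_equal; ring).
    set (h := (x - x0, t - t0)) in *.
    assert (Hh : Cmod h <= Rabs (x - x0) + Rabs (t - t0)) by (apply (Cmod_le_Re_Im h)).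
    pose proof (Cmod_ge_0 h) as Hh0. pose proof (Cmod_ge_0 (D (RtoC 0))) as HD0.
    replace (Cminus (c (x, t)) (c (x0, t0))) with
      (Cplus (Cminus (Cminus (c (x, t)) (c (x0, t0))) (Cmult h (D (RtoC 0)))) (Cmult h (D (RtoC 0)))) by ring.
    eapply Rle_trans; [apply Cmod_triangle|]. rewrite Cmod_mult.
    assert (K * Cmod h ^ 2 <= K * (2 * d) * (Rabs (x - x0) + Rabs (t - t0))).
    { rewrite Rmult_assoc. apply Rmult_le_compat_l; [exact HK|]. simpl. rewrite Rmult_1_r.
      apply Rmult_le_compat; lra. }
    assert (Cmod h * Cmod (D (RtoC 0)) <= Cmod (D (RtoC 0)) * (Rabs (x - x0) + Rabs (t - t0))).
    { rewrite Rmult_comm. apply Rmult_le_compat_l; lra. }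
    lra. }
  split; [|split; [|exists p, q; split; [apply Hp|split; [apply Hp|exact Hloc2]]]].
  - apply (lipschitz_continuity_2d _ x0 t0 (K * (2 * d) + Cmod (D (RtoC 0))) d Hd). intros x t Hx Ht.
    eapply Rle_trans; [|apply (Hc0 x t Hx Ht)].
    apply (Rabs_Re_le (Cminus (c (x, t)) (c (x0, t0)))).
  - apply (lipschitz_continuity_2d _ x0 t0 (K * (2 * d) + Cmod (D (RtoC 0))) d Hd). intros x t Hx Ht.
    eapply Rle_trans; [|apply (Hc0 x t Hx Ht)].
    apply (Rabs_Im_le (Cminus (c (x, t)) (c (x0, t0)))).
Qed.

Lemma continuity_2d_swap (f : R -> R -> R) x y :
  continuity_2d_pt f x y -> continuity_2d_pt (fun u v => f v u) y x.
Proof. intros H eps. destruct (H eps) as [d Hd]. exists d. intros u v Hu Hv. apply Hd; assumption. Qed.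

Lemma continuity_2d_slice (f : R -> R -> R) x y : continuity_2d_pt f x y -> continuous (fun x => f x y) x.
Proof.
  intros H P [eps HP]. destruct (H eps) as [d Hd]. exists d. intros z Hz. apply HP.
  apply Hd; [exact Hz|]. unfold Rminus. rewrite Rplus_opp_r, Rabs_R0. apply cond_pos.
Qed.

Lemma CR_mult P Q P' Q' x t : CR_at P Q x t -> CR_at P' Q' x t ->
  CR_at (fun x t => P x t * P' x t - Q x t * Q' x t) (fun x t => P x t * Q' x t + Q x t * P' x t) x t.
Proof.
  intros [CP [CQ [p [q [Cp [Cq L]]]]]] [CP' [CQ' [p' [q' [Cp' [Cq' L']]]]]].
  split; [apply continuity_2d_pt_minus; apply continuity_2d_pt_mult; assumption|].
  split; [apply continuity_2d_pt_plus; apply continuity_2d_pt_mult; assumption|].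
  exists (fun x t => (p x t * P' x t + P x t * p' x t) - (q x t * Q' x t + Q x t * q' x t)),
    (fun x t => (p x t * Q' x t + P x t * q' x t) + (q x t * P' x t + Q x t * p' x t)).
  split; [apply continuity_2d_pt_minus; apply continuity_2d_pt_plus; apply continuity_2d_pt_mult; assumption|].
  split; [apply continuity_2d_pt_plus; apply continuity_2d_pt_plus; apply continuity_2d_pt_mult; assumption|].
  destruct L as [d L]. destruct L' as [d' L'].
  exists (mkposreal (Rmin d d') (Rmin_pos d d' (cond_pos d) (cond_pos d'))). simpl.
  intros x' t' Hx Ht. pose proof (Rmin_l d d'). pose proof (Rmin_r d d').
  destruct (L x' t' ltac:(lra) ltac:(lra)) as [A1 [A2 [A3 A4]]].
  destruct (L' x' t' ltac:(lra) ltac:(lra)) as [B1 [B2 [B3 B4]]].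
  assert (M : forall (f g : R -> R) z a b, is_derive f z a -> is_derive g z b ->
    is_derive (fun z => f z * g z) z (a * g z + f z * b)).
  { intros f g z a b Hf Hg. apply (is_derive_mult f g z a b Hf Hg). intros; apply Rmult_comm. }
  split; [|split; [|split]].
  - apply (is_derive_minus _ _ _ _ _ (M _ _ _ _ _ A1 B1) (M _ _ _ _ _ A3 B3)).
  - replace (- _) with (minus (- q x' t' * P' x' t' + P x' t' * (- q' x' t')) (p x' t' * Q' x' t' + Q x' t' * p' x' t'))
      by (unfold minus, plus, opp; simpl; ring).
    apply (is_derive_minus _ _ _ _ _ (M _ _ _ _ _ A2 B2) (M _ _ _ _ _ A4 B4)).
  - apply (is_derive_plus _ _ _ _ _ (M _ _ _ _ _ A1 B3) (M _ _ _ _ _ A3 B1)).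
  - replace (_ - _) with (plus (- q x' t' * Q' x' t' + P x' t' * p' x' t') (p x' t' * P' x' t' + Q x' t' * (- q' x' t')))
      by (unfold plus; simpl; ring).
    apply (is_derive_plus _ _ _ _ _ (M _ _ _ _ _ A2 B4) (M _ _ _ _ _ A4 B2)).
Qed.

Lemma continuity_2d_sep (f g : R -> R) x t : (forall x, continuous f x) -> (forall t, continuous g t) ->
  continuity_2d_pt (fun x t => f x * g t) x t.
Proof.
  intros Hf Hg. apply continuity_2d_pt_mult.
  - apply (continuity_1d_2d_pt_comp f (fun x _ => x)).
    + apply continuity_pt_filterlim, Hf.
    + apply continuity_2d_pt_id1.
  - apply (continuity_1d_2d_pt_comp g (fun _ t => t)).
    + apply continuity_pt_filterlim, Hg.
    + apply continuity_2d_pt_id2.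
Qed.

(* [exp (- i w (x + i t)) = exp (w t) (cos (w x) - i sin (w x))] *)
Lemma CR_exp w x t : CR_at (fun x t => cos (w * x) * exp (w * t)) (fun x t => - sin (w * x) * exp (w * t)) x t.
Proof.
  assert (D : forall (f : R -> R), (forall x, ex_derive f x) -> forall x, continuous f x)
    by (intros f Hf z; exact (ex_derive_continuous (K := R_AbsRing) (V := R_NormedModule) f z (Hf z))).
  assert (De : forall t, continuous (fun t => exp (w * t)) t) by (apply D; intros; auto_derive; auto).
  split; [apply continuity_2d_sep; [apply D; intros; auto_derive; auto|exact De]|].
  split; [apply (continuity_2d_sep (fun x => - sin (w * x))); [apply D; intros; auto_derive; auto|exact De]|].
  exists (fun x t => (- w * sin (w * x)) * exp (w * t)), (fun x t => (- w * cos (w * x)) * exp (w * t)).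
  split; [apply (continuity_2d_sep (fun x => - w * sin (w * x))); [apply D; intros; auto_derive; auto|exact De]|].
  split; [apply (continuity_2d_sep (fun x => - w * cos (w * x))); [apply D; intros; auto_derive; auto|exact De]|].
  exists (mkposreal 1 Rlt_0_1). intros x' t' _ _.
  repeat match goal with |- _ /\ _ => split end; auto_derive; auto; ring.
Qed.

(** * Contour shift and decay of Fourier coefficients *)

Lemma CR_ex_RInt P Q t : (forall x, CR_at P Q x t) ->
  ex_RInt (fun x => P x t) 0 1 /\ ex_RInt (fun x => Q x t) 0 1.
Proof.
  intros H. split; apply (ex_RInt_continuous (V := R_CompleteNormedModule)); intros z _;
    destruct (H z) as [HP [HQ _]].
  - apply (continuity_2d_slice _ _ _ HP).
  - apply (continuity_2d_slice _ _ _ HQ).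
Qed.

(* By the Cauchy-Riemann equations the mean over a horizontal circle does not depend on its height. *)
Lemma contour_shift a P Q : (forall x t, Rabs t < a -> CR_at P Q x t) ->
  (forall x t, Rabs t < a -> Q (x + 1) t = Q x t) ->
  forall t, Rabs t < a -> RInt (fun x => P x t) 0 1 = RInt (fun x => P x 0) 0 1.
Proof.
  intros H Hper.
  assert (HD : forall t, Rabs t < a -> is_derive (fun t => RInt (fun x => P x t) 0 1) t 0).
  { intros t Ht.
    assert (Hnear : locally t (fun t' => Rabs t' < a)).
    { assert (Hg : 0 < a - Rabs t) by lra. exists (mkposreal _ Hg). intros t' Ht'.
      change (Rabs (t' - t) < a - Rabs t) in Ht'.
      replace t' with (t + (t' - t)) by (change R in t'; ring).
      eapply Rle_lt_trans; [apply Rabs_triang|]. lra. }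
    assert (Hpt : forall x t, Rabs t < a -> ex_derive (fun t => P x t) t /\
      Derive (fun t => P x t) t = - Derive (fun x => Q x t) x /\ ex_derive (fun x => Q x t) x).
    { intros x t' Ht'. destruct (H x t' Ht') as [_ [_ [p [q [_ [_ L]]]]]].
      apply locally_2d_singleton in L. destruct L as [_ [L2 [L3 _]]].
      split; [eexists; exact L2|]. split; [|eexists; exact L3].
      transitivity (- q x t'); [apply is_derive_unique, L2|].
      f_equal. symmetry. apply is_derive_unique, L3. }
    assert (Hcont : forall x, continuity_2d_pt (fun x t => Derive (fun t => P x t) t) x t).
    { intros x. destruct (H x t Ht) as [_ [_ [p [q [_ [Cq L]]]]]].
      apply (continuity_2d_pt_ext_loc (fun x t => - q x t)); [|apply continuity_2d_pt_opp, Cq].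
      destruct L as [d L]. exists d. intros u v Hu Hv. destruct (L u v Hu Hv) as [_ [L2 _]].
      symmetry. apply is_derive_unique, L2. }
    assert (E : RInt (fun x => Derive (fun t => P x t) t) 0 1 = 0).
    { rewrite (RInt_ext _ (fun x => - Derive (fun x => Q x t) x)) by (intros x _; apply Hpt, Ht).
      assert (HI : is_RInt (Derive (fun x => Q x t)) 0 1 (Q 1 t - Q 0 t)).
      { apply (is_RInt_derive (fun x => Q x t)).
        - intros x _. apply Derive_correct, Hpt, Ht.
        - intros x _. apply (continuous_ext (fun x => - Derive (fun t => P x t) t)).
          + intros z. rewrite (proj1 (proj2 (Hpt z t Ht))). eqR. ring.
          + apply (continuous_opp (fun x => Derive (fun t => P x t) t)).
            apply (continuity_2d_slice _ _ _ (Hcont x)). }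
      pose proof (is_RInt_opp _ _ _ _ HI) as HI'.
      transitivity (- (Q 1 t - Q 0 t)); [apply is_RInt_unique; exact HI'|].
      pose proof (Hper 0 t Ht) as H01. rewrite Rplus_0_l in H01. lra. }
    pose proof (is_derive_RInt_param (fun t x => P x t) 0 1 t) as DI.
    cbv beta in DI. rewrite E in DI. apply DI; clear DI.
    - apply (filter_imp (fun t' => Rabs t' < a)); [|exact Hnear].
      intros t' Ht' x _. apply (Hpt x t' Ht').
    - intros x _. apply (continuity_2d_swap (fun x t => Derive (fun t => P x t) t)). apply Hcont.
    - apply (filter_imp (fun t' => Rabs t' < a)); [|exact Hnear].
      intros t' Ht'. apply (CR_ex_RInt P Q t'). intros x. apply H, Ht'. }
  intros t Ht. set (I := fun t => RInt (fun x => P x t) 0 1) in *.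
  destruct (Rle_dec 0 t) as [H0|H0].
  - rewrite Rabs_pos_eq in Ht by exact H0. apply Rle_antisym.
    + pose proof (derive_nonneg_le (fun t => - I t) (fun _ => - 0) 0 t H0) as L.
      assert (- I 0 <= - I t); [|unfold I in *; lra]. apply L; [|intros; lra].
      intros x Hx. apply (is_derive_opp I). apply HD. rewrite Rabs_pos_eq; lra.
    + apply (derive_nonneg_le I (fun _ => 0) 0 t H0); [|intros; lra].
      intros x Hx. apply HD. rewrite Rabs_pos_eq; lra.
  - rewrite Rabs_left1 in Ht by lra. apply Rle_antisym.
    + apply (derive_nonneg_le I (fun _ => 0) t 0); [lra| |intros; lra].
      intros x Hx. apply HD. rewrite Rabs_left1; lra.
    + pose proof (derive_nonneg_le (fun t => - I t) (fun _ => - 0) t 0) as L.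
      assert (- I t <= - I 0); [|unfold I in *; lra]. apply L; [lra| |intros; lra].
      intros x Hx. apply (is_derive_opp I). apply HD. rewrite Rabs_left1; lra.
Qed.

Lemma RInt_Rabs_le f M : (forall x, continuous f x) -> (forall x, Rabs (f x) <= M) -> Rabs (RInt f 0 1) <= M.
Proof.
  intros Hc HM. replace M with ((1 - 0) * M) by ring.
  apply (abs_RInt_le_const f 0 1 M); [lra| |intros; apply HM].
  apply (ex_RInt_continuous (V := R_CompleteNormedModule)). intros; apply Hc.
Qed.

Lemma trig_comb_bound P Q M x e : Rabs P <= M -> Rabs Q <= M -> 0 <= e ->
  Rabs (P * (cos x * e) - Q * (- sin x * e)) <= 2 * M * e.
Proof.
  intros HP HQ He. replace (P * (cos x * e) - Q * (- sin x * e)) with (e * (P * cos x + Q * sin x)) by ring.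
  rewrite Rabs_mult, (Rabs_pos_eq e He). rewrite (Rmult_comm (2 * M)). apply Rmult_le_compat_l; [exact He|].
  eapply Rle_trans; [apply Rabs_triang|]. rewrite !Rabs_mult.
  pose proof (Rabs_cos_le x). assert (Rabs (sin x) <= 1) by (apply Rabs_le; pose proof (SIN_bound x); lra).
  pose proof (Rabs_pos P). pose proof (Rabs_pos Q). pose proof (Rabs_pos (cos x)). pose proof (Rabs_pos (sin x)).
  nra.
Qed.

Lemma trig_period n x : cos (2 * PI * IZR n * (x + 1)) = cos (2 * PI * IZR n * x) /\
  sin (2 * PI * IZR n * (x + 1)) = sin (2 * PI * IZR n * x).
Proof.
  assert (E : forall th, cos (2 * PI * IZR n * (x + 1) + th) = cos (2 * PI * IZR n * x + th)).
  { intros th. pose proof (W_atom_cos 0 0 1 n th 0 (Rle_refl 0) (Rle_refl 0)) as Hw.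
    pose proof (W_period _ _ _ _ _ x 0 1 Hw ltac:(rewrite Rabs_R0; lra)) as E. simpl in E. lra. }
  split.
  - specialize (E 0). rewrite !Rplus_0_r in E. exact E.
  - specialize (E (- (PI / 2))). rewrite <- !sin_as_cos in E. exact E.
Qed.

(** The two integrals are the real and imaginary parts of the coefficient of [P + i Q] at mode [n].
    Multiplication by [exp (- i w (x + i t))] makes each the mean over a circle, which may be
    computed at any height. *)
Lemma fourier_decay a a' M P Q n : 0 <= a' < a ->
  (forall x t, Rabs t < a -> CR_at P Q x t) ->
  (forall x t, Rabs t < a -> P (x + 1) t = P x t /\ Q (x + 1) t = Q x t) ->
  (forall x t, Rabs t <= a' -> Rabs (P x t) <= M /\ Rabs (Q x t) <= M) ->
  let e := 2 * M * exp (- (2 * PI * a' * Rabs (IZR n))) in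
  Rabs (RInt (fun x => P x 0 * cos (2 * PI * IZR n * x) + Q x 0 * sin (2 * PI * IZR n * x)) 0 1) <= e /\
  Rabs (RInt (fun x => Q x 0 * cos (2 * PI * IZR n * x) - P x 0 * sin (2 * PI * IZR n * x)) 0 1) <= e.
Proof.
  intros Ha HCR Hper HM e. set (w := 2 * PI * IZR n).
  (* The height is moved to the side where [exp (w t)] is small. *)
  set (t := if Rle_dec 0 (IZR n) then - a' else a').
  assert (Hta : Rabs t <= a').
  { unfold t. destruct (Rle_dec 0 (IZR n)); [rewrite Rabs_Ropp|]; rewrite Rabs_pos_eq; lra. }
  assert (Hwt : w * t = - (2 * PI * a' * Rabs (IZR n))).
  { unfold w, t. destruct (Rle_dec 0 (IZR n)).
    - rewrite Rabs_pos_eq by assumption. ring.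
    - rewrite Rabs_left1 by lra. ring. }
  set (P1 := fun x t => P x t * (cos (w * x) * exp (w * t)) - Q x t * (- sin (w * x) * exp (w * t))).
  set (Q1 := fun x t => P x t * (- sin (w * x) * exp (w * t)) + Q x t * (cos (w * x) * exp (w * t))).
  assert (H1 : forall x t, Rabs t < a -> CR_at P1 Q1 x t).
  { intros x s Hs. apply (CR_mult P Q _ _ x s (HCR x s Hs) (CR_exp w x s)). }
  assert (Hp : forall x t, Rabs t < a -> P1 (x + 1) t = P1 x t /\ Q1 (x + 1) t = Q1 x t).
  { intros x s Hs. unfold P1, Q1, w. destruct (Hper x s Hs) as [-> ->].
    destruct (trig_period n x) as [-> ->]. auto. }
  (* Multiplication by [- i] puts [Q1] in the place of the real part, so that [contour_shift]
     applies to it too. *)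
  assert (Hrot : forall x t, Rabs t < a -> CR_at Q1 (fun x t => - P1 x t) x t).
  { intros x s Hs. destruct (H1 x s Hs) as [C1 [C2 [p [q [C3 [C4 L]]]]]].
    split; [exact C2|]. split; [apply continuity_2d_pt_opp, C1|].
    exists q, (fun x t => - p x t). split; [exact C4|]. split; [apply continuity_2d_pt_opp, C3|].
    destruct L as [d L]. exists d. intros x' t' Hx Ht. destruct (L x' t' Hx Ht) as [L1 [L2 [L3 L4]]].
    split; [exact L3|]. split; [rewrite Ropp_involutive; exact L4|].
    split; [apply (is_derive_opp (fun x => P1 x t')), L1|].
    replace (q x' t') with (opp (- q x' t')) by (unfold opp; simpl; ring).
    apply (is_derive_opp (fun t => P1 x' t)), L2. }
  assert (Ht : Rabs t < a) by lra.
  assert (HcP : forall x, continuous (fun x => P1 x t) x)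
    by (intros x; destruct (H1 x t Ht) as [C1 _]; apply (continuity_2d_slice _ _ _ C1)).
  assert (HcQ : forall x, continuous (fun x => Q1 x t) x)
    by (intros x; destruct (Hrot x t Ht) as [C1 _]; apply (continuity_2d_slice _ _ _ C1)).
  assert (S1 := contour_shift a P1 Q1 H1 (fun x t Ht => proj2 (Hp x t Ht)) t Ht).
  assert (S2 := contour_shift a Q1 (fun x t => - P1 x t) Hrot
    (fun x t Ht => f_equal Ropp (proj1 (Hp x t Ht))) t Ht).
  assert (E0 : exp (w * 0) = 1) by (rewrite Rmult_0_r; apply exp_0).
  split.
  - rewrite (RInt_ext _ (fun x => P1 x 0)) by (intros x _; unfold P1; rewrite E0; unfold w; eqR; ring).
    rewrite <- S1. apply RInt_Rabs_le; [exact HcP|]. intros x.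
    destruct (HM x t Hta) as [M1 M2]. unfold P1, e. rewrite Hwt.
    apply trig_comb_bound; auto. left; apply exp_pos.
  - rewrite (RInt_ext _ (fun x => Q1 x 0)) by (intros x _; unfold Q1; rewrite E0; unfold w; eqR; ring).
    rewrite <- S2. apply RInt_Rabs_le; [exact HcQ|]. intros x.
    destruct (HM x t Hta) as [M1 M2]. unfold Q1, e. rewrite Hwt.
    replace (P x t * (- sin (w * x) * exp (- (2 * PI * a' * Rabs (IZR n)))) +
      Q x t * (cos (w * x) * exp (- (2 * PI * a' * Rabs (IZR n))))) with
      (Q x t * (cos (w * x) * exp (- (2 * PI * a' * Rabs (IZR n)))) -
      P x t * - (- sin (w * x) * exp (- (2 * PI * a' * Rabs (IZR n))))) by ring.
    replace (P x t * - (- sin (w * x) * exp (- (2 * PI * a' * Rabs (IZR n))))) with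
     (- P x t * (- sin (w * x) * exp (- (2 * PI * a' * Rabs (IZR n))))) by ring.
    apply trig_comb_bound; auto; [rewrite Rabs_Ropp; auto|left; apply exp_pos].
Qed.

(** * Fourier inversion through the Fejer kernel *)

Definition dirichlet (m : nat) (th : R) : R := 1 + psum (fun n => 2 * cos (INR (S n) * th)) m.
(** The kernel is not divided by [N]: its mean over a period is [N]. *)
Definition fejer (N : nat) (th : R) : R := psum (fun m => dirichlet m th) N.

Lemma dirichlet_telescope m th :
  dirichlet m th * (1 - cos th) = cos (INR m * th) - cos (INR (S m) * th).
Proof.
  unfold dirichlet. induction m as [|m IH].
  - simpl. rewrite Rmult_0_l, cos_0, Rmult_1_l. ring.
  - cbn [psum]. rewrite <- Rplus_assoc, Rmult_plus_distr_r, IH.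
    assert (E : 2 * cos (INR (S m) * th) * cos th = cos (INR (S (S m)) * th) + cos (INR m * th)).
    { replace (INR (S (S m)) * th) with (INR (S m) * th + th) by (rewrite (S_INR (S m)); ring).
      replace (INR m * th) with (INR (S m) * th - th) by (rewrite S_INR; ring).
      rewrite cos_plus, cos_minus. ring. }
    lra.
Qed.

Lemma fejer_telescope N th : fejer N th * (1 - cos th) = 1 - cos (INR N * th).
Proof.
  unfold fejer. induction N as [|N IH].
  - simpl. rewrite !Rmult_0_l, cos_0. ring.
  - cbn [psum]. rewrite Rmult_plus_distr_r, IH, dirichlet_telescope. ring.
Qed.

Lemma fejer_nonneg N th : 0 <= fejer N th.
Proof.
  pose proof (COS_bound th). pose proof (COS_bound (INR N * th)). pose proof (fejer_telescope N th) as E.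
  destruct (Rlt_dec (cos th) 1) as [Hlt|Hge].
  - apply Rmult_le_reg_r with (1 - cos th); lra.
  - assert (Hc : cos th = 1) by lra.
    assert (Hs : sin th = 0) by (pose proof (sin2_cos2 th) as Q; unfold Rsqr in Q; rewrite Hc in Q; nra).
    assert (Hn : forall n, cos (INR n * th) = 1).
    { induction n as [|n IH]; [simpl; rewrite Rmult_0_l; apply cos_0|].
      rewrite S_INR. replace ((INR n + 1) * th) with (INR n * th + th) by ring.
      rewrite cos_plus, IH, Hc, Hs. ring. }
    apply psum_nonneg. intros m. unfold dirichlet.
    assert (0 <= psum (fun n => 2 * cos (INR (S n) * th)) m); [|lra].
    apply psum_nonneg. intros n. rewrite Hn. lra.
Qed.

Lemma half_le_sin x : 0 <= x <= PI / 2 -> x / 2 <= sin x.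
Proof.
  intros Hx. pose proof PI_ge_3.
  assert (Hc : 0 <= cos x) by (apply cos_ge_0; lra).
  assert (Hc2 : 0 <= cos (x / 2)) by (apply cos_ge_0; lra).
  assert (E1 : sin x = 2 * sin (x / 2) * cos (x / 2)) by (rewrite <- sin_2a; f_equal; field).
  assert (E2 : cos x = 2 * cos (x / 2) ^ 2 - 1).
  { replace x with (2 * (x / 2)) at 1 by field. rewrite cos_2a_cos. ring. }
  assert (Hs : x / 2 * cos (x / 2) <= sin (x / 2)).
  { pose proof (derive_nonneg_le (fun t => sin t - t * cos t) (fun t => t * sin t) 0 (x / 2)) as D.
    cbv beta in D. rewrite sin_0 in D.
    assert (0 - 0 * cos 0 <= sin (x / 2) - x / 2 * cos (x / 2)); [|lra]. apply D; try lra.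
    - intros t _. auto_derive; auto. ring.
    - intros t Ht. apply Rmult_le_pos; [lra|]. apply sin_ge_0; lra. }
  nra.
Qed.

Lemma sq_le_one_minus_cos s : Rabs s <= 1 / 2 -> 2 * s ^ 2 <= 1 - cos (2 * PI * s).
Proof.
  intros Hs. pose proof PI_ge_3.
  replace (2 * PI * s) with (2 * (PI * s)) by ring. rewrite cos_2a_sin.
  assert (Habs : PI * Rabs s / 2 <= sin (PI * Rabs s)).
  { apply half_le_sin. pose proof (Rabs_pos s). split; nra. }
  assert (E : sin (PI * s) * sin (PI * s) = sin (PI * Rabs s) * sin (PI * Rabs s)).
  { destruct (Rle_dec 0 s); [rewrite Rabs_pos_eq by assumption; reflexivity|].
    rewrite Rabs_left1 by lra. replace (PI * - s) with (- (PI * s)) by ring. rewrite sin_neg. ring. }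
  rewrite Rmult_assoc, E. rewrite <- pow2_abs. pose proof (Rabs_pos s).
  assert (Rabs s <= sin (PI * Rabs s)) by nra. nra.
Qed.

Lemma RInt_psum (f : nat -> R -> R) N : (forall n x, continuous (f n) x) ->
  RInt (fun x => psum (fun n => f n x) N) 0 1 = psum (fun n => RInt (f n) 0 1) N.
Proof.
  intros Hf.
  assert (Hex : forall n, ex_RInt (f n) 0 1)
    by (intros n; apply (ex_RInt_continuous (V := R_CompleteNormedModule)); intros; apply Hf).
  assert (HI : is_RInt (fun x => psum (fun n => f n x) N) 0 1 (psum (fun n => RInt (f n) 0 1) N)).
  { induction N as [|N IH]; simpl.
    - pose proof (is_RInt_const (V := R_NormedModule) 0 1 0) as Z.
      change (is_RInt (fun _ => 0) 0 1 ((1 - 0) * 0)) in Z. rewrite Rmult_0_r in Z. exact Z.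
    - exact (is_RInt_plus (V := R_NormedModule) (fun x => psum (fun n => f n x) N) (f N) 0 1 _ _ IH
        (RInt_correct (V := R_CompleteNormedModule) (f N) 0 1 (Hex N))). }
  apply is_RInt_unique, HI.
Qed.

Lemma continuous_cos_lin w x0 x : continuous (fun x => cos (w * (x - x0))) x.
Proof.
  apply (ex_derive_continuous (K := R_AbsRing) (V := R_NormedModule) (fun x => cos (w * (x - x0)))).
  auto_derive. auto.
Qed.

Lemma RInt_cos_mode n x0 : RInt (fun x => cos (INR (S n) * (2 * PI * (x - x0)))) 0 1 = 0.
Proof.
  pose proof PI_ge_3. pose proof (pos_INR n). set (w := INR (S n) * (2 * PI)).
  assert (Hw : 0 < w) by (unfold w; rewrite S_INR; nra).
  assert (HI : is_RInt (fun x => cos (INR (S n) * (2 * PI * (x - x0)))) 0 1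
    (sin (w * (1 - x0)) / w - sin (w * (0 - x0)) / w)).
  { apply (is_RInt_derive (fun x => sin (w * (x - x0)) / w)).
    - intros x _. auto_derive; auto.
      replace (INR (S n) * (2 * PI * (x - x0))) with (w * (x - x0)) by (unfold w; ring).
      replace (x + - x0) with (x - x0) by ring. field. lra.
    - intros x _. apply (continuous_ext (fun x => cos (w * (x - x0)))).
      + intros z. unfold w. f_equal. ring.
      + apply continuous_cos_lin. }
  rewrite (is_RInt_unique _ _ _ _ HI).
  replace (w * (1 - x0)) with (w * (0 - x0) + 2 * INR (S n) * PI) by (unfold w; ring).
  rewrite sin_period. apply Rminus_diag_eq. reflexivity.
Qed.

Section Inversion.
Variables (phi : R -> R) (M : R).
Hypotheses (Hc : forall x, continuous phi x) (Hper : forall x, phi (x + 1) = phi x)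
  (HM : forall x, Rabs (phi x) <= M) (Hd : forall x, ex_derive phi x).

Lemma period_Z x n : phi (x + IZR n) = phi x.
Proof.
  assert (Hn : forall m : nat, forall x, phi (x + INR m) = phi x).
  { induction m as [|m IH]; intros z; [simpl; rewrite Rplus_0_r; reflexivity|].
    rewrite S_INR, <- Rplus_assoc, Hper. apply IH. }
  destruct (Z_le_gt_dec 0 n) as [H|H].
  - rewrite <- (Z2Nat.id n H), <- INR_IZR_INZ. apply Hn.
  - rewrite <- (Hn (Z.to_nat (- n)) (x + IZR n)), INR_IZR_INZ, Z2Nat.id by lia.
    f_equal. rewrite opp_IZR. ring.
Qed.

Lemma lipschitz_at x0 : exists L, 0 <= L /\ forall s, Rabs (phi (x0 + s) - phi x0) <= L * Rabs s.
Proof.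
  destruct (Hd x0) as [l Hl]. apply is_derive_Reals in Hl.
  destruct (Hl 1 Rlt_0_1) as [d Hdl].
  assert (HM0 : 0 <= M) by (eapply Rle_trans; [apply Rabs_pos|apply (HM 0)]).
  pose proof (cond_pos d) as Hd0. pose proof (Rabs_pos l).
  assert (Hq : 0 <= 2 * M / d) by (apply Rmult_le_pos; [lra|left; apply Rinv_0_lt_compat; lra]).
  exists (Rabs l + 1 + 2 * M / d). split; [lra|]. intros s.
  destruct (Req_dec s 0) as [->|Hs].
  { rewrite Rplus_0_r, Rabs_R0. unfold Rminus. rewrite Rplus_opp_r, Rabs_R0. lra. }
  pose proof (Rabs_pos_lt s Hs). rewrite !Rmult_plus_distr_r.
  destruct (Rlt_dec (Rabs s) d) as [Hsd|Hsd].
  - specialize (Hdl s Hs Hsd).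
    replace (phi (x0 + s) - phi x0) with (((phi (x0 + s) - phi x0) / s - l) * s + l * s) by (field; exact Hs).
    eapply Rle_trans; [apply Rabs_triang|]. rewrite !Rabs_mult.
    assert (0 <= 2 * M / d * Rabs s) by (apply Rmult_le_pos; lra).
    assert (Rabs ((phi (x0 + s) - phi x0) / s - l) * Rabs s <= 1 * Rabs s) by (apply Rmult_le_compat_r; lra).
    lra.
  - assert (Rabs (phi (x0 + s) - phi x0) <= 2 * M).
    { eapply Rle_trans; [apply Rabs_triang|]. rewrite Rabs_Ropp. pose proof (HM (x0 + s)). pose proof (HM x0). lra. }
    assert (2 * M <= 2 * M / d * Rabs s).
    { apply Rle_trans with (2 * M / d * d); [right; field; lra|]. apply Rmult_le_compat_l; lra. }
    assert (0 <= Rabs l * Rabs s) by (apply Rmult_le_pos; lra). lra.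
Qed.

(** By [fejer_telescope] the product of the kernel with [1 - cos] is at most 2 whatever [N], so
    [1 - cos] is the right gauge for the variation of [phi]. Differentiability at [x0] with
    boundedness gives a Lipschitz bound there, and the period reduces to [|s| <= 1 / 2]. *)
Lemma variation_sq x0 : exists K, 0 <= K /\
  forall x, (phi x - phi x0) ^ 2 <= K * (1 - cos (2 * PI * (x - x0))).
Proof.
  destruct (lipschitz_at x0) as [L [HL H]]. exists (L ^ 2). split; [apply pow2_ge_0|]. intros x.
  destruct (archimed (x - x0 - 1 / 2)) as [A1 A2]. set (n := up (x - x0 - 1 / 2)) in *.
  set (s := x - x0 - IZR n).
  assert (Hs : Rabs s <= 1 / 2) by (apply Rabs_le; unfold s; lra).
  replace (phi x) with (phi (x0 + s)) by (rewrite <- (period_Z (x0 + s) n); f_equal; unfold s; ring).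
  specialize (H s). pose proof (sq_le_one_minus_cos s Hs) as Q.
  replace (cos (2 * PI * (x - x0))) with (cos (2 * PI * s)).
  - rewrite <- pow2_abs. apply Rle_trans with ((L * Rabs s) ^ 2).
    + apply pow_incr. split; [apply Rabs_pos|exact H].
    + rewrite Rpow_mult_distr, pow2_abs. apply Rmult_le_compat_l; [apply pow2_ge_0|].
      pose proof (pow2_ge_0 s). lra.
  - replace (2 * PI * (x - x0)) with (2 * PI * s + 2 * PI * IZR n) by (unfold s; ring).
    pose proof (W_atom_cos 0 0 1 1 0 0 (Rle_refl 0) (Rle_refl 0)) as Hw.
    pose proof (W_period _ _ _ _ _ s 0 n Hw ltac:(rewrite Rabs_R0; lra)) as E. simpl in E.
    rewrite !Rmult_1_r, !Rmult_1_l, !Rplus_0_r in E. rewrite <- E. f_equal. ring.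
Qed.

Definition coef (x0 : R) (n : nat) : R := RInt (fun x => phi x * cos (INR n * (2 * PI * (x - x0)))) 0 1.

Definition partial_sum (x0 : R) (m : nat) : R := coef x0 0 + psum (fun n => 2 * coef x0 (S n)) m.

Lemma continuous_mode n x0 x : continuous (fun x => cos (INR n * (2 * PI * (x - x0)))) x.
Proof.
  apply (continuous_ext (fun x => cos (INR n * (2 * PI) * (x - x0)))).
  - intros z. f_equal. ring.
  - apply continuous_cos_lin.
Qed.

Lemma continuous_psum (f : nat -> R -> R) N x : (forall n, continuous (f n) x) ->
  continuous (fun x => psum (fun n => f n x) N) x.
Proof.
  intros H. induction N as [|N IH]; simpl; [apply continuous_const|].
  apply (continuous_plus (fun x => psum (fun n => f n x) N) (f N)); auto.
Qed.

Lemma continuous_dirichlet x0 m x : continuous (fun x => dirichlet m (2 * PI * (x - x0))) x.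
Proof.
  unfold dirichlet. apply (continuous_plus (fun _ => 1)); [apply continuous_const|].
  apply continuous_psum. intros n.
  apply (continuous_mult (fun _ => 2) (fun x => cos (INR (S n) * (2 * PI * (x - x0))))).
  - apply continuous_const.
  - apply continuous_mode.
Qed.

Lemma continuous_fejer x0 N x : continuous (fun x => fejer N (2 * PI * (x - x0))) x.
Proof. apply continuous_psum. intros n. apply continuous_dirichlet. Qed.

Lemma ex_RInt_cont (f : R -> R) : (forall x, continuous f x) -> ex_RInt f 0 1.
Proof. intros H. apply (ex_RInt_continuous (V := R_CompleteNormedModule)). intros; apply H. Qed.

Lemma RInt_add (f g : R -> R) : (forall x, continuous f x) -> (forall x, continuous g x) ->
  RInt (fun x => f x + g x) 0 1 = RInt f 0 1 + RInt g 0 1.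
Proof. intros. apply (RInt_plus (V := R_CompleteNormedModule) f g); apply ex_RInt_cont; auto. Qed.

Lemma RInt_mul c (f : R -> R) : (forall x, continuous f x) ->
  RInt (fun x => c * f x) 0 1 = c * RInt f 0 1.
Proof. intros. apply (RInt_scal (V := R_CompleteNormedModule) f); apply ex_RInt_cont; auto. Qed.

Lemma continuous_mul (f g : R -> R) x : continuous f x -> continuous g x -> continuous (fun x => f x * g x) x.
Proof. apply (continuous_mult f g). Qed.

Lemma RInt_dirichlet (f : R -> R) x0 m : (forall x, continuous f x) ->
  RInt (fun x => f x * dirichlet m (2 * PI * (x - x0))) 0 1 =
  RInt f 0 1 + psum (fun n => 2 * RInt (fun x => f x * cos (INR (S n) * (2 * PI * (x - x0)))) 0 1) m.
Proof.
  intros Hf.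
  assert (Hfc : forall n x, continuous (fun x => f x * cos (INR n * (2 * PI * (x - x0)))) x).
  { intros n x. apply (continuous_mult f (fun x => cos (INR n * (2 * PI * (x - x0))))); [apply Hf|apply continuous_mode]. }
  rewrite (RInt_ext _ (fun x => f x + psum (fun n => 2 * (f x * cos (INR (S n) * (2 * PI * (x - x0))))) m)).
  - rewrite RInt_add; [|exact Hf|].
    + f_equal. rewrite (RInt_psum (fun n x => 2 * (f x * cos (INR (S n) * (2 * PI * (x - x0)))))).
      * apply psum_ext. intros n _. apply RInt_mul. intros; apply Hfc.
      * intros n x. apply continuous_mul; [apply continuous_const|apply Hfc].
    + intros x. apply (continuous_psum (fun n x => 2 * (f x * cos (INR (S n) * (2 * PI * (x - x0)))))).
      intros n. apply continuous_mul; [apply continuous_const|apply Hfc].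
  - intros x _. eqR. unfold dirichlet. rewrite Rmult_plus_distr_l, Rmult_1_r.
    f_equal. rewrite <- psum_scal. apply psum_ext. intros; ring.
Qed.

Lemma RInt_fejer_phi x0 N :
  RInt (fun x => phi x * fejer N (2 * PI * (x - x0))) 0 1 = psum (partial_sum x0) N.
Proof.
  rewrite (RInt_ext _ (fun x => psum (fun m => phi x * dirichlet m (2 * PI * (x - x0))) N)).
  - rewrite RInt_psum.
    + apply psum_ext. intros m _. rewrite RInt_dirichlet by exact Hc. unfold partial_sum, coef.
      f_equal. apply RInt_ext. intros x _. eqR. simpl. rewrite Rmult_0_l, cos_0, Rmult_1_r. reflexivity.
    + intros n x. apply (continuous_mult phi); [apply Hc|apply continuous_dirichlet].
  - intros x _. eqR. unfold fejer. rewrite <- psum_scal. reflexivity.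
Qed.

Lemma RInt_fejer x0 N : RInt (fun x => fejer N (2 * PI * (x - x0))) 0 1 = INR N.
Proof.
  unfold fejer. rewrite RInt_psum by (intros; apply continuous_dirichlet).
  rewrite (psum_ext _ (fun _ => 1)); [rewrite psum_const; eqR; ring|]. intros m _.
  rewrite (RInt_ext _ (fun x => 1 * dirichlet m (2 * PI * (x - x0)))) by (intros; eqR; ring).
  rewrite RInt_dirichlet by (intros; apply continuous_const).
  rewrite (psum_ext _ (fun _ => 0)).
  - rewrite psum_zero, RInt_const. unfold scal; simpl; unfold mult; simpl. eqR. ring.
  - intros n _. rewrite (RInt_ext _ (fun x => cos (INR (S n) * (2 * PI * (x - x0))))) by (intros; eqR; ring).
    rewrite RInt_cos_mode. eqR. ring.
Qed.

(** With [d = phi x - phi x0], use [|d| <= eta + d^2 / (4 eta)]. The first term integrates to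
    [eta N]; the second is at most [K (1 - cos) / (4 eta)], whose product with the kernel is bounded
    independently of [N]. *)
Lemma fejer_mean x0 K eta N : 0 < eta -> 0 <= K ->
  (forall x, (phi x - phi x0) ^ 2 <= K * (1 - cos (2 * PI * (x - x0)))) ->
  Rabs (psum (partial_sum x0) N - INR N * phi x0) <= eta * INR N + K / (2 * eta).
Proof.
  intros He HK Hvar.
  set (F := fun x => fejer N (2 * PI * (x - x0))).
  assert (HF : forall x, continuous F x) by (intros; apply continuous_fejer).
  assert (HFp : forall x, continuous (fun x => phi x * F x) x) by (intros; apply (continuous_mult phi F); auto).
  assert (HFk : forall c x, continuous (fun x => c * F x) x)
    by (intros; apply (continuous_mult (fun _ => c) F); auto; apply continuous_const).
  assert (E : psum (partial_sum x0) N - INR N * phi x0 = RInt (fun x => phi x * F x - phi x0 * F x) 0 1).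
  { rewrite <- RInt_fejer_phi, <- (RInt_fejer x0 N).
    transitivity (RInt (fun x => phi x * F x + - phi x0 * F x) 0 1).
    - rewrite RInt_add, RInt_mul by auto. unfold F. eqR. ring.
    - apply RInt_ext. intros x _. eqR. ring. }
  rewrite E.
  assert (Hb : forall x, Rabs (phi x * F x - phi x0 * F x) <= eta * F x + K / (2 * eta)).
  { intros x. rewrite <- Rmult_minus_distr_r, Rabs_mult.
    pose proof (fejer_nonneg N (2 * PI * (x - x0))) as F0. fold (F x) in F0.
    rewrite (Rabs_pos_eq (F x)) by exact F0.
    pose proof (fejer_telescope N (2 * PI * (x - x0))) as Tl. fold (F x) in Tl.
    pose proof (COS_bound (INR N * (2 * PI * (x - x0)))).
    specialize (Hvar x). set (d := phi x - phi x0) in *. set (c := 1 - cos (2 * PI * (x - x0))) in *.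
    assert (Hd1 : Rabs d <= eta + d ^ 2 / (4 * eta)).
    { rewrite <- (pow2_abs d). apply Rmult_le_reg_r with (4 * eta); [lra|].
      replace ((eta + Rabs d ^ 2 / (4 * eta)) * (4 * eta)) with (4 * eta ^ 2 + Rabs d ^ 2) by (field; lra).
      pose proof (pow2_ge_0 (2 * eta - Rabs d)). nra. }
    apply Rle_trans with ((eta + K * c / (4 * eta)) * F x).
    - apply Rmult_le_compat_r; [exact F0|]. eapply Rle_trans; [exact Hd1|].
      apply Rplus_le_compat_l. apply Rmult_le_compat_r; [left; apply Rinv_0_lt_compat; lra|exact Hvar].
    - replace ((eta + K * c / (4 * eta)) * F x) with (eta * F x + K / (4 * eta) * (F x * c)) by (field; lra).
      apply Rplus_le_compat_l. replace (K / (2 * eta)) with (K / (4 * eta) * 2) by (field; lra).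
      apply Rmult_le_compat_l; [apply Rmult_le_pos; [lra|left; apply Rinv_0_lt_compat; lra]|lra]. }
  assert (Hg : forall x, continuous (fun x => eta * F x + K / (2 * eta)) x).
  { intros x. apply (continuous_plus (fun x => eta * F x) (fun _ => K / (2 * eta))); [apply HFk|apply continuous_const]. }
  eapply Rle_trans; [apply abs_RInt_le; [lra|]|].
  { apply ex_RInt_cont. intros x. apply (continuous_minus (fun x => phi x * F x) (fun x => phi x0 * F x)); auto. }
  eapply Rle_trans; [apply (RInt_le _ (fun x => eta * F x + K / (2 * eta))); [lra| | |intros; apply Hb]|].
  - apply ex_RInt_cont. intros x. apply (continuous_comp (fun x => phi x * F x - phi x0 * F x) Rabs).
    + apply (continuous_minus (fun x => phi x * F x) (fun x => phi x0 * F x)); auto.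
    + apply continuous_Rabs.
  - apply ex_RInt_cont, Hg.
  - rewrite RInt_add by (auto; intros; apply continuous_const).
    rewrite RInt_mul by exact HF. unfold F. rewrite RInt_fejer, RInt_const.
    unfold scal; simpl; unfold mult; simpl. lra.
Qed.

(** Convergence of the partial sums is assumed, so only the limit has to be identified. Their Cesaro
    means have the same limit, and [fejer_mean] with [eta] half the supposed discrepancy excludes
    any other value than [phi x0]. *)
Lemma fourier_inversion x0 (l : R) : is_lim_seq (partial_sum x0) l -> l = phi x0.
Proof.
  intros Hl. destruct (variation_sq x0) as [K [HK Hvar]].
  apply is_lim_seq_Reals in Hl. apply Cesaro_1 in Hl.
  assert (HC : is_lim_seq (fun n => psum (partial_sum x0) (S n) / INR (S n)) l).
  { apply is_lim_seq_Reals in Hl. apply is_lim_seq_incr_1 in Hl. revert Hl. apply is_lim_seq_ext.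
    intros n. f_equal. rewrite psum_sum_n, sum_n_Reals. reflexivity. }
  destruct (Req_dec l (phi x0)) as [|Hne]; [assumption|exfalso].
  set (e := Rabs (l - phi x0)). assert (He : 0 < e) by (apply Rabs_pos_lt; lra).
  assert (B : forall n, Rabs (psum (partial_sum x0) (S n) / INR (S n) - phi x0) <= e / 2 + K / e * / INR (S n)).
  { intros n. assert (Hn : 0 < INR (S n)) by (apply lt_0_INR; lia).
    pose proof (fejer_mean x0 K (e / 2) (S n) ltac:(lra) HK Hvar) as Q.
    replace (psum (partial_sum x0) (S n) / INR (S n) - phi x0) with
      ((psum (partial_sum x0) (S n) - INR (S n) * phi x0) * / INR (S n)) by (field; lra).
    rewrite Rabs_mult, (Rabs_pos_eq (/ INR (S n))) by (left; apply Rinv_0_lt_compat; lra).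
    apply Rle_trans with ((e / 2 * INR (S n) + K / (2 * (e / 2))) * / INR (S n)).
    - apply Rmult_le_compat_r; [left; apply Rinv_0_lt_compat; lra|exact Q].
    - right. field. split; lra. }
  assert (L1 : is_lim_seq (fun n => Rabs (psum (partial_sum x0) (S n) / INR (S n) - phi x0)) e).
  { apply (is_lim_seq_abs _ (l - phi x0)). apply is_lim_seq_minus'; [exact HC|apply is_lim_seq_const]. }
  assert (L2 : is_lim_seq (fun n => e / 2 + K / e * / INR (S n)) (e / 2 + K / e * 0)).
  { apply is_lim_seq_plus'; [apply is_lim_seq_const|]. apply (is_lim_seq_scal_l _ (K / e) 0).
    apply (is_lim_seq_incr_1 (fun n => / INR n) 0).
    replace (Finite 0) with (Rbar_inv p_infty) by reflexivity.
    apply is_lim_seq_inv; [apply is_lim_seq_INR|discriminate]. }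
  pose proof (is_lim_seq_le _ _ _ _ B L1 L2) as Hle. simpl in Hle. lra.
Qed.

End Inversion.

(** * Holomorphic functions as sums of atoms *)

Lemma half_sum_bound x y e : Rabs (x + y) <= e -> Rabs (x - y) <= e -> Rabs x <= e /\ Rabs y <= e.
Proof. intros H1 H2. apply Rabs_le_between in H1, H2. split; apply Rabs_le; lra. Qed.

(** The decay is known for the coefficients of [P + i Q]. Half sums and half differences over the
    modes [n] and [- n] isolate those of [P], with the same bound. *)
Lemma fourier_coef_bound a a' M P Q : 0 <= a' < a ->
  (forall x t, Rabs t < a -> CR_at P Q x t) ->
  (forall x t, Rabs t < a -> P (x + 1) t = P x t /\ Q (x + 1) t = Q x t) ->
  (forall x t, Rabs t <= a' -> Rabs (P x t) <= M /\ Rabs (Q x t) <= M) -> forall n : nat,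
  Rabs (RInt (fun x => P x 0 * cos (2 * PI * INR n * x)) 0 1) <= 2 * M * exp (- (2 * PI * a' * INR n)) /\
  Rabs (RInt (fun x => P x 0 * sin (2 * PI * INR n * x)) 0 1) <= 2 * M * exp (- (2 * PI * a' * INR n)).
Proof.
  intros Ha HCR Hper HM n.
  pose proof (fourier_decay a a' M P Q (Z.of_nat n) Ha HCR Hper HM) as [E1 E2].
  pose proof (fourier_decay a a' M P Q (- Z.of_nat n) Ha HCR Hper HM) as [E3 E4].
  rewrite opp_IZR, <- INR_IZR_INZ in E3, E4. rewrite <- INR_IZR_INZ in E1, E2.
  rewrite Rabs_Ropp in E3, E4. rewrite (Rabs_pos_eq (INR n)) in E1, E2, E3, E4 by apply pos_INR.
  assert (H0 : Rabs 0 < a) by (rewrite Rabs_R0; lra).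
  assert (HP : forall x, continuous (fun x => P x 0) x)
    by (intros x; destruct (HCR x 0 H0) as [C1 _]; apply (continuity_2d_slice _ _ _ C1)).
  assert (HQ : forall x, continuous (fun x => Q x 0) x)
    by (intros x; destruct (HCR x 0 H0) as [_ [C1 _]]; apply (continuity_2d_slice _ _ _ C1)).
  set (w := 2 * PI * INR n) in *.
  assert (Hcs : forall x, continuous (fun x => cos (w * x)) x).
  { intros x. apply (ex_derive_continuous (K := R_AbsRing) (V := R_NormedModule) (fun x => cos (w * x))).
    auto_derive. auto. }
  assert (Hsn : forall x, continuous (fun x => sin (w * x)) x).
  { intros x. apply (ex_derive_continuous (K := R_AbsRing) (V := R_NormedModule) (fun x => sin (w * x))).
    auto_derive. auto. }
  assert (K1 : forall x, continuous (fun x => P x 0 * cos (w * x)) x) by (intros; apply (continuous_mul (fun x => P x 0)); auto).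
  assert (K2 : forall x, continuous (fun x => P x 0 * sin (w * x)) x) by (intros; apply (continuous_mul (fun x => P x 0)); auto).
  assert (K3 : forall x, continuous (fun x => Q x 0 * cos (w * x)) x) by (intros; apply (continuous_mul (fun x => Q x 0)); auto).
  assert (K4 : forall x, continuous (fun x => Q x 0 * sin (w * x)) x) by (intros; apply (continuous_mul (fun x => Q x 0)); auto).
  assert (O : forall f, (forall x, continuous f x) -> forall x, continuous (fun x => -1 * f x) x)
    by (intros f Hf x; apply continuous_mul; [apply continuous_const|apply Hf]).
  split.
  - rewrite RInt_add in E1 by auto.
    rewrite (RInt_ext _ (fun x => P x 0 * cos (w * x) + -1 * (Q x 0 * sin (w * x)))) in E3.
    2:{ intros x _. replace (2 * PI * - INR n * x) with (- (w * x)) by (unfold w; ring).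
        rewrite cos_neg, sin_neg. eqR. ring. }
    rewrite RInt_add, RInt_mul in E3 by auto.
    apply (half_sum_bound _ _ _ E1). eapply Rle_trans; [|exact E3]. right. f_equal. eqR. ring.
  - rewrite (RInt_ext _ (fun x => Q x 0 * cos (w * x) + -1 * (P x 0 * sin (w * x)))) in E2
      by (intros x _; eqR; ring).
    rewrite RInt_add, RInt_mul in E2 by auto.
    rewrite (RInt_ext _ (fun x => Q x 0 * cos (w * x) + P x 0 * sin (w * x))) in E4.
    2:{ intros x _. replace (2 * PI * - INR n * x) with (- (w * x)) by (unfold w; ring).
        rewrite cos_neg, sin_neg. eqR. ring. }
    rewrite RInt_add in E4 by auto.
    apply (half_sum_bound _ _ _ E4). eapply Rle_trans; [|exact E2]. right. f_equal. eqR. ring.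
Qed.

Lemma coef_split phi x0 n : (forall x, continuous phi x) ->
  coef phi x0 n = RInt (fun x => phi x * cos (2 * PI * INR n * x)) 0 1 * cos (2 * PI * INR n * x0)
    + RInt (fun x => phi x * sin (2 * PI * INR n * x)) 0 1 * sin (2 * PI * INR n * x0).
Proof.
  intros Hc. set (w := 2 * PI * INR n).
  assert (Hcs : forall x, continuous (fun x => phi x * cos (w * x)) x).
  { intros x. apply continuous_mul; [apply Hc|].
    apply (ex_derive_continuous (K := R_AbsRing) (V := R_NormedModule) (fun x => cos (w * x))).
    auto_derive. auto. }
  assert (Hsn : forall x, continuous (fun x => phi x * sin (w * x)) x).
  { intros x. apply continuous_mul; [apply Hc|].
    apply (ex_derive_continuous (K := R_AbsRing) (V := R_NormedModule) (fun x => sin (w * x))).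
    auto_derive. auto. }
  unfold coef.
  rewrite (RInt_ext _ (fun x => cos (w * x0) * (phi x * cos (w * x)) + sin (w * x0) * (phi x * sin (w * x)))).
  - rewrite RInt_add, !RInt_mul by (auto; intros; apply continuous_mul; auto; apply continuous_const).
    eqR. ring.
  - intros x _. replace (INR n * (2 * PI * (x - x0))) with (w * x - w * x0) by (unfold w; ring).
    rewrite cos_minus. eqR. ring.
Qed.

Lemma exp_pow x n : exp x ^ n = exp (x * INR n).
Proof.
  induction n as [|n IH]; [simpl; rewrite Rmult_0_r, exp_0; reflexivity|].
  rewrite S_INR. simpl pow. rewrite IH, <- exp_plus. f_equal. ring.
Qed.

(** A geometric series with first term 8: each cosine and sine coefficient is at most [2 M] times
    the decay, they are two, and all but the mean occur twice in the series. *)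
Definition fourier_const (d : R) : R := 8 / (1 - exp (- (2 * PI * d))).

(** The coefficients decay at the rate of the width [a']. Weighed at the smaller width [a''], their
    atoms form a geometric series of ratio [exp (- 2 pi (a' - a''))], which converges absolutely as
    [fourier_inversion] requires. *)
Lemma fourier_W a a' a'' b M P Q : 0 <= a'' < a' -> a' < a -> 0 <= b ->
  (forall x t, Rabs t < a -> CR_at P Q x t) ->
  (forall x t, Rabs t < a -> P (x + 1) t = P x t /\ Q (x + 1) t = Q x t) ->
  (forall x t, Rabs t <= a' -> Rabs (P x t) <= M /\ Rabs (Q x t) <= M) ->
  W a'' b (fourier_const (a' - a'') * M) (fun x _ => P x 0).
Proof.
  intros Ha Ha' Hb HCR Hper HM.
  pose proof (fourier_coef_bound a a' M P Q ltac:(lra) HCR Hper HM) as HB.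
  assert (HM0 : 0 <= M).
  { destruct (HM 0 0) as [E _]; [rewrite Rabs_R0; lra|]. pose proof (Rabs_pos (P 0 0)). lra. }
  assert (H0 : Rabs 0 < a) by (rewrite Rabs_R0; lra).
  set (phi := fun x => P x 0).
  assert (Hc : forall x, continuous phi x)
    by (intros x; destruct (HCR x 0 H0) as [C1 _]; apply (continuity_2d_slice _ _ _ C1)).
  set (A := fun n : nat => RInt (fun x => phi x * cos (2 * PI * INR n * x)) 0 1 : R).
  set (B := fun n : nat => RInt (fun x => phi x * sin (2 * PI * INR n * x)) 0 1 : R).
  set (r := exp (- (2 * PI * (a' - a'')))).
  assert (Hr : 0 <= r < 1).
  { pose proof PI_ge_3. split; [left; apply exp_pos|]. unfold r. rewrite <- exp_0. apply exp_increasing. nra. }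
  set (fn := fun n x (_ : R) => match n with O => coef phi x 0 | S n => 2 * coef phi x (S n) end).
  assert (Hrn : forall n : nat, exp (- (2 * PI * a' * INR n)) * carrier_norm a'' (Z.of_nat n) = r ^ n).
  { intros n. unfold carrier_norm, r. rewrite <- INR_IZR_INZ, (Rabs_pos_eq (INR n)), <- exp_plus by apply pos_INR.
    rewrite exp_pow. f_equal. ring. }
  assert (Hcoef : forall n : nat, W a'' b (4 * M * r ^ n) (fun x _ => coef phi x n)).
  { intros n. destruct (HB n) as [HA HBn].
    change (Rabs (A n) <= 2 * M * exp (- (2 * PI * a' * INR n))) in HA.
    change (Rabs (B n) <= 2 * M * exp (- (2 * PI * a' * INR n))) in HBn.
    pose proof (W_atom_cos a'' b (A n) (Z.of_nat n) 0 0 (proj1 Ha) Hb) as W1.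
    pose proof (W_atom_cos a'' b (B n) (Z.of_nat n) (- (PI / 2)) 0 (proj1 Ha) Hb) as W2.
    pose proof (W_plus _ _ _ _ _ _ _ W1 W2) as W3.
    apply (W_ext _ _ _ _ _ (fun x _ => coef phi x n)) in W3.
    - eapply W_le; [|exact W3]. simpl. rewrite !Rmult_1_r, <- Rmult_plus_distr_r, <- Hrn, <- Rmult_assoc.
      apply Rmult_le_compat_r; [left; apply carrier_norm_pos|]. lra.
    - intros x y _. rewrite coef_split by exact Hc. fold (A n). fold (B n).
      rewrite sin_as_cos, <- INR_IZR_INZ, Rplus_0_r. simpl. ring. }
  assert (Hfn : forall n, W a'' b (8 * M * r ^ n) (fn n)).
  { intros [|n]; simpl fn.
    - eapply W_le; [|apply Hcoef]. simpl. lra.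
    - pose proof (W_lin _ _ _ _ _ 2 (Hcoef (S n))) as W1. eapply W_le; [|exact W1].
      rewrite (Rabs_pos_eq 2) by lra. right. ring. }
  assert (Hsum : forall n, psum (fun n => 8 * M * r ^ n) n <= fourier_const (a' - a'') * M).
  { intros n. eapply Rle_trans; [apply psum_geom; [lra|exact Hr]|].
    unfold fourier_const. fold r. right. field. lra. }
  apply (W_series _ _ _ _ _ fn _ Hfn Hsum).
  intros x y Hy.
  assert (Hbs : bsum (fun n => fn n x y) (fourier_const (a' - a'') * M)).
  { apply (bsum_le_pos _ (fun n => 8 * M * r ^ n) (fourier_const (a' - a'') * M)); [|lra|exact Hsum].
    intros n. apply (W_bound _ _ _ _ _ x y (Hfn n) Hy). }
  pose proof (bsum_is_series _ _ Hbs) as HS.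
  replace (P x 0) with (Series (fun n => fn n x y)); [exact HS|].
  apply (fourier_inversion phi M Hc).
  - intros z. apply (Hper z 0 H0).
  - intros z. apply (HM z 0). rewrite Rabs_R0; lra.
  - intros z. destruct (HCR z 0 H0) as [_ [_ [p [q [_ [_ L]]]]]].
    apply locally_2d_singleton in L. exists (p z 0). apply L.
  - apply is_series_psum in HS. apply is_lim_seq_incr_1 in HS. revert HS. apply is_lim_seq_ext.
    intros n. unfold partial_sum. induction n as [|n IH]; [simpl; ring|].
    cbn [psum] in *. rewrite IH. simpl fn. ring.
Qed.

(** * Expansion of the map at the curve *)

Lemma coef_le c rho M k : 0 < rho -> c * rho ^ k <= M -> c <= M / rho ^ k.
Proof.
  intros Hr H. pose proof (pow_lt rho k Hr) as P. apply Rmult_le_reg_r with (rho ^ k); [exact P|].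
  unfold Rdiv. rewrite Rmult_assoc, Rinv_l by lra. rewrite Rmult_1_r. exact H.
Qed.

Lemma pseries_tail (d : nat -> R) rho M g y N : 0 < rho -> (forall k, Rabs (d k) * rho ^ k <= M) ->
  Rabs y <= rho / 2 -> is_series (fun k => d k * y ^ k) g ->
  Rabs (g - psum (fun k => d k * y ^ k) N) <= 2 * M * (2 / rho) ^ N * Rabs y ^ N.
Proof.
  intros Hr Hd Hy Hg.
  assert (HM : 0 <= M).
  { specialize (Hd 0%nat). simpl in Hd. pose proof (Rabs_pos (d 0%nat)). lra. }
  set (h := fun k => if (k <? N)%nat then d k * y ^ k else 0).
  assert (Hh : is_series h (psum (fun k => d k * y ^ k) N)).
  { apply (is_series_finite_eq h N).
    - intros i Hi. unfold h. destruct (Nat.ltb_spec i N); [lia|reflexivity].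
    - apply psum_ext. intros i Hi. unfold h. destruct (Nat.ltb_spec i N); [reflexivity|lia]. }
  pose proof (is_series_minus _ _ _ _ Hg Hh) as HD.
  set (B := M * ((2 / rho) ^ N * Rabs y ^ N)).
  assert (HB : 0 <= B).
  { apply Rmult_le_pos; [exact HM|]. apply Rmult_le_pos; apply pow_le; [|apply Rabs_pos].
    left. apply Rdiv_lt_0_compat; lra. }
  change (is_series (fun k => d k * y ^ k - h k) (g - psum (fun k => d k * y ^ k) N)) in HD.
  apply (is_series_Rabs_le _ _ _ HD).
  apply (bsum_le_pos _ (fun k => B * (1 / 2) ^ k) (B / (1 - 1 / 2))).
  - intros k. unfold h. destruct (Nat.ltb_spec k N) as [Hk|Hk].
    + unfold Rminus. rewrite Rplus_opp_r, Rabs_R0. apply Rmult_le_pos; [exact HB|apply pow_le; lra].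
    + rewrite Rminus_0_r, Rabs_mult, <- RPow_abs.
      apply Rle_trans with (M / rho ^ k * Rabs y ^ k).
      * apply Rmult_le_compat_r; [apply pow_le, Rabs_pos|]. apply coef_le; auto.
      * unfold B. replace k with (N + (k - N))%nat at 1 2 3 by lia. rewrite !pow_add.
        assert (Q : Rabs y ^ (k - N) <= (rho / 2) ^ (k - N))
          by (apply pow_incr; split; [apply Rabs_pos|exact Hy]).
        pose proof (pow_lt rho N Hr). pose proof (pow_lt rho (k - N) Hr).
        pose proof (pow_lt (1 / 2) N ltac:(lra)).
        replace (2 / rho) with (/ (rho * (1 / 2))) by (field; lra).
        rewrite pow_inv, Rpow_mult_distr.
        replace (rho / 2) with (rho * (1 / 2)) in Q by field. rewrite Rpow_mult_distr in Q.
        pose proof (pow_le (Rabs y) N (Rabs_pos y)).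
        apply Rle_trans with (M / (rho ^ N * rho ^ (k - N)) * (Rabs y ^ N * (rho ^ (k - N) * (1 / 2) ^ (k - N)))).
        -- apply Rmult_le_compat_l.
           ++ apply Rmult_le_pos; [lra|]. left. apply Rinv_0_lt_compat. nra.
           ++ apply Rmult_le_compat_l; lra.
        -- right. field. repeat split; lra.
  - replace (B / (1 - 1 / 2)) with (2 * B) by field. unfold B. right. ring.
  - intros n. apply psum_geom; [exact HB|lra].
Qed.

(** Strong induction: if [d k] were the first nonzero coefficient, then [d k y^k] would be of order
    [y^(k+1)], which fails at the explicit [y] below. *)
Lemma pseries_low_zero (d : nat -> R) rho M K s (g : R -> R) : 0 < rho -> (forall k, Rabs (d k) * rho ^ k <= M) ->
  (forall y, Rabs y < rho -> is_series (fun k => d k * y ^ k) (g y)) ->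
  (forall y, Rabs y < rho -> Rabs (g y) <= K * Rabs y ^ s) -> forall k, (k < s)%nat -> d k = 0.
Proof.
  intros Hr Hd Hg Hs k. induction k as [k IH] using (well_founded_induction Wf_nat.lt_wf). intros Hk.
  destruct (Req_dec (d k) 0) as [|Hne]; [assumption|exfalso].
  pose proof (Rabs_pos_lt _ Hne) as Hdk.
  assert (HM : 0 <= M).
  { specialize (Hd 0%nat). simpl in Hd. pose proof (Rabs_pos (d 0%nat)). lra. }
  set (C := 2 * M * (2 / rho) ^ S k).
  assert (HC : 0 <= C).
  { apply Rmult_le_pos; [lra|]. apply pow_le. left. apply Rdiv_lt_0_compat; lra. }
  set (y := Rmin (Rmin 1 (rho / 2)) (Rabs (d k) / (2 * (Rabs K + C + 1)))).
  pose proof (Rabs_pos K) as HK.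
  assert (Hy0 : 0 < y).
  { apply Rmin_pos; [apply Rmin_pos; lra|]. apply Rdiv_lt_0_compat; lra. }
  assert (Hy1 : y <= 1 /\ y <= rho / 2).
  { unfold y. pose proof (Rmin_l (Rmin 1 (rho / 2)) (Rabs (d k) / (2 * (Rabs K + C + 1)))).
    pose proof (Rmin_l 1 (rho / 2)). pose proof (Rmin_r 1 (rho / 2)). lra. }
  assert (Hy2 : y * (2 * (Rabs K + C + 1)) <= Rabs (d k)).
  { apply Rle_trans with (Rabs (d k) / (2 * (Rabs K + C + 1)) * (2 * (Rabs K + C + 1))).
    - apply Rmult_le_compat_r; [lra|apply Rmin_r].
    - right. field. lra. }
  assert (Hya : Rabs y = y) by (apply Rabs_pos_eq; lra).
  pose proof (pseries_tail d rho M (g y) y (S k) Hr Hd ltac:(lra) (Hg y ltac:(lra))) as T.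
  pose proof (Hs y ltac:(lra)) as G. fold C in T. rewrite Hya in T, G. cbn [psum] in T.
  rewrite (psum_ext _ (fun _ => 0)), psum_zero, Rplus_0_l in T.
  2:{ intros i Hi. rewrite (IH i Hi ltac:(lia)). ring. }
  pose proof (pow_lt y k Hy0) as Pk.
  assert (Hys : y ^ s <= y * y ^ k).
  { replace s with (S k + (s - S k))%nat by lia. rewrite pow_add. simpl pow at 1.
    rewrite <- (Rmult_1_r (y * y ^ k)) at 2. apply Rmult_le_compat_l; [nra|].
    rewrite <- (pow1 (s - S k)). apply pow_incr. lra. }
  assert (E : Rabs (d k) * y ^ k <= (Rabs K + C) * y * y ^ k).
  { replace (Rabs (d k) * y ^ k) with (Rabs (d k * y ^ k)) by (rewrite Rabs_mult, (Rabs_pos_eq (y ^ k)); lra).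
    replace (d k * y ^ k) with (g y - (g y - d k * y ^ k)) by ring.
    eapply Rle_trans; [apply Rabs_triang|]. rewrite Rabs_Ropp.
    assert (K * y ^ s <= Rabs K * (y * y ^ k)).
    { apply Rle_trans with (Rabs K * y ^ s); [|apply Rmult_le_compat_l; lra].
      apply Rmult_le_compat_r; [apply pow_le; lra|apply Rle_abs]. }
    simpl pow in T. lra. }
  apply Rmult_le_reg_r in E; [|exact Pk]. nra.
Qed.

Lemma csum_head (a : nat -> C) l : csum (fun k => Cmult (a k) (Cpow (RtoC 0) k)) l -> l = a 0%nat.
Proof.
  intros H. apply (csum_unique _ _ _ H). split; apply (is_series_finite_eq _ 1).
  - intros [|i] Hi; [lia|]. rewrite Cpow_S, Cmult_0_l, Cmult_0_r. reflexivity.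
  - cbn [psum]. replace (Cpow (RtoC 0) 0) with (RtoC 1) by reflexivity. rewrite Cmult_1_r, Rplus_0_l. reflexivity.
  - intros [|i] Hi; [lia|]. rewrite Cpow_S, Cmult_0_l, Cmult_0_r. reflexivity.
  - cbn [psum]. replace (Cpow (RtoC 0) 0) with (RtoC 1) by reflexivity. rewrite Cmult_1_r, Rplus_0_l. reflexivity.
Qed.

Lemma is_series_swap (a : nat -> nat -> R) M r q s : dbsum a M -> (forall i, is_series (a i) (r i)) ->
  is_series r s -> (forall j, is_series (fun i => a i j) (q j)) -> is_series q s.
Proof.
  intros H Hr Hs Hq. destruct (dsum_swap a M H) as [s' [A [B _]]].
  replace s with s'.
  - revert B. apply is_series_ext. intros j. apply is_series_unique, Hq.
  - apply (is_series_unique_R (fun i => Series (a i)) _ _ A). revert Hs. apply is_series_ext.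
    intros i. symmetry. apply is_series_unique, Hr.
Qed.

Lemma dbsum_le (a b : nat -> nat -> R) M : (forall i j, Rabs (a i j) <= b i j) ->
  (forall n m, psum (fun i => psum (b i) m) n <= M) -> dbsum a M.
Proof.
  intros H HM n m. eapply Rle_trans; [|apply (HM n m)]. apply psum_le. intros i _. apply psum_le. auto.
Qed.

Lemma csum_swap (T : nat -> nat -> C) M r q s :
  (forall n m, psum (fun i => psum (fun j => Cmod (T i j)) m) n <= M) -> (forall i, csum (T i) (r i)) ->
  csum r s -> (forall j, csum (fun i => T i j) (q j)) -> csum q s.
Proof.
  intros HM Hr [Hs1 Hs2] Hq. split.
  - apply (is_series_swap (fun i j => Re (T i j)) M (fun i => Re (r i))); auto.
    + apply (dbsum_le _ (fun i j => Cmod (T i j))); auto. intros; apply Rabs_Re_le.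
    + intros i. apply Hr.
    + intros j. apply Hq.
  - apply (is_series_swap (fun i j => Im (T i j)) M (fun i => Im (r i))); auto.
    + apply (dbsum_le _ (fun i j => Cmod (T i j))); auto. intros; apply Rabs_Im_le.
    + intros i. apply Hr.
    + intros j. apply Hq.
Qed.

(** [H (z, y)] is the sum of [c k z * y^k], with coefficient functions defined on the whole strip
    and analytic with local radii and bounds. Only real [y] occur, while [z] is complex for the sake
    of the contour shift. *)
Definition has_coefs (a : R) (H : C * C -> C) (c : nat -> C -> C) : Prop :=
  forall z0, Rabs (Im z0) < a -> exists rho M, 0 < rho /\ 0 <= M /\
    (forall k, analytic_at (c k) z0 rho (M / rho ^ k)) /\
    forall u y, Cmod u < rho -> Rabs y < rho ->
      csum (fun k => Cmult (c k (Cplus z0 u)) (Cpow (RtoC y) k)) (H (Cplus z0 u, RtoC y)).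

Lemma csum_coef_unique (d d' : nat -> C) rho M rho' M' (g : R -> C) : 0 < rho -> 0 < rho' ->
  (forall k, Cmod (d k) * rho ^ k <= M) -> (forall k, Cmod (d' k) * rho' ^ k <= M') ->
  (forall y, Rabs y < rho -> csum (fun k => Cmult (d k) (Cpow (RtoC y) k)) (g y)) ->
  (forall y, Rabs y < rho' -> csum (fun k => Cmult (d' k) (Cpow (RtoC y) k)) (g y)) ->
  forall k, d k = d' k.
Proof.
  intros Hr Hr' Hd Hd' Hg Hg' k.
  set (r := Rmin rho rho'). assert (H0 : 0 < r) by (apply Rmin_pos; assumption).
  assert (r <= rho) by apply Rmin_l. assert (r <= rho') by apply Rmin_r.
  assert (HB : forall p : C -> R, (forall z, Rabs (p z) <= Cmod z) -> forall k, Rabs (p (d k) - p (d' k)) * r ^ k <= M + M').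
  { intros p Hp i. apply Rle_trans with ((Cmod (d i) + Cmod (d' i)) * r ^ i).
    - apply Rmult_le_compat_r; [apply pow_le; lra|]. eapply Rle_trans; [apply Rabs_triang|].
      rewrite Rabs_Ropp. pose proof (Hp (d i)). pose proof (Hp (d' i)). lra.
    - rewrite Rmult_plus_distr_r. apply Rplus_le_compat.
      + eapply Rle_trans; [|apply (Hd i)]. apply Rmult_le_compat_l; [apply Cmod_ge_0|apply pow_incr; lra].
      + eapply Rle_trans; [|apply (Hd' i)]. apply Rmult_le_compat_l; [apply Cmod_ge_0|apply pow_incr; lra]. }
  assert (Hz : forall p : C -> R, (forall z, Rabs (p z) <= Cmod z) ->
    (forall y, Rabs y < r -> is_series (fun k => (p (d k) - p (d' k)) * y ^ k) 0) -> p (d k) = p (d' k)).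
  { intros p Hp Hy. apply Rminus_diag_uniq.
    apply (pseries_low_zero (fun k => p (d k) - p (d' k)) r (M + M') 0 (S k) (fun _ => 0)); auto.
    - intros y _. rewrite Rabs_R0. lra. }
  assert (E1 : Re (d k) = Re (d' k)).
  { apply Hz; [apply Rabs_Re_le|]. intros y Hy.
    destruct (Hg y ltac:(lra)) as [S1 _]. destruct (Hg' y ltac:(lra)) as [S2 _].
    pose proof (is_series_minus _ _ _ _ S1 S2) as S3.
    replace 0 with (plus (Re (g y)) (opp (Re (g y)))) by (apply Rplus_opp_r).
    revert S3. apply is_series_ext. intros n. rewrite <- !RtoC_pow, !re_scal_r. unfold plus, opp; simpl. ring. }
  assert (E2 : Im (d k) = Im (d' k)).
  { apply Hz; [apply Rabs_Im_le|]. intros y Hy.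
    destruct (Hg y ltac:(lra)) as [_ S1]. destruct (Hg' y ltac:(lra)) as [_ S2].
    pose proof (is_series_minus _ _ _ _ S1 S2) as S3.
    replace 0 with (plus (Im (g y)) (opp (Im (g y)))) by (apply Rplus_opp_r).
    revert S3. apply is_series_ext. intros n. rewrite <- !RtoC_pow, !im_scal_r. unfold plus, opp; simpl. ring. }
  destruct (d k), (d' k). simpl in *. congruence.
Qed.

Lemma psum_box_geom M q q' n m : 0 <= M -> 0 <= q <= 1 / 2 -> 0 <= q' <= 1 / 2 ->
  psum (fun i => psum (fun j => M * q ^ i * q' ^ j) m) n <= 4 * M.
Proof.
  intros HM Hq Hq'.
  assert (G : forall M q n, 0 <= M -> 0 <= q <= 1 / 2 -> psum (fun i => M * q ^ i) n <= 2 * M).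
  { intros M0 q0 n0 HM0 Hq0. eapply Rle_trans; [apply psum_geom; lra|].
    apply Rmult_le_reg_r with (1 - q0); [lra|].
    replace (M0 / (1 - q0) * (1 - q0)) with M0 by (field; lra). nra. }
  apply Rle_trans with (psum (fun i => 2 * M * q ^ i) n).
  - apply psum_le. intros i _. eapply Rle_trans; [apply G; auto; apply Rmult_le_pos; [lra|apply pow_le; lra]|].
    right. ring.
  - eapply Rle_trans; [apply G; lra|]. lra.
Qed.

(** Analyticity provides an unrelated double expansion at every point of the strip. Regrouping the
    one at [z0] by powers of [y] gives functions [D k] near [z0], and uniqueness of coefficients
    glues them together. *)
Lemma has_coefs_ex a b H : 0 < b -> analytic2 C_AbsRing (complex_strip a b) H ->
  exists c, has_coefs a H c.
Proof.
  intros Hb HA.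
  destruct (fun_choice (fun (z0 : C) (t : (nat -> nat -> C) * (R * R)) => Rabs (Im z0) < a ->
    0 < fst (snd t) /\ (forall j k, Cmod (fst t j k) * fst (snd t) ^ (j + k) <= snd (snd t)) /\
    forall u v : C, Cmod u < fst (snd t) -> Cmod v < fst (snd t) -> exists S : nat -> C,
      (forall j, csum (fun k => Cmult (fst t j k) (Cpow v k)) (S j)) /\
      csum (fun k => Cmult (S k) (Cpow u k)) (H (Cplus z0 u, v)))) as [t Ht].
  { intros z0. destruct (Rlt_dec (Rabs (Im z0)) a) as [Hz|Hz].
    - destruct (HA (z0, RtoC 0)) as [c [rho [M [H1 [H2 H3]]]]].
      { split; simpl; [exact Hz|]. rewrite Cmod_0. exact Hb. }
      exists (c, (rho, M)). intros _. simpl. split; [exact H1|]. split; [exact H2|].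
      intros u v Hu Hv. destruct (H3 u v Hu Hv) as [S [S1 S2]]. exists S. split.
      + intros j. apply is_pseries_csum, S1.
      + apply is_pseries_csum. simpl in S2.
        replace v with (plus (RtoC 0) v) at 1; [exact S2|]. apply (Cplus_0_l v).
    - exists (fun _ _ => RtoC 0, (0, 0)). intros; lra. }
  (* The coefficient at [z] is read off the expansion centred at [z] itself. *)
  set (c := fun k z => fst (t z) 0%nat k). exists c.
  assert (Hself : forall z0, Rabs (Im z0) < a -> forall y, Rabs y < fst (snd (t z0)) ->
    csum (fun k => Cmult (c k z0) (Cpow (RtoC y) k)) (H (z0, RtoC y))).
  { intros z0 Hz y Hy. destruct (Ht z0 Hz) as [H1 [H2 H3]].
    destruct (H3 (RtoC 0) (RtoC y)) as [S [S1 S2]]; [rewrite Cmod_0; exact H1|rewrite Cmod_R; exact Hy|].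
    rewrite Cplus_0_r in S2. apply csum_head in S2. rewrite S2. apply S1. }
  intros z0 Hz. destruct (Ht z0 Hz) as [H1 [H2 H3]]. set (rho := fst (snd (t z0))) in *.
  set (M := snd (snd (t z0))) in *. set (C0 := fst (t z0)) in *.
  assert (HM : 0 <= M).
  { specialize (H2 0%nat 0%nat). simpl in H2. pose proof (Cmod_ge_0 (C0 0%nat 0%nat)). lra. }
  set (r := Rmin (rho / 2) (a - Rabs (Im z0))).
  assert (Hr : 0 < r) by (apply Rmin_pos; lra).
  assert (Hr1 : r <= rho / 2) by apply Rmin_l. assert (Hr2 : r <= a - Rabs (Im z0)) by apply Rmin_r.
  assert (Hcr : forall j k, Cmod (C0 j k) * (r ^ j * r ^ k) <= M).
  { intros j k. eapply Rle_trans; [|apply (H2 j k)]. apply Rmult_le_compat_l; [apply Cmod_ge_0|].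
    rewrite <- pow_add. apply pow_incr. lra. }
  assert (Hq : forall s, 0 <= s < r -> 0 <= s / rho <= 1 / 2).
  { intros s Hs. split; [apply Rmult_le_pos; [lra|left; apply Rinv_0_lt_compat; lra]|].
    apply Rmult_le_reg_r with rho; [lra|]. replace (s / rho * rho) with s by (field; lra). lra. }
  assert (Hterm : forall u v j k, 0 <= u -> 0 <= v -> Cmod (C0 j k) * (u ^ j * v ^ k) <= M * (u / rho) ^ j * (v / rho) ^ k).
  { intros u v j k Hu Hv. unfold Rdiv. rewrite !Rpow_mult_distr, !pow_inv.
    pose proof (pow_lt rho j H1). pose proof (pow_lt rho k H1).
    apply Rle_trans with (M / rho ^ (j + k) * (u ^ j * v ^ k)).
    - apply Rmult_le_compat_r; [apply Rmult_le_pos; apply pow_le; assumption|]. apply coef_le; auto.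
    - rewrite pow_add. right. field. lra. }
  assert (HD : forall k (u : C), exists l, Cmod u < r -> csum (fun j => Cmult (C0 j k) (Cpow u j)) l).
  { intros k u. destruct (Rlt_dec (Cmod u) r) as [Hu|Hu]; [|exists (RtoC 0); intros; lra].
    destruct (csum_ex (fun j => Cmult (C0 j k) (Cpow u j)) (fun j => M / rho ^ k * (Cmod u / rho) ^ j)
      (M / rho ^ k / (1 - Cmod u / rho))) as [l Hl].
    - intros j. rewrite Cmod_mult, Cmod_pow. pose proof (Hterm (Cmod u) 1 j k (Cmod_ge_0 u) ltac:(lra)) as Q.
      rewrite pow1, Rmult_1_r in Q. eapply Rle_trans; [exact Q|]. right.
      unfold Rdiv. rewrite Rmult_1_l, pow_inv. ring.
    - intros n. apply psum_geom.
      + apply Rmult_le_pos; [exact HM|]. left. apply Rinv_0_lt_compat, pow_lt, H1.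
      + pose proof (Hq (Cmod u) (conj (Cmod_ge_0 u) Hu)). lra.
    - exists l. auto. }
  destruct (fun_choice (fun (k : nat) (D : C -> C) => forall u, Cmod u < r ->
    csum (fun j => Cmult (C0 j k) (Cpow u j)) (D u))) as [D HDD].
  { intros k. destruct (fun_choice _ (HD k)) as [Dk HDk]. exists Dk. exact HDk. }
  assert (Hsum : forall u y, Cmod u < r -> Rabs y < r ->
    csum (fun k => Cmult (D k u) (Cpow (RtoC y) k)) (H (Cplus z0 u, RtoC y))).
  { intros u y Hu Hy. destruct (H3 u (RtoC y)) as [S [S1 S2]]; [lra|rewrite Cmod_R; lra|].
    apply (csum_swap (fun j k => Cmult (Cpow u j) (Cmult (C0 j k) (Cpow (RtoC y) k))) (4 * M)
      (fun j => Cmult (S j) (Cpow u j))).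
    - intros n m. eapply Rle_trans; [|apply (psum_box_geom M (Cmod u / rho) (Rabs y / rho) n m HM)].
      + apply psum_le. intros i _. apply psum_le. intros j _.
        rewrite !Cmod_mult, !Cmod_pow, Cmod_R.
        eapply Rle_trans; [|apply (Hterm (Cmod u) (Rabs y) i j); [apply Cmod_ge_0|apply Rabs_pos]]. right. ring.
      + apply Hq. split; [apply Cmod_ge_0|exact Hu].
      + apply Hq. split; [apply Rabs_pos|exact Hy].
    - intros j. rewrite (Cmult_comm (S j)). apply csum_scal, S1.
    - exact S2.
    - intros k. rewrite (Cmult_comm (D k u)).
      apply (csum_ext (fun j => Cmult (Cpow (RtoC y) k) (Cmult (C0 j k) (Cpow u j)))); [intros; ring|].
      apply csum_scal, HDD, Hu. }
  assert (HDb : forall u k, Cmod u < r -> Cmod (D k u) * rho ^ k <= 4 * M).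
  { intros u k Hu. pose proof (pow_lt rho k H1).
    apply Rle_trans with (4 * M / rho ^ k * rho ^ k); [|right; field; lra].
    apply Rmult_le_compat_r; [lra|].
    replace (4 * M / rho ^ k) with (2 * (M / rho ^ k / (1 - 1 / 2))) by (field; lra).
    assert (0 <= M / rho ^ k) by (apply Rmult_le_pos; [exact HM|left; apply Rinv_0_lt_compat; lra]).
    apply (csum_bound _ _ (fun j => M / rho ^ k * (1 / 2) ^ j) _ (HDD k u Hu)).
    - intros j. rewrite Cmod_mult, Cmod_pow.
      pose proof (Hterm (Cmod u) 1 j k (Cmod_ge_0 u) ltac:(lra)) as Q.
      rewrite pow1, Rmult_1_r in Q. eapply Rle_trans; [exact Q|].
      apply Rle_trans with (M / rho ^ k * (Cmod u / rho) ^ j).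
      + right. unfold Rdiv. rewrite Rmult_1_l, pow_inv. ring.
      + apply Rmult_le_compat_l; [assumption|]. apply pow_incr. apply Hq. split; [apply Cmod_ge_0|exact Hu].
    - intros n. apply psum_geom; lra. }
  (* The gluing: at [z0 + u] both families expand the same function of [y], hence they agree, and
     [c k] inherits the analyticity of [D k]. *)
  assert (HcD : forall u k, Cmod u < r -> c k (Cplus z0 u) = D k u).
  { intros u k Hu. assert (Hzu : Rabs (Im (Cplus z0 u)) < a).
    { simpl. eapply Rle_lt_trans; [apply Rabs_triang|]. pose proof (Rabs_Im_le u). unfold Im in *. lra. }
    destruct (Ht _ Hzu) as [T1 [T2 _]].
    apply (csum_coef_unique (fun k => c k (Cplus z0 u)) (fun k => D k u) (fst (snd (t (Cplus z0 u))))
      (snd (snd (t (Cplus z0 u)))) r (4 * M) (fun y => H (Cplus z0 u, RtoC y))); auto.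
    - intros i. apply (T2 0%nat i).
    - intros i. eapply Rle_trans; [|apply (HDb u i Hu)]. apply Rmult_le_compat_l; [apply Cmod_ge_0|].
      apply pow_incr. lra. }
  exists r, M. split; [exact Hr|]. split; [exact HM|]. split.
  - intros k. exists (fun j => C0 j k). split.
    + intros j. apply coef_le; [exact Hr|]. rewrite Rmult_assoc. apply Hcr.
    + intros u Hu. rewrite HcD by exact Hu. apply HDD, Hu.
  - intros u y Hu Hy. apply (csum_ext (fun k => Cmult (D k u) (Cpow (RtoC y) k))); [|apply Hsum; assumption].
    intros k. rewrite HcD by exact Hu. reflexivity.
Qed.

Lemma has_coefs_at a H c z : has_coefs a H c -> Rabs (Im z) < a -> exists rho M, 0 < rho /\
  (forall k, Cmod (c k z) * rho ^ k <= M) /\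
  forall y, Rabs y < rho -> csum (fun k => Cmult (c k z) (Cpow (RtoC y) k)) (H (z, RtoC y)).
Proof.
  intros Hc Hz. destruct (Hc z Hz) as [rho [M [Hr [HM [HA HS]]]]].
  exists rho, (4 * M). split; [exact Hr|]. split.
  - intros k. pose proof (pow_lt rho k Hr).
    pose proof (analytic_at_bound _ _ _ _ (RtoC 0) Hr (HA k) ltac:(rewrite Cmod_0; lra)) as B.
    rewrite Cplus_0_r in B. apply Rle_trans with (4 * (M / rho ^ k) * rho ^ k).
    + apply Rmult_le_compat_r; lra.
    + right. field. lra.
  - intros y Hy. specialize (HS (RtoC 0) y ltac:(rewrite Cmod_0; lra) Hy).
    rewrite Cplus_0_r in HS. exact HS.
Qed.

Lemma has_coefs_zero a H c z : has_coefs a H c -> Rabs (Im z) < a -> H (z, RtoC 0) = c 0%nat z.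
Proof.
  intros Hc Hz. destruct (has_coefs_at _ _ _ _ Hc Hz) as [rho [M [Hr [_ HS]]]].
  apply (csum_head (fun k => c k z)), HS. rewrite Rabs_R0. exact Hr.
Qed.

(** Compactness of the rectangle over one period makes the local radii and bounds uniform. *)
Lemma has_coefs_uniform a a' H c : has_coefs a H c -> 0 < a' < a -> exists d, 0 < d /\
  forall x t, 0 <= x <= 1 -> Rabs t <= a' ->
    (forall k, Cmod (c k (x, t)) <= 4 / d / d ^ k) /\
    forall y, Rabs y < d -> csum (fun k => Cmult (c k (x, t)) (Cpow (RtoC y) k)) (H ((x, t), RtoC y)).
Proof.
  intros Hc Ha.
  destruct (fun_choice (fun (z : C) (p : R * R) => Rabs (Im z) < a -> 0 < fst p /\ 0 <= snd p /\
    (forall k, analytic_at (c k) z (fst p) (snd p / fst p ^ k)) /\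
    forall u y, Cmod u < fst p -> Rabs y < fst p ->
      csum (fun k => Cmult (c k (Cplus z u)) (Cpow (RtoC y) k)) (H (Cplus z u, RtoC y)))) as [p Hp].
  { intros z. destruct (Rlt_dec (Rabs (Im z)) a) as [Hz|Hz].
    - destruct (Hc z Hz) as [rho [M HM]]. exists (rho, M). intros _. exact HM.
    - exists (0, 0). intros; lra. }
  (* One gauge serves for both: it is at most [rho / 4], and [delta * (M + 1) <= 1] gives
     [M <= / delta]. *)
  destruct (fun_choice (fun (z : R * R) (d : posreal) => Rabs (snd z) <= a' ->
    pos d <= fst (p z) / 4 /\ pos d * (snd (p z) + 1) <= 1)) as [delta Hdelta].
  { intros z. destruct (Rle_dec (Rabs (snd z)) a') as [Hz|Hz].
    - destruct (Hp z ltac:(unfold Im; lra)) as [H1 [H2 _]].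
      assert (Hm : 0 < Rmin (fst (p z) / 4) (/ (snd (p z) + 1)))
        by (apply Rmin_pos; [lra|apply Rinv_0_lt_compat; lra]).
      exists (mkposreal _ Hm). intros _. simpl. split; [apply Rmin_l|].
      apply Rle_trans with (/ (snd (p z) + 1) * (snd (p z) + 1)).
      + apply Rmult_le_compat_r; [lra|apply Rmin_r].
      + right. field. lra.
    - exists (mkposreal 1 Rlt_0_1). intros; lra. }
  destruct (compactness_value_2d 0 1 (- a') a' (fun u v => delta (u, v))) as [d Hd].
  exists d. split; [apply cond_pos|]. intros x t Hx Ht. pose proof (cond_pos d) as Hd0.
  destruct (NNPP _ (Hd x t Hx (proj1 (Rabs_le_between t a') Ht)))
    as [u [v [Hu [Hv [H1 [H2 H3]]]]]].
  assert (Hva : Rabs v <= a') by (apply Rabs_le; exact Hv).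
  destruct (Hdelta (u, v) Hva) as [D1 D2]. destruct (Hp (u, v) ltac:(simpl; lra)) as [P1 [P2 [P3 P4]]].
  set (rho := fst (p (u, v))) in *. set (M := snd (p (u, v))) in *.
  assert (E : (x, t) = Cplus (u, v) (x - u, t - v)) by (unfold Cplus; simpl; f_equal; ring).
  assert (Hz : Cmod (x - u, t - v) <= rho / 2).
  { eapply Rle_trans; [apply Cmod_le_Re_Im|]. simpl. lra. }
  split.
  - intros k. rewrite E. eapply Rle_trans; [apply (analytic_at_bound _ _ _ _ _ P1 (P3 k) Hz)|].
    pose proof (pow_lt d k Hd0). pose proof (pow_lt rho k P1).
    assert (pos d ^ k <= rho ^ k) by (apply pow_incr; lra).
    assert (M <= / d).
    { apply Rmult_le_reg_r with d; [exact Hd0|]. rewrite Rinv_l by lra. nra. }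
    unfold Rdiv. rewrite !Rmult_assoc. apply Rmult_le_compat_l; [lra|].
    apply Rmult_le_compat; [exact P2|left; apply Rinv_0_lt_compat; lra|assumption|].
    apply Rinv_le_contravar; assumption.
  - intros y Hy. rewrite E. apply P4; lra.
Qed.

Lemma csum_plus_head (a : nat -> C) l n y :
  csum (fun k => Cmult (a k) (Cpow (RtoC y) k)) l ->
  csum (fun k => Cmult (match k with O => Cplus (a O) n | _ => a k end) (Cpow (RtoC y) k)) (Cplus l n).
Proof.
  intros [H1 H2].
  assert (HF : csum (fun k => match k with O => n | _ => RtoC 0 end) n).
  { split; apply (is_series_finite_eq _ 1); try (intros [|i] Hi; [lia|reflexivity]); simpl; unfold Re, Im; ring. }
  destruct HF as [F1 F2]. split.
  - generalize (is_series_plus _ _ _ _ H1 F1). apply is_series_ext. intros [|k].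
    + change (Re (Cmult (a 0%nat) (RtoC 1)) + Re n = Re (Cmult (Cplus (a 0%nat) n) (RtoC 1))).
      rewrite !Cmult_1_r. reflexivity.
    + apply Rplus_0_r.
  - generalize (is_series_plus _ _ _ _ H2 F2). apply is_series_ext. intros [|k].
    + change (Im (Cmult (a 0%nat) (RtoC 1)) + Im n = Im (Cmult (Cplus (a 0%nat) n) (RtoC 1))).
      rewrite !Cmult_1_r. reflexivity.
    + apply Rplus_0_r.
Qed.

Lemma Re_series_near (d : nat -> C) rho M y l : 0 < rho -> (forall k, Cmod (d k) * rho ^ k <= M) ->
  Rabs y <= rho / 2 -> csum (fun k => Cmult (d k) (Cpow (RtoC y) k)) l ->
  Rabs (Re l - Re (d 0%nat)) <= 4 * M / rho * Rabs y.
Proof.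
  intros Hr Hd Hy [H1 _].
  assert (Hb : forall k, Rabs (Re (d k)) * rho ^ k <= M).
  { intros k. eapply Rle_trans; [|apply (Hd k)]. apply Rmult_le_compat_r; [apply pow_le; lra|apply Rabs_Re_le]. }
  assert (H2 : is_series (fun k => Re (d k) * y ^ k) (Re l)).
  { revert H1. apply is_series_ext. intros n. rewrite <- RtoC_pow, re_scal_r. reflexivity. }
  pose proof (pseries_tail _ rho M _ y 1 Hr Hb Hy H2) as T. simpl in T.
  rewrite !Rmult_1_r, Rplus_0_l in T. eapply Rle_trans; [exact T|]. right. field. lra.
Qed.

(** The integer in the hypothesis may depend on [y]. Near [y = 0] continuity forces it to be the one
    at 0, and uniqueness of coefficients then shows that only the coefficient of order 0 changes
    under the period. *)
Lemma coef_shift a b H c z : 0 < b -> has_coefs a H c -> Rabs (Im z) < a ->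
  (forall y, Rabs y < b -> exists n : Z, H (Cplus z (RtoC 1), RtoC y) = Cplus (H (z, RtoC y)) (RtoC (IZR n))) ->
  forall k, c (S k) (Cplus z (RtoC 1)) = c (S k) z.
Proof.
  intros Hb Hc Hz Hn.
  assert (Hz1 : Rabs (Im (Cplus z (RtoC 1))) < a) by (simpl; rewrite Rplus_0_r; exact Hz).
  destruct (has_coefs_at _ _ _ _ Hc Hz) as [rho [M [Hr [HM HS]]]].
  destruct (has_coefs_at _ _ _ _ Hc Hz1) as [rho1 [M1 [Hr1 [HM1 HS1]]]].
  destruct (Hn 0) as [n0 Hn0]; [rewrite Rabs_R0; exact Hb|].
  rewrite (has_coefs_zero _ _ _ _ Hc Hz), (has_coefs_zero _ _ _ _ Hc Hz1) in Hn0.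
  assert (HM0 : 0 <= M).
  { specialize (HM 0%nat). simpl in HM. pose proof (Cmod_ge_0 (c 0%nat z)). lra. }
  assert (HM10 : 0 <= M1).
  { specialize (HM1 0%nat). simpl in HM1. pose proof (Cmod_ge_0 (c 0%nat (Cplus z (RtoC 1)))). lra. }
  (* For [K |y| < 1] the two integers differ by less than 1. *)
  set (K := 4 * M / rho + 4 * M1 / rho1 + 1).
  assert (HK1 : 0 <= 4 * M / rho) by (apply Rmult_le_pos; [lra|left; apply Rinv_0_lt_compat; lra]).
  assert (HK2 : 0 <= 4 * M1 / rho1) by (apply Rmult_le_pos; [lra|left; apply Rinv_0_lt_compat; lra]).
  assert (HK : 0 < K) by (unfold K; lra).
  set (r := Rmin (Rmin b (/ K)) (Rmin (rho / 2) (rho1 / 2))).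
  assert (H0 : 0 < r).
  { apply Rmin_pos; apply Rmin_pos; try lra. apply Rinv_0_lt_compat, HK. }
  assert (Hrs : r <= b /\ r <= / K /\ r <= rho / 2 /\ r <= rho1 / 2).
  { unfold r. pose proof (Rmin_l (Rmin b (/ K)) (Rmin (rho / 2) (rho1 / 2))).
    pose proof (Rmin_r (Rmin b (/ K)) (Rmin (rho / 2) (rho1 / 2))).
    pose proof (Rmin_l b (/ K)). pose proof (Rmin_r b (/ K)).
    pose proof (Rmin_l (rho / 2) (rho1 / 2)). pose proof (Rmin_r (rho / 2) (rho1 / 2)). lra. }
  assert (Hy : forall y, Rabs y < r -> H (Cplus z (RtoC 1), RtoC y) = Cplus (H (z, RtoC y)) (RtoC (IZR n0))).
  { intros y Hyr. destruct (Hn y ltac:(lra)) as [n E]. rewrite E. do 3 f_equal.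
    pose proof (Re_series_near _ rho M y _ Hr HM ltac:(lra) (HS y ltac:(lra))) as N1.
    pose proof (Re_series_near _ rho1 M1 y _ Hr1 HM1 ltac:(lra) (HS1 y ltac:(lra))) as N2.
    rewrite E, Hn0 in N2. simpl in N2.
    assert (KY : K * Rabs y < 1).
    { apply Rlt_le_trans with (K * / K); [apply Rmult_lt_compat_l; lra|right; field; lra]. }
    assert (Rabs (IZR n - IZR n0) < 1).
    { replace (IZR n - IZR n0) with ((Re (H (z, RtoC y)) + IZR n - (Re (c 0%nat z) + IZR n0)) - (Re (H (z, RtoC y)) - Re (c 0%nat z))) by ring.
      eapply Rle_lt_trans; [apply Rabs_triang|]. rewrite Rabs_Ropp. unfold Re in *. unfold K in KY.
      pose proof (Rabs_pos y). lra. }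
    apply Rabs_def2 in H1. rewrite <- minus_IZR in H1. destruct H1 as [A1 A2].
    apply lt_IZR in A1. apply (lt_IZR (-1)) in A2. lia. }
  assert (HU : forall k, c k (Cplus z (RtoC 1)) = match k with O => Cplus (c 0%nat z) (RtoC (IZR n0)) | _ => c k z end).
  { apply (csum_coef_unique _ _ r M1 r (M + Rabs (IZR n0)) (fun y => H (Cplus z (RtoC 1), RtoC y)) H0 H0).
    - intros k. eapply Rle_trans; [|apply (HM1 k)]. apply Rmult_le_compat_l; [apply Cmod_ge_0|].
      apply pow_incr. lra.
    - intros [|k].
      + rewrite Rmult_1_r. eapply Rle_trans; [apply Cmod_triangle|]. rewrite Cmod_R.
        specialize (HM 0%nat). rewrite Rmult_1_r in HM. lra.
      + apply Rle_trans with M; [|pose proof (Rabs_pos (IZR n0)); lra].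
        eapply Rle_trans; [|apply (HM (S k))]. apply Rmult_le_compat_l; [apply Cmod_ge_0|].
        apply pow_incr. lra.
    - intros y Hyr. apply HS1. lra.
    - intros y Hyr. rewrite Hy by exact Hyr. apply (csum_plus_head (fun k => c k z)), HS. lra. }
  intros k. apply (HU (S k)).
Qed.

Lemma unit_translate x : exists n, 0 <= x + IZR n <= 1.
Proof.
  destruct (archimed x) as [A1 A2]. exists (1 - up x)%Z. rewrite minus_IZR. lra.
Qed.

Lemma is_series_shift (a : nat -> R) s (l : R) : is_series (fun k => a (k + s)%nat) l -> is_series a (psum a s + l).
Proof.
  revert l. induction s as [|s IH]; intros l H.
  - simpl. rewrite Rplus_0_l. revert H. apply is_series_ext. intros n. f_equal. lia.
  - cbn [psum]. rewrite Rplus_assoc. apply IH. apply is_series_decr_1.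
    replace (plus _ _) with l.
    + revert H. apply is_series_ext. intros n. f_equal. lia.
    + change (l = a s + l + - a s). ring.
Qed.

(** The coefficients of order at least [s] are periodic, so [fourier_W] turns each into a sum of
    atoms of norm proportional to [d^(-k)]; at height [d / 2] these sum geometrically. The final
    identity is stated on one period, where the uniform radius holds and where the low coefficients
    need no periodicity. *)
Lemma coefs_W a a0 H c s : 0 < a0 < a -> has_coefs a H c ->
  (forall k z, (s <= k)%nat -> Rabs (Im z) < a -> c k (Cplus z (RtoC 1)) = c k z) ->
  let h := fun x y => Series (fun k => Re (c (k + s)%nat (x, 0)) * y ^ k) in
  exists b0 M0, 0 < b0 /\ W a0 b0 M0 h /\
    forall x y, 0 <= x <= 1 -> Rabs y <= b0 ->
      Re (H (RtoC x, RtoC y)) = psum (fun k => Re (c k (x, 0)) * y ^ k) s + y ^ s * h x y.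
Proof.
  intros Ha Hc Hper h. set (a' := (a0 + a) / 2).
  destruct (has_coefs_uniform a a' H c Hc ltac:(unfold a'; lra)) as [d [Hd HU]].
  assert (Hshift : forall k x t, (s <= k)%nat -> Rabs t < a ->
    Re (c k (x + 1, t)) = Re (c k (x, t)) /\ Im (c k (x + 1, t)) = Im (c k (x, t))).
  { intros k x t Hk Ht. replace (x + 1, t) with (Cplus (x, t) (RtoC 1))
      by (unfold Cplus, RtoC; simpl; f_equal; ring).
    rewrite Hper; auto. }
  assert (HB : forall k x t, (s <= k)%nat -> Rabs t <= a' ->
    Rabs (Re (c k (x, t))) <= 4 / d / d ^ k /\ Rabs (Im (c k (x, t))) <= 4 / d / d ^ k).
  { intros k x t Hk Ht. assert (Hta : Rabs t < a) by (unfold a' in Ht; lra).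
    destruct (unit_translate x) as [n Hn].
    pose proof (period_Z (fun x => Re (c k (x, t))) (fun x => proj1 (Hshift k x t Hk Hta)) x n) as E1.
    pose proof (period_Z (fun x => Im (c k (x, t))) (fun x => proj2 (Hshift k x t Hk Hta)) x n) as E2.
    simpl in E1, E2. rewrite <- E1, <- E2. destruct (HU _ t Hn Ht) as [B _].
    split; (eapply Rle_trans; [|apply (B k)]); [apply Rabs_Re_le|apply Rabs_Im_le]. }
  set (KF := fourier_const (a' - a0)). set (b0 := d / 2).
  assert (Hb0 : 0 <= b0) by (unfold b0; lra).
  set (M := KF * (4 / d / d ^ s)).
  assert (HW : forall k, W a0 b0 (M * (1 / 2) ^ k) (fun x y => Re (c (k + s)%nat (x, 0)) * y ^ k)).
  { intros k.
    assert (W1 : W a0 b0 (KF * (4 / d / d ^ (k + s))) (fun x _ => Re (c (k + s)%nat (x, 0)))).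
    { apply (fourier_W a a' a0 b0 (4 / d / d ^ (k + s)) (fun x t => Re (c (k + s)%nat (x, t)))
        (fun x t => Im (c (k + s)%nat (x, t)))); [unfold a'; lra|unfold a'; lra|exact Hb0| | |].
      - intros x t Ht. destruct (Hc (x, t) Ht) as [rho [M1 [Hr [_ [HA _]]]]].
        exact (analytic_at_CR _ _ _ _ _ Hr (HA (k + s)%nat)).
      - intros x t Ht. apply Hshift; [lia|exact Ht].
      - intros x t Ht. apply HB; [lia|exact Ht]. }
    pose proof (W_mult _ _ _ _ _ _ W1 (W_pow _ _ _ _ k (W_y a0 b0 ltac:(lra) Hb0))) as W2.
    cbv beta in W2. eapply W_le; [|exact W2]. right. unfold M, b0, Rdiv.
    rewrite pow_add, !Rpow_mult_distr, pow1. field.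
    repeat split; try apply pow_nonzero; lra. }
  pose proof (W_M_pos _ _ _ _ _ (HW 0%nat)) as HM. rewrite Rmult_1_r in HM.
  assert (Hser : forall x y, Rabs y <= b0 ->
    is_series (fun k => Re (c (k + s)%nat (x, 0)) * y ^ k) (h x y)).
  { intros x y Hy. apply (bsum_is_series _ (M / (1 - 1 / 2))).
    apply (bsum_le_pos _ (fun k => M * (1 / 2) ^ k) (M / (1 - 1 / 2))); [|lra|].
    - intros k. apply (W_bound _ _ _ _ _ x y (HW k) Hy).
    - intros n. apply psum_geom; lra. }
  exists b0, (M / (1 - 1 / 2)). split; [unfold b0; lra|]. split.
  - apply (W_series _ _ _ _ _ (fun k x y => Re (c (k + s)%nat (x, 0)) * y ^ k) h HW); [|exact Hser].
    intros n. apply psum_geom; lra.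
  - intros x y Hx Hy. destruct (HU x 0 Hx) as [_ HS]; [rewrite Rabs_R0; unfold a'; lra|].
    destruct (HS y) as [S1 _]; [unfold b0 in Hy; lra|].
    apply (is_series_unique_R (fun k => Re (c k (x, 0)) * y ^ k)).
    + revert S1. apply is_series_ext. intros n. rewrite <- RtoC_pow, re_scal_r. reflexivity.
    + apply is_series_shift. generalize (is_series_cmult (y ^ s) _ _ (Hser x y Hy)).
      apply is_series_ext. intros n. eqR. rewrite pow_add. ring.
Qed.

Lemma pseries_low_coefs (d e : nat -> R) rho M Me g N K s delta : 0 < rho -> 0 < delta ->
  (forall k, Rabs (d k) * rho ^ k <= M) -> (forall k, Rabs (e k) <= Me) ->
  (forall y, Rabs y < rho -> is_series (fun k => d k * y ^ k) (g y)) ->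
  (forall y, Rabs y < delta -> Rabs (g y - psum (fun k => e k * y ^ k) N) <= K * Rabs y ^ s) ->
  forall k, (k < s)%nat -> d k = if (k <? N)%nat then e k else 0.
Proof.
  intros Hr Hdel Hd He Hg Hs k Hk. apply Rminus_diag_uniq.
  set (r := Rmin (Rmin rho delta) 1).
  assert (H0 : 0 < r) by (repeat apply Rmin_pos; lra).
  assert (Hrs : r <= rho /\ r <= delta /\ r <= 1).
  { unfold r. pose proof (Rmin_l (Rmin rho delta) 1). pose proof (Rmin_r (Rmin rho delta) 1).
    pose proof (Rmin_l rho delta). pose proof (Rmin_r rho delta). lra. }
  apply (pseries_low_zero (fun k => d k - if (k <? N)%nat then e k else 0) r (M + Me) K s
    (fun y => g y - psum (fun k => e k * y ^ k) N)); auto.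
  - intros i. apply Rle_trans with ((Rabs (d i) + Me) * r ^ i).
    + apply Rmult_le_compat_r; [apply pow_le; lra|]. eapply Rle_trans; [apply Rabs_triang|].
      rewrite Rabs_Ropp. apply Rplus_le_compat_l. destruct (i <? N)%nat; [apply He|].
      rewrite Rabs_R0. eapply Rle_trans; [apply Rabs_pos|apply (He 0%nat)].
    + rewrite Rmult_plus_distr_r. apply Rplus_le_compat.
      * eapply Rle_trans; [|apply (Hd i)]. apply Rmult_le_compat_l; [apply Rabs_pos|apply pow_incr; lra].
      * rewrite <- (Rmult_1_r Me) at 2. apply Rmult_le_compat_l.
        -- eapply Rle_trans; [apply Rabs_pos|apply (He 0%nat)].
        -- rewrite <- (pow1 i). apply pow_incr. lra.
  - intros y Hy.
    assert (HE : is_series (fun k => (if (k <? N)%nat then e k else 0) * y ^ k) (psum (fun k => e k * y ^ k) N)).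
    { apply (is_series_finite_eq _ N).
      - intros i Hi. destruct (Nat.ltb_spec i N); [lia|ring].
      - apply psum_ext. intros i Hi. destruct (Nat.ltb_spec i N); [reflexivity|lia]. }
    generalize (is_series_minus _ _ _ _ (Hg y ltac:(lra)) HE). apply is_series_ext.
    intros n. unfold plus, opp; simpl. eqR. ring.
  - intros y Hy. apply Hs. lra.
Qed.

Lemma real_low_coefs a b H c (phi : R -> R -> R) (e : R -> nat -> R) N K s delta x Me : 0 < delta -> 0 < a -> 0 < b ->
  has_coefs a H c ->
  (forall x y, - b < y < b -> H (RtoC x, RtoC y) = RtoC (phi x y)) ->
  (forall k, Rabs (e x k) <= Me) ->
  (forall y, Rabs y < delta -> Rabs (phi x y - psum (fun k => e x k * y ^ k) N) <= K * Rabs y ^ s) ->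
  forall k, (k < s)%nat -> Re (c k (x, 0)) = if (k <? N)%nat then e x k else 0.
Proof.
  intros Hdel Ha Hb Hc HH He Hg.
  destruct (has_coefs_at _ _ _ (x, 0) Hc) as [rho [M [Hr [HM HS]]]]; [simpl; rewrite Rabs_R0; exact Ha|].
  apply (pseries_low_coefs (fun k => Re (c k (x, 0))) (e x) (Rmin rho b) M Me (phi x) N K s delta); auto.
  - apply Rmin_pos; assumption.
  - intros k. eapply Rle_trans; [|apply (HM k)]. pose proof (Rmin_l rho b).
    assert (0 < Rmin rho b) by (apply Rmin_pos; assumption).
    apply Rmult_le_compat; [apply Rabs_pos|apply pow_le; lra|apply Rabs_Re_le|apply pow_incr; lra].
  - intros y Hy. pose proof (Rmin_l rho b). pose proof (Rmin_r rho b).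
    destruct (HS y ltac:(lra)) as [S1 _]. change (x, 0) with (RtoC x) in *.
    rewrite HH in S1 by (apply Rabs_lt_between; lra).
    change (Re (RtoC (phi x y))) with (phi x y) in S1. revert S1. apply is_series_ext.
    intros n. rewrite <- RtoC_pow, re_scal_r. reflexivity.
Qed.

(** The estimates at [y = 0] determine the coefficients below orders 2 and 3, and [coefs_W] writes
    the rest as [y^2 h1] and [y^3 h2] over one period. To reach all [x], the lift must be seen to
    advance by exactly 1 over a period. *)
Lemma real_trace_normal_form a b fxy a0 M delta : 0 < a0 < a -> 0 < b -> extends_to_complex_strip a b fxy ->
  0 < delta ->
  (forall x y, Rabs y < delta -> Rabs (fst (fxy (x, y)) - (x + y)) <= M * Rabs y ^ 2 /\
     Rabs (snd (fxy (x, y)) - y) <= M * Rabs y ^ 3) ->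
  exists b0 M0 h1 h2, 0 < b0 < b /\ W a0 b0 M0 h1 /\ W a0 b0 M0 h2 /\
    forall x y, Rabs y <= b0 -> fxy (x, y) = (F1 h1 x y, F2 h2 x y).
Proof.
  intros Ha Hb [H1 [H2 [A1 [A2 [Hper Hreal]]]]] Hdel Hg.
  destruct (has_coefs_ex a b H1 Hb A1) as [c1 C1]. destruct (has_coefs_ex a b H2 Hb A2) as [c2 C2].
  assert (Hstrip : forall z y, Rabs (Im z) < a -> Rabs y < b -> complex_strip a b (z, RtoC y)).
  { intros z y Hz Hy. split; simpl; [exact Hz|]. rewrite Cmod_R. exact Hy. }
  assert (P1 : forall k z, (2 <= k)%nat -> Rabs (Im z) < a -> c1 k (Cplus z (RtoC 1)) = c1 k z).
  { intros [|k] z Hk Hz; [lia|]. apply (coef_shift a b H1 c1 z Hb C1 Hz).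
    intros y Hy. apply (Hper z (RtoC y)), Hstrip; assumption. }
  assert (P2 : forall k z, (3 <= k)%nat -> Rabs (Im z) < a -> c2 k (Cplus z (RtoC 1)) = c2 k z).
  { intros [|k] z Hk Hz; [lia|]. apply (coef_shift a b H2 c2 z Hb C2 Hz).
    intros y Hy. exists 0%Z. rewrite Cplus_0_r. apply (Hper z (RtoC y)), Hstrip; assumption. }
  destruct (coefs_W a a0 H1 c1 2 Ha C1 P1) as [b1 [M1 [Hb1 [W1 E1]]]].
  destruct (coefs_W a a0 H2 c2 3 Ha C2 P2) as [b2 [M2 [Hb2 [W2 E2]]]].
  set (h1 := fun x y => Series (fun k => Re (c1 (k + 2)%nat (x, 0)) * y ^ k)) in *.
  set (h2 := fun x y => Series (fun k => Re (c2 (k + 3)%nat (x, 0)) * y ^ k)) in *.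
  assert (L1 : forall x k, (k < 2)%nat -> Re (c1 k (x, 0)) = if (k =? 0)%nat then x else 1).
  { intros x k Hk.
    rewrite (real_low_coefs a b H1 c1 (fun x y => fst (fxy (x, y))) (fun x k => if (k =? 0)%nat then x else 1) 2 M 2
      delta x (Rabs x + 1) Hdel ltac:(lra) Hb C1 (fun x y Hy => proj1 (Hreal x y Hy))).
    - destruct (Nat.ltb_spec k 2); [reflexivity|lia].
    - intros i. pose proof (Rabs_pos x). destruct (i =? 0)%nat; [lra|rewrite Rabs_R1; lra].
    - intros y Hy. eapply Rle_trans; [|apply (Hg x y Hy)]. right. f_equal. simpl. ring.
    - exact Hk. }
  assert (L2 : forall x k, (k < 3)%nat -> Re (c2 k (x, 0)) = if (k =? 1)%nat then 1 else 0).
  { intros x k Hk.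
    rewrite (real_low_coefs a b H2 c2 (fun x y => snd (fxy (x, y))) (fun x k => if (k =? 1)%nat then 1 else 0) 3 M 3
      delta x 1 Hdel ltac:(lra) Hb C2 (fun x y Hy => proj2 (Hreal x y Hy))).
    - destruct (Nat.ltb_spec k 3); [reflexivity|lia].
    - intros i. destruct (i =? 1)%nat; [rewrite Rabs_R1|rewrite Rabs_R0]; lra.
    - intros y Hy. eapply Rle_trans; [|apply (Hg x y Hy)]. right. f_equal. simpl. ring.
    - exact Hk. }
  pose proof (Rabs_pos M) as HM.
  (* For [|y| <= q] and [|y| <= 1] the deviation of the first component from [x + y] is at most 1/4,
     so the integer by which it advances lies strictly between 0 and 2. *)
  set (q := / (4 * (Rabs M + 1))).
  assert (Hq : 0 < q) by (apply Rinv_0_lt_compat; lra).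
  assert (HqM : q * (4 * (Rabs M + 1)) = 1) by (unfold q; field; lra).
  set (b0 := Rmin (Rmin (Rmin b1 b2) (Rmin (b / 2) (delta / 2))) (Rmin 1 q)).
  assert (H0 : 0 < b0) by (repeat apply Rmin_pos; lra).
  assert (Hbs : b0 <= b1 /\ b0 <= b2 /\ b0 <= b / 2 /\ b0 <= delta / 2 /\ b0 <= 1 /\ b0 <= q).
  { unfold b0.
    pose proof (Rmin_l (Rmin (Rmin b1 b2) (Rmin (b / 2) (delta / 2))) (Rmin 1 q)).
    pose proof (Rmin_r (Rmin (Rmin b1 b2) (Rmin (b / 2) (delta / 2))) (Rmin 1 q)).
    pose proof (Rmin_l (Rmin b1 b2) (Rmin (b / 2) (delta / 2))).
    pose proof (Rmin_r (Rmin b1 b2) (Rmin (b / 2) (delta / 2))).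
    pose proof (Rmin_l b1 b2). pose proof (Rmin_r b1 b2).
    pose proof (Rmin_l (b / 2) (delta / 2)). pose proof (Rmin_r (b / 2) (delta / 2)).
    pose proof (Rmin_l 1 q). pose proof (Rmin_r 1 q). lra. }
  assert (W1' : W a0 b0 (Rmax M1 M2) h1) by (apply (W_mono _ a0 b1 M1); [lra|lra|apply Rmax_l|exact W1]).
  assert (W2' : W a0 b0 (Rmax M1 M2) h2) by (apply (W_mono _ a0 b2 M2); [lra|lra|apply Rmax_r|exact W2]).
  exists b0, (Rmax M1 M2), h1, h2. split; [lra|]. split; [exact W1'|]. split; [exact W2'|].
  assert (Hunit : forall x y, 0 <= x <= 1 -> Rabs y <= b0 -> fxy (x, y) = (F1 h1 x y, F2 h2 x y)).
  { intros x y Hx Hy. destruct (Hreal x y ltac:(apply Rabs_lt_between; lra)) as [R1 R2].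
    specialize (E1 x y Hx ltac:(lra)). specialize (E2 x y Hx ltac:(lra)).
    rewrite R1 in E1. rewrite R2 in E2. cbn [psum] in E1, E2.
    rewrite !L1 in E1 by lia. rewrite !L2 in E2 by lia. simpl Nat.eqb in E1, E2. cbv iota in E1, E2.
    change (Re (RtoC (fst (fxy (x, y))))) with (fst (fxy (x, y))) in E1.
    change (Re (RtoC (snd (fxy (x, y))))) with (snd (fxy (x, y))) in E2.
    rewrite (surjective_pairing (fxy (x, y))), E1, E2. unfold F1, F2. f_equal; [unfold h1|unfold h2]; ring. }
  assert (Hp1 : forall y, Rabs y <= b0 -> forall x, fst (fxy (x + 1, y)) - (x + 1) = fst (fxy (x, y)) - x).
  { intros y Hy x. assert (Hyb : - b < y < b) by (apply Rabs_lt_between; lra).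
    destruct (Hper (RtoC x) (RtoC y)) as [[n Hn] _]; [apply Hstrip; [simpl; rewrite Rabs_R0; lra|lra]|].
    rewrite <- RtoC_plus in Hn.
    rewrite (proj1 (Hreal x y Hyb)), (proj1 (Hreal (x + 1) y Hyb)), <- RtoC_plus in Hn. apply RtoC_inj in Hn.
    pose proof (proj1 (Hg x y ltac:(lra))) as G1. pose proof (proj1 (Hg (x + 1) y ltac:(lra))) as G2.
    assert (Q : M * Rabs y ^ 2 <= 1 / 4).
    { pose proof (Rabs_pos y). apply Rle_trans with (Rabs M * q).
      - apply Rle_trans with (Rabs M * Rabs y ^ 2).
        + apply Rmult_le_compat_r; [apply pow2_ge_0|apply Rle_abs].
        + apply Rmult_le_compat_l; [exact HM|]. simpl. nra.
      - lra. }
    assert (n = 1%Z); [|subst n; lra].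
    apply Rabs_le_between in G1, G2.
    assert (B1 : 0 < IZR n) by lra. assert (B2 : IZR n < 2) by lra.
    apply lt_IZR in B1, B2. lia. }
  assert (Hp2 : forall y, Rabs y <= b0 -> forall x, snd (fxy (x + 1, y)) = snd (fxy (x, y))).
  { intros y Hy x. assert (Hyb : - b < y < b) by (apply Rabs_lt_between; lra).
    destruct (Hper (RtoC x) (RtoC y)) as [_ Hn]; [apply Hstrip; [simpl; rewrite Rabs_R0; lra|lra]|].
    rewrite <- RtoC_plus in Hn.
    rewrite (proj2 (Hreal x y Hyb)), (proj2 (Hreal (x + 1) y Hyb)) in Hn. apply RtoC_inj in Hn. exact Hn. }
  intros x y Hy. destruct (unit_translate x) as [n Hn].
  pose proof (Hunit _ y Hn Hy) as E.
  pose proof (period_Z _ (Hp1 y Hy) x n) as Q1. pose proof (period_Z _ (Hp2 y Hy) x n) as Q2.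
  simpl in Q1, Q2. rewrite E in Q1, Q2. simpl in Q1, Q2. unfold F1, F2 in *.
  rewrite (W_period _ _ _ _ _ x y n W1' Hy) in Q1. rewrite (W_period _ _ _ _ _ x y n W2' Hy) in Q2.
  rewrite (surjective_pairing (fxy (x, y))). f_equal; lra.
Qed.

(** * Loops on the cylinder *)

Lemma integer_valued_const (g : R -> R) s t : (forall x, continuous g x) -> (forall x, exists n : Z, g x = IZR n) ->
  g s = g t.
Proof.
  intros Hc Hi. destruct (Req_dec (g s) (g t)) as [|Hne]; [assumption|exfalso].
  destruct (Hi s) as [n Hn]. destruct (Hi t) as [m Hm].
  set (k := Z.min n m).
  destruct (IVT_gen_consistent g s t (IZR k + 1 / 2) Hc) as [x [_ Hx]].
  - rewrite Hn, Hm in *. assert (Hnm : n <> m) by (intros ->; auto).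
    unfold k. destruct (Z.min_spec n m) as [[H ->]|[H ->]].
    + assert (IZR (n + 1) <= IZR m) by (apply IZR_le; lia). rewrite plus_IZR in H0.
      rewrite Rmin_left, Rmax_right by lra. lra.
    + assert (IZR (m + 1) <= IZR n) by (apply IZR_le; lia). rewrite plus_IZR in H0.
      rewrite Rmin_right, Rmax_left by lra. lra.
  - destruct (Hi x) as [j Hj]. rewrite Hj in Hx.
    assert (H1 : IZR k < IZR j) by lra. assert (H2 : IZR j < IZR (k + 1)) by (rewrite plus_IZR; lra).
    apply lt_IZR in H1, H2. lia.
Qed.

Lemma continuous_to_pair (f g : R -> R) t : continuous f t -> continuous g t -> continuous (fun t => (f t, g t)) t.
Proof.
  intros Hf Hg. apply (continuous_comp_2 f g (fun x y => (x, y))); auto.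
  apply (continuous_ext (fun p : R * R => p)); [intros [x y]; reflexivity|apply continuous_id].
Qed.

Lemma continuous_fst_comp (c : R -> R * R) t : continuous c t -> continuous (fun t => fst (c t)) t.
Proof. intros Hc. apply (continuous_comp c fst); [exact Hc|]. destruct (c t). apply continuous_fst. Qed.

Lemma continuous_snd_comp (c : R -> R * R) t : continuous c t -> continuous (fun t => snd (c t)) t.
Proof. intros Hc. apply (continuous_comp c snd); [exact Hc|]. destruct (c t). apply continuous_snd. Qed.

Lemma continuous_translate (f : R -> R) s t : (forall t, continuous f t) -> continuous (fun t => f (t + s)) t.
Proof.
  intros Hf. apply (continuous_comp (fun t => t + s) f); [|apply Hf].
  apply (continuous_plus (fun t : R => t) (fun _ => s)); [apply continuous_id|apply continuous_const].
Qed.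

(** The increment of the lift over a period is an integer depending continuously on the homotopy
    parameter, and it is 0 for the constant loop. *)
Lemma null_homotopic_degree J c : null_homotopic J c -> fst (c 1) = fst (c 0).
Proof.
  intros [H [p0 [Hc [_ [He [H0 H1]]]]]].
  (* The retraction of the line onto [[0, 1]]: it extends the homotopy to all parameters, so that
     continuity on the whole line can be used. *)
  set (clamp := fun u : R => (Rabs u - Rabs (u - 1) + 1) / 2).
  assert (Hcl : forall u, 0 <= clamp u <= 1).
  { intros u. unfold clamp, Rabs. destruct (Rcase_abs u), (Rcase_abs (u - 1)); lra. }
  assert (Hcc : forall u, continuous clamp u).
  { intros u. unfold clamp. apply (continuous_mult (fun u => Rabs u - Rabs (u - 1) + 1) (fun _ => / 2));
      [|apply continuous_const].
    apply (continuous_plus (fun u => Rabs u - Rabs (u - 1)) (fun _ => 1)); [|apply continuous_const].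
    apply (continuous_minus Rabs (fun u => Rabs (u - 1))); [apply continuous_Rabs|].
    apply (continuous_comp (fun u => u - 1) Rabs); [|apply continuous_Rabs].
    apply (continuous_minus (fun u : R => u) (fun _ => 1)); [apply continuous_id|apply continuous_const]. }
  assert (HH : forall t u, continuous (fun u => H (clamp u, t)) u).
  { intros t u. unfold continuous.
    apply (filterlim_comp _ _ _ (fun u => (clamp u, t)) H _ (within (fun q => 0 <= fst q <= 1) (locally (clamp u, t)))).
    - intros P HP. unfold within in HP.
      pose proof (continuous_to_pair clamp (fun _ => t) u (Hcc u) (continuous_const _ _) _ HP) as Q.
      unfold filtermap in Q |- *. revert Q. apply filter_imp. intros s Hs. apply Hs, Hcl.
    - apply Hc. simpl. apply Hcl. }
  set (g := fun u => fst (H (clamp u, 1)) - fst (H (clamp u, 0))).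
  assert (E : g 0 = g 1).
  { apply integer_valued_const.
    - intros u. apply (continuous_minus (fun u => fst (H (clamp u, 1))) (fun u => fst (H (clamp u, 0))));
        apply continuous_fst_comp, HH.
    - intros u. destruct (He (clamp u) 0 (Hcl u)) as [n Hn]. exists n. unfold g.
      rewrite Rplus_0_l in Hn. rewrite Hn. simpl. ring. }
  unfold g in E.
  assert (C0 : clamp 0 = 0) by (unfold clamp, Rabs; destruct (Rcase_abs 0), (Rcase_abs (0 - 1)); lra).
  assert (C1 : clamp 1 = 1) by (unfold clamp, Rabs; destruct (Rcase_abs 1), (Rcase_abs (1 - 1)); lra).
  rewrite C0, C1, !H0, !H1 in E. lra.
Qed.

Lemma loop_degree_const J c : is_loop J c -> forall t, fst (c (t + 1)) - fst (c t) = fst (c 1) - fst (c 0).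
Proof.
  intros [Hc [_ He]] t.
  pose proof (integer_valued_const (fun t => fst (c (t + 1)) - fst (c t)) t 0) as E.
  cbv beta in E. rewrite Rplus_0_l in E. apply E.
  - intros s. apply (continuous_minus (fun t => fst (c (t + 1))) (fun t => fst (c t))).
    + apply (continuous_translate (fun t => fst (c t))). intros; apply continuous_fst_comp, Hc.
    + apply continuous_fst_comp, Hc.
  - intros s. destruct (He s) as [n Hn]. exists n. rewrite Hn. simpl. ring.
Qed.

(** For degree 0 the lift is periodic, and it contracts linearly to the origin inside the strip,
    which is convex and contains 0. *)
Lemma degree_zero_null_homotopic b c : is_loop (sym_itv b) c -> fst (c 1) = fst (c 0) ->
  null_homotopic (sym_itv b) c.
Proof.
  intros Hl Hd. pose proof (loop_degree_const _ _ Hl) as Hdeg. destruct Hl as [Hc [HJ He]].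
  assert (Hper : forall t, c (t + 1) = c t).
  { intros t. specialize (Hdeg t). destruct (He t) as [n Hn].
    rewrite Hn in Hdeg |- *. unfold Defs.shift in *. simpl in Hdeg.
    assert (En : IZR n = 0) by lra. rewrite En, Rplus_0_r. symmetry. apply surjective_pairing. }
  exists (fun q => ((1 - fst q) * fst (c (snd q)), (1 - fst q) * snd (c (snd q)))), (0, 0).
  split; [|split; [|split; [|split]]].
  - intros [u t] _.
    assert (HC : continuous (fun q : R * R => ((1 - fst q) * fst (c (snd q)), (1 - fst q) * snd (c (snd q)))) (u, t)).
    2:{ intros P HP. pose proof (HC P HP) as Q. unfold filtermap, within in Q |- *. revert Q. apply filter_imp. intros q Hq _. exact Hq. }
    assert (K : forall pr : R * R -> R, (forall t, continuous (fun t => pr (c t)) t) ->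
      continuous (fun q : R * R => (1 - fst q) * pr (c (snd q))) (u, t)).
    { intros pr Hp. apply (continuous_mult (fun q : R * R => 1 - fst q) (fun q : R * R => pr (c (snd q)))).
      - apply (continuous_minus (fun _ => 1) (fun q : R * R => fst q)); [apply continuous_const|apply continuous_fst].
      - apply (continuous_comp snd (fun t => pr (c t))); [apply continuous_snd|apply Hp]. }
    apply (continuous_comp_2 (U := prod_UniformSpace R_UniformSpace R_UniformSpace)
      (fun q => (1 - fst q) * fst (c (snd q))) (fun q => (1 - fst q) * snd (c (snd q))) (fun x y => (x, y))).
    + apply K. intros; apply continuous_fst_comp, Hc.
    + apply K. intros; apply continuous_snd_comp, Hc.
    + apply (continuous_ext (fun p : R * R => p)); [intros [x y]; reflexivity|apply continuous_id].
  - intros u t Hu. simpl. specialize (HJ t). unfold sym_itv in *. nra.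
  - intros u t _. exists 0%Z. unfold Defs.shift. simpl. rewrite Hper, Rplus_0_r. reflexivity.
  - intros t. simpl. rewrite Rminus_0_r, !Rmult_1_l. symmetry. apply surjective_pairing.
  - intros t. simpl. rewrite Rminus_diag, !Rmult_0_l. reflexivity.
Qed.

(** Loops [t + c1 t] with periodic [c1] have degree one, hence are not contractible. The integer by
    which the two points may differ is absorbed in the parameter [t']. *)
Lemma intersection_meets a b bs b0 M0 h1 h2 f : W a b0 M0 h1 -> W a b0 M0 h2 -> 0 < bs <= b0 -> b0 < b ->
  (forall x y, Rabs y <= b0 -> f (x, y) = (F1 h1 x y, F2 h2 x y)) ->
  intersection_property (sym_itv b) f -> meets h1 h2 bs.
Proof.
  intros W1 W2 Hbs Hb Hf HI c1 c2 K1 K2 P1 P2 Hc2.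
  set (c := fun t => (t + c1 t, c2 t)).
  assert (Hl : is_loop (sym_itv b) c).
  { split; [|split].
    - intros t. apply continuous_to_pair; [|apply K2].
      apply (continuous_plus (fun t : R => t) c1); [apply continuous_id|apply K1].
    - intros t. simpl. apply Rabs_lt_between. specialize (Hc2 t). lra.
    - intros t. exists 1%Z. unfold c, Defs.shift. simpl. rewrite P1, P2. f_equal. ring. }
  destruct (HI c Hl) as [t [t' [n Hn]]].
  - intros Hn. apply null_homotopic_degree in Hn. unfold c in Hn. simpl in Hn.
    specialize (P1 0). rewrite Rplus_0_l in P1. lra.
  - unfold c in Hn. rewrite Hf in Hn by (specialize (Hc2 t); lra). unfold Defs.shift in Hn. simpl in Hn.
    injection Hn as E1 E2. exists t, (t' + IZR (- n)).
    rewrite (period_Z c1 P1), (period_Z c2 P2), opp_IZR. lra.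
Qed.

Lemma W_continuity_2d a b M f x y : W a b M f -> 0 < a -> Rabs y < b -> continuity_2d_pt f x y.
Proof.
  intros Hf Ha Hy. set (r := Rmin a (b - Rabs y)).
  assert (Hr : 0 < r) by (apply Rmin_pos; lra).
  assert (r <= a) by apply Rmin_l. assert (r <= b - Rabs y) by apply Rmin_r.
  apply (lipschitz_continuity_2d f x y (M / (r / 2)) (r / 2)); [lra|]. intros x' y' Hx Hy'.
  pose proof (W_lip a b M f (r / 2) (r / 2) x y (x' - x) (y' - y) Hf ltac:(lra) ltac:(lra) ltac:(lra) ltac:(lra)) as L.
  replace (x + (x' - x)) with x' in L by ring. replace (y + (y' - y)) with y' in L by ring. lra.
Qed.

Lemma W_continuous_comp a b M f (c1 c2 : R -> R) t : W a b M f -> 0 < a -> Rabs (c2 t) < b ->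
  continuous c1 t -> continuous c2 t -> continuous (fun t => f (c1 t) (c2 t)) t.
Proof.
  intros Hf Ha Hy H1 H2. apply (continuous_comp_2 c1 c2 f); auto.
  apply (continuity_2d_pt_filterlim f). apply (W_continuity_2d a b M); auto.
Qed.

Definition shear (u v : R -> R -> R) (q : R * R) : R * R :=
  (fst q + snd q * u (fst q) (snd q), snd q + snd q ^ 2 * v (fst q) (snd q)).

Lemma shear_shift a b C u v q n : W a b C u -> W a b C v -> Rabs (snd q) <= b ->
  shear u v (Defs.shift n q) = Defs.shift n (shear u v q).
Proof.
  intros Wu Wv Hq. unfold shear, Defs.shift. simpl fst; simpl snd.
  rewrite (W_period _ _ _ _ _ _ _ n Wu), (W_period _ _ _ _ _ _ _ n Wv) by assumption. f_equal. ring.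
Qed.

(** [Phi] commutes with the integer shifts, so it preserves the degree of loops and carries
    noncontractible ones to noncontractible ones. The intersection found for [f] is carried back by
    [Psi]. *)
Lemma intersection_conjugate a b bs C u v (f G Psi : R * R -> R * R) : 0 < a -> 0 < b ->
  W a b C u -> W a b C v ->
  let Phi := shear u v in
  (forall q, strip (sym_itv b) q -> strip (sym_itv bs) (Phi q)) ->
  (forall q, strip (sym_itv b) q -> Psi (Phi q) = q) ->
  (forall q n, strip (sym_itv b) q -> Psi (Defs.shift n (f (Phi q))) = Defs.shift n (G q)) ->
  intersection_property (sym_itv bs) f -> intersection_property (sym_itv b) G.
Proof.
  intros Ha Hb Wu Wv Phi HPhi Hinv HG HI c Hl Hnull.
  assert (Hl' := Hl). destruct Hl' as [Hc [HJ He]].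
  assert (Hy : forall t, Rabs (snd (c t)) < b) by (intros t; apply Rabs_lt_between, HJ).
  assert (Hsh : forall q n, strip (sym_itv b) q -> Phi (Defs.shift n q) = Defs.shift n (Phi q)).
  { intros q n Hq. apply (shear_shift a b C); auto. left. apply Rabs_lt_between, Hq. }
  assert (K1 : forall t, continuous (fun t => fst (c t)) t) by (intros; apply continuous_fst_comp, Hc).
  assert (K2 : forall t, continuous (fun t => snd (c t)) t) by (intros; apply continuous_snd_comp, Hc).
  assert (Hl2 : is_loop (sym_itv bs) (fun t => Phi (c t))).
  { split; [|split].
    - intros t. apply continuous_to_pair.
      + apply (continuous_plus (fun t => fst (c t)) (fun t => snd (c t) * u (fst (c t)) (snd (c t)))); [apply K1|].
        apply (continuous_mult (fun t => snd (c t)) (fun t => u (fst (c t)) (snd (c t)))); [apply K2|].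
        apply (W_continuous_comp a b C u (fun t => fst (c t)) (fun t => snd (c t))); auto.
      + apply (continuous_plus (fun t => snd (c t)) (fun t => snd (c t) ^ 2 * v (fst (c t)) (snd (c t)))); [apply K2|].
        apply (continuous_mult (fun t => snd (c t) ^ 2) (fun t => v (fst (c t)) (snd (c t)))).
        * apply (continuous_ext (fun t => snd (c t) * snd (c t))); [intros; simpl; ring|].
          apply (continuous_mult (fun t => snd (c t)) (fun t => snd (c t))); apply K2.
        * apply (W_continuous_comp a b C v (fun t => fst (c t)) (fun t => snd (c t))); auto.
    - intros t. apply HPhi, HJ.
    - intros t. destruct (He t) as [n Hn]. exists n. rewrite Hn. apply Hsh, HJ. }
  destruct (HI _ Hl2) as [t [t' [n Hn]]].
  - intros H0. apply null_homotopic_degree in H0. apply Hnull.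
    apply degree_zero_null_homotopic; [exact Hl|].
    destruct (He 0) as [n Hn]. rewrite Rplus_0_l in Hn.
    rewrite Hn, Hsh in H0 by apply HJ. rewrite Hn. unfold Defs.shift in *. simpl in *. lra.
  - exists t, t'. exists n. rewrite <- (Hinv (c t')) by apply HJ. rewrite Hn. apply HG, HJ.
Qed.

(** * The change of variables *)

Lemma W_shear_part a b C v n : W a b C v -> exists M, W a b M (fun x y => y ^ n * v x y).
Proof.
  intros Hv. pose proof (W_pos _ _ _ _ _ Hv). exists (b ^ n * C).
  apply (W_mult _ _ _ _ (fun _ y => y ^ n) v); [|exact Hv].
  apply (W_pow a b b (fun _ y => y)), W_y; lra.
Qed.

Lemma analytic2_subset (U U' : R * R -> Prop) f : (forall p, U p -> U' p) ->
  analytic2 R_AbsRing U' f -> analytic2 R_AbsRing U f.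
Proof. intros HU H p Hp. apply H, HU, Hp. Qed.

Lemma W_analytic_perturbation a b b' C u v n : W a b C u -> W a b C v -> 0 < a -> b' <= b ->
  analytic2 R_AbsRing (strip (sym_itv b')) (fun p => fst p + snd p ^ n * u (fst p) (snd p)) /\
  analytic2 R_AbsRing (strip (sym_itv b')) (fun p => fst p + snd p + snd p ^ n * u (fst p) (snd p)) /\
  analytic2 R_AbsRing (strip (sym_itv b')) (fun p => snd p + snd p ^ n * v (fst p) (snd p)).
Proof.
  intros Hu Hv Ha Hb. pose proof (W_pos _ _ _ _ _ Hu) as H0.
  destruct (W_shear_part _ _ _ _ n Hu) as [M Wu]. destruct (W_shear_part _ _ _ _ n Hv) as [M' Wv].
  pose proof (W_y a b ltac:(lra) ltac:(lra)) as Wy.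
  split; [|split].
  - exact (W_analytic2_fst _ _ b' _ _ Wu Ha Hb).
  - pose proof (W_analytic2_fst _ _ b' _ _ (W_plus _ _ _ _ _ _ _ Wy Wu) Ha Hb) as A.
    intros p Hp. destruct (A p Hp) as [c [rho [M0 [A1 [A2 A3]]]]]. exists c, rho, M0.
    split; [exact A1|]. split; [exact A2|]. intros s t Hs Ht. rewrite Rplus_assoc. exact (A3 s t Hs Ht).
  - exact (W_analytic2 _ _ b' _ _ (W_plus _ _ _ _ _ _ _ Wy Wv) Ha Hb).
Qed.

Lemma shear_analytic a b C u v U : W a b C u -> W a b C v -> 0 < a -> (forall p, U p -> Rabs (snd p) < b) ->
  analytic_map U (shear u v).
Proof.
  intros Hu Hv Ha HU.
  assert (HU' : forall p, U p -> strip (sym_itv b) p) by (intros p Hp; apply Rabs_lt_between, HU, Hp).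
  split; apply (analytic2_subset _ _ _ HU').
  - pose proof (proj1 (W_analytic_perturbation a b b C u v 1 Hu Hv Ha (Rle_refl _))) as A.
    intros p Hp. destruct (A p Hp) as [c [rho [M0 [A1 [A2 A3]]]]]. exists c, rho, M0.
    split; [exact A1|]. split; [exact A2|]. intros s t Hs Ht.
    destruct (A3 s t Hs Ht) as [S HS]. exists S. rewrite pow_1 in HS. exact HS.
  - exact (proj2 (proj2 (W_analytic_perturbation a b b C u v 2 Hu Hv Ha (Rle_refl _)))).
Qed.

Lemma continuous_small_locally (g : R * R -> R) p r : continuous g p -> Rabs (g p) < r ->
  locally p (fun q => Rabs (g q) < r).
Proof.
  intros Hg Hr. assert (H0 : 0 < r - Rabs (g p)) by lra.
  pose proof (Hg (fun z => Rabs (z - g p) < r - Rabs (g p))) as Q.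
  assert (HL : locally (g p) (fun z => Rabs (z - g p) < r - Rabs (g p))).
  { exists (mkposreal _ H0). intros z Hz. exact Hz. }
  specialize (Q HL). unfold filtermap in Q. revert Q. apply filter_imp. intros q Hq.
  replace (g q) with ((g q - g p) + g p) by ring.
  eapply Rle_lt_trans; [apply Rabs_triang|]. lra.
Qed.

Lemma continuous_snd_shear a b C u v p : W a b C v -> 0 < a -> Rabs (snd p) < b ->
  continuous (fun q => snd (shear u v q)) p.
Proof.
  intros Hv Ha Hp. destruct p as [x y]. simpl in Hp. destruct (W_shear_part _ _ _ _ 2 Hv) as [M Wv].
  apply (continuous_plus (fun q : R * R => snd q) (fun q => snd q ^ 2 * v (fst q) (snd q))); [apply continuous_snd|].
  apply (continuity_2d_pt_filterlim (fun x y => y ^ 2 * v x y)).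
  apply (W_continuity_2d _ _ _ _ _ _ Wv Ha Hp).
Qed.

Lemma shear_snd_bound a b C u v q : W a b C v -> Rabs (snd q) <= b ->
  Rabs (snd (shear u v q)) <= Rabs (snd q) + Rabs (snd q) ^ 2 * C.
Proof.
  intros Hv Hq. unfold shear. cbn [snd]. eapply Rle_trans; [apply Rabs_triang|]. apply Rplus_le_compat_l.
  rewrite Rabs_mult, <- RPow_abs. apply Rmult_le_compat_l; [apply pow2_ge_0|].
  apply (W_bound _ _ _ _ _ _ _ Hv Hq).
Qed.

(** The derivative inherits the constant of [W_lip_x], which does not blow up as [y] approaches the
    boundary, nor for small [b]; the bound of [W_partials] would. *)
Lemma W_partial1_bound a b M f x y : W a b M f -> 0 < a -> Rabs y < b -> exists d,
  is_derive (fun x => f x y) x d /\ Rabs d <= 4 * M / a.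
Proof.
  intros Hf Ha Hy. destruct (W_partials a b M f x y (Rmin a (b - Rabs y)) Hf) as [d [_ [D _]]].
  - split; [apply Rmin_pos; lra|apply Rmin_l].
  - pose proof (Rmin_r a (b - Rabs y)). lra.
  - exists d. split; [exact D|]. apply is_derive_Reals in D.
    apply Rnot_lt_le. intros Hlt. destruct (D (Rabs d - 4 * M / a) ltac:(lra)) as [del Hdel].
    pose proof (cond_pos del). specialize (Hdel (del / 2) ltac:(lra) ltac:(rewrite Rabs_pos_eq; lra)).
    pose proof (W_lip_x a b M f x (x + del / 2) y Hf Ha Hy) as L.
    replace (x + del / 2 - x) with (del / 2) in L by ring. rewrite (Rabs_pos_eq (del / 2)) in L by lra.
    assert (Q : Rabs ((f (x + del / 2) y - f x y) / (del / 2)) <= 4 * M / a).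
    { unfold Rdiv at 1. rewrite Rabs_mult, (Rabs_pos_eq (/ (del / 2))) by (left; apply Rinv_0_lt_compat; lra).
      apply Rmult_le_reg_r with (del / 2); [lra|]. rewrite Rmult_assoc, Rinv_l by lra. lra. }
    pose proof (Rabs_triang_inv d ((f (x + del / 2) y - f x y) / (del / 2))) as T.
    rewrite Rabs_minus_sym in T. lra.
Qed.

(** The [y] derivatives of [u] and [v] are only bounded by [C / (e b)], but each comes with a factor
    [y] smaller than [b] beyond the factor taken out. This makes the bound uniform in [b]. *)
Lemma shear_jacobian_bound a b e C u v x y : 0 < a -> 0 < e <= 1 -> 0 < b <= 1 -> b < a -> 0 < C ->
  W a ((1 + 5 * e) * b) C u -> W a ((1 + 5 * e) * b) C v -> Rabs y < b ->
  Rabs (jacobian (shear u v) (x, y) - 1) <= (3 * (C / e) + 4 * C / a * (1 + 5 * (C / e))) * Rabs y.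
Proof.
  intros Ha He Hb Hba HC Hu Hv Hy.
  assert (HD : C <= C / e).
  { apply Rmult_le_reg_r with e; [lra|]. replace (C / e * e) with C by (field; lra). nra. }
  set (D := C / e) in *.
  assert (Heb : Rabs y + e * b <= (1 + 5 * e) * b) by nra.
  assert (Hyb : Rabs y < (1 + 5 * e) * b) by nra.
  assert (Hrho : 0 < e * b <= a) by nra.
  destruct (W_partial1_bound _ _ _ _ x y Hu Ha Hyb) as [ux [Dux Bux]].
  destruct (W_partial1_bound _ _ _ _ x y Hv Ha Hyb) as [vx [Dvx Bvx]].
  destruct (W_partials _ _ _ _ x y (e * b) Hu Hrho Heb) as [_ [uy [_ [Duy [_ Buy]]]]].
  destruct (W_partials _ _ _ _ x y (e * b) Hv Hrho Heb) as [_ [vy [_ [Dvy [_ Bvy]]]]].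
  pose proof (W_bound _ _ _ _ _ x y Hu ltac:(lra)) as Bu. pose proof (W_bound _ _ _ _ _ x y Hv ltac:(lra)) as Bv.
  set (Q := 4 * C / a) in *.
  assert (S1 : forall (f : R -> R) (z c l : R), is_derive f z l -> is_derive (fun x => c * f x) z (c * l))
    by (intros f z c l Hf; exact (is_derive_scal f z c l Hf)).
  assert (S2 : forall (f : R -> R) (z l : R), is_derive f z l -> is_derive (fun x => x + f x) z (1 + l))
    by (intros f z l Hf; exact (is_derive_plus (fun x : R => x) f z 1 l (is_derive_id z) Hf)).
  assert (S3 : forall (f : R -> R) (c z l : R), is_derive f z l -> is_derive (fun x => c + f x) z l).
  { intros f c z l Hf. pose proof (is_derive_plus (fun _ : R => c) f z 0 l (is_derive_const c z) Hf) as D0.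
    replace l with (plus 0 l) by apply Rplus_0_l. exact D0. }
  assert (S4 : forall (f g : R -> R) (z k l : R), is_derive f z k -> is_derive g z l ->
    is_derive (fun x => f x * g x) z (k * g z + f z * l))
    by (intros f g z k l Hf Hg; exact (is_derive_mult f g z k l Hf Hg Rmult_comm)).
  assert (J1 : partial1 (fun q => fst (shear u v q)) (x, y) = 1 + y * ux).
  { apply is_derive_unique. apply (S2 (fun x => y * u x y)), (S1 (fun x => u x y)), Dux. }
  assert (J2 : partial2 (fun q => snd (shear u v q)) (x, y) = 1 + (2 * y * v x y + y ^ 2 * vy)).
  { apply is_derive_unique. apply (S2 (fun y => y ^ 2 * v x y)), (S4 (fun y => y ^ 2) (fun y => v x y)).
    - auto_derive; auto. ring.
    - exact Dvy. }
  assert (J3 : partial2 (fun q => fst (shear u v q)) (x, y) = 1 * u x y + y * uy).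
  { apply is_derive_unique.
    exact (S3 (fun y => y * u x y) x y _ (S4 (fun y => y) (fun y => u x y) y 1 uy (is_derive_id y) Duy)). }
  assert (J4 : partial1 (fun q => snd (shear u v q)) (x, y) = y ^ 2 * vx).
  { apply is_derive_unique.
    exact (S3 (fun x => y ^ 2 * v x y) y x _ (S1 (fun x => v x y) x (y ^ 2) vx Dvx)). }
  rewrite Rmult_1_l in J3.
  unfold jacobian. rewrite J1, J2, J3, J4. clear J1 J2 J3 J4.
  pose proof (Rabs_pos y) as Hy0.
  assert (HQ : 0 < Q) by (unfold Q; apply Rdiv_lt_0_compat; lra).
  assert (B1 : forall d, Rabs d <= C / (e * b) -> Rabs (y * d) <= D).
  { intros d Hd. rewrite Rabs_mult. apply Rle_trans with (b * (C / (e * b))).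
    - apply Rmult_le_compat; try apply Rabs_pos; lra.
    - right. unfold D. field. lra. }
  pose proof (B1 uy Buy) as Byu. pose proof (B1 vy Bvy) as Byv.
  set (k := 2 * v x y + y * vy).
  assert (Hk : Rabs k <= 3 * D).
  { unfold k. eapply Rle_trans; [apply Rabs_triang|]. rewrite Rabs_mult, (Rabs_pos_eq 2) by lra. lra. }
  set (l := u x y + y * uy).
  assert (Hl : Rabs l <= 2 * D).
  { unfold l. eapply Rle_trans; [apply Rabs_triang|]. lra. }
  replace ((1 + y * ux) * (1 + (2 * y * v x y + y ^ 2 * vy)) - l * (y ^ 2 * vx) - 1) with
    (y * (k + ux * (1 + y * k) - l * (y * vx))) by (unfold k; ring).
  rewrite Rabs_mult, Rmult_comm. apply Rmult_le_compat_r; [exact Hy0|].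
  assert (Hyk : Rabs (1 + y * k) <= 1 + 3 * D).
  { eapply Rle_trans; [apply Rabs_triang|]. rewrite Rabs_R1, Rabs_mult. apply Rplus_le_compat_l.
    pose proof (Rabs_pos k). nra. }
  assert (Hyv : Rabs (y * vx) <= Q).
  { rewrite Rabs_mult. pose proof (Rabs_pos vx). nra. }
  assert (T1 : Rabs (ux * (1 + y * k)) <= Q * (1 + 3 * D)).
  { rewrite Rabs_mult. apply Rmult_le_compat; try apply Rabs_pos; assumption. }
  assert (T2 : Rabs (l * (y * vx)) <= 2 * D * Q).
  { rewrite Rabs_mult. apply Rmult_le_compat; try apply Rabs_pos; assumption. }
  eapply Rle_trans; [apply Rabs_triang|]. rewrite Rabs_Ropp.
  eapply Rle_trans; [apply Rplus_le_compat_r, Rabs_triang|]. lra.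
Qed.

(** Cauchy estimate with the margin [e b] between the heights [b] and [(1 + e) b]. *)
Lemma W_partial_bounds a b e C g x y : 0 < a -> 0 < e <= 1 -> 0 < b <= 1 -> b < a -> 0 < C ->
  W a ((1 + e) * b) C g -> Rabs y < b ->
  Rabs (partial1 (fun q => g (fst q) (snd q)) (x, y)) <= C / e / b ^ 2 /\
  Rabs (partial2 (fun q => g (fst q) (snd q)) (x, y)) <= C / e / b ^ 2.
Proof.
  intros Ha He Hb Hba HC Hg Hy.
  destruct (W_partials _ _ _ _ x y (e * b) Hg ltac:(nra) ltac:(nra)) as [d1 [d2 [D1 [D2 [B1 B2]]]]].
  assert (HB : C / (e * b) <= C / e / b ^ 2).
  { replace (C / e / b ^ 2) with (C / (e * b) * / b) by (field; lra).
    rewrite <- (Rmult_1_r (C / (e * b))) at 1. apply Rmult_le_compat_l.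
    - left. apply Rdiv_lt_0_compat; nra.
    - rewrite <- Rinv_1. apply Rinv_le_contravar; lra. }
  assert (E1 : partial1 (fun q => g (fst q) (snd q)) (x, y) = d1) by (apply is_derive_unique, D1).
  assert (E2 : partial2 (fun q => g (fst q) (snd q)) (x, y) = d2) by (apply is_derive_unique, D2).
  rewrite E1, E2. lra.
Qed.

Theorem theorem3 (r_minus r_plus : Rbar) (Hr : Rbar_lt r_minus r_plus)
    (f : R * R -> R * R)
    (Hf : cyl_map (strip (itv r_minus r_plus)) (strip (itv r_minus r_plus)) f)
    (Hfan : analytic_map (strip (itv r_minus r_plus)) f)
    (a_star b_star : R) (Ha : 0 < a_star) (Hb : 0 < b_star)
    (Gam Dom : R * R -> Prop) (E : R * R -> R * R)
    (HGam : resonant_curve r_minus r_plus f Gam Dom E)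
    (U V : R * R -> Prop) (kappa psi fxy : R * R -> R * R)
    (Hxy : adapted_coordinates a_star b_star Gam Dom E U V kappa psi fxy)
    (m : nat) (Hm : (2 <= m)%nat)
    (alpha : R) (Halpha : 0 < alpha < a_star) :
  exists K b'_star L : R,
    0 < K /\ 0 < b'_star < b_star /\
    forall b : R, 0 < b < b'_star ->
      exists (A B : R * R -> Prop) (Phi Phi_inv : R * R -> R * R),
        analytic_diffeo A B Phi Phi_inv /\
        (forall q, strip (sym_itv b) q ->
           A q /\ strip (sym_itv b_star) (Phi q) /\ B (fxy (Phi q))) /\
        (forall xi eta, - b < eta < b ->
           Rabs (fst (Phi (xi, eta)) - xi) <= L * Rabs eta /\
           Rabs (snd (Phi (xi, eta)) - eta) <= L * Rabs eta ^ 2 /\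
           Rabs (jacobian Phi (xi, eta) - 1) <= L * Rabs eta) /\
        exists (G : R * R -> R * R) (g1 g2 : R * R -> R),
          (forall q, strip (sym_itv b) q -> cyl_eq (Phi_inv (fxy (Phi q))) (G q)) /\
          analytic_map (strip (sym_itv b)) G /\
          intersection_property (sym_itv b) G /\
          analytic2 R_AbsRing (strip (sym_itv b)) g1 /\
          analytic2 R_AbsRing (strip (sym_itv b)) g2 /\
          (forall xi eta, - b < eta < b ->
             g1 (xi + 1, eta) = g1 (xi, eta) /\
             g2 (xi + 1, eta) = g2 (xi, eta) /\
             G (xi, eta) = (xi + eta + eta ^ m * g1 (xi, eta),
                            eta + eta ^ (m + 1) * g2 (xi, eta)) /\
             Rabs (g1 (xi, eta)) <= K * exp (- (2 * PI * alpha / b)) /\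
             Rabs (g2 (xi, eta)) <= K * exp (- (2 * PI * alpha / b)) /\
             Rabs (partial1 g1 (xi, eta)) <= K / b ^ 2 /\
             Rabs (partial2 g1 (xi, eta)) <= K / b ^ 2 /\
             Rabs (partial1 g2 (xi, eta)) <= K / b ^ 2 /\
             Rabs (partial2 g2 (xi, eta)) <= K / b ^ 2).
Proof.
  destruct Hxy as [_ [_ [_ [_ [_ [Hext [HI [M [delta [Hdel Hg]]]]]]]]]].
  destruct m as [|[|q]]; [lia|lia|]. clear Hm.
  (* The Fourier expansion costs some width and the normal form needs more than [alpha]: the
     midpoint serves both. *)
  destruct (real_trace_normal_form a_star b_star fxy ((alpha + a_star) / 2) M delta ltac:(lra) Hb Hext Hdel Hg)
    as [b0 [M0 [h1 [h2 [Hb0 [W1 [W2 Hfxy]]]]]]].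
  pose proof (intersection_meets _ b_star b0 _ _ _ _ fxy W1 W2 ltac:(lra) ltac:(lra) Hfxy HI) as Hmeets.
  destruct (model_normal_form _ _ _ b0 _ _ W1 W2 ltac:(lra) ltac:(lra) ltac:(lra) Hmeets q alpha ltac:(lra))
    as [ah [C [e [bst [Hah [HC [He [Hbst HN]]]]]]]].
  pose proof (W_M_pos _ _ _ _ _ W1) as HM0.
  assert (HD : C <= C / e).
  { apply Rmult_le_reg_r with e; [lra|]. replace (C / e * e) with C by (field; lra). nra. }
  assert (HQ : 0 < 4 * C / ah) by (apply Rdiv_lt_0_compat; lra).
  set (L := 3 * (C / e) + 4 * C / ah * (1 + 5 * (C / e))).
  assert (HL : C <= L) by (unfold L; nra).
  exists (C / e), (Rmin (Rmin bst ah) (b_star / 2)), L.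
  assert (Hmin : 0 < Rmin (Rmin bst ah) (b_star / 2)) by (repeat apply Rmin_pos; lra).
  pose proof (Rmin_l (Rmin bst ah) (b_star / 2)). pose proof (Rmin_r (Rmin bst ah) (b_star / 2)).
  pose proof (Rmin_l bst ah). pose proof (Rmin_r bst ah).
  split; [lra|]. split; [lra|]. intros b Hbb.
  destruct (HN b ltac:(lra)) as [Hs1 [Hs2 [_ [u [v [p [p' [g1 [g2 [Wu [Wv [Wp [Wp' [Wg1 [Wg2 [I1 [I2 HG]]]]]]]]]]]]]]]]].
  pose proof (Rmin_l b0 1). pose proof (Rmin_r b0 1).
  assert (Hb1 : b <= 1 / 12) by lra. assert (Hbb0 : 12 * b <= b0) by lra.
  assert (HbC : b * C <= e / 144) by nra. assert (HbM : b * M0 <= e / 144) by nra.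
  assert (Heb : 0 < e * b) by nra.
  (* The change of height is at most [(6 b)^2 C], and [b C <= e / 144] makes this at most [e b / 4],
     a quarter of one layer. *)
  assert (HPhi : forall x y r, Rabs y < r -> r <= (1 + 5 * e) * b -> Rabs (snd (shear u v (x, y))) < r + e * b / 4).
  { intros x y r Hy Hyr. pose proof (shear_snd_bound _ _ _ u _ (x, y) Wv ltac:(simpl; lra)) as Q. simpl snd at 2 3 in Q.
    pose proof (Rabs_pos y). assert (Rabs y <= 6 * b) by nra.
    assert (Rabs y ^ 2 * C <= e * b / 4); [|lra].
    apply Rle_trans with ((6 * b) * (6 * b) * C); [|nra].
    apply Rmult_le_compat_r; [lra|]. simpl. nra. }
  assert (HPsi : forall x y, Rabs y < (1 + 2 * e) * b -> Rabs (snd (shear p p' (x, y))) < (1 + 2 * e) * b + e * b / 4).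
  { intros x y Hy. pose proof (shear_snd_bound _ _ _ p _ (x, y) Wp' ltac:(simpl; nra)) as Q. simpl snd at 2 3 in Q.
    pose proof (Rabs_pos y). assert (Rabs y <= 3 * b) by nra.
    assert (Rabs y ^ 2 * C <= e * b / 4); [|lra].
    apply Rle_trans with ((3 * b) * (3 * b) * C); [|nra].
    apply Rmult_le_compat_r; [lra|]. simpl. nra. }
  assert (J1 : forall x y, Rabs y <= (1 + 4 * e) * b -> shear u v (shear p p' (x, y)) = (x, y)).
  { intros x y Hy. destruct (I1 x y Hy) as [E1 E2]. unfold shear. cbn [fst snd]. rewrite E1, E2. reflexivity. }
  assert (J2 : forall x y, Rabs y <= (1 + 3 * e) * b -> shear p p' (shear u v (x, y)) = (x, y)).
  { intros x y Hy. destruct (I2 x y Hy) as [E1 E2]. unfold shear. cbn [fst snd]. rewrite E1, E2. reflexivity. }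
  (* [A] is the preimage of [B] within the cylinder where [shear p p'] is a left inverse, so the
     change of variables is a bijection of [A] onto [B]. The height of [B] leaves room for the
     images under the map of points over the cylinder of height [b]. *)
  set (A := fun z : R * R => Rabs (snd z) < (1 + 3 * e) * b /\ Rabs (snd (shear u v z)) < (1 + 2 * e) * b).
  set (B := fun z : R * R => Rabs (snd z) < (1 + 2 * e) * b).
  set (G := fun z : R * R => (fst z + snd z + snd z ^ S (S q) * g1 (fst z) (snd z),
    snd z + snd z ^ S (S (S q)) * g2 (fst z) (snd z))).
  assert (Hin : forall z, strip (sym_itv b) z -> Rabs (snd z) < b) by (intros z Hz; apply Rabs_lt_between, Hz).
  assert (Hsu : forall z n, Rabs (snd z) <= (1 + 5 * e) * b ->
    shear u v (Defs.shift n z) = Defs.shift n (shear u v z)) by (intros; eapply shear_shift; eauto).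
  assert (Hsp : forall z n, Rabs (snd z) <= (1 + 4 * e) * b ->
    shear p p' (Defs.shift n z) = Defs.shift n (shear p p' z)) by (intros; eapply shear_shift; eauto).
  assert (Hrefl : forall z w : R * R, z = w -> cyl_eq z w).
  { intros z w <-. exists 0%Z. destruct z. unfold Defs.shift. simpl. rewrite Rplus_0_r. reflexivity. }
  assert (Hfs : forall z, strip (sym_itv b) z -> fxy (shear u v z) =
    (F1 h1 (fst (shear u v z)) (snd (shear u v z)), F2 h2 (fst (shear u v z)) (snd (shear u v z)))).
  { intros [x y] Hz. pose proof (HPhi x y b (Hin _ Hz) ltac:(nra)).
    rewrite <- Hfxy; [rewrite <- surjective_pairing; reflexivity|]. nra. }
  assert (HfB : forall z, strip (sym_itv b) z -> B (fxy (shear u v z))).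
  { intros [x y] Hz. unfold B. rewrite Hfs by exact Hz. cbn [snd]. pose proof (HPhi x y b (Hin _ Hz) ltac:(nra)) as HY.
    set (Y := snd (shear u v (x, y))) in *. unfold F2.
    assert (HY2 : Rabs Y <= 2 * b) by nra.
    pose proof (W_bound _ _ _ _ _ (fst (shear u v (x, y))) Y W2 ltac:(lra)) as Hh.
    eapply Rle_lt_trans; [apply Rabs_triang|]. rewrite Rabs_mult, <- RPow_abs.
    pose proof (Rabs_pos Y). assert (Rabs Y ^ 3 * Rabs (h2 (fst (shear u v (x, y))) Y) <= (2 * b) ^ 3 * M0).
    { apply Rmult_le_compat; auto; [apply pow_le; assumption|apply Rabs_pos|apply pow_incr; lra]. }
    assert ((2 * b) ^ 3 * M0 <= e * b / 4); [|nra].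
    replace ((2 * b) ^ 3 * M0) with (8 * (b * b) * (b * M0)) by ring. nra. }
  assert (HGP : forall z, strip (sym_itv b) z -> shear p p' (fxy (shear u v z)) = G z).
  { intros [x y] Hz. rewrite Hfs by exact Hz. pose proof (Hin _ Hz) as Hy. simpl in Hy.
    destruct (HG x y ltac:(nra)) as [E1 [E2 _]]. unfold shear at 1, G. simpl fst; simpl snd.
    f_equal; [exact E1|exact E2]. }
  exists A, B, (shear u v), (shear p p'). split; [|split; [|split]].
  - split; [|split; [|split; [|split; [|split; [|split; [|split]]]]]].
    + split.
      * intros z w [n ->] [Z1 Z2]. split; [exact Z1|]. rewrite Hsu by nra. exact Z2.
      * intros z [Z1 Z2]. apply filter_and.
        -- apply (continuous_small_locally snd); [|exact Z1]. destruct z. apply continuous_snd.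
        -- apply (continuous_small_locally (fun z => snd (shear u v z))); [|exact Z2].
           apply (continuous_snd_shear _ _ _ _ _ _ Wv Hah). eapply Rlt_trans; [exact Z1|lra].
    + split.
      * intros z w [n ->] Hz. exact Hz.
      * intros z Hz. apply (continuous_small_locally snd); [|exact Hz]. destruct z. apply continuous_snd.
    + split; [intros z [_ Hz]; exact Hz|]. intros z w [Z1 _] _ [n ->]. exists n. apply Hsu. nra.
    + split.
      * intros [x y] Hz. unfold B in Hz. simpl in Hz. split.
        -- pose proof (HPsi x y Hz). nra.
        -- rewrite J1 by nra. exact Hz.
      * intros z w Hz _ [n ->]. exists n. apply Hsp. unfold B in Hz. nra.
    + apply (shear_analytic _ _ _ _ _ _ Wu Wv Hah). intros z [Z1 _]. nra.
    + apply (shear_analytic _ _ _ _ _ _ Wp Wp' Hah). intros z Hz. unfold B in Hz. nra.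
    + intros [x y] [Z1 _]. apply Hrefl, J2. simpl in Z1. lra.
    + intros [x y] Hz. apply Hrefl, J1. unfold B in Hz. simpl in Hz. nra.
  - intros [x y] Hz. pose proof (Hin _ Hz) as Hy. pose proof (HPhi x y b Hy ltac:(nra)) as HY. split; [|split].
    + split; [simpl in *; nra|nra].
    + apply Rabs_lt_between. nra.
    + apply HfB, Hz.
  - intros x y Hy. apply Rabs_lt_between in Hy.
    pose proof (W_bound _ _ _ _ _ x y Wu ltac:(nra)) as Bu. pose proof (W_bound _ _ _ _ _ x y Wv ltac:(nra)) as Bv.
    split; [|split].
    + simpl. replace (x + y * u x y - x) with (u x y * y) by ring. rewrite Rabs_mult.
      apply Rmult_le_compat_r; [apply Rabs_pos|lra].
    + unfold shear. cbn [fst snd]. replace (y + y ^ 2 * v x y - y) with (v x y * y ^ 2) by ring.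
      rewrite Rabs_mult, <- RPow_abs. apply Rmult_le_compat_r; [apply pow2_ge_0|lra].
    + apply shear_jacobian_bound with b; auto; lra.
  - exists G, (fun z => g1 (fst z) (snd z)), (fun z => g2 (fst z) (snd z)).
    assert (Hbe : b <= (1 + e) * b) by nra.
    split; [|split; [|split; [|split; [|split]]]].
    + intros z Hz. apply Hrefl, HGP, Hz.
    + split.
      * apply (W_analytic_perturbation _ _ b _ _ _ (S (S q)) Wg1 Wg2 Hah Hbe).
      * apply (W_analytic_perturbation _ _ b _ _ _ (S (S (S q))) Wg1 Wg2 Hah Hbe).
    + apply (intersection_conjugate ah b b_star C u v fxy G (shear p p') Hah ltac:(lra)).
      * apply (W_mono _ ah ((1 + 5 * e) * b) C); [lra|nra|lra|exact Wu].
      * apply (W_mono _ ah ((1 + 5 * e) * b) C); [lra|nra|lra|exact Wv].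
      * intros [x y] Hz. apply Rabs_lt_between. pose proof (HPhi x y b (Hin _ Hz) ltac:(nra)). nra.
      * intros [x y] Hz. apply J2. pose proof (Hin _ Hz) as Hy. simpl in Hy. nra.
      * intros z n Hz. rewrite <- HGP by exact Hz. apply Hsp. pose proof (HfB z Hz) as Q. unfold B in Q. nra.
      * exact HI.
    + exact (W_analytic2 _ _ _ _ _ Wg1 Hah Hbe).
    + exact (W_analytic2 _ _ _ _ _ Wg2 Hah Hbe).
    + intros x y Hy. apply Rabs_lt_between in Hy. assert (Hy' : Rabs y <= (1 + e) * b) by lra.
      destruct (HG x y Hy') as [_ [_ [G1 G2]]].
      assert (HE : C * exp (- (2 * PI * alpha / b)) <= C / e * exp (- (2 * PI * alpha / b)))
        by (apply Rmult_le_compat_r; [left; apply exp_pos|exact HD]).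
      destruct (W_partial_bounds ah b e C g1 x y Hah He ltac:(lra) ltac:(lra) HC Wg1 Hy) as [P1 P2].
      destruct (W_partial_bounds ah b e C g2 x y Hah He ltac:(lra) ltac:(lra) HC Wg2 Hy) as [P3 P4].
      split; [exact (W_period _ _ _ _ _ x y 1 Wg1 Hy')|].
      split; [exact (W_period _ _ _ _ _ x y 1 Wg2 Hy')|].
      split; [rewrite Nat.add_1_r; reflexivity|].
      cbn [fst snd]. repeat split; lra.
Qed.
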